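(* (1) For every temporal datalog query $(\pi,G)$, the answering problem is in PSPACE for data complexity, and there exists a monadic temporal datalog query whose answering problem is PSPACE-hard. (2) For every linear temporal datalog query $(\pi,G)$, the answering problem is in NL for data complexity, and there exists a linear monadic temporal datalog query whose answering problem is NL-hard.
   Context: A temporal database $\mathcal D$ over a schema $\Sigma$ is a finite sequence $\langle D_l,\dots,D_r\rangle$ ($l<r$ integers) of finite sets of ground atoms over $\Sigma$; $\mathrm{tem}(\mathcal D)=[l,r]$, $\Delta_{\mathcal D}$ is its set of objects. For a family $\mathcal E=\langle E_\ell\rangle_{\ell\in I}$ of sets of ground atoms indexed by an integer interval $I$ (finite, or $I=\mathbb Z$) and $\ell\in\mathbb Z$: $\mathcal E,\ell\models R(\bar d)$ iff $\ell\in I$ and $R(\bar d)\in E_\ell$; conjunction as usual; $\bigcirc\varphi$ / $\bigcirc^{-}\varphi$ hold at $\ell$ iff $\varphi$ holds at $\ell+1$ / $\ell-1$; $\Diamond\varphi$ / $\Diamond^{-}\varphi$ hold at $\ell$ iff $\varphi$ holds at some $\ell'>\ell$ / some $\ell'<\ell$. A temporal datalog rule has the form $C(\overline X)\leftarrow \mathcal O_1R_1(\overline U_1)\wedge\dots\wedge\mathcal O_sR_s(\overline U_s)$, where each $\mathcal O_i$ is a finite (possibly empty) sequence of operators from $\{\bigcirc,\bigcirc^{-},\Diamond,\Diamond^{-}\}$ and every head variable occurs in the body. A program $\pi$ is a finite set of rules; its IDB relations are those occurring in rule heads, the others are EDB. A rule is linear if its body contains at most one IDB atom, monadic if its head has arity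 1; a program is linear (monadic) if all its rules are. Given a temporal database $\mathcal D$ over the EDB schema, a model of $\pi$ and $\mathcal D$ is a family $\mathcal E=\langle E_\ell\rangle_{\ell\in\mathbb Z}$ over EDB and IDB relations with objects from $\Delta_{\mathcal D}$, whose EDB atoms are exactly those of $\mathcal D$ (at the same timestamps, none outside $\mathrm{tem}(\mathcal D)$), such that for every rule, every $\ell\in\mathbb Z$ and every assignment of objects to its variables, if the body holds at $\ell$ then the head holds at $\ell$. $\mathcal D,\pi,\ell\models C(\bar d)$ iff $\mathcal E,\ell\models C(\bar d)$ for every model $\mathcal E$ of $\pi$ and $\mathcal D$. A query is a pair $(\pi,G)$ with $G$ an IDB relation of $\pi$; its answering problem is: given $\mathcal D$ over the EDB schema, a tuple $\bar d$ of objects of $\Delta_{\mathcal D}$ and $\ell\in\mathrm{tem}(\mathcal D)$, decide whether $\mathcal D,\pi,\ell\models G(\bar d)$. Data complexity means $(\pi,G)$ is fixed. *)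

(* Defs.v *)
From Stdlib Require Import ZArith Relations.
From mathcomp Require Import all_boot.



Unset Printing Implicit Defensive.

Inductive tok : Type := T0 | T1 | TSep | TOpen | TClose | TNeg.

Inductive dir : Type := DL | DS | DR.

(* A nondeterministic Turing machine with a two-way read-only input tape
   (with end markers, read as [None]), one work tape (one-way infinite to the
   right, over a finite work alphabet) and a write-only output tape (only used
   by transducers).  A transition, given the current state, the input symbol
   under the input head and the work symbol under the work head, chooses a new
   state, a symbol to write on the work tape, input-head and work-head moves,
   and optionally a symbol to append to the output tape. *)
Record TM : Type := MkTM {
  st : finType;
  wal : finType;
  q_start : st;
  q_acc : pred st;
  wblank : wal;
  delta : st -> option tok -> wal -> seq (st * wal * dir * dir * option tok)
}.

Record cfg (M : TM) : Type := Cfg {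
  cq : st M;
  cin : nat;          (* input head: 0 = left end marker, 1..n = input, n+1 = right end marker *)
  ctape : nat -> wal M;
  cwp : nat;
  cout : seq tok
}.
Arguments cq {M}. Arguments cin {M}. Arguments ctape {M}. Arguments cwp {M}.
Arguments cout {M}.

Definition read_in (w : seq tok) (p : nat) : option tok :=
  if p is 0 then None
  else if (p.-1 < size w)%N then Some (nth T0 w p.-1) else None.

Definition move_in (n : nat) (d : dir) (p : nat) : nat :=
  match d with DL => p.-1 | DS => p | DR => minn p.+1 n.+1 end.

Definition move_w (d : dir) (p : nat) : nat :=
  match d with DL => p.-1 | DS => p | DR => p.+1 end.

Definition upd {A : Type} (t : nat -> A) (p : nat) (g : A) : nat -> A :=
  fun i => if i == p then g else t i.

Definition init_cfg (M : TM) : cfg M :=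
  Cfg M (q_start M) 0 (fun _ => wblank M) 0 [::].

Definition step (M : TM) (w : seq tok) (c c' : cfg M) : Prop :=
  exists (q' : st M) (g : wal M) (di dw : dir) (o : option tok),
    List.In (q', g, di, dw, o) (delta M (cq c) (read_in w (cin c)) (ctape c (cwp c))) /\
    c' = Cfg M q' (move_in (size w) di (cin c)) (upd (ctape c) (cwp c) g)
                 (move_w dw (cwp c))
                 (cout c ++ (if o is Some t then [:: t] else [::])).

Definition reach (M : TM) (w : seq tok) (c : cfg M) : Prop :=
  clos_refl_trans (cfg M) (step M w) (init_cfg M) c.

Definition deterministic (M : TM) : Prop :=
  forall q a g, (size (delta M q a g) <= 1)%N.

Definition decides_in_space (M : TM) (L : seq tok -> Prop) (s : nat -> nat) : Prop :=
  forall w, (L w <-> exists c, reach M w c /\ q_acc M (cq c)) /\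
            (forall c, reach M w c -> (cwp c <= s (size w))%N).

Definition computes_in_space (M : TM) (f : seq tok -> seq tok) (s : nat -> nat) : Prop :=
  deterministic M /\
  (forall q a g, q_acc M q -> delta M q a g = [::]) /\
  forall w, (exists c, reach M w c /\ q_acc M (cq c) /\ cout c = f w) /\
            (forall c, reach M w c -> (cwp c <= s (size w))%N).

Definition log_bound (c : nat) : nat -> nat := fun n => c * Nat.log2 n + c.
Definition poly_bound (c k : nat) : nat -> nat := fun n => c * n ^ k + c.

Definition in_PSPACE (L : seq tok -> Prop) : Prop :=
  exists M c k, deterministic M /\ decides_in_space M L (poly_bound c k).

Definition in_NL (L : seq tok -> Prop) : Prop :=
  exists M c, decides_in_space M L (log_bound c).

Definition logspace_reducible (A B : seq tok -> Prop) : Prop :=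
  exists f M c, computes_in_space M f (log_bound c) /\ forall w, A w <-> B (f w).

Definition PSPACE_hard (B : seq tok -> Prop) : Prop :=
  forall A, in_PSPACE A -> logspace_reducible A B.

Definition NL_hard (B : seq tok -> Prop) : Prop :=
  forall A, in_NL A -> logspace_reducible A B.

(* A relation symbol is a pair (name, arity); objects and variables are nats. *)
Definition relsym := (nat * nat)%type.
Definition arity (R : relsym) : nat := R.2.
Definition atom := (relsym * seq nat)%type.
Definition wf_atom (a : atom) : Prop := size a.2 = arity a.1.

Inductive top : Type := ONext | OPrev | OFut | OPast.

Definition literal := (seq top * relsym * seq nat)%type.
Definition lit_ops (l : literal) : seq top := l.1.1.
Definition lit_rel (l : literal) : relsym := l.1.2.
Definition lit_args (l : literal) : seq nat := l.2.

Record rule : Type := Rule { rhead : relsym * seq nat; rbody : seq literal }.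
Definition program := seq rule.

Definition rvars (ru : rule) : seq nat :=
  (rhead ru).2 ++ flatten [seq lit_args l | l <- rbody ru].

Definition wf_rule (ru : rule) : Prop :=
  size (rhead ru).2 = arity (rhead ru).1 /\
  (forall l, List.In l (rbody ru) -> size (lit_args l) = arity (lit_rel l)) /\
  (forall x, x \in (rhead ru).2 -> has (fun l => x \in lit_args l) (rbody ru)).

Definition wf_program (p : program) : Prop := forall ru, List.In ru p -> wf_rule ru.

Definition idb (p : program) (R : relsym) : bool := R \in [seq (rhead ru).1 | ru <- p].
Definition rels (p : program) : seq relsym :=
  flatten [seq (rhead ru).1 :: [seq lit_rel l | l <- rbody ru] | ru <- p].
Definition edb (p : program) (R : relsym) : bool := (R \in rels p) && ~~ idb p R.

Definition linear (p : program) : Prop :=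
  forall ru, List.In ru p -> (count (fun l => idb p (lit_rel l)) (rbody ru) <= 1)%N.
Definition monadic (p : program) : Prop :=
  forall ru, List.In ru p -> arity (rhead ru).1 = 1%N.

(* temporal database <D_l, ..., D_r>, given by l and the list of the D_i *)
Record tdb : Type := TDB { tl : Z; tsets : seq (seq atom) }.
Definition tr (D : tdb) : Z := (tl D + Z.of_nat (size (tsets D)) - 1)%Z.
Definition in_tem (D : tdb) (t : Z) : Prop := (tl D <= t <= tr D)%Z.
Definition dfact (D : tdb) (t : Z) (a : atom) : Prop :=
  in_tem D t /\ List.In a (nth [::] (tsets D) (Z.to_nat (t - tl D))).
Definition objs (D : tdb) : seq nat := flatten [seq a.2 | a <- flatten (tsets D)].

(* D is a temporal database (l < r) over the EDB schema of p *)
Definition db_over_edb (p : program) (D : tdb) : Prop :=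
  (2 <= size (tsets D))%N /\
  forall a, a \in flatten (tsets D) -> wf_atom a /\ edb p a.1.

Definition family := Z -> atom -> Prop.

Fixpoint holds (E : family) (t : Z) (ops : seq top) (a : atom) : Prop :=
  match ops with
  | [::] => E t a
  | ONext :: o => holds E (t + 1)%Z o a
  | OPrev :: o => holds E (t - 1)%Z o a
  | OFut :: o => exists t', (t < t')%Z /\ holds E t' o a
  | OPast :: o => exists t', (t' < t)%Z /\ holds E t' o a
  end.

Definition is_model (p : program) (D : tdb) (E : family) : Prop :=
  (forall t a, E t a -> wf_atom a /\ a.1 \in rels p /\ all (fun d => d \in objs D) a.2) /\
  (forall t a, ~~ idb p a.1 -> (E t a <-> dfact D t a)) /\
  (forall ru, List.In ru p -> forall (t : Z) (nu : nat -> nat),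
     (forall x, x \in rvars ru -> nu x \in objs D) ->
     (forall l, List.In l (rbody ru) -> holds E t (lit_ops l) (lit_rel l, map nu (lit_args l))) ->
     E t ((rhead ru).1, map nu (rhead ru).2)).

Definition certain (p : program) (D : tdb) (t : Z) (a : atom) : Prop :=
  forall E, is_model p D E -> E t a.

Definition is_query (p : program) (G : relsym) : Prop := wf_program p /\ idb p G.

Fixpoint enc_pos (q : positive) : seq tok :=
  match q with
  | xH => [:: T1]
  | xO q => T0 :: enc_pos q
  | xI q => T1 :: enc_pos q
  end.
Definition enc_nat (n : nat) : seq tok :=
  match N.of_nat n with N0 => [:: T0] | Npos q => enc_pos q end.
Definition enc_Z (z : Z) : seq tok :=
  match z with Z0 => [:: T0] | Zpos q => enc_pos q | Zneg q => TNeg :: enc_pos q end.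
Definition enc_tuple (ds : seq nat) : seq tok :=
  TOpen :: flatten [seq enc_nat d ++ [:: TSep] | d <- ds] ++ [:: TClose].
Definition enc_atom (a : atom) : seq tok :=
  TOpen :: enc_nat a.1.1 ++ TSep :: enc_nat a.1.2 ++ TSep :: enc_tuple a.2 ++ [:: TClose].
Definition enc_set (s : seq atom) : seq tok :=
  TOpen :: flatten [seq enc_atom a | a <- s] ++ [:: TClose].
Definition enc_db (D : tdb) : seq tok :=
  enc_Z (tl D) ++ TSep :: flatten [seq enc_set s | s <- tsets D] ++ [:: TSep].
Definition enc_input (D : tdb) (dbar : seq nat) (t : Z) : seq tok :=
  enc_db D ++ enc_tuple dbar ++ enc_Z t.

Definition query_lang (p : program) (G : relsym) : seq tok -> Prop :=
  fun w => exists (D : tdb) (dbar : seq nat) (t : Z),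
    [/\ db_over_edb p D, size dbar = arity G, all (fun d => d \in objs D) dbar,
        in_tem D t & w = enc_input D dbar t] /\
    certain p D t (G, dbar).

(* Main.v *)
Require Import Defs.
From Stdlib Require Import ZArith Relations FunctionalExtensionality Lia.
From mathcomp Require Import all_boot zify.
From mathcomp Require Import boolp.

(** Upper bounds. Pending temporal operators are kept as part of the facts, so that
    every inference moves by at most one time step and the database only matters in
    a bounded stretch of time. A set of facts that is closed under inference on a
    window around this stretch extends to a closed set on all of the integers as soon
    as the margins exceed the number of possible "summaries" of one side: pairs of
    facts for linear programs, and pairs of a set of facts and a fact in general.
    Hence derivations may be confined to a window of polynomial length in the linear
    case, which makes answering a reachability problem over pairs (time, fact), and of
    exponential length in general. In the latter case the window is saturated by
    recursive bisection, storing only the sets of facts at the current midpoints.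

    Lower bounds. Reachability in the configuration graph is a linear monadic program.
    For PSPACE, the facts at time [k] describe the configuration after [k] steps of a
    deterministic machine, time serving as an exponential counter.

    Turing machines are programmed through counter machines, structured programs and
    terms for bounded arithmetic over the input word. *)

Set Implicit Arguments.
Unset Strict Implicit.
Unset Printing Implicit Defensive.
Local Open Scope nat_scope.

(** Certain facts are the derivable ones, because the derivable facts form a model. The obstacle is
    that a derivation may wander arbitrarily far outside the database before it returns. A summary
    records which fact can be inferred at the border from facts handed over to one side. Enlarging
    the allowed excursion by one step is a monotone operator on a finite set of such pairs, so it is
    stable after as many steps as there are pairs, and the stable value then defines the facts at
    all later times. With at most one IDB premise per rule, single facts determine what comes back;
    in general sets are needed, whence the exponential. Objects and timestamps are a second
    obstacle: written in binary, they may be exponential in the input length. So an object is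
    represented by the position of its first occurrence, a time by its distance from the first
    slice, and the sum relating the two timestamps is checked bit by bit. For PSPACE-hardness,
    determinism is essential: the facts at one time are inferred independently, and the parts of two
    different successor configurations would mix. *)

Section DetRun.
Variables (T : Type) (stp : T -> T -> Prop) (good : T -> Prop).

(** The last configuration need be neither good nor deterministic, so that a run may end where the
    machine accepts, halts or branches. *)
Inductive drun : T -> T -> Prop :=
| drun_refl c : drun c c
| drun_step c c1 c2 :
    good c -> (forall c', stp c c' <-> c' = c1) -> drun c1 c2 -> drun c c2.

Lemma drun_trans a b c : drun a b -> drun b c -> drun a c.
Proof. by elim=> // x y z gx sx _ IH /IH; apply: drun_step gx sx. Qed.

Lemma drun_star a b : drun a b -> clos_refl_trans T stp a b.
Proof.
elim=> [x|x y z gx sx _ IH]; first exact: rt_refl.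
by apply: rt_trans IH; apply: rt_step; apply/sx.
Qed.

(** All steps before [b] are forced, so any other run from [a] either is still on the way to [b] or
    has passed through [b]. This turns a forward simulation into a statement about every reachable
    configuration. *)
Lemma drun_split a b c :
  drun a b -> clos_refl_trans T stp a c ->
  (good c /\ drun c b) \/ clos_refl_trans T stp b c.
Proof.
move=> rab /clos_rt_rt1n_iff; elim: rab => [x|x y z gx sx ryz IH] xc.
  by right; apply/clos_rt_rt1n_iff.
inversion xc as [|d e xd de]; subst.
  by left; split=> //; apply: drun_step gx sx ryz.
by apply: IH; move/sx: xd => <-.
Qed.

Definition drunp a b := exists2 c, good a /\ (forall c', stp a c' <-> c' = c) & drun c b.

Lemma drunp_trans a b c : drunp a b -> drun b c -> drunp a c.
Proof. by case=> d ? db bc; exists d => //; apply: drun_trans bc. Qed.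

Lemma drunpW a b : drunp a b -> drun a b.
Proof. by case=> d [? ?]; apply: drun_step. Qed.

Lemma drun_drunp a b c : drun a b -> drunp b c -> drunp a c.
Proof. by case=> // x y z g s r /drunpW r'; exists y => //; exact: drun_trans r r'. Qed.

Lemma drunp_next a b c : drunp a b -> stp a c -> drun c b.
Proof. by case=> d [_ sd] run /sd ->. Qed.

End DetRun.

Lemma drun_sub (T : Type) (stp : T -> T -> Prop) (g g' : T -> Prop) a b :
  (forall c, g c -> g' c) -> drun stp g a b -> drun stp g' a b.
Proof.
move=> gg'; elim=> [c|c c1 c2 gc sc _ IH]; first exact: drun_refl.
exact: drun_step (gg' _ gc) sc IH.
Qed.

Lemma drunp_sub (T : Type) (stp : T -> T -> Prop) (g g' : T -> Prop) a b :
  (forall c, g c -> g' c) -> drunp stp g a b -> drunp stp g' a b.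
Proof. by move=> gg' [c [/gg' ? ?]] /(drun_sub gg'); exists c. Qed.

(** Symbols are compared through these codes, which are also the values that terms read; 0 stands
    for an end marker. *)
Definition tokn (a : option tok) : nat :=
  match a with
  | None => 0 | Some T0 => 1 | Some T1 => 2 | Some TSep => 3
  | Some TOpen => 4 | Some TClose => 5 | Some TNeg => 6
  end.

Lemma tokn_inj : injective tokn.
Proof. by move=> [[]|] [[]|]. Qed.

(** * Counter machines *)

(* [IDec x l] decrements register [x], or jumps to [l] if it is zero;
   [ITst a l] falls through if the scanned input symbol is [a], and jumps to
   [l] otherwise; [ICho l] nondeterministically falls through or jumps. *)
Inductive instr : Type :=
| IInc (x : nat) | IDec (x l : nat) | IJmp (l : nat) | IMov (d : dir)
| ITst (a : option tok) (l : nat) | IOut (t : tok) | ICho (l : nat)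
| IAcc | IHlt.

Record ccfg : Type := CCfg { cpc : nat; chd : nat; creg : nat -> nat; cemit : seq tok }.

Definition csucc (C : seq instr) (w : seq tok) (c : ccfg) : seq ccfg :=
  let: CCfg pc h v o := c in
  match nth IHlt C pc with
  | IInc x => [:: CCfg pc.+1 h (upd v x (v x).+1) o]
  | IDec x l => if v x is n.+1 then [:: CCfg pc.+1 h (upd v x n) o]
                else [:: CCfg l h v o]
  | IJmp l => [:: CCfg l h v o]
  | IMov d => [:: CCfg pc.+1 (move_in (size w) d h) v o]
  | ITst a l => [:: CCfg (if tokn (read_in w h) == tokn a then pc.+1 else l) h v o]
  | IOut t => [:: CCfg pc.+1 h v (rcons o t)]
  | ICho l => [:: CCfg pc.+1 h v o; CCfg l h v o]
  | IAcc | IHlt => [::]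
  end.

Definition cstep C w (c c' : ccfg) : Prop := List.In c' (csucc C w c).

Definition cinit : ccfg := CCfg 0 0 (fun _ => 0) [::].

Definition creach C w (c : ccfg) : Prop := clos_refl_trans ccfg (cstep C w) cinit c.

Lemma upd_eq (A : Type) (t : nat -> A) p g : upd t p g p = g.
Proof. by rewrite /upd eqxx. Qed.

Lemma upd_same (A : Type) (t : nat -> A) p g : t p = g -> upd t p g = t.
Proof. by move=> <-; apply: functional_extensionality => i; rewrite /upd; case: eqP => [->|]. Qed.

Section BitFacts.

Lemma dvdn2S i m : 2 ^ i %| m -> (2 ^ i.+1 %| m) = ~~ odd (m %/ 2 ^ i).
Proof.
move=> /dvdnP[q ->]; rewrite mulnK ?expn_gt0 // expnSr mulnC.
by rewrite mulnC [2 ^ i * 2]mulnC dvdn_pmul2r ?expn_gt0 // dvdn2.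
Qed.

(** The carry of the increment reaches bit [i] exactly when all lower bits of [v] are ones, that is,
    when [2 ^ i] divides [v.+1]. *)
Lemma bit_succ v i : odd (v.+1 %/ 2 ^ i) = odd (v %/ 2 ^ i) (+) (2 ^ i %| v.+1).
Proof.
by rewrite divnS ?expn_gt0 // oddD addbC; case: (_ %| _).
Qed.
End BitFacts.

(** * Simulation of counter machines by Turing machines with binary registers *)

Section TMofCM.
Variable C : seq instr.

Definition ireg i := match i with IInc x | IDec x _ => x | _ => 0 end.
Definition ilab i := match i with IDec _ l | IJmp l | ITst _ l | ICho l => l | _ => 0 end.
Definition maxreg := \max_(i <- C) ireg i.
Definition maxlab := maxn (size C) (\max_(i <- C) ilab i).

(** Cell [i.+1] of the work tape holds the [i]-th bits of all registers, so register values below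
    [2 ^ L] need only [L] cells. [None] is the start state, which marks cell 0. The two booleans are
    the phase of an increment or decrement: [phScan] moves right to the bit where the carry or
    borrow stops, [phFlip] returns flipping the bits up to there, and [phBack] returns without
    changes after an attempt to decrement zero. *)
Definition cmst : finType := option ('I_maxlab.+1 * (bool * bool)).
Definition track := {ffun 'I_maxreg.+1 -> bool}.
(* [None] is the blank, [Some None] marks cell 0. *)
Definition cmwal : finType := option (option track).

Definition at_pc (pc : nat) (ph : bool * bool) : cmst := Some (inord pc, ph).
Definition phExec := (false, false).
Definition phScan := (true, false).
Definition phFlip := (true, true).
Definition phBack := (false, true).

Definition flipb (x : nat) (v : track) : track := [ffun y => v y (+) (val y == x)].

Definition cm_delta (q : cmst) (a : option tok) (g : cmwal) :
    seq (cmst * cmwal * dir * dir * option tok) :=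
  if q is Some (pc, ph) then
    let i := nth IHlt C pc in
    match ph with
    | (false, false) =>
      match i with
      | IInc _ | IDec _ _ => [:: (at_pc pc phScan, g, DS, DR, None)]
      | IJmp l => [:: (at_pc l phExec, g, DS, DS, None)]
      | IMov d => [:: (at_pc pc.+1 phExec, g, d, DS, None)]
      | ITst b l =>
        [:: (at_pc (if tokn a == tokn b then pc.+1 else l) phExec, g, DS, DS, None)]
      | IOut t => [:: (at_pc pc.+1 phExec, g, DS, DS, Some t)]
      | ICho l => [:: (at_pc pc.+1 phExec, g, DS, DS, None); (at_pc l phExec, g, DS, DS, None)]
      | IAcc | IHlt => [::]
      end
    | (true, false) =>
      match i, g with
      | IInc x, Some (Some v) =>
        if v (inord x) then [:: (at_pc pc phScan, g, DS, DR, None)]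
        else [:: (at_pc pc phFlip, Some (Some (flipb x v)), DS, DL, None)]
      | IInc x, None => [:: (at_pc pc phFlip, Some (Some (flipb x [ffun => false])), DS, DL, None)]
      | IDec x _, Some (Some v) =>
        if v (inord x) then [:: (at_pc pc phFlip, Some (Some (flipb x v)), DS, DL, None)]
        else [:: (at_pc pc phScan, g, DS, DR, None)]
      | IDec x _, None => [:: (at_pc pc phBack, g, DS, DL, None)]
      | _, _ => [::]
      end
    | (true, true) =>
      match i, g with
      | (IInc x | IDec x _), Some (Some v) =>
        [:: (at_pc pc phFlip, Some (Some (flipb x v)), DS, DL, None)]
      | _, _ => [:: (at_pc pc.+1 phExec, g, DS, DS, None)]
      end
    | (false, true) =>
      match i, g with
      | IDec _ l, Some None => [:: (at_pc l phExec, g, DS, DS, None)]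
      | _, _ => [:: (at_pc pc phBack, g, DS, DL, None)]
      end
    end
  else [:: (at_pc 0 phExec, Some None, DS, DS, None)].

Definition cm_acc (q : cmst) : bool :=
  if q is Some (pc, (false, false)) then if nth IHlt C pc is IAcc then true else false
  else false.

Definition cm_tm : TM := MkTM cmst cmwal None cm_acc None cm_delta.

Definition cho_free := forall i, if nth IHlt C i is ICho _ then False else True.

Lemma cm_tm_det : cho_free -> deterministic cm_tm.
Proof.
move=> cf [[pc [a b]]|] s g //=; have := cf pc.
by case: a; case: b; case: (nth _ _ _) => //= *; case: g => [[v|]|] //=; case: ifP.
Qed.

Lemma cm_acc_halt q a g : q_acc cm_tm q -> delta cm_tm q a g = [::].
Proof. by case: q => [[pc [[] []]]|] //=; case: (nth _ _ _). Qed.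

Lemma step_det (w : seq tok) (c : cfg cm_tm) q g di dw o :
  cm_delta (cq c) (read_in w (cin c)) (ctape c (cwp c)) = [:: (q, g, di, dw, o)] ->
  forall c', step cm_tm w c c' <->
    c' = Cfg cm_tm q (move_in (size w) di (cin c)) (upd (ctape c) (cwp c) g)
             (move_w dw (cwp c)) (cout c ++ (if o is Some t then [:: t] else [::])).
Proof.
move=> E c'; split.
  move=> [q' [g' [di' [dw' [o' []]]]]]; rewrite /= E /= => [] [|//].
  by case=> <- <- <- <- <- ->.
by move=> ->; exists q, g, di, dw, o; split=> //; rewrite /= E; left.
Qed.

Definition cell (v : nat -> nat) (i : nat) : track := [ffun x : 'I_maxreg.+1 => odd (v x %/ 2 ^ i)].

Definition tape (L : nat) (v : nat -> nat) : nat -> cmwal := fun p =>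
  if p is i.+1 then if i < L then Some (Some (cell v i)) else None else Some None.

Definition ftape L v x lo hi : nat -> cmwal := fun p =>
  if p is i.+1 then
    if i < L then Some (Some (if lo <= i <= hi then flipb x (cell v i) else cell v i)) else None
  else Some None.

Definition nhlt (i : instr) : bool := if i is IHlt then false else true.

Lemma mem_nth_instr pc : nhlt (nth IHlt C pc) -> pc < size C.
Proof. by case: ltnP => // /(nth_default IHlt) ->. Qed.

Lemma leq_bigmax_nth (F : instr -> nat) pc : pc < size C -> F (nth IHlt C pc) <= \max_(i <- C) F i.
Proof. by move=> h; rewrite (big_nth IHlt) big_mkord; apply: (leq_bigmax (Ordinal h)). Qed.

Lemma ireg_le pc : nhlt (nth IHlt C pc) -> ireg (nth IHlt C pc) <= maxreg.
Proof. by move/mem_nth_instr; exact: leq_bigmax_nth. Qed.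

Lemma ilab_le pc : nhlt (nth IHlt C pc) -> ilab (nth IHlt C pc) <= maxlab.
Proof. by move/mem_nth_instr=> h; rewrite leq_max orbC leq_bigmax_nth. Qed.

Lemma next_le pc : nhlt (nth IHlt C pc) -> pc.+1 <= maxlab.
Proof. by move/mem_nth_instr=> h; rewrite leq_max h. Qed.

Lemma flipbE x v (y : 'I_maxreg.+1) : flipb x v y = v y (+) (val y == x).
Proof. by rewrite ffunE. Qed.

Variable w : seq tok.

Definition tgood (L : nat) (c : cfg cm_tm) := (cwp c <= L.+1) /\ ~~ cm_acc (cq c).

Lemma tgoodW L L' c : L <= L' -> tgood L c -> tgood L' c.
Proof. by move=> h [a b]; split=> //; lia. Qed.

Notation drunT L := (drun (step cm_tm w) (tgood L)).
Notation drunpT L := (drunp (step cm_tm w) (tgood L)).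

Lemma upd_ftape L v x lo hi : lo <= hi -> lo < L ->
  upd (ftape L v x lo.+1 hi) lo.+1 (Some (Some (flipb x (cell v lo)))) = ftape L v x lo hi.
Proof.
move=> h1 h2; apply: functional_extensionality => -[|i] //=.
rewrite /upd eqSS; case: (eqVneq i lo) => [->|ne]; first by rewrite /= h2 leqnn h1.
by rewrite /ftape; case: ifP => // _; congr (Some (Some _)); rewrite ltn_neqAle eq_sym ne.
Qed.

Lemma flip_run L v x pc h hi o n :
  pc <= maxlab -> hi < L -> n <= hi.+1 ->
  (nth IHlt C pc = IInc x \/ exists l, nth IHlt C pc = IDec x l) ->
  drunT L (Cfg cm_tm (at_pc pc phFlip) h (ftape L v x n hi) n o)
          (Cfg cm_tm (at_pc pc phFlip) h (ftape L v x 0 hi) 0 o).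
Proof.
move=> pcl hL; elim: n => [|n IH] nh ix; first exact: drun_refl.
apply: drun_step (IH _ _) => //; last by lia.
  by split=> //=; lia.
move=> c'; have nL : n < L by lia.
rewrite (@step_det _ _ (at_pc pc phFlip) (Some (Some (flipb x (cell v n)))) DS DL None) /=.
  by rewrite cats0 upd_ftape.
by rewrite nL ltnn /= inordK //; case: ix => [->|[l ->]].
Qed.

Lemma scan_run L v x pc h o n b :
  pc <= maxlab -> x <= maxreg -> n <= L -> (forall i, i < n -> odd (v x %/ 2 ^ i) = b) ->
  (if b then nth IHlt C pc = IInc x else exists l, nth IHlt C pc = IDec x l) ->
  drunT L (Cfg cm_tm (at_pc pc phScan) h (tape L v) 1 o)
          (Cfg cm_tm (at_pc pc phScan) h (tape L v) n.+1 o).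
Proof.
move=> pcl xl; elim: n => [|n IH] nL hb ix; first exact: drun_refl.
apply: drun_trans (IH _ _ ix) _; [lia|by move=> i hi; apply: hb; lia|].
apply: drun_step (drun_refl _ _ _); first by split=> //=; lia.
move=> c'.
rewrite (@step_det _ _ (at_pc pc phScan) (Some (Some (cell v n))) DS DR None) /=.
  by rewrite cats0 upd_same //= nL.
rewrite nL inordK //; have := hb n (ltnSn n).
by case: b ix {hb IH} => [->|[l ->]] hb; rewrite /= ffunE inordK // hb.
Qed.

Lemma back_run L v x l pc h o n :
  pc <= maxlab -> n <= L -> nth IHlt C pc = IDec x l ->
  drunT L (Cfg cm_tm (at_pc pc phBack) h (tape L v) n o)
          (Cfg cm_tm (at_pc l phExec) h (tape L v) 0 o).
Proof.
move=> pcl + ix; elim: n => [|n IH] nL.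
  apply: drun_step (drun_refl _ _ _); first by split.
  move=> c'; rewrite (@step_det _ _ (at_pc l phExec) (Some None) DS DS None) /=.
    by rewrite cats0 upd_same.
  by rewrite inordK // ix.
apply: drun_step (IH _); last by lia.
  by split=> //=; lia.
move=> c'; rewrite (@step_det _ _ (at_pc pc phBack) (Some (Some (cell v n))) DS DL None) /=.
  by rewrite cats0 upd_same //= nL.
by rewrite inordK // ix nL.
Qed.

(** With [m] the larger of the old and the new value, [2 ^ i] divides [m] exactly for the bits
    [i <= logn 2 m], and these are the bits that an increment or decrement changes. *)
Lemma ftape_full L v x m v' : x <= maxreg -> 0 < m ->
  (forall i, odd (v' x %/ 2 ^ i) = odd (v x %/ 2 ^ i) (+) (2 ^ i %| m)) ->
  (forall y, y != x -> v' y = v y) ->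
  ftape L v x 0 (logn 2 m) = tape L v'.
Proof.
move=> xl m0 hx hy; apply: functional_extensionality => -[|i] //=; case: ifP => // _.
congr (Some (Some _)); apply/ffunP => y; rewrite /cell.
case: (eqVneq (val y) x) => [e|ne].
  rewrite !ffunE e hx pfactor_dvdn //; case: leqP => _; last by rewrite ffunE e addbF.
  by rewrite flipbE ffunE e (introT eqP e).
by case: ifP => _; rewrite ?flipbE !ffunE hy // (negPf ne) addbF.
Qed.

Definition enc_ccfg (L : nat) (c : ccfg) : cfg cm_tm :=
  Cfg cm_tm (at_pc (cpc c) phExec) (chd c) (tape L (creg c)) 0 (cemit c).

Lemma exec_scan L c (x : nat) :
  cpc c <= maxlab ->
  (nth IHlt C (cpc c) = IInc x \/ exists l, nth IHlt C (cpc c) = IDec x l) ->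
  drunpT L (enc_ccfg L c) (Cfg cm_tm (at_pc (cpc c) phScan) (chd c) (tape L (creg c)) 1 (cemit c)).
Proof.
move=> pcl ix; eexists; last exact: drun_refl.
split; first by split=> //=; rewrite inordK //; case: ix => [->|[l ->]].
move=> c'; rewrite (@step_det _ _ (at_pc (cpc c) phScan) (Some None) DS DR None) /=.
  by rewrite cats0 upd_same.
by rewrite inordK //; case: ix => [->|[l ->]].
Qed.

Lemma flip_end L v x pc h hi o :
  pc <= maxlab -> (nth IHlt C pc = IInc x \/ exists l, nth IHlt C pc = IDec x l) ->
  drunT L (Cfg cm_tm (at_pc pc phFlip) h (ftape L v x 0 hi) 0 o)
          (Cfg cm_tm (at_pc pc.+1 phExec) h (ftape L v x 0 hi) 0 o).
Proof.
move=> pcl ix; apply: drun_step (drun_refl _ _ _); first by split.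
move=> c'; rewrite (@step_det _ _ (at_pc pc.+1 phExec) (Some None) DS DS None) /=.
  by rewrite cats0 upd_same.
by rewrite inordK //; case: ix => [->|[l ->]].
Qed.

(** A new cell is needed only if the carry runs past the last one, and then the new value is
    [2 ^ L], hence at most [B]. So the condition [2 ^ L.-1 <= B] survives, and it is what bounds the
    number of cells by the logarithm of [B]. *)
Lemma sim_inc L c x B :
  cpc c <= maxlab -> nth IHlt C (cpc c) = IInc x ->
  (forall y, y <= maxreg -> creg c y < 2 ^ L) -> creg c x < B -> (0 < L -> 2 ^ L.-1 <= B) ->
  exists L', [/\ (0 < L' -> 2 ^ L'.-1 <= B), L <= L',
    (forall y, y <= maxreg -> upd (creg c) x (creg c x).+1 y < 2 ^ L') &
    drunpT L' (enc_ccfg L c)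
      (enc_ccfg L' (CCfg (cpc c).+1 (chd c) (upd (creg c) x (creg c x).+1) (cemit c)))].
Proof.
case: c => pc h v o /= pcl ix vL vB LB.
have xl : x <= maxreg by have := @ireg_le pc; rewrite ix; exact.
have vxL := vL x xl.
set m := (v x).+1; set j := logn 2 m.
have jP i : (2 ^ i %| m) = (i <= j) by rewrite pfactor_dvdn.
have jL : j <= L.
  by have /dvdn_leq := pfactor_dvdnn 2 m; rewrite -/j => /(_ isT) h1;
     rewrite -(@leq_exp2l 2) //; apply: leq_trans h1 _.
have hb i : i < j -> odd (v x %/ 2 ^ i) = true.
  move=> ij; have := bit_succ (v x) i; rewrite -/m jP (ltnW ij) addbT.
  by move=> e; have := @dvdn2S i m; rewrite !jP (ltnW ij) ij => /(_ isT); rewrite e negbK.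
have hj : odd (v x %/ 2 ^ j) = false.
  have := bit_succ (v x) j; rewrite -/m jP leqnn addbT.
  by move=> e; have := @dvdn2S j m; rewrite !jP leqnn ltnn => /(_ isT); rewrite e negbK.
pose L' := maxn L j.+1.
have LL' : L <= L' by rewrite leq_maxl.
have jB : 2 ^ j <= B.
  by apply: leq_trans (dvdn_leq _ _) _; [..|exact: pfactor_dvdnn|]; rewrite -/m.
exists L'; split=> //.
- by rewrite /L'; case: (leqP L j.+1).
- move=> y yl; have hL : 2 ^ L <= 2 ^ L' by rewrite leq_exp2l.
  rewrite /upd; case: eqP => [_|_]; last by apply: leq_trans hL; exact: vL.
  rewrite -/m; have [jL'|] := ltnP j L; last first.
    move=> Lj; have jLe : j = L by lia.
    have -> : L' = L.+1 by rewrite /L' jLe; lia.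
    by rewrite expnS /m; lia.
  apply: leq_trans hL; rewrite ltn_neqAle vxL andbT; apply/eqP => e.
  by have := jP L; rewrite e dvdnn; lia.
have ixor : nth IHlt C pc = IInc x \/ exists l, nth IHlt C pc = IDec x l by left.
apply: drunp_trans.
  by apply: (drunp_sub (fun c => tgoodW LL')); apply: (@exec_scan L (CCfg pc h v o) x).
apply: drun_trans.
  by apply: (drun_sub (fun c => tgoodW LL')); apply: (@scan_run L v x pc h o j true).
have -> : enc_ccfg L' (CCfg pc.+1 h (upd v x m) o) =
          Cfg cm_tm (at_pc pc.+1 phExec) h (ftape L' v x 0 j) 0 o.
  congr Cfg; symmetry; apply: ftape_full => //.
    by move=> i; rewrite /= upd_eq; exact: bit_succ.
  by move=> y ne; rewrite /= /upd (negPf ne).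
apply: drun_trans; last by apply: flip_end.
apply: drun_trans; last by apply: (@flip_run L' v x pc h j o j) => //; rewrite ?/L'; lia.
apply: drun_step (drun_refl _ _ _); first by split=> //=; lia.
move=> c'.
rewrite (@step_det _ _ (at_pc pc phFlip) (Some (Some (flipb x (cell v j)))) DS DL None) /=.
  rewrite cats0; suff -> : upd (tape L v) j.+1 (Some (Some (flipb x (cell v j)))) = ftape L' v x j j by [].
  apply: functional_extensionality => -[|i] //=; rewrite /upd eqSS.
  case: (eqVneq i j) => [->|ne]; first by rewrite leqnn ifT // /L'; lia.
  have -> : (j <= i <= j) = false by lia.
  by have -> : (i < L') = (i < L) by rewrite /L'; lia.
rewrite inordK // ix; case: ltnP => jL2.
  by rewrite /= ffunE inordK // hj.
congr [:: (_, Some (Some _), _, _, _)]; apply/ffunP=> y; rewrite !flipbE !ffunE.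
by rewrite divn_small //; have -> : j = L by [lia]; apply: vL; rewrite -ltnS.
Qed.

Lemma sim_dec L c x l :
  cpc c <= maxlab -> nth IHlt C (cpc c) = IDec x l ->
  (forall y, y <= maxreg -> creg c y < 2 ^ L) ->
  drunpT L (enc_ccfg L c)
    (enc_ccfg L (if creg c x is n.+1 then CCfg (cpc c).+1 (chd c) (upd (creg c) x n) (cemit c)
                 else CCfg l (chd c) (creg c) (cemit c))).
Proof.
case: c => pc h v o /= pcl ix vL.
have xl : x <= maxreg by have := @ireg_le pc; rewrite ix; exact.
have ixor : nth IHlt C pc = IInc x \/ exists l, nth IHlt C pc = IDec x l by right; exists l.
have ixb : if false then nth IHlt C pc = IInc x else exists l, nth IHlt C pc = IDec x l by exists l.
apply: drunp_trans; first by apply: (@exec_scan L (CCfg pc h v o) x).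
case vx: (v x) => [|n] /=.
  apply: drun_trans.
    by apply: (@scan_run L v x pc h o L false) => // i _; rewrite vx div0n.
  apply: drun_trans; last by apply: (@back_run L v x l pc h o L).
  apply: drun_step (drun_refl _ _ _); first by split=> //=; lia.
  move=> c'; rewrite (@step_det _ _ (at_pc pc phBack) None DS DL None) /=.
    by rewrite cats0 upd_same //= ltnn.
  by rewrite inordK // ix ltnn.
set m := n.+1; set j := logn 2 m.
have jP i : (2 ^ i %| m) = (i <= j) by rewrite pfactor_dvdn.
have jL : j < L.
  have /dvdn_leq := pfactor_dvdnn 2 m; rewrite -/j => /(_ isT) h1.
  by rewrite -(@ltn_exp2l 2) //; apply: leq_ltn_trans h1 _; rewrite /m -vx; exact: vL.
have hb i : i < j -> odd (v x %/ 2 ^ i) = false.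
  by move=> ij; have := @dvdn2S i m; rewrite !jP (ltnW ij) ij vx => /(_ isT)/esym/negbTE.
have hj : odd (v x %/ 2 ^ j) = true.
  by have := @dvdn2S j m; rewrite !jP leqnn ltnn vx => /(_ isT)/esym/negbFE.
apply: drun_trans; first by apply: (@scan_run L v x pc h o j false) => //; exact: ltnW.
have -> : enc_ccfg L (CCfg pc.+1 h (upd v x n) o) =
          Cfg cm_tm (at_pc pc.+1 phExec) h (ftape L v x 0 j) 0 o.
  congr Cfg; symmetry; apply: ftape_full => //.
    by move=> i; rewrite /= upd_eq vx bit_succ -/m; case: (odd _); case: (_ %| _).
  by move=> y ne; rewrite /= /upd (negPf ne).
apply: drun_trans; last by apply: flip_end.
apply: drun_trans; last by apply: (@flip_run L v x pc h j o j) => //; lia.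
apply: drun_step (drun_refl _ _ _); first by split=> //=; lia.
move=> c'.
rewrite (@step_det _ _ (at_pc pc phFlip) (Some (Some (flipb x (cell v j)))) DS DL None) /=.
  rewrite cats0; suff -> : upd (tape L v) j.+1 (Some (Some (flipb x (cell v j)))) = ftape L v x j j by [].
  apply: functional_extensionality => -[|i] //=; rewrite /upd eqSS.
  case: (eqVneq i j) => [->|ne]; first by rewrite leqnn ifT.
  by have -> : (j <= i <= j) = false by lia.
by rewrite inordK // ix jL /= ffunE inordK // hj.
Qed.

Definition cbounded B (c : ccfg) := forall x, x <= maxreg -> creg c x <= B.

Definition Lok B L (c : ccfg) :=
  [/\ cpc c <= maxlab, (0 < L -> 2 ^ L.-1 <= B) & forall x, x <= maxreg -> creg c x < 2 ^ L].

Lemma sim_plain L c c' (q' : cmst) di o :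
  cm_delta (at_pc (cpc c) phExec) (read_in w (chd c)) (Some None) = [:: (q', Some None, di, DS, o)] ->
  enc_ccfg L c' = Cfg cm_tm q' (move_in (size w) di (chd c)) (tape L (creg c)) 0
                   (cemit c ++ (if o is Some t then [:: t] else [::])) ->
  drunpT L (enc_ccfg L c) (enc_ccfg L c').
Proof.
move=> e ->; eexists; last exact: drun_refl.
split; first split=> //; first move: e; rewrite /= /cm_acc /=.
  by case: (nth IHlt C _) => //= *.
by move=> d; rewrite (@step_det w (enc_ccfg L c) _ _ _ _ _ e) /= upd_same.
Qed.

Lemma sim_step B L c c' :
  Lok B L c -> cstep C w c c' -> cbounded B c' ->
  exists L', [/\ Lok B L' c', L <= L' &
    drunpT L' (enc_ccfg L c) (enc_ccfg L' c') \/
    (exists l, nth IHlt C (cpc c) = ICho l) /\ step cm_tm w (enc_ccfg L c) (enc_ccfg L' c')].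
Proof.
case: c => pc h v o [/= pcl LB vL].
have ln := @next_le pc; have ll := @ilab_le pc; have lr := @ireg_le pc.
rewrite /cstep /=; case ix: (nth IHlt C pc) ln ll lr => [x|x l|l|d|a l|t|l||] //= ln ll lr.
- case=> // <- bc; have xl := lr isT.
  have [|L' [LB' LL' vL' run]] := @sim_inc L (CCfg pc h v o) x B pcl ix vL _ LB.
    by have := bc x xl; rewrite /= upd_eq.
  by exists L'; split=> //; [split=> //; exact: ln|left].
- move=> st bc; exists L; split=> //; last first.
    left; have := @sim_dec L (CCfg pc h v o) x l pcl ix vL; rewrite /=.
    by case: (v x) st => [|n] [] // <-.
  case vx: (v x) st => [|n] [] // <-; split=> //=; [exact: ll|exact: ln|].
  move=> y yl; rewrite /upd; case: eqP => [e|_]; last exact: vL.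
  by have := vL x (lr isT); rewrite vx; lia.
- case=> // <- _; exists L; split=> //; [split=> //=; exact: ll|left].
  by apply: sim_plain; rewrite /= ?inordK // ?ix // ?cats0.
- case=> // <- _; exists L; split=> //; [split=> //=; exact: ln|left].
  by apply: sim_plain; rewrite /= ?inordK // ?ix // ?cats0.
- case=> // <- _; exists L; split=> //; [split=> //=; case: ifP => _; [exact: ln|exact: ll]|left].
  by apply: sim_plain; rewrite /= ?inordK // ?ix // ?cats0.
- case=> // <- _; exists L; split=> //; [split=> //=; exact: ln|left].
  by apply: sim_plain; rewrite /= ?inordK // ?ix // ?cats1.
- have aux l' : l' = pc.+1 \/ l' = l -> step cm_tm w (enc_ccfg L (CCfg pc h v o)) (enc_ccfg L (CCfg l' h v o)).
    move=> el; exists (at_pc l' phExec), (Some None), DS, DS, None; rewrite /= inordK // ix.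
    rewrite cats0 upd_same //; split=> //=.
    by case: el => ->; [left|right; left].
  case=> [<-|[<-|//]] _; exists L; split=> //; try (by right; split; [exists l|apply: aux; auto]).
    by split=> //; exact: ln.
  by split=> //; exact: ll.
Qed.

Lemma enc_halt L c : cpc c <= maxlab -> (forall c', ~ cstep C w c c') ->
  forall tc, ~ step cm_tm w (enc_ccfg L c) tc.
Proof.
case: c => pc h v o /= pcl nost tc [q [g [di [dw [s []]]]]] /=; rewrite inordK //.
move: nost; rewrite /cstep /=; case: (nth IHlt C pc) => //=.
- by move=> x /(_ _ (or_introl erefl)).
- by move=> x l; case: (v x) => [|n] /(_ _ (or_introl erefl)).
- by move=> x /(_ _ (or_introl erefl)).
- by move=> x /(_ _ (or_introl erefl)).
- by move=> a x /(_ _ (or_introl erefl)).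
- by move=> x /(_ _ (or_introl erefl)).
- by move=> x /(_ _ (or_introl erefl)).
Qed.

Lemma enc_cho L c l tc : cpc c <= maxlab -> nth IHlt C (cpc c) = ICho l ->
  step cm_tm w (enc_ccfg L c) tc -> exists2 c', cstep C w c c' &
    tc = enc_ccfg L c' /\ (cpc c' <= maxlab /\ creg c' = creg c).
Proof.
case: c => pc h v o /= pcl ix.
have ln := @next_le pc; have ll := @ilab_le pc; move: ln ll; rewrite ix /= => ln ll.
case=> [q [g [di [dw [s []]]]]]; rewrite /= inordK // ix => [] [|[|//]].
  case=> <- <- <- <- <- ->; exists (CCfg pc.+1 h v o).
    by rewrite /cstep /= ix; left.
  by rewrite /= cats0 upd_same //; split=> //; split=> //; apply: ln.
case=> <- <- <- <- <- ->; exists (CCfg l h v o).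
  by rewrite /cstep /= ix; right; left.
by rewrite /= cats0 upd_same //; split=> //; split=> //; apply: ll.
Qed.

Section Sim.
Variable B : nat.
Hypothesis bnd : forall c, creach C w c -> cbounded B c.

Lemma init_run : drunT 0 (init_cfg cm_tm) (enc_ccfg 0 cinit).
Proof.
apply: drun_step (drun_refl _ _ _); first by split.
move=> c'; rewrite (@step_det _ _ (at_pc 0 phExec) (Some None) DS DS None) //=.
have -> // : upd (fun=> None) 0 (Some None) = tape 0 (fun=> 0).
by apply: functional_extensionality => -[|i].
Qed.

Lemma Lok0 : Lok B 0 cinit.
Proof. by split. Qed.

Lemma creach_step c c' : creach C w c -> cstep C w c c' -> creach C w c'.
Proof. by move=> r s; apply: rt_trans r (rt_step _ _ _ _ s). Qed.

Lemma cm_tm_forward c : creach C w c -> exists2 L, Lok B L c & reach cm_tm w (enc_ccfg L c).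
Proof.
move=> /clos_rt_rtn1_iff; elim=> [|d e de rd [L okL rL]].
  by exists 0; [exact: Lok0|exact: drun_star init_run].
have re : creach C w e by apply: creach_step de; apply/clos_rt_rtn1_iff.
have [L' [okL' _ [run|[_ s]]]] := sim_step okL de (bnd re).
  by exists L' => //; apply: rt_trans rL (drun_star (drunpW run)).
by exists L' => //; apply: rt_trans rL (rt_step _ _ _ _ s).
Qed.

(** A Turing configuration in the middle of the simulation of an instruction is described by the
    encoding that it is bound to reach. *)
Definition on_track (tc : cfg cm_tm) :=
  exists c L, [/\ creach C w c, Lok B L c & drunT L tc (enc_ccfg L c)].

(** A step of the Turing machine either stays on the forced run to an encoding or leaves an
    encoding. In the latter case the instruction is a choice, or it has a simulated step whose first
    move must be this one, or it halts and there is no move at all. *)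
Lemma cm_tm_backward tc : reach cm_tm w tc -> on_track tc.
Proof.
move=> /clos_rt_rtn1_iff; elim=> [|d e de _ [c [L [rc okL run]]]].
  by exists cinit, 0; split; [exact: rt_refl|exact: Lok0|exact: init_run].
have [[_ rune]|] := drun_split run (rt_step _ _ _ _ de); first by exists c, L.
inversion run as [d' E|d' d1 d2 g sd run' E1 E2]; subst; last first.
  by move: de => /sd -> _; exists c, L.
move=> _; case: (okL) => pcl _ vL.
have [[l cho]|ncho] : (exists l, nth IHlt C (cpc c) = ICho l) \/ ~ (exists l, nth IHlt C (cpc c) = ICho l).
  by case: (nth IHlt C (cpc c)) => *; try (by right; case); left; eexists.
  have [c' s [-> [pcl' rE]]] := enc_cho pcl cho de.
  exists c', L; split; [exact: creach_step s| |exact: drun_refl].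
  by case: okL => ? ? ?; split; rewrite ?rE.
have [[c' s]|nos] : (exists c', cstep C w c c') \/ ~ (exists c', cstep C w c c').
  rewrite /cstep; case: (csucc C w c) => [|c' ?]; first by right; case.
  by left; exists c'; left.
  have [L' [okL' LL' [run'|[/ncho//]]]] := sim_step okL s (bnd (creach_step rc s)).
  exists c', L'; split=> //; first exact: creach_step s.
  exact: drunp_next run' de.
by case: (@enc_halt L c pcl _ e de) => c' s; apply: nos; exists c'.
Qed.

Lemma exp_log2 L : (0 < L -> 2 ^ L.-1 <= B) -> L <= Nat.log2 B + 1.
Proof.
case: L => // L /(_ isT) /= h; have -> : Nat.log2 B + 1 = (Nat.log2 B).+1 by lia.
rewrite ltnS; apply/leP; have B0 : 0 < B by apply: leq_trans h; rewrite expn_gt0.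
apply/Nat.log2_le_pow2; first by apply/ltP.
apply/leP; suff -> : Nat.pow 2 L = 2 ^ L by [].
by elim: L {h} => //= L ->; rewrite expnS; lia.
Qed.

(** At most [Nat.log2 B + 1] cells carry register bits, and the head goes one cell beyond them to
    meet the blank. *)
Lemma cm_tm_space tc : reach cm_tm w tc -> cwp tc <= Nat.log2 B + 2.
Proof.
move=> /cm_tm_backward[c [L [_ [_ /exp_log2 hL _] run]]].
inversion run as [d' E|d' d1 d2 [g _] sd run' E1 E2]; subst; first by rewrite /=; lia.
lia.
Qed.

Lemma cm_tm_accept o :
  (exists c, [/\ creach C w c, nth IHlt C (cpc c) = IAcc & cemit c = o]) <->
  exists tc, [/\ reach cm_tm w tc, q_acc cm_tm (cq tc) & cout tc = o].
Proof.
split=> [[c [/cm_tm_forward[L [pcl _ _] rL] ia <-]]|[tc [/cm_tm_backward[c [L [rc [pcl _ _] run]]] acc <-]]].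
  by exists (enc_ccfg L c); split=> //; rewrite /= inordK // ia.
inversion run as [d' E|d' d1 d2 [_ g] sd run' E1 E2]; subst; last by move: g; rewrite /= in acc; rewrite acc.
exists c; split=> //; move: acc; rewrite /= inordK //.
by case: (nth _ _ _).
Qed.
End Sim.
End TMofCM.

(** * Structured programs *)

(** The loop and the conditional test a register by decrementing it, so the tested register is used
    up; this is why [ccopy] works with an auxiliary register. *)
Inductive cmd : Type :=
| CNop | CInc (x : nat) | COut (t : tok) | CMov (d : dir) | CSeq (a b : cmd)
| CLoop (x : nat) (a : cmd) | CIf (x : nat) (a : cmd)
| CTok (t : option tok) (a : cmd) | CWTok (a : cmd).

Fixpoint csize (c : cmd) : nat :=
  match c with
  | CNop => 0 | CInc _ | COut _ | CMov _ => 1 | CSeq a b => csize a + csize b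
  | CLoop _ a => csize a + 2 | CIf _ a | CTok _ a => csize a + 1 | CWTok a => csize a + 3
  end.

Fixpoint compile (pc : nat) (c : cmd) : seq instr :=
  match c with
  | CNop => [::]
  | CInc x => [:: IInc x]
  | COut t => [:: IOut t]
  | CMov d => [:: IMov d]
  | CSeq a b => compile pc a ++ compile (pc + csize a) b
  | CLoop x a => IDec x (pc + csize a + 2) :: compile pc.+1 a ++ [:: IJmp pc]
  | CIf x a => IDec x (pc + csize a + 1) :: compile pc.+1 a
  | CTok t a => ITst t (pc + csize a + 1) :: compile pc.+1 a
  | CWTok a => [:: ITst None pc.+2, IJmp (pc + csize a + 3) & compile pc.+2 a ++ [:: IJmp pc]]
  end.

Lemma size_compile c : forall pc, size (compile pc c) = csize c.
Proof.
by elim: c => //= [a IHa b IHb|x a IH|x a IH|t a IH|a IH] pc;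
  rewrite ?size_cat ?IHa ?IHb ?IH /=; lia.
Qed.

Section Exec.
Variables (B : nat) (w : seq tok).

(** The bound [B] is part of the semantics: an increment is possible only below [B], so the mere
    existence of an execution from a bounded state bounds all registers throughout the run. *)
Inductive exec : cmd -> nat * (nat -> nat) * seq tok -> nat * (nat -> nat) * seq tok -> Prop :=
| xNop s : exec CNop s s
| xInc x h v o : v x < B -> exec (CInc x) (h, v, o) (h, upd v x (v x).+1, o)
| xOut t h v o : exec (COut t) (h, v, o) (h, v, rcons o t)
| xMov d h v o : exec (CMov d) (h, v, o) (move_in (size w) d h, v, o)
| xSeq a b s1 s2 s3 : exec a s1 s2 -> exec b s2 s3 -> exec (CSeq a b) s1 s3
| xLoop0 x a h v o : v x = 0 -> exec (CLoop x a) (h, v, o) (h, v, o)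
| xLoopS x a h v o n s1 s2 : v x = n.+1 -> exec a (h, upd v x n, o) s1 ->
    exec (CLoop x a) s1 s2 -> exec (CLoop x a) (h, v, o) s2
| xIf0 x a h v o : v x = 0 -> exec (CIf x a) (h, v, o) (h, v, o)
| xIfS x a h v o n s : v x = n.+1 -> exec a (h, upd v x n, o) s -> exec (CIf x a) (h, v, o) s
| xTok1 t a h v o s : read_in w h = t -> exec a (h, v, o) s -> exec (CTok t a) (h, v, o) s
| xTok0 t a h v o : read_in w h <> t -> exec (CTok t a) (h, v, o) (h, v, o)
| xWTok0 a h v o : read_in w h = None -> exec (CWTok a) (h, v, o) (h, v, o)
| xWTokS a h v o s1 s2 : read_in w h <> None -> exec a (h, v, o) s1 ->
    exec (CWTok a) s1 s2 -> exec (CWTok a) (h, v, o) s2.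

Definition code_at (C : seq instr) pc code := exists C1 C2, size C1 = pc /\ C = C1 ++ code ++ C2.

Lemma code_at_cat C pc a b :
  code_at C pc (a ++ b) -> code_at C pc a /\ code_at C (pc + size a) b.
Proof.
move=> [C1 [C2 [<- ->]]]; split; first by exists C1, (b ++ C2); rewrite -catA.
by exists (C1 ++ a), C2; rewrite size_cat -!catA.
Qed.

Lemma code_at_cons C pc i a : code_at C pc (i :: a) -> nth IHlt C pc = i /\ code_at C pc.+1 a.
Proof.
move=> [C1 [C2 [h ->]]]; split; first by rewrite nth_cat -h ltnn subnn.
by exists (rcons C1 i), C2; rewrite size_rcons cat_rcons h.
Qed.

Definition cgood C (c : ccfg) :=
  (forall x, creg c x <= B) /\ nth IHlt C (cpc c) <> IAcc.

Definition cfg_of pc (s : nat * (nat -> nat) * seq tok) := CCfg pc s.1.1 s.1.2 s.2.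

Lemma drun1 C pc s c : (forall x, s.1.2 x <= B) -> nth IHlt C pc <> IAcc ->
  csucc C w (cfg_of pc s) = [:: c] -> drun (cstep C w) (cgood C) (cfg_of pc s) c.
Proof.
move=> vB nacc e; apply: drun_step (drun_refl _ _ _); first by split.
by move=> c'; rewrite /cstep e /=; split=> [[|//]|->]; auto.
Qed.

Lemma exec_drun C c s s' : exec c s s' -> forall pc, code_at C pc (compile pc c) ->
  (forall x, s.1.2 x <= B) ->
  drun (cstep C w) (cgood C) (cfg_of pc s) (cfg_of (pc + csize c) s') /\
  (forall x, s'.1.2 x <= B).
Proof.
have updB v x n : (forall x, v x <= B) -> n <= B -> forall y, upd v x n y <= B.
  by move=> hv hn y; rewrite /upd; case: ifP.
elim=> {c s s'}.
- by move=> s pc _ sB; rewrite addn0; split=> //; exact: drun_refl.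
- move=> x h v o vx pc /code_at_cons[ix _] sB /=; split; last exact: updB.
  by apply: drun1 => //=; rewrite ix // addn1.
- move=> t h v o pc /code_at_cons[ix _] sB /=; split=> //.
  by apply: drun1 => //=; rewrite ix // addn1.
- move=> d h v o pc /code_at_cons[ix _] sB /=; split=> //.
  by apply: drun1 => //=; rewrite ix // addn1.
- move=> a b s1 s2 s3 _ IHa _ IHb pc /code_at_cat[/IHa{}IHa]; rewrite size_compile.
  move=> /IHb{}IHb /IHa[run1 /IHb[run2 B3]]; split=> //.
  by rewrite /= addnA; apply: drun_trans run2.
- move=> x a h v o vx pc /code_at_cons[ix _] sB /=; split=> //.
  by apply: drun1 => //=; rewrite ix // vx /cfg_of /= addnA.
- move=> x a h v o n s1 s2 vx _ IHa _ IHl pc cc sB; move: (cc) => /=.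
  move=> /code_at_cons[ix /code_at_cat[/IHa{}IHa]].
  rewrite size_compile => /code_at_cons[jx _].
  have [|run1 B1] := IHa; first by apply: updB => //; have := sB x; rewrite /= vx; lia.
  have [run2 B2] := IHl _ cc B1; split=> //.
  apply: drun_trans; first by apply: drun1 => //=; rewrite ix // vx.
  apply: drun_trans run1 _; apply: drun_trans run2.
  by apply: drun1 => //=; rewrite jx.
- move=> x a h v o vx pc /code_at_cons[ix _] sB /=; split=> //.
  by apply: drun1 => //=; rewrite ix // vx /cfg_of /= addnA.
- move=> x a h v o n s vx _ IHa pc /= /code_at_cons[ix /IHa{}IHa] sB.
  have [|run1 B1] := IHa; first by apply: updB => //; have := sB x; rewrite /= vx; lia.
  split=> //; apply: drun_trans; first by apply: drun1 => //=; rewrite ix // vx.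
  by have -> : pc + (csize a + 1) = pc.+1 + csize a by lia.
- move=> t a h v o s rd _ IHa pc /= /code_at_cons[ix /IHa{}IHa] sB.
  have [//|run1 B1] := IHa.
  split=> //; apply: drun_trans; first by apply: drun1 => //=; rewrite ix // rd eqxx.
  by have -> : pc + (csize a + 1) = pc.+1 + csize a by [lia]; rewrite rd eqxx.
- move=> t a h v o rd pc /= /code_at_cons[ix _] sB; split=> //.
  apply: drun1 => //=; rewrite ix // /cfg_of /= addnA.
  by case: eqP => // /tokn_inj.
- move=> a h v o rd pc /= /code_at_cons[ix /code_at_cons[jx _]] sB; split=> //.
  apply: (@drun_trans _ _ _ _ (cfg_of pc.+1 (h, v, o))).
    by apply: drun1 => //=; rewrite ix // rd eqxx.
  by apply: drun1 => //=; rewrite jx // /cfg_of addnA.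
- move=> a h v o s1 s2 rd _ IHa _ IHl pc cc sB; move: (cc) => /=.
  move=> /code_at_cons[ix /code_at_cons[_ /code_at_cat[/IHa{}IHa]]].
  rewrite size_compile => /code_at_cons[jx _].
  have [//|run1 B1] := IHa.
  have [run2 B2] := IHl _ cc B1; split=> //.
  apply: (@drun_trans _ _ _ _ (cfg_of pc.+2 (h, v, o))).
    apply: drun1 => //=; rewrite ix // /cfg_of /=.
    by case: eqP => // e; case: rd; exact: tokn_inj.
  apply: drun_trans run1 _; apply: drun_trans run2.
  by apply: drun1 => //=; rewrite jx.
Qed.

End Exec.

(** * Terms *)

(* [Rec d n b i body] iterates [body] over the index and the running value,
   clipping the latter at [b]; the body sees the first [d] variables, the index
   and the running value. *)
Inductive tm : Type :=
| Var (i : nat) | Zero | Suc (t : tm) | Add (a b : tm) | Mul (a b : tm)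
| Inp (t : tm) | Len | Rec (d : nat) (n b i body : tm).

Fixpoint eval (w : seq tok) (e : seq nat) (t : tm) : nat :=
  match t with
  | Var i => nth 0 e i
  | Zero => 0
  | Suc t => (eval w e t).+1
  | Add a b => eval w e a + eval w e b
  | Mul a b => eval w e a * eval w e b
  | Inp t => tokn (read_in w (eval w e t).+1)
  | Len => size w
  | Rec d n b i body =>
    iteri (eval w e n)
      (fun k a => minn (eval w e b) (eval w (take d e ++ [:: k; a]) body))
      (minn (eval w e b) (eval w e i))
  end.

(** Bounds the value of a term and also the register contents during its evaluation, hence the extra
    summands for the factors of a product. In [Rec] the clipping keeps the running value below
    [bnd b m], so the bound of the body is not iterated and the whole stays polynomial. *)
Fixpoint bnd (t : tm) (m : nat) : nat :=
  match t with
  | Var _ | Len => m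
  | Zero => 0
  | Suc t => (bnd t m).+1
  | Add a b => bnd a m + bnd b m
  | Mul a b => bnd a m * bnd b m + bnd a m + bnd b m
  | Inp t => bnd t m + 6
  | Rec _ n b i body => bnd n m + bnd b m + bnd i m + bnd body (m + bnd n m + bnd b m)
  end.

Lemma tokn_le a : tokn a <= 6.
Proof. by case: a => [[]|]. Qed.

Lemma eval_bnd w t : forall e m, size w <= m -> all (fun x => x <= m) e -> eval w e t <= bnd t m.
Proof.
elim: t => //=.
- move=> i e m _ /allP h; have [ie|ie] := ltnP i (size e); last by rewrite nth_default.
  exact: h (mem_nth _ _).
- by move=> a IHa b IHb e m h1 h2; rewrite leq_add ?IHa ?IHb.
- move=> a IHa b IHb e m h1 h2; rewrite -addnA; apply: leq_trans (leq_addr _ _).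
  by rewrite leq_mul ?IHa ?IHb.
- by move=> t _ e m _ _; set a := (if _ then _ else _); have := tokn_le a; lia.
- move=> d n IHn b IHb i IHi body _ e m h1 h2.
  have h := IHb _ _ h1 h2.
  by case: (eval w e n) => [|k] /=; lia.
Qed.

Definition cmove x y := CLoop x (CInc y).
Definition cclear x := CLoop x CNop.
Definition ccopy x y z := CSeq (CLoop x (CSeq (CInc y) (CInc z))) (cmove z x).
Definition cincn n x := iter n (CSeq (CInc x)) CNop.
Definition chome := CSeq (CMov DL) (CWTok (CMov DL)).
Definition ctokn dst t := CTok t (cincn (tokn t) dst).
Definition cread dst :=
  CSeq (ctokn dst (Some T0)) (CSeq (ctokn dst (Some T1)) (CSeq (ctokn dst (Some TSep))
  (CSeq (ctokn dst (Some TOpen)) (CSeq (ctokn dst (Some TClose)) (ctokn dst (Some TNeg)))))).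
(* moves [min t bd] to [a], clearing [t] *)
Definition cclip bd t a u :=
  CSeq (CLoop bd (CSeq (CInc u) (CIf t (CInc a)))) (CSeq (cmove u bd) (cclear t)).

(** The value is added to register [dst], and the scratch registers from [fr] on are zero again at
    the end. In [Rec], [fr] counts the remaining rounds, [fr + 1] holds the clipping bound, [fr + 2]
    the index, [fr + 3] the running value and [fr + 4] the new value before clipping. *)
Fixpoint comp (t : tm) (rho : seq nat) (dst fr : nat) : cmd :=
  match t with
  | Var i => if i < size rho then ccopy (nth 0 rho i) dst fr else CNop
  | Zero => CNop
  | Suc t => CSeq (comp t rho dst fr) (CInc dst)
  | Add a b => CSeq (comp a rho dst fr) (comp b rho dst fr)
  | Mul a b =>
    CSeq (comp a rho fr fr.+1) (CSeq (comp b rho fr.+1 fr.+2)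
      (CSeq (CLoop fr (ccopy fr.+1 dst fr.+2)) (cclear fr.+1)))
  | Inp t =>
    CSeq (comp t rho fr fr.+1) (CSeq (CMov DR) (CSeq (CLoop fr (CMov DR))
      (CSeq (cread dst) chome)))
  | Len => CSeq (CMov DR) (CSeq (CWTok (CSeq (CInc dst) (CMov DR))) chome)
  | Rec d n b i body =>
    CSeq (comp n rho fr (fr + 1)) (CSeq (comp b rho (fr + 1) (fr + 2))
    (CSeq (comp i rho (fr + 4) (fr + 5)) (CSeq (cclip (fr + 1) (fr + 4) (fr + 3) (fr + 5))
    (CSeq (CLoop fr (CSeq (comp body (take d rho ++ [:: fr + 2; fr + 3]) (fr + 4) (fr + 5))
             (CSeq (cclear (fr + 3)) (CSeq (cclip (fr + 1) (fr + 4) (fr + 3) (fr + 5))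
                (CInc (fr + 2))))))
    (CSeq (cmove (fr + 3) dst) (CSeq (cclear (fr + 1)) (cclear (fr + 2))))))))
  end.

Ltac store_eq :=
  apply: functional_extensionality => ?; rewrite /upd;
  repeat (case: eqP => ?; try subst); try lia.

Section CompCorrect.
Variables (B : nat) (w : seq tok).
Notation ex := (exec B w).

Lemma ex_to c s s1 s2 : ex c s s1 -> s1 = s2 -> ex c s s2.
Proof. by move=> h <-. Qed.

(** Loops count down, so [f i] has to be the state with [i] rounds left. *)
Lemma ex_loop x a (f : nat -> nat * (nat -> nat) * seq tok) n :
  (forall i, i <= n -> (f i).1.2 x = i) ->
  (forall i, i < n -> ex a ((f i.+1).1.1, upd (f i.+1).1.2 x i, (f i.+1).2) (f i)) ->
  ex (CLoop x a) (f n) (f 0).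
Proof.
elim: n => [|n IH] hx ha.
  by have := hx 0 isT; case: (f 0) => -[h v] o /= e; apply: xLoop0.
have := ha n (ltnSn n); have := hx n.+1 (leqnn _); case: (f n.+1) => -[h v] o /= e ea.
by apply: xLoopS e ea _; apply: IH => i hi; [apply: hx|apply: ha]; lia.
Qed.

Lemma ex_move x y h v o : x != y -> v y + v x <= B ->
  ex (cmove x y) (h, v, o) (h, upd (upd v y (v y + v x)) x 0, o).
Proof.
move=> xy vB.
pose f i := (h, upd (upd v y (v y + (v x - i))) x i, o).
apply: (@ex_to _ _ (f 0)); last by rewrite /f subn0.
have -> : (h, v, o) = f (v x) by rewrite /f subnn; congr (_, _, _); store_eq.
apply: ex_loop => i hi; first by rewrite /= upd_eq.
rewrite /f /=; apply: ex_to; first by apply: xInc; rewrite /upd; repeat case: eqP; lia.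
by congr (_, _, _); store_eq.
Qed.

Lemma ex_clear x h v o : ex (cclear x) (h, v, o) (h, upd v x 0, o).
Proof.
pose f i := (h, upd v x i, o).
have -> : (h, v, o) = f (v x) by rewrite /f upd_same.
apply: (@ex_loop x CNop f) => i hi; first by rewrite /= upd_eq.
by apply: ex_to; [exact: xNop|congr (_, _, _); rewrite /=; store_eq].
Qed.

Lemma ex_copy x y z h v o : x != y -> x != z -> y != z -> v z = 0 ->
  v y + v x <= B -> v x <= B ->
  ex (ccopy x y z) (h, v, o) (h, upd v y (v y + v x), o).
Proof.
move=> xy xz yz vz vB vB'.
pose f i := (h, upd (upd (upd v z (v x - i)) y (v y + (v x - i))) x i, o).
apply: (@xSeq _ _ _ _ _ (f 0)).
  have -> : (h, v, o) = f (v x) by rewrite /f subnn; congr (_, _, _); store_eq.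
  apply: ex_loop => i hi; first by rewrite /= upd_eq.
  rewrite /f /=; apply: xSeq; first by apply: xInc; rewrite /upd; repeat case: eqP; lia.
  apply: ex_to; first by apply: xInc; rewrite /upd; repeat case: eqP; lia.
  by congr (_, _, _); store_eq.
apply: ex_to; first by apply: ex_move; rewrite 1?eq_sym // /upd; repeat case: eqP; lia.
by congr (_, _, _); store_eq.
Qed.

Lemma ex_incn n x h v o : v x + n <= B -> ex (cincn n x) (h, v, o) (h, upd v x (v x + n), o).
Proof.
elim: n v => [|n IH] v vB /=; first by rewrite addn0 upd_same //; exact: xNop.
apply: xSeq; first by apply: xInc; lia.
apply: ex_to; first by apply: IH; rewrite upd_eq; lia.
by congr (_, _, _); store_eq.
Qed.

Lemma ex_read dst h v o : v dst + 6 <= B ->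
  ex (cread dst) (h, v, o) (h, upd v dst (v dst + tokn (read_in w h)), o).
Proof.
move=> vB; have vB' a : v dst + tokn a <= B by have := tokn_le a; lia.
have skip t v' : read_in w h <> t -> ex (ctokn dst t) (h, v', o) (h, v', o) by exact: xTok0.
have hit t : read_in w h = t -> ex (ctokn dst t) (h, v, o) (h, upd v dst (v dst + tokn t), o).
  by move=> e; apply: xTok1 => //; apply: ex_incn.
rewrite /cread; case rd: (read_in w h) => [t|]; last rewrite [tokn _]/= addn0 upd_same //.
  by case: t rd => rd;
    repeat first [apply: (hit _ rd) | by apply: skip; rewrite rd
                 | apply: xSeq; first exact: (hit _ rd) | apply: xSeq; first by apply: skip; rewrite rd].
by repeat first [by apply: skip; rewrite rd | apply: xSeq; first by apply: skip; rewrite rd].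
Qed.

Lemma ex_wleft h v o : h <= size w -> ex (CWTok (CMov DL)) (h, v, o) (0, v, o).
Proof.
elim: h => [|h IH] hw; first exact: xWTok0.
apply: xWTokS (IH _); [by rewrite /= hw|exact: xMov|exact: ltnW].
Qed.

Lemma ex_home h v o : h <= (size w).+1 -> ex chome (h, v, o) (0, v, o).
Proof. by move=> hw; apply: xSeq (xMov _ _ _ _ _ _) _; apply: ex_wleft; rewrite /=; lia. Qed.

Lemma ex_clip bd t a u h v o :
  uniq [:: bd; t; a; u] -> v a = 0 -> v u = 0 -> v bd <= B ->
  ex (cclip bd t a u) (h, v, o) (h, upd (upd v a (minn (v bd) (v t))) t 0, o).
Proof.
rewrite /= !inE !negb_or => /and4P[/and3P[n1 n2 n3] /andP[n4 n5] n6 _] va vu vB.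
pose f i := (h, upd (upd (upd (upd v u (v bd - i)) a (minn (v bd - i) (v t))) t (v t - (v bd - i))) bd i, o).
apply: (@xSeq _ _ _ _ _ (f 0)).
  have -> : (h, v, o) = f (v bd) by rewrite /f subnn; congr (_, _, _); store_eq.
  apply: ex_loop => i hi; first by rewrite /= upd_eq.
  rewrite /f /=; apply: xSeq; first by apply: xInc; rewrite /upd; repeat case: eqP; lia.
  case E: (v t - (v bd - i.+1)) => [|k].
    apply: ex_to; first by apply: xIf0; rewrite /upd; repeat case: eqP; lia.
    by congr (_, _, _); store_eq.
  apply: ex_to.
    apply: (@xIfS _ _ _ _ _ _ _ k); first by rewrite /upd; repeat case: eqP; lia.
    by apply: xInc; rewrite /upd; repeat case: eqP; lia.
  by congr (_, _, _); store_eq.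
apply: xSeq; first by apply: ex_move; rewrite 1?eq_sym // /upd; repeat case: eqP; lia.
apply: ex_to; first exact: ex_clear.
by congr (_, _, _); store_eq.
Qed.

(* The register conventions under which [comp] works: variables and the target
   are below the first free register [fr], above which everything is zero. *)
Definition okst (rho : seq nat) dst fr (v : nat -> nat) m :=
  [/\ (forall r, r \in rho -> r < fr), dst < fr, dst \notin rho,
      (forall r, fr <= r -> v r = 0) & (forall r, v r <= B) /\ all (fun r => v r <= m) rho].

Lemma okst_upd rho dst fr v m x dst' fr' n :
  okst rho dst fr v m -> x \notin rho -> fr <= fr' -> x < fr' -> n <= B ->
  dst' < fr' -> dst' \notin rho -> okst rho dst' fr' (upd v x n) m /\ map (upd v x n) rho = map v rho.
Proof.
move=> [rf df dr v0 [vB rm]] xr ff xf nB df' dr'.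
have E : map (upd v x n) rho = map v rho.
  by apply/eq_in_map => r rr; rewrite /upd; case: eqP => // e; rewrite e (negPf xr) in rr.
split=> //; split=> //.
- by move=> r /rf; lia.
- by move=> r rr; rewrite /upd; case: eqP => [e|_]; [lia|apply: v0; lia].
- split; first by move=> r; rewrite /upd; case: eqP.
  by rewrite -(all_map _ (fun x => x <= m)) E all_map.
Qed.

Lemma okst_fresh rho dst fr v m r : okst rho dst fr v m -> fr <= r -> r \notin rho.
Proof. by case=> rf _ _ _ _ h; apply/negP => /rf; lia. Qed.

Lemma comp_correct t : forall rho dst fr v o m,
  size w <= m -> okst rho dst fr v m -> v dst + bnd t m <= B ->
  ex (comp t rho dst fr) (0, v, o) (0, upd v dst (v dst + eval w (map v rho) t), o).
Proof.
have bde (rho : seq nat) (v : nat -> nat) m t' : size w <= m -> all (fun r => v r <= m) rho ->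
    eval w (map v rho) t' <= bnd t' m by move=> *; apply: eval_bnd; rewrite ?all_map.
elim: t => [i||t IH|a IHa b IHb|a IHa b IHb|t IH||d n IHn b IHb i IHi body IHbody]
  rho dst fr v o m wm ok tB /=; move: (ok) => [rf df dr v0 [vB rm]].
- case: ltnP => ir; last by rewrite nth_default ?size_map // addn0 upd_same //; exact: xNop.
  rewrite (nth_map 0) //; have ri := mem_nth 0 ir; have rfi := rf _ ri.
  have /= vm := allP rm _ ri; rewrite /= in tB.
  apply: ex_copy; [by apply: contraNneq dr => <-| | |exact: v0|lia|exact: vB].
    by rewrite neq_ltn rfi.
  by rewrite neq_ltn df.
- by rewrite addn0 upd_same //; exact: xNop.
- rewrite /= in tB; have tb := bde _ _ _ t wm rm.
  apply: xSeq; first by apply: (IH _ _ _ _ _ _ wm ok); lia.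
  apply: ex_to; first by apply: xInc; rewrite upd_eq; lia.
  by congr (_, _, _); store_eq.
- rewrite /= in tB; have tb := bde _ _ _ a wm rm.
  have [|ok1 E] := okst_upd (n := v dst + eval w (map v rho) a) ok dr (leqnn fr) df _ df dr; first lia.
  apply: xSeq; first by apply: (IHa _ _ _ _ _ _ wm ok); lia.
  apply: ex_to; first by apply: (IHb _ _ _ _ _ _ wm ok1); rewrite upd_eq; lia.
  by rewrite E; congr (_, _, _); store_eq.
- rewrite /= in tB; have ta := bde _ _ _ a wm rm; have tb := bde _ _ _ b wm rm.
  set x := eval w _ a in ta *; set y := eval w _ b in tb *.
  have fr1 := okst_fresh ok (leqnn fr); have fr2 := okst_fresh ok (leqnSn fr).
  have z0 := v0 fr (leqnn _); have z1 := v0 fr.+1 (leqnSn _).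
  have z2 : v fr.+2 = 0 by apply: v0; lia.
  (* Storing the present value of [fr] leaves the state as it is; the point is to make [fr] the
     target and [fr.+1] the first free register. *)
  have [|ok1 _] := okst_upd (n := v fr) ok fr1 (leqnSn fr) (ltnSn fr) _ (ltnSn fr) fr1; first by rewrite v0.
  rewrite upd_same // in ok1.
  apply: xSeq; first by apply: (IHa _ _ _ _ _ _ wm ok1); rewrite v0 //; lia.
  rewrite v0 // add0n -/x.
  have [|||||ok2 E] := okst_upd (n := x) (dst' := fr.+1) (fr' := fr.+2) ok fr1; try lia.
  apply: xSeq; first by apply: (IHb _ _ _ _ _ _ wm ok2); rewrite /upd; case: eqP => [|_]; [lia|rewrite v0; lia].
  rewrite E -/y.
  pose f k := (0, upd (upd (upd v fr k) fr.+1 y) dst (v dst + (x - k) * y), o).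
  have xy : x * y <= bnd a m * bnd b m by apply: leq_mul.
  apply: (@xSeq _ _ _ _ _ (f 0)).
    apply: (@ex_to _ _ (f 0)) => //.
    have -> : (0, upd (upd v fr x) fr.+1 (upd v fr x fr.+1 + y), o) = f x.
      rewrite /f subnn mul0n addn0; congr (_, _, _).
      by store_eq.
    apply: ex_loop => k hk; first by rewrite /= /upd; repeat case: eqP; lia.
    have ky : (x - k) * y <= x * y by rewrite leq_mul2r leq_subr orbT.
    have ky' : (x - k) * y = (x - k.+1) * y + y by have -> : x - k = (x - k.+1).+1 by [lia]; rewrite mulSn; lia.
    rewrite /f /=; apply: ex_to.
      by apply: ex_copy; rewrite /upd; repeat (case: eqP => ?); lia.
    by congr (_, _, _); store_eq.
  apply: ex_to; first exact: ex_clear.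
  by rewrite subn0; congr (_, _, _); store_eq.
- rewrite /= in tB; have tb := bde _ _ _ t wm rm.
  have fr1 := okst_fresh ok (leqnn fr).
  have [|ok1 _] := okst_upd (n := v fr) ok fr1 (leqnSn fr) (ltnSn fr) _ (ltnSn fr) fr1; first by rewrite v0.
  rewrite upd_same // in ok1.
  apply: xSeq; first by apply: (IH _ _ _ _ _ _ wm ok1); rewrite v0 //; lia.
  rewrite v0 // add0n; set x := eval w _ t in tb *.
  apply: xSeq; first exact: xMov.
  pose f k := (minn (1 + (x - k)) (size w).+1, upd v fr k, o).
  apply: (@xSeq _ _ _ _ _ (f 0)).
    have -> : (move_in (size w) DR 0, upd v fr x, o) = f x by rewrite /f subnn /=; congr (_, _, _); lia.
    apply: ex_loop => k hk; first by rewrite /= upd_eq.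
    rewrite /f; apply: ex_to; first exact: xMov.
    by rewrite /=; congr (_, _, _); [lia|store_eq].
  rewrite /f subn0 add1n.
  have -> : upd v fr 0 = v by rewrite upd_same // v0.
  apply: xSeq; first by apply: ex_read; lia.
  apply: ex_to; first by apply: ex_home; lia.
  congr (_, upd _ _ (_ + tokn _), _); rewrite minnSS.
  have [//|xw] := leqP x (size w).
  by rewrite /read_in /= ltnn ltnNge ltnW.
- rewrite /= in tB; apply: xSeq; first exact: xMov.
  apply: xSeq; last by apply: ex_home; exact: leqnn.
  have -> : move_in (size w) DR 0 = 1 by rewrite /=; lia.
  suff loop k : k <= size w ->
      ex (CWTok (CSeq (CInc dst) (CMov DR))) ((size w - k).+1, upd v dst (v dst + (size w - k)), o)
         ((size w).+1, upd v dst (v dst + size w), o).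
    by have := loop _ (leqnn _); rewrite subnn addn0 upd_same.
  elim: k => [|k IH] kw; first by rewrite subn0; apply: xWTok0; rewrite /= ltnn.
  apply: xWTokS (IH _); last exact: ltnW.
    by rewrite /= ifT //; lia.
  apply: xSeq; first by apply: xInc; rewrite upd_eq; lia.
  apply: ex_to; first exact: xMov.
  by rewrite /=; congr (_, _, _); [lia|store_eq].
- rewrite /= in tB; have tn := bde _ _ _ n wm rm; have tb := bde _ _ _ b wm rm; have ti := bde _ _ _ i wm rm.
  set N := eval w _ n in tn *; set Bd := eval w _ b in tb *; set I0 := eval w _ i in ti *.
  have fre k : fr + k \notin rho by apply: okst_fresh ok _; lia.
  have vz k : v (fr + k) = 0 by apply: v0; lia.
  have vfr : v fr = 0 by apply: v0.
  have z1 := vz 1; have z2 := vz 2; have z3 := vz 3; have z4 := vz 4; have z5 := vz 5.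
  have fre0 : fr \notin rho by apply: okst_fresh ok _.
  have [|||||ok1 _] := okst_upd (n := v fr) (dst' := fr) (fr' := fr + 1) ok fre0 => //; try lia.
  rewrite upd_same // in ok1.
  apply: xSeq; first by apply: (IHn _ _ _ _ _ _ wm ok1); lia.
  rewrite vfr add0n -/N.
  have [|||||ok2 E2] := okst_upd (n := N) (dst' := fr + 1) (fr' := fr + 2) ok fre0 => //; try lia.
  apply: xSeq; first by apply: (IHb _ _ _ _ _ _ wm ok2); rewrite /upd; case: eqP => [|_]; [lia|rewrite vz; lia].
  rewrite E2 -/Bd.
  have -> : upd v fr N (fr + 1) = 0 by rewrite /upd; case: eqP => [|_]; [lia|exact: vz].
  rewrite add0n.
  have [|||||ok3 E3] := okst_upd (n := Bd) (dst' := fr + 4) (fr' := fr + 5) ok2 (fre 1) => //; try lia.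
  apply: xSeq.
    by apply: (IHi _ _ _ _ _ _ wm ok3); rewrite /upd; repeat (case: eqP => ?); lia.
  rewrite E3 E2 -/I0.
  pose av k := iteri k (fun k a => minn Bd (eval w (take d (map v rho) ++ [:: k; a]) body)) (minn Bd I0).
  have avB k : av k <= Bd by case: k => [|k]; rewrite /av /=; lia.
  pose g k := upd (upd (upd (upd v fr (N - k)) (fr + 1) Bd) (fr + 2) k) (fr + 3) (av k).
  apply: (@xSeq _ _ _ _ _ (0, g 0, o)).
    apply: ex_to.
      by apply: ex_clip; first (by rewrite /= ?inE; lia); rewrite /upd; repeat (case: eqP => ?); lia.
    rewrite /g subn0; congr (_, _, _).
    by apply: functional_extensionality => r; rewrite /upd /av /=; repeat (case: eqP => ?; try subst); lia.
  apply: (@xSeq _ _ _ _ _ (0, g N, o)).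
    pose f k := (0, g (N - k), o).
    have -> : (0, g N, o) = f 0 by rewrite /f subn0.
    have -> : (0, g 0, o) = f N by rewrite /f subnn.
    apply: ex_loop => k hk; first by rewrite /f /g /= /upd; repeat case: eqP; lia.
    rewrite /f /=; set j := N - k.+1.
    have -> : N - k = j.+1 by rewrite /j; lia.
    have jN : j < N by rewrite /j; lia.
    set rho' := take d rho ++ [:: fr + 2; fr + 3].
    have Emap : map (upd (g j) fr k) rho' = take d (map v rho) ++ [:: j; av j].
      rewrite map_cat map_take; congr (take d _ ++ _).
        apply/eq_in_map => r rr; have := rf _ rr.
        by rewrite /g /upd; repeat (case: eqP => ?); lia.
      rewrite /= /g /upd; congr [:: _; _]; repeat (case: eqP => ?); lia.
    have vbody : eval w (take d (map v rho) ++ [:: j; av j]) body <= bnd body (m + bnd n m + bnd b m).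
      apply: eval_bnd; first lia.
      rewrite all_cat; apply/andP; split.
        apply/allP => r /mem_take /mapP[r' /(allP rm) h ->]; lia.
      by have := avB j; rewrite /=; lia.
    have ok4 : okst rho' (fr + 4) (fr + 5) (upd (g j) fr k) (m + bnd n m + bnd b m).
      split; try lia.
      + by move=> r; rewrite mem_cat !inE => /or3P[/mem_take/rf| |]; lia.
      + rewrite mem_cat !inE !negb_or; apply/and3P; split; try lia.
        by apply/negP => /mem_take; rewrite (negPf (fre 4)).
      + by move=> r h; rewrite /g /upd; repeat (case: eqP => ?); try lia; apply: v0; lia.
      + split; first by move=> r; rewrite /g /upd; have := avB j; repeat (case: eqP => ?); try lia; rewrite ?vB.
        rewrite -(all_map _ (fun x => x <= _)) Emap all_cat; apply/andP; split.
          apply/allP => r /mem_take /mapP[r' /(allP rm) h ->]; lia.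
        by have := avB j; rewrite /=; lia.
    have g4 : upd (g j) fr k (fr + 4) = 0.
      by rewrite /g /upd; repeat (case: eqP => ?); try lia; exact: vz.
    apply: xSeq; first by apply: (IHbody _ _ _ _ _ _ _ ok4); rewrite ?g4; lia.
    rewrite g4 add0n Emap; set bv := eval w _ body.
    apply: xSeq; first exact: ex_clear.
    apply: xSeq.
      by apply: ex_clip; first (by rewrite /= ?inE; lia); rewrite /g /upd; repeat (case: eqP => ?); lia.
    apply: ex_to; first by apply: xInc; rewrite /g /upd; repeat (case: eqP => ?); lia.
    congr (_, _, _); apply: functional_extensionality => r.
    have -> : g j.+1 r = upd (upd (upd (upd v fr (N - j.+1)) (fr + 1) Bd) (fr + 2) j.+1) (fr + 3) (minn Bd bv) r by [].
    rewrite /g /upd; repeat (case: eqP => ?; try subst); lia.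
  apply: xSeq; first by apply: ex_move; rewrite /g /upd; have := avB N; repeat (case: eqP => ?); lia.
  apply: xSeq; first exact: ex_clear.
  apply: ex_to; first exact: ex_clear.
  congr (_, _, _); apply: functional_extensionality => r.
  have -> : iteri N (fun k a => minn Bd (eval w (take d [seq v i | i <- rho] ++ [:: k; a]) body)) (minn Bd I0) = av N by [].
  by rewrite /g /upd; repeat (case: eqP => ?; try subst); lia.
Qed.

End CompCorrect.

(** * Polynomial bounds *)

Section PolyBounded.

(** The base [m + 2] is at least 2 even for [m = 0], so constants, sums and compositions can be
    absorbed into the exponent. *)
Definition polyb (f : nat -> nat) := exists c, forall m, f m <= (m + 2) ^ c.

Lemma polyb_le f g : (forall m, f m <= g m) -> polyb g -> polyb f.
Proof. by move=> fg [c h]; exists c => m; apply: leq_trans (h m). Qed.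

Lemma polyb_id : polyb id.
Proof. by exists 1 => m; rewrite expn1; lia. Qed.

Lemma polyb_const k : polyb (fun=> k).
Proof.
exists k => m; apply: ltnW; apply: leq_trans (ltn_expl k (ltnSn 1)) _.
by case: k => // k; rewrite leq_exp2r //; lia.
Qed.

Lemma polyb_mul f g : polyb f -> polyb g -> polyb (fun m => f m * g m).
Proof. by move=> [c h] [d h']; exists (c + d) => m; rewrite expnD leq_mul. Qed.

Lemma polyb_add f g : polyb f -> polyb g -> polyb (fun m => f m + g m).
Proof.
move=> [c h] [d h']; exists (c + d + 1) => m; rewrite !expnD expn1.
have c0 : 0 < (m + 2) ^ c by rewrite expn_gt0; lia.
have d0 : 0 < (m + 2) ^ d by rewrite expn_gt0; lia.
move: (h m) (h' m); nia.
Qed.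

Lemma leq_expl a b c : a <= b -> a ^ c <= b ^ c.
Proof. by case: c => // c h; rewrite leq_exp2r. Qed.

Lemma polyb_comp f g : polyb f -> polyb g -> polyb (fun m => f (g m)).
Proof.
(* The exponent comes from [g m + 2 <= (m + 2) ^ (d + 2)], which holds because the base is at least
   2. *)
move=> [c h] [d h']; exists ((d + 2) * c) => m; apply: leq_trans (h _) _.
rewrite expnM; apply: leq_expl; rewrite expnD; move: (h' m).
have d0 : 0 < (m + 2) ^ d by rewrite expn_gt0; lia.
rewrite expnS expn1; nia.
Qed.

Lemma polyb_bnd t : polyb (bnd t).
Proof.
elim: t => [i||t IH|a IHa b IHb|a IHa b IHb|t IH||d n IHn b IHb i IHi body IHbody] /=.
- exact: polyb_id.
- exact: polyb_const.
- by apply: polyb_le (polyb_add IH (polyb_const 1)) => m; lia.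
- exact: polyb_add.
- by do 2?apply: polyb_add => //; apply: polyb_mul.
- by apply: polyb_add => //; exact: polyb_const.
- exact: polyb_id.
- apply: polyb_add; first exact: polyb_add (polyb_add _ _) _.
  exact: (polyb_comp IHbody (polyb_add (polyb_add polyb_id IHn) IHb)).
Qed.

End PolyBounded.

Lemma log2_exp a c : Nat.log2 (a ^ c) <= c * (Nat.log2 a).+1.
Proof.
have pw n : Nat.pow 2 n = 2 ^ n by elim: n => //= n ->; rewrite expnS; lia.
apply/leP; have [->|a0] := posnP a.
  by case: c => [|c]; rewrite ?expn0 ?exp0n //; apply: Nat.le_0_l.
have ha : a <= 2 ^ (Nat.log2 a).+1.
  by have [_] := Nat.log2_spec a (elimT ltP a0); rewrite pw; lia.
have : a ^ c <= 2 ^ (c * (Nat.log2 a).+1).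
  by rewrite mulnC expnM; apply: leq_expl.
move=> /leP /Nat.log2_le_mono h; apply: Nat.le_trans h _.
by rewrite -pw Nat.log2_pow2; lia.
Qed.

Lemma log2_add2 n : Nat.log2 (n + 2) <= Nat.log2 n + 2.
Proof.
case: n => [|n]; first by apply/leP; vm_compute; lia.
apply/leP; apply: (@Nat.le_trans _ (Nat.log2 (n.+1 * 4))).
  by apply: Nat.log2_le_mono; lia.
have -> : n.+1 * 4 = Nat.mul 2 (Nat.mul 2 n.+1) by lia.
by rewrite !Nat.log2_double; lia.
Qed.

(** * Output programs *)

Inductive oprog : Type :=
| ONop | OTok (t : tok) | OSeq (a b : oprog) | OIf (t : tm) (a : oprog)
| OFor (d : nat) (n : tm) (body : oprog).

Fixpoint osem (w : seq tok) (e : seq nat) (o : oprog) : seq tok :=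
  match o with
  | ONop => [::]
  | OTok t => [:: t]
  | OSeq a b => osem w e a ++ osem w e b
  | OIf t a => if 0 < eval w e t then osem w e a else [::]
  | OFor d n body =>
    flatten [seq osem w (take d e ++ [:: k]) body | k <- iota 0 (eval w e n)]
  end.

Fixpoint obnd (o : oprog) (m : nat) : nat :=
  match o with
  | ONop | OTok _ => 0
  | OSeq a b => obnd a m + obnd b m
  | OIf t a => bnd t m + obnd a m
  | OFor _ n body => bnd n m + obnd body (m + bnd n m)
  end.

Lemma polyb_obnd o : polyb (obnd o).
Proof.
elim: o => [|t|a IHa b IHb|t a IH|d n body IH] /=.
- exact: polyb_const.
- exact: polyb_const.
- exact: polyb_add.
- by apply: polyb_add => //; exact: polyb_bnd.
- apply: polyb_add; first exact: polyb_bnd.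
  by apply: (polyb_comp IH); apply: polyb_add; [exact: polyb_id|exact: polyb_bnd].
Qed.

(** Nothing is returned in a register: [fr] and all registers above it are zero again at the end. In
    [OIf], clearing [fr] removes what the test has left of the condition. *)
Fixpoint ocomp (o : oprog) (rho : seq nat) (fr : nat) : cmd :=
  match o with
  | ONop => CNop
  | OTok t => COut t
  | OSeq a b => CSeq (ocomp a rho fr) (ocomp b rho fr)
  | OIf t a => CSeq (comp t rho fr fr.+1) (CIf fr (CSeq (cclear fr) (ocomp a rho fr)))
  | OFor d n body =>
    CSeq (comp n rho fr fr.+1)
      (CSeq (CLoop fr (CSeq (ocomp body (take d rho ++ [:: fr.+1]) fr.+2) (CInc fr.+1)))
         (cclear fr.+1))
  end.

Section OComp.
Variables (B : nat) (w : seq tok).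

Lemma ocomp_correct p : forall rho fr v o m,
  size w <= m -> okst B rho fr fr.+1 v m -> v fr = 0 -> obnd p m <= B ->
  exec B w (ocomp p rho fr) (0, v, o) (0, v, o ++ osem w (map v rho) p).
Proof.
elim: p => [|t|a IHa b IHb|t a IH|d n body IH] rho fr v o m wm ok vf pB /=.
- by rewrite cats0; exact: xNop.
- by rewrite cats1; exact: xOut.
- rewrite /= in pB; rewrite catA; apply: (xSeq (s2 := (0, v, o ++ osem w (map v rho) a))).
    by apply: (IHa _ _ _ _ _ wm ok); lia.
  by apply: (IHb _ _ _ _ _ wm ok); lia.
- rewrite /= in pB; apply: xSeq; first by apply: (comp_correct _ wm ok); lia.
  rewrite vf add0n; case E: (eval w _ t) => [|k] /=.
    by rewrite cats0 upd_same //; apply: xIf0.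
  apply: (xIfS (n := k)); first by rewrite upd_eq.
  apply: xSeq; first exact: ex_clear.
  have -> : upd (upd (upd v fr k.+1) fr k) fr 0 = v by store_eq.
  by apply: (IH _ _ _ _ _ wm ok); lia.
rewrite /= in pB; case: (ok) => rf df dr v0 [vB rm].
apply: xSeq; first by apply: (comp_correct _ wm ok); lia.
rewrite vf add0n; set N := eval w _ n.
have tn : N <= bnd n m by apply: eval_bnd; rewrite ?all_map.
have vf1 : v fr.+1 = 0 by apply: v0; lia.
pose g k := upd (upd v fr (N - k)) fr.+1 k.
pose F k := osem w (take d (map v rho) ++ [:: k]) body.
pose f k := (0, g (N - k), o ++ flatten (map F (iota 0 (N - k)))).
apply: (xSeq (s2 := f 0)).
  have -> : (0, upd v fr N, o) = f N.
    by rewrite /f subnn /= cats0 /g; congr (_, _, _); store_eq.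
  apply: ex_loop => k hk; first by rewrite /= /g /upd; repeat case: eqP; lia.
  rewrite /f /=; set j := N - k.+1; have -> : N - k = j.+1 by rewrite /j; lia.
  have jN : j < N by rewrite /j; lia.
  set rho' := take d rho ++ [:: fr.+1].
  have Emap : map (upd (g j) fr k) rho' = take d (map v rho) ++ [:: j].
    rewrite map_cat map_take; congr (take d _ ++ _).
      apply/eq_in_map => r rr; have rr' := rf _ rr; have : r != fr by apply: contraNneq dr => <-.
      by rewrite /g /upd; repeat (case: eqP => ?); lia.
    by rewrite /= /g /upd; congr [:: _]; repeat (case: eqP => ?); lia.
  apply: (xSeq (s2 := (0, upd (g j) fr k, (o ++ flatten (map F (iota 0 j))) ++ F j))).
    rewrite /F -Emap; apply: (IH _ _ _ _ (m + bnd n m)); last by lia.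
    - lia.
    - split.
      + by move=> r; rewrite mem_cat !inE => /orP[/mem_take/rf|]; lia.
      + lia.
      + rewrite mem_cat !inE negb_or; apply/andP; split; last by lia.
        by apply/negP => /mem_take/rf; lia.
      + by move=> r h; rewrite /g /upd; repeat (case: eqP => ?); try lia; apply: v0; lia.
      + split; first by move=> r; rewrite /g /upd; repeat (case: eqP => ?); try lia; rewrite ?vB.
        rewrite -(all_map _ (fun x => x <= _)) Emap all_cat; apply/andP; split; last by rewrite /=; lia.
        by apply/allP => r /mem_take /mapP[r' /(allP rm) h ->]; lia.
    - by rewrite /g /upd; repeat (case: eqP => ?); try lia; apply: v0; lia.
  apply: ex_to; first by apply: xInc; rewrite /g /upd; repeat case: eqP; lia.
  congr (_, _, _); first by rewrite /g; store_eq.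
  by rewrite -[j.+1]addn1 iotaD map_cat flatten_cat /= add0n cats0 catA.
apply: ex_to; first exact: ex_clear.
by rewrite subn0; congr (_, _, _); rewrite /g; store_eq.
Qed.
End OComp.

Definition not_cho (i : instr) : bool := if i is ICho _ then false else true.

Lemma compile_not_cho c : forall pc, all not_cho (compile pc c).
Proof.
by elim: c => [|x|t|d|a IHa b IHb|x a IH|x a IH|t a IH|a IH] pc //=;
  rewrite ?all_cat ?IHa ?IHb ?IH.
Qed.

Lemma all_cho_free C : all not_cho C -> cho_free C.
Proof.
move=> h i; have [iC|iC] := ltnP i (size C); last by rewrite nth_default.
by have := all_nthP IHlt h i iC; case: (nth _ _ _).
Qed.

Lemma code_at_prefix C1 code C2 pc : size C1 = pc -> code_at (C1 ++ code ++ C2) pc code.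
Proof. by move=> <-; exists C1, C2. Qed.

Lemma log_bound_poly f : polyb f -> exists c, forall n, Nat.log2 (f n) + 2 <= log_bound c n.
Proof.
move=> [c h]; exists (c * 3 + 2) => n; rewrite /log_bound.
have /leP h1 := Nat.log2_le_mono _ _ (elimT leP (h n)).
have h2 := log2_exp (n + 2) c; have h3 := log2_add2 n; nia.
Qed.

Theorem transducer (p : oprog) :
  exists M c, computes_in_space M (fun w => osem w [::] p) (log_bound c).
Proof.
have [c hc] := log_bound_poly (polyb_obnd p).
pose code := compile 0 (ocomp p [::] 0); pose C := code ++ [:: IAcc].
exists (cm_tm C), c; split.
  by apply: cm_tm_det; apply: all_cho_free; rewrite all_cat compile_not_cho.
split; first exact: cm_acc_halt.
move=> w; pose B := obnd p (size w).
pose f0 := cfg_of (size code) (0, fun=> 0, osem w [::] p).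
have run : drun (cstep C w) (cgood B C) cinit f0.
  have e : exec B w (ocomp p [::] 0) (0, fun=> 0, [::]) (0, fun=> 0, osem w [::] p).
    by apply: (@ocomp_correct B w p [::] 0 (fun=> 0) [::] (size w)).
  have := @exec_drun B w C _ _ _ e 0; rewrite add0n /f0 size_compile; case=> //.
  by exists [::], [:: IAcc].
have accf : nth IHlt C (size code) = IAcc by rewrite nth_cat ltnn subnn.
(* The accepting configuration has no successor, so every reachable configuration lies on the run
   and obeys its bound. *)
have stuck c' : clos_refl_trans _ (cstep C w) f0 c' -> c' = f0.
  move=> /clos_rt_rt1n_iff h; inversion h as [|a b s]; subst=> //.
  by move: s; rewrite /cstep /= accf.
have bnd0 c' : creach C w c' -> cbounded C B c'.
  by move=> /(drun_split run) [[[h _] _] x _|/stuck -> x _] //; exact: h.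
split; last by move=> tc /(cm_tm_space bnd0) h; apply: leq_trans h (hc _).
have /(cm_tm_accept bnd0) [tc [h1 h2 h3]] :
    exists c', [/\ creach C w c', nth IHlt C (cpc c') = IAcc & cemit c' = osem w [::] p].
  by exists f0; split=> //; exact: drun_star run.
by exists tc.
Qed.

(** * Decision procedures that iterate a term *)

Section Decider.
Variables (nd pow : bool) (tn ta tf : tm).

Definition dpre : cmd :=
  if pow then
    CSeq (comp tn [::] 2 3) (CSeq (CInc 0)
      (CLoop 2 (CSeq (CLoop 0 (CSeq (CInc 3) (CInc 3))) (cmove 3 0))))
  else CNop.
Definition dacc := comp ta [:: 0; 1] 2 3.
Definition dstp := CSeq (comp tf [:: 0; 1; 3] 2 4) (CSeq (cclear 1) (CSeq (cmove 2 1) (cclear 3))).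
Definition dP := csize dpre.
Definition dT := dP + csize dacc.

(** Register 0 holds the power of two, or 0 if none is wanted, register 1 the current state and
    register 3 the guessed bit. A round accepts if [ta] is positive and otherwise replaces the state
    by the value of [tf]. Acceptance is the only exit: a decider has to bound its space, and
    rejection may be an infinite run. *)
Definition dcode : seq instr :=
  compile 0 dpre ++ compile dP dacc ++
  [:: IDec 2 (dT + 2); IAcc; if nd then ICho (dT + 4) else IJmp (dT + 4); IInc 3] ++
  compile (dT + 4) dstp ++ [:: IJmp dP].

Definition dB w := if pow then 2 ^ eval w [::] tn else 0.
Definition dstep w x (b : bool) := eval w [:: dB w; x; nat_of_bool b] tf.
Definition drunx w bs := foldl (dstep w) 0 bs.
(** A deterministic program always takes the branch that leaves the bit at 0. *)
Definition dchoice (bs : seq bool) := nd || ~~ has id bs.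

Variables (w : seq tok) (m : nat).
Hypothesis wm : size w < m.
Hypothesis Bm : dB w <= m.
Hypothesis runm : forall bs, dchoice bs -> drunx w bs <= m.

Definition dbnd m := m + bnd ta m + bnd tf m + bnd tn m + 2.
Let BB := dbnd m.
Let C := dcode.

Definition regs x := upd (upd (fun=> 0) 0 (dB w)) 1 x.
Definition dLoop x := cfg_of dP (0, regs x, [::]).

Lemma dpre_correct : exec BB w dpre (0, fun=> 0, [::]) (0, regs 0, [::]).
Proof.
rewrite /dpre /regs /dB; case: ifP => hp; last first.
  have -> : upd (upd (fun=> 0) 0 0) 1 0 = fun=> 0 by store_eq.
  exact: xNop.
have wm' : size w <= m by lia.
have Bm' : 2 ^ eval w [::] tn <= m by move: Bm; rewrite /dB hp.
apply: xSeq.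
  by apply: (@comp_correct _ _ tn [::] 2 3 _ _ m) => //; rewrite /BB /dbnd; lia.
apply: xSeq; first by apply: xInc; rewrite /upd /= /BB /dbnd; lia.
rewrite /=; set T := eval w [::] tn in Bm' *.
pose f k := (0, upd (upd (fun=> 0) 0 (2 ^ (T - k))) 2 k, [::] : seq tok).
apply: (@ex_to _ _ _ _ (f 0)); last by rewrite /f subn0; congr (_, _, _); store_eq.
have -> : (0, upd (upd (fun=> 0) 2 (0 + T)) 0 (upd (fun=> 0) 2 (0 + T) 0).+1, [::]) = f T.
  by rewrite /f subnn expn0; congr (_, _, _); store_eq.
apply: ex_loop => k hk; first by rewrite /= upd_eq.
have p2 : 2 ^ (T - k) = 2 * 2 ^ (T - k.+1) by rewrite -expnS; congr (2 ^ _); lia.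
have pm : 2 ^ (T - k) <= 2 ^ T by rewrite leq_exp2l //; lia.
rewrite /f /=; set N := 2 ^ (T - k.+1) in p2 *.
pose g i := (0, upd (upd (upd (fun=> 0) 0 i) 3 (2 * (N - i))) 2 k, [::] : seq tok).
apply: (xSeq (s2 := g 0)).
  have -> : (0, upd (upd (upd (fun=> 0) 0 N) 2 k.+1) 2 k, [::]) = g N.
    by rewrite /g subnn; congr (_, _, _); store_eq.
  apply: ex_loop => i hi; first by rewrite /= /upd; repeat case: eqP; lia.
  have BBm : m <= BB by rewrite /BB /dbnd; lia.
  rewrite /g /=; apply: xSeq; first by apply: xInc; rewrite /upd /=; lia.
  apply: ex_to; first by apply: xInc; rewrite /upd /=; lia.
  by congr (_, _, _); store_eq.
apply: ex_to; first by apply: ex_move => //; rewrite /upd /=; rewrite /BB /dbnd; lia.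
by rewrite p2 subn0; congr (_, _, _); store_eq.
Qed.

Let sP : size (compile 0 dpre) = dP := size_compile _ _.

Lemma dcode_acc : code_at C dP (compile dP dacc).
Proof. exact: code_at_prefix. Qed.

Lemma dcode_mid : code_at C dT [:: IDec 2 (dT + 2); IAcc; if nd then ICho (dT + 4) else IJmp (dT + 4); IInc 3].
Proof. by rewrite /C /dcode catA; apply: code_at_prefix; rewrite size_cat !size_compile. Qed.

Lemma dcode_stp : code_at C (dT + 4) (compile (dT + 4) dstp ++ [:: IJmp dP]).
Proof.
exists (compile 0 dpre ++ compile dP dacc ++
  [:: IDec 2 (dT + 2); IAcc; if nd then ICho (dT + 4) else IJmp (dT + 4); IInc 3]), [::].
by split; [rewrite !size_cat !size_compile /= /dT addnA|rewrite /C /dcode cats0 -!catA].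
Qed.

Lemma dregsB x : x <= m -> forall r, regs x r <= BB.
Proof. by move=> xm r; rewrite /regs /upd /BB /dbnd; repeat case: eqP => _; lia. Qed.

Lemma dinit_run : drun (cstep C w) (cgood BB C) cinit (dLoop 0).
Proof.
have [] := @exec_drun BB w C _ _ _ dpre_correct 0; rewrite ?add0n //.
by exists [::]; eexists.
Qed.

Definition dacc_val x := eval w [:: dB w; x] ta.

Lemma dloop_run x : x <= m ->
  drunp (cstep C w) (cgood BB C) (dLoop x)
    (if dacc_val x is a.+1 then CCfg dT.+1 0 (upd (regs x) 2 a) [::] else CCfg (dT + 2) 0 (regs x) [::]).
Proof.
move=> xm; have wm' : size w <= m by lia.
have ok : okst BB [:: 0; 1] 2 3 (regs x) m.
  split=> //.
  - by move=> r; rewrite !inE => /orP[] /eqP ->.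
  - by move=> r; rewrite /regs /upd; repeat case: eqP; lia.
  - by split; [exact: dregsB|rewrite /= /regs /upd /=; lia].
have e : exec BB w dacc (0, regs x, [::]) (0, upd (regs x) 2 (dacc_val x), [::]).
  apply: ex_to; first by apply: (@comp_correct _ _ ta _ _ _ _ _ m) => //; rewrite /regs /upd /= /BB /dbnd; lia.
  by rewrite /dacc_val /regs /= /upd /=.
have [|run1 B1] := @exec_drun BB w C _ _ _ e dP dcode_acc; first exact: dregsB.
have [i0 /code_at_cons[i1 _]] := code_at_cons dcode_mid.
have run2 : drunp (cstep C w) (cgood BB C) (cfg_of dT (0, upd (regs x) 2 (dacc_val x), [::]))
    (if dacc_val x is a.+1 then CCfg dT.+1 0 (upd (regs x) 2 a) [::] else CCfg (dT + 2) 0 (regs x) [::]).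
  eexists; last exact: drun_refl.
  split; first by split=> //=; rewrite i0.
  move=> c'; rewrite /cstep /= i0 upd_eq; case: (dacc_val x) => [|a] /=.
    rewrite upd_same // ; split=> [[|//]|->]; auto.
  have -> : upd (upd (regs x) 2 a.+1) 2 a = upd (regs x) 2 a by store_eq.
  by split=> [[|//]|->]; auto.
exact: drun_drunp run1 run2.
Qed.

Definition dChosen (b : bool) x := CCfg (if b then dT.+3 else dT + 4) 0 (regs x) [::].

Lemma dchoice_succ x : csucc C w (CCfg (dT + 2) 0 (regs x) [::]) =
  if nd then [:: dChosen true x; dChosen false x] else [:: dChosen false x].
Proof.
have [_ /code_at_cons[_ /code_at_cons[i2 _]]] := code_at_cons dcode_mid.
by rewrite /= addn2 i2; case: nd.
Qed.

Lemma dchoice_run x b : x <= m ->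
  drun (cstep C w) (cgood BB C) (dChosen b x) (dLoop (dstep w x b)).
Proof.
move=> xm; have wm' : size w <= m by lia.
have [_ /code_at_cons[_ /code_at_cons[_ /code_at_cons[i3 _]]]] := code_at_cons dcode_mid.
pose v := upd (regs x) 3 b.
have vB r : v r <= BB.
  by rewrite /v /upd; case: eqP => _; [case: b {v}; rewrite /BB /dbnd; lia|exact: dregsB].
have ok : okst BB [:: 0; 1; 3] 2 4 v m.
  split=> //.
  - by move=> r; rewrite !inE => /or3P[] /eqP ->.
  - by move=> r; rewrite /v /regs /upd; repeat case: eqP; lia.
  - by split=> //; rewrite /v /= /regs /upd /=; case: b {v vB}; lia.
have fB : dstep w x b <= bnd tf m.
  by apply: eval_bnd => //=; case: b {v ok vB}; lia.
have e : exec BB w dstp (0, v, [::]) (0, regs (dstep w x b), [::]).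
  apply: xSeq; first by apply: (@comp_correct _ _ tf _ _ _ _ _ m) => //; rewrite /v /regs /upd /= /BB /dbnd; lia.
  have -> : map v [:: 0; 1; 3] = [:: dB w; x; nat_of_bool b] by [].
  have -> : v 2 + eval w [:: dB w; x; nat_of_bool b] tf = dstep w x b by rewrite /v /regs /upd.
  apply: xSeq; first exact: ex_clear.
  apply: xSeq; first by apply: ex_move => //; rewrite /upd /=; rewrite /BB /dbnd; lia.
  apply: ex_to; first exact: ex_clear.
  by congr (_, _, _); rewrite /v /regs; store_eq.
have [k1 ] := code_at_cat dcode_stp; rewrite size_compile => /code_at_cons[k2 _].
have [//|run1 B1] := @exec_drun BB w C _ _ _ e _ k1.
apply: (@drun_trans _ _ _ _ (cfg_of (dT + 4) (0, v, [::]))); last first.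
  by apply: drun_trans run1 _; apply: drun1 => //=; rewrite k2.
case: b @v {vB ok fB e run1 B1} => /=; last first.
  by rewrite [upd _ _ _]upd_same //; exact: drun_refl.
apply: (@drun1 BB w C dT.+3 (0, regs x, [::])) => //=; [exact: dregsB|by rewrite i3|].
by rewrite i3 addn4.
Qed.

(** A round has three waypoints: its beginning, the branching after a failed test, and acceptance.
    The steps between them are forced. *)
Definition on_path (c : ccfg) := exists bs, let x := drunx w bs in
  dchoice bs /\ [\/ drun (cstep C w) (cgood BB C) c (dLoop x),
    (dacc_val x = 0 /\ drun (cstep C w) (cgood BB C) c (CCfg (dT + 2) 0 (regs x) [::])) |
    exists2 a, dacc_val x = a.+1 & drun (cstep C w) (cgood BB C) c (CCfg dT.+1 0 (upd (regs x) 2 a) [::])].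

Lemma dacc_instr : nth IHlt C dT.+1 = IAcc.
Proof. by have [_ /code_at_cons[->]] := code_at_cons dcode_mid. Qed.

Lemma dreach_path c : creach C w c -> on_path c.
Proof.
move=> /clos_rt_rtn1_iff; elim=> [|d e de _ [bs [ch IH]]].
  by exists [::]; split; [rewrite /dchoice orbT|constructor; exact: dinit_run].
have xm := runm ch; set x := drunx w bs in xm IH *.
have next c0 : drun (cstep C w) (cgood BB C) d c0 ->
    drun (cstep C w) (cgood BB C) e c0 \/ d = c0.
  by move=> r; inversion r as [|z z1 z2 _ sd r']; subst; [right|left; move: de => /sd ->].
case: IH => [/next[r|dE]|[a0 /next[r|dE]]|[a aE /next[r|dE]]].
- by exists bs; split=> //; constructor 1.
- rewrite dE in de; have r := drunp_next (dloop_run xm) de.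
  exists bs; split=> //; case E: (dacc_val x) r => [|a] r; first by constructor 2.
  by constructor 3; exists a.
- by exists bs; split=> //; constructor 2.
- move: de; rewrite dE /cstep dchoice_succ => de.
  have [b bn ->] : exists2 b : bool, (b -> nd) & e = dChosen b x.
    by case: (nd) de => /= [[<-|[<-|//]]|[<-|//]]; [exists true|exists false|exists false].
  exists (rcons bs b); rewrite /drunx foldl_rcons -/(drunx w bs) -/x; split; last first.
    by constructor 1; exact: dchoice_run.
  by move: ch; rewrite /dchoice has_rcons /=; case: (b) bn => [->|_].
- by exists bs; split=> //; constructor 3; exists a.
- by move: de; rewrite dE /cstep /= dacc_instr.
Qed.

Definition daccepts :=
  exists2 c, creach C w c & nth IHlt C (cpc c) = IAcc.

Lemma dloop_accepts x : x <= m -> creach C w (dLoop x) -> 0 < dacc_val x -> daccepts.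
Proof.
move=> xm r; have := drun_star (drunpW (dloop_run xm)); case: (dacc_val x) => // a r' _.
by exists (CCfg dT.+1 0 (upd (regs x) 2 a) [::]); [exact: rt_trans r r'|exact: dacc_instr].
Qed.

(** A sequence of choices may run past a state at which the machine has already accepted and
    stopped; hence the first alternative. *)
Lemma dpath_reach bs : dchoice bs -> daccepts \/ creach C w (dLoop (drunx w bs)).
Proof.
elim/last_ind: bs => [_|bs b IH ch]; first by right; exact: drun_star dinit_run.
have ch' : dchoice bs /\ (b -> nd).
  by move: ch; rewrite /dchoice has_rcons; case: (nd) => //=; case: b.
case: ch' => ch' bn; have [?|r] := IH ch'; first by left.
have xm := runm ch'; case E: (dacc_val (drunx w bs)) => [|a]; last first.
  by left; apply: dloop_accepts r _; rewrite ?E.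
right; rewrite /drunx foldl_rcons -/(drunx w bs); apply: rt_trans r _.
have r1 := drun_star (drunpW (dloop_run xm)); rewrite E in r1.
apply: rt_trans r1 _; apply: rt_trans (drun_star (dchoice_run b xm)).
apply: rt_step; rewrite /cstep dchoice_succ.
by case: b bn {ch} => [->|_]; rewrite /=; auto; case: (nd) => /=; auto.
Qed.

Lemma decider_bounded c : creach C w c -> cbounded C BB c.
Proof.
have aux d e : drun (cstep C w) (cgood BB C) d e -> (forall r, creg e r <= BB) -> cbounded C BB d.
  by move=> r eB; inversion r as [|z z1 z2 [g _] _ _]; subst => y _; [exact: eB|exact: g].
move=> /dreach_path[bs [/runm xm [r|[_ r]|[a aE r]]]]; apply: aux r _; try exact: dregsB.
move=> r; rewrite /= /upd; case: eqP => _; last exact: dregsB.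
have wm' : size w <= m by lia.
suff : dacc_val (drunx w bs) <= bnd ta m by rewrite aE /BB /dbnd; lia.
by apply: eval_bnd => //=; lia.
Qed.

Lemma decider_accept : daccepts <->
  exists2 bs, dchoice bs & 0 < dacc_val (drunx w bs).
Proof.
split=> [[c /dreach_path[bs [ch IH]] acc]|].
  have stop e : drun (cstep C w) (cgood BB C) c e -> c = e.
    by move=> r; inversion r as [|z z1 z2 [_ g] _ _]; subst.
  case: IH => [/stop cE|[_ /stop cE]|[a aE _]]; last by exists bs; rewrite ?aE.
    move: acc; rewrite cE /=; have := dloop_run (runm ch) => -[d [[_ h] _] _].
    by move/h.
  by move: acc; rewrite cE /=; have := dchoice_succ (drunx w bs); rewrite /= => + h; rewrite h; case: (nd).
move=> [bs ch pos]; have [//|r] := dpath_reach ch.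
exact: dloop_accepts (runm ch) r pos.
Qed.
End Decider.

Lemma cm_tm_accept_any C w B : (forall c, creach C w c -> cbounded C B c) ->
  (exists2 c, creach C w c & nth IHlt C (cpc c) = IAcc) <->
  exists tc, reach (cm_tm C) w tc /\ q_acc (cm_tm C) (cq tc).
Proof.
move=> bd; split=> [[c r a]|[tc [r a]]].
  have [] := cm_tm_accept bd (cemit c); case; first by exists c.
  by move=> tc [r' a' _] _; exists tc.
have [_ []] := cm_tm_accept bd (cout tc); first by exists tc.
by move=> c [r' a' _]; exists c.
Qed.

Theorem decider nd pow tn ta tf (L : seq tok -> Prop) (m s : nat -> nat) :
  (forall w : seq tok, size w < m (size w)) ->
  (forall w, dB pow tn w <= m (size w)) ->
  (forall w bs, dchoice nd bs -> drunx pow tn tf w bs <= m (size w)) ->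
  (forall w : seq tok, Nat.log2 (dbnd tn ta tf (m (size w))) + 2 <= s (size w)) ->
  (forall w, L w <-> exists2 bs, dchoice nd bs &
     0 < eval w [:: dB pow tn w; drunx pow tn tf w bs] ta) ->
  decides_in_space (cm_tm (dcode nd pow tn ta tf)) L s.
Proof.
move=> h1 h2 h3 h4 hL w.
have bd := decider_bounded (ta := ta) (h1 w) (h2 w) (h3 w).
split; last by move=> c /(cm_tm_space bd) h; apply: leq_trans h (h4 w).
rewrite hL -(cm_tm_accept_any bd).
by have := decider_accept ta (h1 w) (h2 w) (h3 w); rewrite /daccepts => ->.
Qed.

Lemma dcode_det pow tn ta tf : deterministic (cm_tm (dcode false pow tn ta tf)).
Proof.
apply: cm_tm_det; apply: all_cho_free; rewrite /dcode !all_cat !compile_not_cho.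
by [].
Qed.

(** * Representable functions *)

(* A context describes the data a term may depend on: the input word and the
   values of [cdim] variables, constrained by [cok]. *)
Record ctx : Type := Ctx {
  cX : Type;
  cinp : cX -> seq tok;
  cenv : cX -> seq nat;
  cdim : nat;
  cok : cX -> Prop;
  cdimP : forall x, size (cenv x) = cdim
}.

(** The variables come first in the environment and anything may follow, so the same term still
    works after further variables have been appended; this is what makes [cmp_weak] immediate. *)
Definition cmp (G : ctx) (f : cX G -> nat) : Prop :=
  exists t, forall x e, cok x -> eval (cinp x) (cenv x ++ e) t = f x.

Notation cmpb G f := (@cmp G (fun x => nat_of_bool (f x))).

Lemma ext_dimP (G : ctx) (y : cX G * nat) : size (cenv y.1 ++ [:: y.2]) = (cdim G).+1.
Proof. by rewrite size_cat cdimP addn1. Qed.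

(** The bound on the new variable is kept in the context because side conditions, such as those of
    exponentiation, have to be proved for all values of a loop index. *)
Definition ext (G : ctx) (b : cX G -> nat) : ctx :=
  @Ctx (cX G * nat) (fun y => cinp y.1) (fun y => cenv y.1 ++ [:: y.2]) (cdim G).+1
       (fun y => cok y.1 /\ y.2 < b y.1) (@ext_dimP G).

Lemma cmp_ext G (f g : cX G -> nat) : (forall x, cok x -> f x = g x) -> cmp f -> cmp g.
Proof. by move=> fg [t h]; exists t => x e ox; rewrite h // fg. Qed.

Lemma cmp_weak G b (f : cX G -> nat) : cmp f -> @cmp (ext b) (fun y => f y.1).
Proof. by move=> [t h]; exists t => -[x n] e [/= ox _]; rewrite -catA h. Qed.

Lemma cmp_v0 G b : @cmp (@ext G b) (fun y => y.2).
Proof.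
exists (Var (cdim G)) => -[x n] e _ /=.
by rewrite -catA nth_cat cdimP ltnn subnn.
Qed.

Section Basic.
Variable G : ctx.
Implicit Types f g h : cX G -> nat.

Lemma cmp_const n : @cmp G (fun=> n).
Proof. by exists (iter n Suc Zero) => x e _; elim: n => //= n ->. Qed.

Lemma cmp_succ f : cmp f -> cmp (fun x => (f x).+1).
Proof. by move=> [t ht]; exists (Suc t) => x e ox /=; rewrite ht. Qed.

Lemma cmp_add f g : cmp f -> cmp g -> cmp (fun x => f x + g x).
Proof. by move=> [t ht] [u hu]; exists (Add t u) => x e ox /=; rewrite ht ?hu. Qed.

Lemma cmp_mul f g : cmp f -> cmp g -> cmp (fun x => f x * g x).
Proof. by move=> [t ht] [u hu]; exists (Mul t u) => x e ox /=; rewrite ht ?hu. Qed.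

Lemma cmp_size : @cmp G (fun x => size (cinp x)).
Proof. by exists Len. Qed.

Definition tk (w : seq tok) (i : nat) : nat := tokn (read_in w i.+1).

Lemma cmp_tk f : cmp f -> cmp (fun x => tk (cinp x) (f x)).
Proof. by move=> [t ht]; exists (Inp t) => x e ox; rewrite /tk -(ht x e ox). Qed.

Lemma cmp_iteri (n b i : cX G -> nat) (F : cX G -> nat -> nat -> nat) :
  cmp n -> cmp b -> cmp i ->
  @cmp (@ext (ext n) (fun y => (b y.1).+1)) (fun y => F y.1.1 y.1.2 y.2) ->
  (forall x k, cok x -> k <= n x -> iteri k (F x) (i x) <= b x) ->
  cmp (fun x => iteri (n x) (F x) (i x)).
Proof.
move=> [tn hn] [tb hb] [ti hi] [tF hF] bd.
(* Keeping the first [cdim G] entries discards the trailing part [e], so index and running value get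
   the next two places. The bound [bd] then says that the clipping is never active. *)
exists (Rec (cdim G) tn tb ti tF) => x e ox /=; rewrite hn // hb // hi // -(cdimP x).
have -> : take (size (cenv x)) (cenv x ++ e) = cenv x by rewrite take_size_cat.
suff E k : k <= n x ->
    iteri k (fun k0 a => minn (b x) (eval (cinp x) (cenv x ++ [:: k0; a]) tF)) (minn (b x) (i x))
    = iteri k (F x) (i x) by exact: E.
elim: k => [|k IH] kn /=; first by apply/minn_idPr; exact: (bd x 0).
rewrite IH ?(ltnW kn) //; have kb := bd x k ox (ltnW kn).
have /= := hF (x, k, iteri k (F x) (i x)) [::]; rewrite cats0 -catA => -> //.
by apply/minn_idPr; exact: (bd x k.+1).
Qed.

Lemma cmp_pred f : cmp f -> cmp (fun x => (f x).-1).
Proof.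
move=> cf; apply: (@cmp_ext _ (fun x => iteri (f x) (fun k _ => k) 0)).
  by move=> x _; case: (f x).
apply: (cmp_iteri cf cf (cmp_const 0)); first by apply: cmp_weak; exact: cmp_v0.
by move=> x [|k] //= _; lia.
Qed.
End Basic.

Lemma cmp_sub G (f g : cX G -> nat) : cmp f -> cmp g -> cmp (fun x => f x - g x).
Proof.
move=> cf cg; apply: (@cmp_ext _ (fun x => iteri (g x) (fun _ a => a.-1) (f x))).
  by move=> x _; elim: (g x) => [|k IH] /=; lia.
apply: (cmp_iteri cg cf cf); first by apply: cmp_pred; exact: cmp_v0.
by move=> x k ox _; elim: k => [|k IH] /=; lia.
Qed.

Section Bools.
Variable G : ctx.
Implicit Types (f g : cX G -> nat) (a b : cX G -> bool).

Lemma cmp_neg a : cmpb G a -> cmpb G (fun x => ~~ a x).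
Proof.
move=> h; apply: (@cmp_ext _ (fun x => 1 - a x)); first by move=> x _; case: (a x).
by apply: cmp_sub => //; exact: cmp_const.
Qed.

Lemma cmp_and a b : cmpb G a -> cmpb G b -> cmpb G (fun x => a x && b x).
Proof. by move=> ha hb; apply: cmp_ext (cmp_mul ha hb) => x _; case: (a x) (b x) => -[]. Qed.

Lemma cmp_or a b : cmpb G a -> cmpb G b -> cmpb G (fun x => a x || b x).
Proof.
move=> ha hb; apply: cmp_ext (cmp_neg (cmp_and (cmp_neg ha) (cmp_neg hb))) => x _.
by rewrite -negb_or negbK.
Qed.

Lemma cmp_imp a b : cmpb G a -> cmpb G b -> cmpb G (fun x => a x ==> b x).
Proof. by move=> ha hb; apply: cmp_ext (cmp_or (cmp_neg ha) hb) => x _; rewrite implybE. Qed.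

Lemma cmp_leq f g : cmp f -> cmp g -> cmpb G (fun x => f x <= g x).
Proof.
move=> cf cg; apply: (@cmp_ext _ (fun x => 1 - (f x - g x))).
  by move=> x _; case: leqP => /=; lia.
by apply: cmp_sub; [exact: cmp_const|exact: cmp_sub].
Qed.

Lemma cmp_eq f g : cmp f -> cmp g -> cmpb G (fun x => f x == g x).
Proof.
by move=> cf cg; apply: cmp_ext (cmp_and (cmp_leq cf cg) (cmp_leq cg cf)) => x _; rewrite eqn_leq.
Qed.

Lemma cmp_if a f g : cmpb G a -> cmp f -> cmp g -> cmp (fun x => if a x then f x else g x).
Proof.
move=> ha cf cg; apply: cmp_ext (cmp_add (cmp_mul ha cf) (cmp_mul (cmp_neg ha) cg)) => x _.
by case: (a x); rewrite /= ?mul1n ?addn0.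
Qed.

End Bools.

Lemma cmp_has G (F : cX G -> nat -> bool) (n : cX G -> nat) :
  cmp n -> cmpb (ext n) (fun y => F y.1 y.2) -> cmpb G (fun x => has (F x) (iota 0 (n x))).
Proof.
move=> cn cF; apply: (@cmp_ext _ (fun x => iteri (n x) (fun k r => (0 < r) || F x k : nat) 0)).
  move=> x _; elim: (n x) => // k IH; rewrite -[k.+1 in RHS]addn1 iotaD has_cat /= IH.
  by rewrite add0n orbF; case: (has _ _).
apply: (@cmp_iteri _ _ (fun=> 1) _ _ cn (cmp_const _ _) (cmp_const _ _)); last first.
  by move=> x [|k] //= _ _; case: (_ || _).
apply: cmp_or; last exact: (cmp_weak _ cF).
by apply: cmp_leq; [exact: cmp_const|exact: cmp_v0].
Qed.

Lemma cmp_all G (F : cX G -> nat -> bool) (n : cX G -> nat) :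
  cmp n -> cmpb (ext n) (fun y => F y.1 y.2) -> cmpb G (fun x => all (F x) (iota 0 (n x))).
Proof.
move=> cn cF; apply: (@cmp_ext _ (fun x => ~~ has (fun k => ~~ F x k) (iota 0 (n x)) : nat)).
  by move=> x _; rewrite has_predC negbK.
by apply: cmp_neg; apply: (@cmp_has G (fun x k => ~~ F x k)) => //; exact: (@cmp_neg (ext n) (fun y => F y.1 y.2)).
Qed.

Lemma cmp_has_const G (T : Type) (F : cX G -> T -> bool) (s : seq T) :
  (forall t, List.In t s -> cmpb G (fun x => F x t)) -> cmpb G (fun x => has (F x) s).
Proof.
elim: s => [|t s IH] h /=; first exact: cmp_const.
by apply: cmp_or; [apply: h; left|apply: IH => u us; apply: h; right].
Qed.

Lemma cmp_all_const G (T : Type) (F : cX G -> T -> bool) (s : seq T) :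
  (forall t, List.In t s -> cmpb G (fun x => F x t)) -> cmpb G (fun x => all (F x) s).
Proof.
elim: s => [|t s IH] h /=; first exact: cmp_const.
by apply: cmp_and; [apply: h; left|apply: IH => u us; apply: h; right].
Qed.

Lemma cmp_find G (F : cX G -> nat -> bool) (n : cX G -> nat) :
  cmp n -> cmpb (ext n) (fun y => F y.1 y.2) -> cmp (fun x => find (F x) (iota 0 (n x))).
Proof.
(* The running value equals the index as long as nothing has been found; a value below the index is
   the answer and is kept. *)
move=> cn cF; apply: (@cmp_ext _ (fun x => iteri (n x)
    (fun k r => if r < k then r else if F x k then k else k.+1) 0)).
  move=> x _; elim: (n x) => // k IH; rewrite -[k.+1 in RHS]addn1 iotaD find_cat size_iota /= IH.
  rewrite add0n has_find size_iota.
  by case: ltnP => h //=; case: ifP => _; rewrite ?addn0 ?addn1.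
apply: (cmp_iteri cn cn (cmp_const _ _)); last first.
  by move=> x k _; elim: k => //= k IH kn; repeat case: ifP; lia.
apply: cmp_if; first by apply: cmp_leq; [apply: cmp_succ|apply: cmp_weak]; exact: cmp_v0.
  exact: cmp_v0.
by apply: cmp_if; first exact: cmp_weak cF; try apply: cmp_succ; apply: cmp_weak; exact: cmp_v0.
Qed.

Ltac cmp_lift H :=
  first [exact H | exact (cmp_weak _ H) | exact (cmp_weak _ (cmp_weak _ H))
    | exact (cmp_weak _ (cmp_weak _ (cmp_weak _ H)))
    | exact (cmp_weak _ (cmp_weak _ (cmp_weak _ (cmp_weak _ H))))
    | exact (cmp_weak _ (cmp_weak _ (cmp_weak _ (cmp_weak _ (cmp_weak _ H)))))
    | exact (cmp_weak _ (cmp_weak _ (cmp_weak _ (cmp_weak _ (cmp_weak _ (cmp_weak _ H))))))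
    | exact (cmp_weak _ (cmp_weak _ (cmp_weak _ (cmp_weak _ (cmp_weak _ (cmp_weak _ (cmp_weak _ H)))))))
    | exact (cmp_weak _ (cmp_weak _ (cmp_weak _ (cmp_weak _ (cmp_weak _ (cmp_weak _ (cmp_weak _ (cmp_weak _ H))))))))].

Ltac cmp_leaf :=
  first [ cmp_lift uconstr:(cmp_v0 _)
        | match goal with H : @cmp _ _ |- _ => cmp_lift H end
        | match goal with H : forall _, @cmp _ _ |- _ => cmp_lift uconstr:(H _) end
        | exact (cmp_const _ _) | exact (cmp_size _) ].

Ltac cmp_user := fail.

Ltac cmp_step :=
  cbv beta;
  first
  [ cmp_leaf
  | lazymatch goal with
    | |- @cmp ?G (fun x => nat_of_bool (~~ @?a x)) => refine (@cmp_neg G a _)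
    | |- @cmp ?G (fun x => nat_of_bool (@?a x && @?b x)) => refine (@cmp_and G a b _ _)
    | |- @cmp ?G (fun x => nat_of_bool (@?a x || @?b x)) => refine (@cmp_or G a b _ _)
    | |- @cmp ?G (fun x => nat_of_bool (@?a x ==> @?b x)) => refine (@cmp_imp G a b _ _)
    | |- @cmp ?G (fun x => nat_of_bool (leq (@?a x) (@?b x))) => refine (@cmp_leq G a b _ _)
    | |- @cmp ?G (fun x => nat_of_bool (@eq_op _ (@?a x) (@?b x))) => refine (@cmp_eq G a b _ _)
    | |- @cmp ?G (fun x => nat_of_bool (@has nat (@?F x) (iota 0 (@?n x)))) => refine (@cmp_has G F n _ _)
    | |- @cmp ?G (fun x => nat_of_bool (@all nat (@?F x) (iota 0 (@?n x)))) => refine (@cmp_all G F n _ _)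
    | |- @cmp ?G (fun x => @find nat (@?F x) (iota 0 (@?n x))) => refine (@cmp_find G F n _ _)
    | |- @cmp ?G (fun x => addn (@?a x) (@?b x)) => refine (@cmp_add G a b _ _)
    | |- @cmp ?G (fun x => muln (@?a x) (@?b x)) => refine (@cmp_mul G a b _ _)
    | |- @cmp ?G (fun x => subn (@?a x) (@?b x)) => refine (@cmp_sub G a b _ _)
    | |- @cmp ?G (fun x => S (@?a x)) => refine (@cmp_succ G a _)
    | |- @cmp ?G (fun x => predn (@?a x)) => refine (@cmp_pred G a _)
    end
  | cmp_user
  | refine (cmp_if _ _ _) ].

Ltac cmp_tac := repeat cmp_step.

Lemma cmp_div G (f g : cX G -> nat) : cmp f -> cmp g -> cmp (fun x => f x %/ g x).
Proof.
move=> cf cg; apply: (@cmp_ext _ (fun x => iteri (f x)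
    (fun _ r => if (0 < g x) && (r.+1 * g x <= f x) then r.+1 else r) 0)).
  move=> x _; have [g0|g0] := posnP (g x).
    by rewrite g0 divn0; elim: (f x) => //= k ->.
  suff -> k : iteri k (fun _ r => if true && (r.+1 * g x <= f x) then r.+1 else r) 0 = minn k (f x %/ g x).
    by apply/minn_idPr; exact: leq_div.
  elim: k => [|k /= ->] /=; first by rewrite min0n.
  by rewrite -leq_divRL //; case: ifP; lia.
apply: (cmp_iteri cf cf (cmp_const _ _)); first by cmp_tac.
by move=> x k _ /(leq_trans _); apply; elim: k => //= k IH; case: ifP; lia.
Qed.

Lemma cmp_mod G (f g : cX G -> nat) : cmp f -> cmp g -> cmp (fun x => f x %% g x).
Proof.
move=> cf cg; have cd := cmp_div cf cg.
apply: (@cmp_ext _ (fun x => f x - f x %/ g x * g x)); last by cmp_tac.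
by move=> x _; rewrite {1}(divn_eq (f x) (g x)) addKn.
Qed.

Lemma cmp_dvd G (f g : cX G -> nat) : cmp f -> cmp g -> cmpb G (fun x => f x %| g x).
Proof. by move=> cf cg; have cm := cmp_mod cg cf; rewrite /dvdn; cmp_tac. Qed.

Lemma cmp_odd G (f : cX G -> nat) : cmp f -> cmpb G (fun x => odd (f x)).
Proof.
move=> cf; have cm := cmp_mod cf (cmp_const _ 2).
by apply: cmp_ext cm => x _; rewrite modn2.
Qed.

Lemma cmp_expn_const G (f : cX G -> nat) k : cmp f -> cmp (fun x => f x ^ k).
Proof.
move=> cf; elim: k => [|k IH]; first exact: cmp_const.
by apply: cmp_ext (cmp_mul cf IH) => x _; rewrite expnS.
Qed.

(** Exponentiation is iterated multiplication, clipped at a bound that has to be representable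
    itself. *)
Lemma cmp_expn G (f g b : cX G -> nat) :
  cmp f -> cmp g -> cmp b -> (forall x, cok x -> 0 < f x /\ f x ^ g x <= b x) ->
  cmp (fun x => f x ^ g x).
Proof.
move=> cf cg cb fgb.
apply: (@cmp_ext _ (fun x => iteri (g x) (fun _ r => f x * r) 1)).
  by move=> x _; elim: (g x) => //= k ->; rewrite expnS.
apply: (cmp_iteri cg cb (cmp_const _ _)); first by cmp_tac.
move=> x k ox kg; have [f0 /(leq_trans _)] := fgb x ox; apply.
have -> : iteri k (fun _ r => f x * r) 1 = f x ^ k by elim: k {kg} => //= k ->; rewrite expnS.
exact: leq_pexp2l.
Qed.

Lemma cmp_iter G (n b i : cX G -> nat) (F : cX G -> nat -> nat) :
  cmp n -> cmp b -> cmp i ->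
  @cmp (@ext (ext n) (fun y => (b y.1).+1)) (fun y => F y.1.1 y.2) ->
  (forall x k, cok x -> k <= n x -> iter k (F x) (i x) <= b x) ->
  cmp (fun x => iter (n x) (F x) (i x)).
Proof.
move=> cn cb ci cF bd; have E x k : iter k (F x) (i x) = iteri k (fun _ => F x) (i x).
  by elim: k => //= k ->.
apply: (@cmp_ext _ (fun x => iteri (n x) (fun _ => F x) (i x))); first by move=> x _; rewrite E.
by apply: (cmp_iteri cn cb ci) => // x k ox kn; rewrite -E; apply: bd.
Qed.

Ltac cmp_more := fail.

Ltac cmp_user ::=
  lazymatch goal with
  | |- @cmp ?G (fun x => divn (@?a x) (@?b x)) => refine (@cmp_div G a b _ _)
  | |- @cmp ?G (fun x => modn (@?a x) (@?b x)) => refine (@cmp_mod G a b _ _)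
  | |- @cmp ?G (fun x => nat_of_bool (dvdn (@?a x) (@?b x))) => refine (@cmp_dvd G a b _ _)
  | |- @cmp ?G (fun x => nat_of_bool (odd (@?a x))) => refine (@cmp_odd G a _)
  | |- @cmp ?G (fun x => tk _ (@?a x)) => refine (@cmp_tk G a _)
  | |- @cmp ?G (fun x => nat_of_bool (@all _ (@?F x) ?s)) => refine (@cmp_all_const G _ F s _); intros
  | |- @cmp ?G (fun x => nat_of_bool (@has _ (@?F x) ?s)) => refine (@cmp_has_const G _ F s _); intros
  | _ => cmp_more
  end.

(** * Representable output *)

Definition ocmp (G : ctx) (f : cX G -> seq tok) : Prop :=
  exists p, forall x e, cok x -> osem (cinp x) (cenv x ++ e) p = f x.

Section OCmp.
Variable G : ctx.

Lemma ocmp_ext (f g : cX G -> seq tok) : (forall x, cok x -> f x = g x) -> ocmp f -> ocmp g.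
Proof. by move=> fg [p h]; exists p => x e ox; rewrite h // fg. Qed.

Lemma ocmp_nil : @ocmp G (fun=> [::]).
Proof. by exists ONop. Qed.

Lemma ocmp_cat (f g : cX G -> seq tok) : ocmp f -> ocmp g -> ocmp (fun x => f x ++ g x).
Proof. by move=> [p hp] [q hq]; exists (OSeq p q) => x e ox /=; rewrite hp ?hq. Qed.

Lemma ocmp_const (s : seq tok) : @ocmp G (fun=> s).
Proof.
elim: s => [|t s [p h]]; first exact: ocmp_nil.
by exists (OSeq (OTok t) p) => x e ox /=; rewrite h.
Qed.

Lemma ocmp_if (a : cX G -> bool) (f : cX G -> seq tok) : cmpb G a -> ocmp f ->
  ocmp (fun x => if a x then f x else [::]).
Proof.
move=> [t ht] [p hp]; exists (OIf t p) => x e ox /=; rewrite ht // hp //.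
by case: (a x).
Qed.

Lemma ocmp_for (n : cX G -> nat) (F : cX G -> nat -> seq tok) :
  cmp n -> @ocmp (ext n) (fun y => F y.1 y.2) ->
  ocmp (fun x => flatten [seq F x k | k <- iota 0 (n x)]).
Proof.
move=> [t ht] [p hp]; exists (OFor (cdim G) t p) => x e ox /=; rewrite ht //.
congr flatten; apply/eq_in_map => k; rewrite mem_iota /= add0n => kn.
rewrite -(cdimP x) take_size_cat //.
by have /= := hp (x, k) [::]; rewrite cats0; apply.
Qed.

Lemma ocmp_list (T : Type) (s : seq T) (F : cX G -> T -> seq tok) :
  (forall t, List.In t s -> ocmp (fun x => F x t)) ->
  ocmp (fun x => flatten [seq F x t | t <- s]).
Proof.
elim: s => [|t s IH] h /=; first exact: ocmp_nil.
by apply: ocmp_cat; [apply: h; left|apply: IH => u us; apply: h; right].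
Qed.
End OCmp.

Definition ctx0 : ctx := @Ctx (seq tok) id (fun=> [::]) 0 (fun=> True) (fun=> erefl).

Theorem ocmp_logspace (f : seq tok -> seq tok) : @ocmp ctx0 f ->
  exists M c, computes_in_space M f (log_bound c).
Proof.
move=> [p hp]; have [M [c [h1 [h2 h3]]]] := transducer p; exists M, c; split=> //; split=> // w.
by have [[d [r1 [r2 r3]]] h4] := h3 w; split=> //; exists d; do 2!split=> //; rewrite r3; exact: (hp w [::]).
Qed.

(** A number below [b * b] is read as a pair of the current node and a candidate for the next one. A
    guessed 0 advances the candidate and a guessed 1 follows the edge to it, so one bit per round
    suffices to reach any neighbour. *)
Theorem NL_of_graph (L : seq tok -> Prop) (b : seq tok -> nat)
    (edge : seq tok -> nat -> nat -> bool) (acc : seq tok -> nat -> bool) :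
  (forall G, @cmp G (fun x => b (cinp x))) ->
  (forall G (f g : cX G -> nat), cmp f -> cmp g -> cmpb G (fun x => edge (cinp x) (f x) (g x))) ->
  (forall G (f : cX G -> nat), cmp f -> cmpb G (fun x => acc (cinp x) (f x))) ->
  (forall w, 0 < b w) ->
  (forall w, L w <-> exists x, clos_refl_trans nat
     (fun x y => [/\ x < b w, y < b w & edge w x y]) 0 x /\ acc w x) ->
  in_NL L.
Proof.
move=> cb ce ca b0 hL.
pose G := @ext (@ext ctx0 (fun=> 1)) (fun y => b y.1 * b y.1).
pose stp w z bit := let x := z %/ b w in let y := z %% b w in
  if bit == 1 then if edge w x y then y * b w else z else if y.+1 < b w then z.+1 else z.
have cz : @cmp G (fun y => y.2) by exact: cmp_v0.
have cbG G' : @cmp G' (fun y => b (cinp y)) by exact: cb.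
have [tf htf] : @cmp (@ext G (fun=> 2)) (fun y => stp y.1.1.1 y.1.2 y.2).
  have cz' : @cmp (@ext G (fun=> 2)) (fun y => y.1.2) by exact: (cmp_weak _ cz).
  have cb' : @cmp (@ext G (fun=> 2)) (fun y => b y.1.1.1) by exact: cb.
  have cx := cmp_div cz' cb'; have cy := cmp_mod cz' cb'.
  by have cE := ce _ _ _ cx cy; rewrite /stp; cmp_tac.
have [ta hta] : cmpb G (fun y => acc y.1.1 (y.2 %/ b y.1.1)).
  by have := ca _ _ (cmp_div cz (cbG G)).
have [tb htb] := cbG ctx0; have [cc hcc] := polyb_bnd tb.
have bE w : b w <= (size w + 2) ^ cc.
  rewrite -(htb w [::]) //; apply: leq_trans (hcc _); exact: eval_bnd.
pose m n := ((n + 2) ^ cc) * ((n + 2) ^ cc) + n + 2.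
have stpb w z bit : z < b w * b w -> stp w z bit < b w * b w.
  move=> zb; rewrite /stp; have bw := b0 w; case: ifP => _; last first.
    case: ifP => // h; rewrite {1}(divn_eq z (b w)) -addnS.
    have : z %/ b w < b w by rewrite ltn_divLR.
    by move: h; set q := z %/ b w; set r := z %% b w => h1 h2; nia.
  by case: ifP => // _; rewrite ltn_mul2r bw ltn_pmod.
have runE w bs : drunx false Zero tf w bs = foldl (fun z (bit : bool) => stp w z bit) 0 bs /\
     foldl (fun z (bit : bool) => stp w z bit) 0 bs < b w * b w.
  elim/last_ind: bs => [|bs bit [IH1 IH2]].
    by split=> //=; rewrite muln_gt0 b0.
  rewrite /drunx !foldl_rcons -/(drunx _ _ _ _ _) IH1; set z := foldl _ _ _ in IH2 *.
  split; last exact: stpb.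
  by have /= := htf (w, 0, z, nat_of_bool bit) [::]; apply; do !split=> //=; case: bit.
have pm : polyb (fun n => dbnd Zero ta tf (m n)).
  have pm' : polyb m.
    have pc : polyb (fun n => (n + 2) ^ cc) by exists cc.
    by apply: polyb_add; [apply: polyb_add; [exact: polyb_mul|exact: polyb_id]|exact: polyb_const].
  rewrite /dbnd; apply: polyb_add; last exact: polyb_const.
  apply: polyb_add; last exact: (polyb_comp (polyb_bnd _)).
  apply: polyb_add; last exact: (polyb_comp (polyb_bnd _)).
  by apply: polyb_add => //; exact: (polyb_comp (polyb_bnd _)).
have [c hc] := log_bound_poly pm.
exists (cm_tm (dcode true false Zero ta tf)), c.
apply: (decider (m := m)); rewrite ?/m.
- by move=> w; lia.
- by [].
- move=> w bs _; have [-> h] := runE w bs; have := bE w.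
  by move=> h'; have := leq_mul h' h'; lia.
- by move=> w; exact: hc.
move=> w; rewrite hL; split=> [[x [r ax]]|[bs _]].
  have [bs E] : exists bs, drunx false Zero tf w bs = x * b w.
    move: r => /clos_rt_rtn1_iff; elim=> [|y z [yb zb e] _ [bs E]].
      by exists [::].
    have ind k : k <= z -> exists bs', drunx false Zero tf w bs' = y * b w + k.
      elim: k => [|k IH] kz; first by exists bs; rewrite addn0.
      have [|bs' E'] := IH; first lia.
      exists (rcons bs' false); have [-> _] := runE w (rcons bs' false).
      rewrite foldl_rcons; have [<- _] := runE w bs'; rewrite E' /stp /=.
      rewrite modnMDl modn_small; last by lia.
      by rewrite ifT ?addnS //; lia.
    have [bs' E'] := ind z (leqnn z).
    exists (rcons bs' true); have [-> _] := runE w (rcons bs' true).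
    rewrite foldl_rcons; have [<- _] := runE w bs'; rewrite E' /stp /=.
    by rewrite modnMDl modn_small // divnMDl // divn_small // addn0 e.
  exists bs => //; have [E' lt] := runE w bs; rewrite E.
  have /= := hta (w, 0, x * b w) [::]; rewrite mulnK // ax => -> //.
  by do !split=> //=; rewrite -E E'.
have [E lt] := runE w bs; rewrite E; set z := foldl _ _ _ in E lt *.
have /= := hta (w, 0, z) [::] => -> /=; last by do !split.
case acz: (acc _ _) => // _; exists (z %/ b w); split=> //.
move: E lt acz => _ _ _; rewrite /z {z}; elim/last_ind: bs => [|bs bit IH]; first by rewrite div0n; exact: rt_refl.
rewrite foldl_rcons; have [_ zb] := runE w bs; move: IH zb; set z := foldl _ _ _ => IH zb.
have xb : z %/ b w < b w by rewrite ltn_divLR.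
rewrite /stp; case: ifP => _.
  case: ifP => // e; rewrite mulnK //; apply: rt_trans IH _; apply: rt_step.
  by split=> //; rewrite ltn_pmod.
case: ifP => // h; suff -> : z.+1 %/ b w = z %/ b w by [].
by rewrite [in LHS](divn_eq z (b w)) -addnS divnMDl ?b0 // (divn_small h) addn0.
Qed.

(* The second variable of a polynomial-space computation holds a power of two
   of polynomially many bits, from which all space bounds are built. *)
Definition ctxP (T : seq tok -> nat) : ctx :=
  @Ctx (seq tok * nat) fst (fun y => [:: y.2]) 1 (fun y => y.2 = 2 ^ T y.1) (fun=> erefl).

(** All values of the iteration are below a polynomial in the input length and [2 ^ T w], where [T]
    is polynomially bounded; hence they have polynomially many bits. *)
Theorem PSPACE_of_iter (L : seq tok -> Prop) (T : seq tok -> nat) (b : seq tok * nat -> nat)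
    (stp : seq tok -> nat -> nat -> nat) (acc : seq tok -> nat -> nat -> bool) :
  @cmp ctx0 T -> @cmp (ctxP T) b ->
  @cmp (@ext (ctxP T) b) (fun y => stp y.1.1 y.1.2 y.2) ->
  cmpb (@ext (ctxP T) b) (fun y => acc y.1.1 y.1.2 y.2) ->
  (forall w, let B := 2 ^ T w in
     0 < b (w, B) /\ forall z, z < b (w, B) -> stp w B z < b (w, B)) ->
  (forall w, let B := 2 ^ T w in L w <-> exists n, acc w B (iter n (stp w B) 0)) ->
  in_PSPACE L.
Proof.
move=> [tn htn] [tb htb] [tf htf] [ta hta] hb hL.
have dBE w : dB true tn w = 2 ^ T w by rewrite /dB -(htn w [::]).
have [kn hkn] := polyb_bnd tn; have TE w : T w <= (size w + 2) ^ kn.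
  by rewrite -(htn w [::]) //; apply: leq_trans (hkn _); exact: eval_bnd.
pose M0 n := 2 ^ ((n + 2) ^ kn) + n + 2.
pose m n := bnd tb (M0 n) + M0 n.
have MB w : 2 ^ T w <= M0 (size w).
  by rewrite /M0; have := TE w; rewrite -(@leq_exp2l 2) //; lia.
have bE w : b (w, 2 ^ T w) <= bnd tb (M0 (size w)).
  rewrite -(htb (w, 2 ^ T w) [::]) //; apply: eval_bnd => /=; first by rewrite /M0; lia.
  by rewrite MB.
have runE w bs : dchoice false bs -> drunx true tn tf w bs = iter (size bs) (stp w (2 ^ T w)) 0.
  elim/last_ind: bs => // bs bit IH; rewrite /dchoice has_rcons negb_or => /andP[bitF nh].
  rewrite /drunx foldl_rcons -/(drunx _ _ _ _ _) IH // size_rcons iterS.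
  have [h0 hs] := hb w; have zb n : iter n (stp w (2 ^ T w)) 0 < b (w, 2 ^ T w).
    by elim: n => //= n; exact: hs.
  rewrite /dstep dBE; have /= := htf ((w, 2 ^ T w), iter (size bs) (stp w (2 ^ T w)) 0) [:: nat_of_bool bit].
  by apply; split=> //; exact: zb.
have [c hc] : polyb (fun x => dbnd tn ta tf (bnd tb x + x)).
  have pm' : polyb (fun x => bnd tb x + x) by apply: polyb_add; [exact: polyb_bnd|exact: polyb_id].
  rewrite /dbnd; apply: polyb_add; last exact: polyb_const.
  apply: polyb_add; last exact: (polyb_comp (polyb_bnd _)).
  apply: polyb_add; last exact: (polyb_comp (polyb_bnd _)).
  by apply: polyb_add => //; exact: (polyb_comp (polyb_bnd _)).
(* [M0 n + 2] is at most 2 to the power of a polynomial, so its [c]-th power has a polynomial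
   logarithm. The factor [3 ^ kn.+1] comes from replacing [n + 2] by [3 * n] for positive [n]. *)
have [d [k hs]] : exists d k, forall n, Nat.log2 (dbnd tn ta tf (m n)) + 2 <= poly_bound d k n.
  exists (c * 7 * 3 ^ kn.+1 + 2), kn.+1 => n; rewrite /poly_bound.
  have l1 : Nat.log2 (dbnd tn ta tf (m n)) <= Nat.log2 ((M0 n + 2) ^ c).
    by apply/leP; apply: Nat.log2_le_mono; apply/leP; exact: hc.
  have l2 : M0 n + 2 <= 2 ^ ((n + 2) ^ kn + n + 4).
    have -> : (n + 2) ^ kn + n + 4 = (n + 2) ^ kn + (n + 4) by lia.
    rewrite expnD /M0; have : n + 4 < 2 ^ (n + 4) by exact: ltn_expl.
    have : 0 < 2 ^ ((n + 2) ^ kn) by rewrite expn_gt0.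
    by set X := 2 ^ (_ ^ _); set Y := 2 ^ (n + 4); nia.
  have l3 : Nat.log2 ((M0 n + 2) ^ c) <= c * ((n + 2) ^ kn + n + 5).
    apply: leq_trans (log2_exp _ _) _; rewrite leq_mul2l; apply/orP; right.
    have /leP := Nat.log2_le_mono _ _ (elimT leP l2).
    have -> : 2 ^ ((n + 2) ^ kn + n + 4) = Nat.pow 2 ((n + 2) ^ kn + n + 4).
      by elim: (_ + 4) => //= j; rewrite expnS => ->; lia.
    by rewrite Nat.log2_pow2; lia.
  have l4 : (n + 2) ^ kn + n + 5 <= 4 * (n + 2) ^ kn.+1.
    rewrite expnS; have : 0 < (n + 2) ^ kn by rewrite expn_gt0; lia.
    by nia.
  have l5 : (n + 2) ^ kn.+1 <= 3 ^ kn.+1 * (n ^ kn.+1 + 1).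
    case: n {l1 l2 l3 l4} => [|n]; first by rewrite exp0n // add0n muln1 leq_expl.
    apply: (@leq_trans ((3 * n.+1) ^ kn.+1)); first by apply: leq_expl; lia.
    by rewrite expnMn leq_mul2l; lia.
  have l6 := leq_trans l1 l3.
  have l7 : c * ((n + 2) ^ kn + n + 5) <= c * (4 * (3 ^ kn.+1 * (n ^ kn.+1 + 1))).
    by rewrite leq_mul2l; apply/orP; right; apply: leq_trans l4 _; rewrite leq_mul2l l5 orbT.
  have := leq_trans l6 l7; set p := n ^ kn.+1; set q := 3 ^ kn.+1.
  by nia.
exists (cm_tm (dcode false true tn ta tf)), d, k; split; first exact: dcode_det.
apply: (decider (m := m)).
- by move=> w; rewrite /m /M0; lia.
- by move=> w; rewrite dBE; apply: leq_trans (MB w) (leq_addl _ _).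
- move=> w bs ch; rewrite runE //; have [h0 hz] := hb w.
  have zb n : iter n (stp w (2 ^ T w)) 0 < b (w, 2 ^ T w) by elim: n => //= n; exact: hz.
  by have := zb (size bs); have := bE w; rewrite /m; lia.
- by move=> w; exact: hs.
move=> w; rewrite hL; have [h0 hz] := hb w.
have zb n : iter n (stp w (2 ^ T w)) 0 < b (w, 2 ^ T w) by elim: n => //= n; exact: hz.
have accE n : eval w [:: 2 ^ T w; iter n (stp w (2 ^ T w)) 0] ta =
     acc w (2 ^ T w) (iter n (stp w (2 ^ T w)) 0).
  have /= := hta ((w, 2 ^ T w), iter n (stp w (2 ^ T w)) 0) [::].
  by apply; split=> //; exact: zb.
split=> [[n an]|[bs ch]].
  exists (nseq n false); first by rewrite /dchoice has_nseq andbF.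
  by rewrite dBE runE ?size_nseq ?accE ?an // /dchoice has_nseq andbF.
by rewrite dBE runE // accE => h; exists (size bs); case: (acc _ _ _) h.
Qed.

(** * Derivations *)

Section Der.
Variables (p : program) (D : tdb).

(* Facts carry the operators still in front of the atom, so that every inference
   moves in time by at most one step. *)
Inductive der : Z -> seq top -> atom -> Prop :=
| der_fact t a : dfact D t a -> der t [::] a
| der_rule ru t nu : List.In ru p ->
    (forall x, x \in rvars ru -> nu x \in objs D) ->
    (forall l, List.In l (rbody ru) -> der t (lit_ops l) (lit_rel l, map nu (lit_args l))) ->
    der t [::] ((rhead ru).1, map nu (rhead ru).2)
| der_next t o a : der (t + 1) o a -> der t (ONext :: o) a
| der_prev t o a : der (t - 1) o a -> der t (OPrev :: o) a
| der_fut1 t o a : der (t + 1) o a -> der t (OFut :: o) a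
| der_futS t o a : der (t + 1) (OFut :: o) a -> der t (OFut :: o) a
| der_past1 t o a : der (t - 1) o a -> der t (OPast :: o) a
| der_pastS t o a : der (t - 1) (OPast :: o) a -> der t (OPast :: o) a.

Hypotheses (wfp : wf_program p) (Dp : db_over_edb p D).

Lemma dfact_flatten t a : dfact D t a -> List.In a (flatten (tsets D)).
Proof.
case=> [[h1 h2]]; set i := Z.to_nat _ => ai.
have : (i < size (tsets D))%N by rewrite /i /tr in h2 *; lia.
elim: (tsets D) i ai => // s ss IH [|i] /=.
  by move=> h _; apply/List.in_or_app; left.
by move=> h hi; apply/List.in_or_app; right; apply: IH hi.
Qed.

Lemma In_mem (T : eqType) (x : T) (s : seq T) : List.In x s <-> x \in s.
Proof.
elim: s => //= y s IH; rewrite inE; split=> [[->|/IH ->]|/orP[/eqP ->|/IH h]]; rewrite ?eqxx ?orbT //; auto.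
Qed.

Lemma dfact_ok t a : dfact D t a -> [/\ wf_atom a, edb p a.1 & all (fun d => d \in objs D) a.2].
Proof.
move=> /dfact_flatten/In_mem h; have [w e] := Dp.2 a h; split=> //.
by apply/allP => d da; apply/flattenP; exists a.2 => //; apply: map_f.
Qed.

Lemma der_holds E t o a : is_model p D E -> der t o a -> holds E t o a.
Proof.
move=> [m1 [m2 m3]]; elim=> {t o a}.
- move=> t a h; have [_ /andP[_ nidb] _] := dfact_ok h.
  by apply/m2.
- by move=> ru t nu ri nuo _ IH; apply: m3.
- by [].
- by [].
- by move=> t o a _ IH; exists (t + 1)%Z; split=> //; lia.
- by move=> t o a _ [t' [h1 h2]]; exists t'; split=> //; lia.
- by move=> t o a _ IH; exists (t - 1)%Z; split=> //; lia.
- by move=> t o a _ [t' [h1 h2]]; exists t'; split=> //; lia.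
Qed.

(** An existential operator is replaced by finitely many single steps from its witness back to [t];
    the induction is on the distance. *)
Lemma holds_der E t o a : (forall t a, E t a -> der t [::] a) -> holds E t o a -> der t o a.
Proof.
move=> ED; elim: o t => [|[] o IH] t /=.
- exact: ED.
- by move=> /IH; exact: der_next.
- by move=> /IH; exact: der_prev.
- move=> [t' [lt /IH h]]; have -> : t = (t' - 1 - Z.of_nat (Z.to_nat (t' - t - 1)))%Z by lia.
  elim: (Z.to_nat _) => [|n IHn].
    by apply: der_fut1; have -> : (t' - 1 - Z.of_nat 0 + 1 = t')%Z by lia.
  by apply: der_futS; have -> : (t' - 1 - Z.of_nat n.+1 + 1 = t' - 1 - Z.of_nat n)%Z by lia.
- move=> [t' [lt /IH h]]; have -> : t = (t' + 1 + Z.of_nat (Z.to_nat (t - t' - 1)))%Z by lia.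
  elim: (Z.to_nat _) => [|n IHn].
    by apply: der_past1; have -> : (t' + 1 + Z.of_nat 0 - 1 = t')%Z by lia.
  by apply: der_pastS; have -> : (t' + 1 + Z.of_nat n.+1 - 1 = t' + 1 + Z.of_nat n)%Z by lia.
Qed.

Lemma in_rels_head ru : List.In ru p -> (rhead ru).1 \in rels p /\ idb p (rhead ru).1.
Proof.
rewrite /rels /idb; elim: (p) => //= r q IH [->|/IH[h1 h2]]; rewrite !inE ?eqxx //.
by rewrite mem_cat h1 h2 !orbT.
Qed.

Lemma der_nilP t a : der t [::] a -> dfact D t a \/ exists ru nu, [/\ List.In ru p,
    (forall x, x \in rvars ru -> nu x \in objs D),
    (forall l, List.In l (rbody ru) -> der t (lit_ops l) (lit_rel l, map nu (lit_args l)))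
    & a = ((rhead ru).1, map nu (rhead ru).2)].
Proof. by move=> h; inversion h as [| ru t' nu| | | | | |]; subst; [left|right; exists ru, nu]. Qed.

Lemma der_edb t a : der t [::] a -> ~~ idb p a.1 -> dfact D t a.
Proof.
move=> /der_nilP[//|[ru [nu [ri _ _ ->]]]].
by have [_ /= ->] := in_rels_head ri.
Qed.

Lemma der_model : is_model p D (fun t a => der t [::] a).
Proof.
split=> [t a /der_nilP[/dfact_ok[w e o]|[ru [nu [ri nuo _ ->]]]]|].
- by move: e => /andP[-> _].
- have [w1 _] := wfp ri; have [r1 _] := in_rels_head ri; rewrite /wf_atom /= size_map; do 2!split=> //.
  by apply/allP => d /mapP[x xh ->]; apply: nuo; rewrite /rvars mem_cat xh.
split=> [t a nidb|ru ri t nu nuo h].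
  by split=> [/der_edb|]; [apply|exact: der_fact].
apply: der_rule => // l lb; apply: (holds_der (E := fun t a => der t [::] a)) => //.
exact: h.
Qed.

Lemma certain_der t a : certain p D t a <-> der t [::] a.
Proof.
split=> [h|h E mE]; first exact: (h _ der_model).
exact: (der_holds mE h).
Qed.

End Der.

(** * Encodings *)

Definition is_bit (t : tok) : bool := match t with T0 | T1 => true | _ => false end.

(** Numerals carry no end mark and one may be a prefix of another, so decoding is unique only if no
    bit follows. *)
Lemma enc_pos_inj q q' r r' : enc_pos q ++ r = enc_pos q' ++ r' ->
  (if r is t :: _ then ~~ is_bit t else true) -> (if r' is t :: _ then ~~ is_bit t else true) ->
  q = q' /\ r = r'.
Proof.
elim: q q' => [q IH|q IH|] [q'|q'|] //= [].
- by move=> /IH{}IH /IH{}IH /IH[-> ->].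
- by case: q {IH} => [q|q|] <- /=.
- by move=> /IH{}IH /IH{}IH /IH[-> ->].
- by case: q' => [q'|q'|] -> /=.
- by move=> ->.
Qed.

Definition nobit (r : seq tok) : bool := if r is t :: _ then ~~ is_bit t else true.

Lemma enc_nat_inj n n' r r' : enc_nat n ++ r = enc_nat n' ++ r' -> nobit r -> nobit r' ->
  n = n' /\ r = r'.
Proof.
rewrite /enc_nat => + h h'; case E: (N.of_nat n) => [|q]; case E': (N.of_nat n') => [|q'].
- by move=> [->]; split=> //; lia.
- by case: q' E' => [q'|q'|] _ //= [] rE; move: h; rewrite rE; case: q' {rE}.
- by case: q E => [q|q|] _ //= [] rE; move: h'; rewrite -rE; case: q {rE}.
- by move=> /enc_pos_inj /(_ h h')[e ->]; split=> //; subst; lia.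
Qed.

Lemma enc_Z_inj z z' r r' : enc_Z z ++ r = enc_Z z' ++ r' -> nobit r -> nobit r' ->
  z = z' /\ r = r'.
Proof.
move=> + h h'; case: z => [|q|q]; case: z' => [|q'|q'] //=.
- by case=> ->.
- by case: q' => [q'|q'|] //= [] rE; move: h; rewrite rE; case: q' {rE}.
- by case: q => [q|q|] //= [] rE; move: h'; rewrite -rE; case: q {rE}.
- by move=> /enc_pos_inj /(_ h h')[-> ->].
- by case: q.
- by case: q'.
- by case=> /enc_pos_inj /(_ h h')[-> ->].
Qed.

Section Star.
Variables (T : Type) (enc : T -> seq tok).
Hypothesis encI : forall x x' r r', enc x ++ r = enc x' ++ r' -> x = x' /\ r = r'.

Lemma star_inj xs xs' r r' :
  (forall x s, r <> enc x ++ s) -> (forall x s, r' <> enc x ++ s) ->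
  flatten (map enc xs) ++ r = flatten (map enc xs') ++ r' -> xs = xs' /\ r = r'.
Proof.
move=> h h'; elim: xs xs' => [|x xs IH] [|x' xs'] //=; rewrite -?catA.
- by move=> e; case: (h _ _ e).
- by move=> e; case: (h' _ _ (esym e)).
by move=> /encI[-> /IH[-> ->]].
Qed.
End Star.

Lemma enc_nat_head n : exists t s, enc_nat n = t :: s /\ is_bit t.
Proof.
rewrite /enc_nat; case: (N.of_nat n) => [|[q|q|]] /=; [exists T0|exists T1|exists T0|exists T1]; eexists; eauto.
Qed.

Definition enc_arg (d : nat) : seq tok := enc_nat d ++ [:: TSep].

Lemma enc_arg_inj x x' r r' : enc_arg x ++ r = enc_arg x' ++ r' -> x = x' /\ r = r'.
Proof. by rewrite /enc_arg -!catA => /enc_nat_inj[] // -> [->]. Qed.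

Lemma enc_arg_noclose x s r : TClose :: r <> enc_arg x ++ s.
Proof. by have [t [u [e b]]] := enc_nat_head x; rewrite /enc_arg e /= => -[tE]; rewrite -tE in b. Qed.

Lemma enc_tuple_inj ds ds' r r' : enc_tuple ds ++ r = enc_tuple ds' ++ r' -> ds = ds' /\ r = r'.
Proof.
rewrite /enc_tuple /= => -[]; rewrite -!catA => /(star_inj enc_arg_inj)[].
- by move=> x s; exact: enc_arg_noclose.
- by move=> x s; exact: enc_arg_noclose.
by move=> -> [->].
Qed.

Lemma enc_atom_inj a a' r r' : enc_atom a ++ r = enc_atom a' ++ r' -> a = a' /\ r = r'.
Proof.
case: a a' => [[n k] ds] [[n' k'] ds']; rewrite /enc_atom /= => -[].
rewrite -!catA /= -!catA => /enc_nat_inj[] // -> [].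
move=> /enc_nat_inj[] // -> [].
move=> e; have [|-> [->] //] := @enc_tuple_inj ds ds' (TClose :: r) (TClose :: r').
by move: e; rewrite /enc_tuple /= -!catA /= => ->.
Qed.

Lemma enc_atom_noclose a s r : TClose :: r <> enc_atom a ++ s.
Proof. by []. Qed.

Lemma enc_set_inj s s' r r' : enc_set s ++ r = enc_set s' ++ r' -> s = s' /\ r = r'.
Proof.
rewrite /enc_set /= => -[]; rewrite -!catA => /(star_inj enc_atom_inj)[] //.
by move=> -> [->].
Qed.

(** The query language quantifies existentially over the instances with a given code; unique
    decoding lets hardness and decision procedures speak of one instance. *)
Lemma enc_input_inj D D' ds ds' t t' :
  enc_input D ds t = enc_input D' ds' t' -> [/\ D = D', ds = ds' & t = t'].
Proof.
case: D D' => [l ss] [l' ss']; rewrite /enc_input /enc_db /= -!catA => /enc_Z_inj[] // -> [].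
rewrite -!catA => /(star_inj enc_set_inj)[] // -> [].
move=> e; have [|-> e'] := @enc_tuple_inj ds ds' (enc_Z t) (enc_Z t').
  by move: e; rewrite /enc_tuple /= -!catA /= => ->.
by have := @enc_Z_inj t t' [::] [::]; rewrite !cats0 => /(_ e' isT isT)[].
Qed.

Lemma query_lang_enc p G D ds t :
  query_lang p G (enc_input D ds t) <->
  [/\ db_over_edb p D, size ds = arity G, all (fun d => d \in objs D) ds & in_tem D t] /\
  certain p D t (G, ds).
Proof.
split=> [[D' [ds' [t' [[h1 h2 h3 h4 /enc_input_inj[-> -> ->]] h5]]]]|[[h1 h2 h3 h4] h5]] //.
by exists D, ds, t.
Qed.

Lemma enc_nat_half n : 0 < n ->
  enc_nat n = (if odd n then T1 else T0) :: (if n %/ 2 == 0 then [::] else enc_nat (n %/ 2)).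
Proof.
move=> n0; rewrite /enc_nat; case E: (N.of_nat n) => [|[q|q|]]; first lia.
- have -> : N.of_nat (n %/ 2) = Npos q by lia.
  have -> : odd n by lia.
  by rewrite ifF //; lia.
- have -> : N.of_nat (n %/ 2) = Npos q by lia.
  have -> : odd n = false by lia.
  by rewrite ifF //; lia.
- by have -> : n = 1 by lia.
Qed.

(** The numeral in the form of a loop that an output program can run. The number [n] of rounds is a
    crude bound on the number of digits; rounds after the last digit write nothing. *)
Lemma enc_nat_bits n :
  enc_nat n = (if n == 0 then [:: T0] else [::]) ++
    flatten [seq (if 0 < iter i (fun a => a %/ 2) n then
                    (if odd (iter i (fun a => a %/ 2) n) then [:: T1] else [::]) ++
                    (if ~~ odd (iter i (fun a => a %/ 2) n) then [:: T0] else [::])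
                  else [::]) | i <- iota 0 n].
Proof.
case: n => // n; rewrite cat0s.
suff gen K m : m <= K -> flatten [seq (if 0 < iter i (fun a => a %/ 2) m then
      (if odd (iter i (fun a => a %/ 2) m) then [:: T1] else [::]) ++
      (if ~~ odd (iter i (fun a => a %/ 2) m) then [:: T0] else [::])
    else [::]) | i <- iota 0 K] = if m == 0 then [::] else enc_nat m by rewrite gen.
elim: K m => [|K IH] m mK; first by have -> : m = 0 by lia.
rewrite /= -[1]addn0 iotaDl -map_comp.
have E i : iter i (fun a => a %/ 2) m %/ 2 = iter i (fun a => a %/ 2) (m %/ 2) by rewrite -iterSr.
under eq_map => i do rewrite /= E.
rewrite IH; last by lia.
case: m {E mK} => [|m] //=; rewrite [in RHS]enc_nat_half //=.
by case: (odd m).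
Qed.

Lemma ocmp_enc_nat G (f : cX G -> nat) : cmp f -> ocmp (fun x => enc_nat (f x)).
Proof.
move=> cf; apply: (ocmp_ext (fun x _ => esym (enc_nat_bits (f x)))).
apply: ocmp_cat; first by apply: (ocmp_if (a := fun x => f x == 0)); [cmp_tac|exact: ocmp_const].
apply: (ocmp_for cf).
have ch : @cmp (ext f) (fun y => iter y.2 (fun a => a %/ 2) (f y.1)).
  apply: (@cmp_iter (ext f) _ (fun y => f y.1)); try by cmp_tac.
  by move=> y k _ _; elim: k => //= k IH; apply: leq_trans (leq_div _ _) IH.
cbv beta; apply: ocmp_if; first by cmp_tac.
by apply: ocmp_cat; apply: ocmp_if; first [exact: ocmp_const|cmp_tac].
Qed.

Definition fcmp (G : ctx) (F : cX G -> seq atom) : Prop :=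
  ocmp (fun x => flatten [seq enc_atom a | a <- F x]).

Section FCmp.
Variable G : ctx.

Lemma fcmp_cat (F H : cX G -> seq atom) : fcmp F -> fcmp H -> fcmp (fun x => F x ++ H x).
Proof.
by move=> cF cH; apply: ocmp_ext (ocmp_cat cF cH) => x _; rewrite map_cat flatten_cat.
Qed.

Lemma fcmp_if (a : cX G -> bool) (F : cX G -> seq atom) : cmpb G a -> fcmp F ->
  fcmp (fun x => if a x then F x else [::]).
Proof. by move=> ca cF; apply: ocmp_ext (ocmp_if ca cF) => x _; case: (a x). Qed.

Lemma fcmp_for (n : cX G -> nat) (F : cX G -> nat -> seq atom) :
  cmp n -> @fcmp (ext n) (fun y => F y.1 y.2) ->
  fcmp (fun x => flatten [seq F x k | k <- iota 0 (n x)]).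
Proof.
move=> cn cF; apply: ocmp_ext (ocmp_for cn cF) => x _.
by elim: (iota _ _) => //= k s ->; rewrite map_cat flatten_cat.
Qed.

Lemma fcmp_list (T : Type) (s : seq T) (F : cX G -> T -> seq atom) :
  (forall t, List.In t s -> fcmp (fun x => F x t)) ->
  fcmp (fun x => flatten [seq F x t | t <- s]).
Proof.
move=> h; apply: ocmp_ext (ocmp_list h) => x _.
by elim: s {h} => //= k s ->; rewrite map_cat flatten_cat.
Qed.

Lemma fcmp_atom (R : relsym) (fs : seq (cX G -> nat)) :
  (forall f, List.In f fs -> cmp f) -> fcmp (fun x => [:: (R, [seq f x | f <- fs])]).
Proof.
move=> h; rewrite /fcmp /=.
apply: (@ocmp_ext _ (fun x => (TOpen :: enc_nat R.1 ++ TSep :: enc_nat R.2 ++ [:: TSep; TOpen]) ++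
   flatten [seq enc_nat (f x) ++ [:: TSep] | f <- fs] ++ [:: TClose; TClose])).
  by move=> x _; rewrite /enc_atom /enc_tuple /= cats0 -map_comp -!catA /= -!catA /=.
apply: ocmp_cat; first exact: ocmp_const.
apply: ocmp_cat; last exact: ocmp_const.
apply: ocmp_list => f /h cf; apply: ocmp_cat; [exact: ocmp_enc_nat|exact: ocmp_const].
Qed.
End FCmp.

(* All facts are put at time 0; the empty slice at time 1 is there because a
   temporal database has at least two slices. *)
Definition two_slices (F : seq atom) : tdb := TDB 0 [:: F; [::]].

Lemma fcmp_logspace (F : seq tok -> seq atom) d : @fcmp ctx0 F ->
  exists M c, computes_in_space M (fun w => enc_input (two_slices (F w)) [:: d] 0) (log_bound c).
Proof.
move=> cF; apply: ocmp_logspace.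
apply: (@ocmp_ext ctx0 (fun w => [:: T0; TSep; TOpen] ++ flatten [seq enc_atom a | a <- F w] ++
   ([:: TClose; TOpen; TClose; TSep] ++ enc_tuple [:: d] ++ [:: T0]))).
  by move=> w _; rewrite /enc_input /enc_db /enc_set /= -?catA /= -?catA /=.
by apply: ocmp_cat; [exact: ocmp_const|apply: ocmp_cat => //; exact: ocmp_const].
Qed.

Lemma dfact_two F t a : dfact (two_slices F) t a <-> t = 0%Z /\ List.In a F.
Proof.
rewrite /dfact /in_tem /tr /=; split=> [[h]|[-> h]]; last by split=> //; lia.
have [->|->] : t = 0%Z \/ t = 1%Z by lia.
  by [].
by [].
Qed.

Lemma objs_two F a d : List.In a F -> d \in a.2 -> d \in objs (two_slices F).
Proof.
move=> /In_mem aF da; rewrite /objs /=; apply/flattenP; exists a.2 => //; apply: map_f.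
by rewrite mem_cat aF.
Qed.

Lemma db_two p F : (forall a, List.In a F -> wf_atom a /\ edb p a.1) -> db_over_edb p (two_slices F).
Proof. by move=> h; split=> // a; rewrite /= !cats0 => /In_mem/h. Qed.

(** * NL-hardness *)

Definition relN : relsym := (0, 1).
Definition relE : relsym := (1, 2).
Definition relI : relsym := (2, 1).

Definition reach_prog : program :=
  [:: Rule (relN, [:: 0]) [:: ([::], relI, [:: 0])];
      Rule (relN, [:: 1]) [:: ([::], relN, [:: 0]); ([::], relE, [:: 0; 1])]].

Lemma reach_prog_ok : [/\ is_query reach_prog relN, linear reach_prog & monadic reach_prog].
Proof.
have wf : wf_program reach_prog.
  move=> ru [<-|[<-|//]]; split=> //; split.
  - by move=> l [<-|].
  - by move=> x; rewrite !inE => /eqP ->.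
  - by move=> l [<-|[<-|]].
  - by move=> x; rewrite !inE => /eqP ->.
by split=> // ru [<-|[<-|]].
Qed.

Lemma reach_prog_der F t x :
  (forall a, List.In a F -> wf_atom a /\ edb reach_prog a.1) ->
  der reach_prog (two_slices F) t [::] (relN, [:: x]) <->
  t = 0%Z /\ exists2 y, List.In (relI, [:: y]) F &
    clos_refl_trans nat (fun u v => List.In (relE, [:: u; v]) F) y x.
Proof.
move=> hF; split.
  move: {-2}[::] {-2}(relN, [:: x]) (erefl ([::] : seq top)) (erefl (relN, [:: x])) => o a oE aE d.
  elim: d x oE aE => {t o a} //.
  - by move=> t a /dfact_two[_ /hF[_ e]] x _ aE; rewrite aE in e.
  - move=> ru t nu [<-|[<-|//]] _ bd IH x _ /= [xE].
      have /dfact_two[-> h] := der_edb (bd _ (or_introl erefl)) isT.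
      by split=> //; exists (nu 0) => //; rewrite -xE; exact: rt_refl.
    have [tE [y yI r]] := IH _ (or_introl erefl) (nu 0) erefl erefl.
    split=> //; exists y => //; apply: rt_trans r _; apply: rt_step; rewrite -xE.
    by have /dfact_two[] := der_edb (bd _ (or_intror (or_introl erefl))) isT.
move=> [-> [y yI /clos_rt_rtn1_iff]]; elim=> [|u v uv _ IH].
  apply: (der_rule (ru := Rule (relN, [:: 0]) [:: ([::], relI, [:: 0])]) (nu := fun=> y)).
  - by left.
  - move=> z _; apply: (objs_two yI); exact: mem_head.
  - by move=> l [<-|//]; apply: der_fact; apply/dfact_two.
apply: (der_rule (ru := Rule (relN, [:: 1]) [:: ([::], relN, [:: 0]); ([::], relE, [:: 0; 1])])
                 (nu := fun z => if z == 0 then u else v)).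
- by right; left.
- by move=> z _; apply: (objs_two uv); rewrite !inE; case: ifP => _; rewrite eqxx ?orbT.
- by move=> l [<-|[<-|//]] //; apply: der_fact; apply/dfact_two.
Qed.

Lemma In_cat (T : Type) (s s' : seq T) x : List.In x (s ++ s') <-> List.In x s \/ List.In x s'.
Proof. exact: List.in_app_iff. Qed.

Lemma In_flatten_map (S T : Type) (f : S -> seq T) (s : seq S) y :
  List.In y (flatten (map f s)) <-> exists2 x, List.In x s & List.In y (f x).
Proof.
elim: s => [|x s IH] /=; first by split=> // -[].
rewrite In_cat IH; split=> [[h|[z h1 h2]]|[z [<-|zs] h]]; auto.
- by exists x => //; left.
- by exists z => //; right.
- by right; exists z.
Qed.

Lemma has_In (T : Type) (P : pred T) (s : seq T) : has P s <-> exists2 x, List.In x s & P x.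
Proof.
elim: s => [|x s IH] /=; first by split=> // -[].
split=> [/orP[h|/IH[y ys h]]|[y [<-|ys] h]].
- by exists x => //; left.
- by exists y => //; right.
- by rewrite h.
- by apply/orP; right; apply/IH; exists y.
Qed.

Lemma In_iota k n : List.In k (iota 0 n) <-> k < n.
Proof. by rewrite In_mem mem_iota. Qed.

Lemma In_if (T : Type) (b : bool) (s : seq T) x : List.In x (if b then s else [::]) <-> b /\ List.In x s.
Proof. by case: b; split=> // -[]. Qed.

Lemma In_seq1 (T : Type) (x y : T) : List.In x [:: y] <-> x = y.
Proof. by split=> [[|//]|->]; [move=> ->|left]. Qed.

(* [g ^ k], capped at [b] so that it is representable without side conditions *)
Definition cpow (g k b : nat) : nat := iter k (fun a => minn b (g * a)) 1.

Lemma cpowE g k b : 0 < g -> g ^ k <= b -> cpow g k b = g ^ k.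
Proof.
move=> g0; elim: k => //= k IH; rewrite expnS => h.
by rewrite IH; [apply/minn_idPr|apply: leq_trans h; rewrite leq_pmull].
Qed.

Lemma cpow_cap g k b : 0 < g -> b < g ^ k -> 0 < b -> cpow g k b = b.
Proof.
move=> g0; elim: k => /= [|k IH]; first by lia.
rewrite expnS => h b0; have [h'|h'] := ltnP b (g ^ k).
  by rewrite IH //; apply/minn_idPl; rewrite leq_pmull.
by rewrite cpowE //; apply/minn_idPl; exact: ltnW.
Qed.

Lemma cmp_min G (f g : cX G -> nat) : cmp f -> cmp g -> cmp (fun x => minn (f x) (g x)).
Proof.
move=> cf cg; apply: (@cmp_ext _ (fun x => if f x < g x then f x else g x)); last by cmp_tac.
by move=> x _; rewrite /minn.
Qed.

Lemma cmp_cpow G (g k b : cX G -> nat) : cmp g -> cmp k -> cmp b ->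
  cmp (fun x => cpow (g x) (k x) (b x)).
Proof.
move=> cg ck cb; apply: (@cmp_iter G k (fun x => (b x).+1)); try by cmp_tac.
by move=> x [|j] //= _ _; lia.
Qed.

Ltac cmp_head := fail.

Ltac cmp_more ::=
  lazymatch goal with
  | |- @cmp ?G (fun x => expn (@?a x) ?k) => refine (@cmp_expn_const G a k _)
  | |- @cmp ?G (fun x => minn (@?a x) (@?b x)) => refine (@cmp_min G a b _ _)
  | |- @cmp ?G (fun x => cpow (@?a x) (@?b x) (@?c x)) => refine (@cmp_cpow G a b c _ _ _)
  | _ => cmp_head
  end.

(** One less than the first exponent whose power of two exceeds [n]. Capping the powers at [n.+1]
    does not affect the comparison with [n]. *)
Definition lg (n : nat) : nat := (find (fun i => n < cpow 2 i n.+1) (iota 0 n.+1)).-1.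

Lemma cmp_lg G (f : cX G -> nat) : cmp f -> cmp (fun x => lg (f x)).
Proof. by move=> cf; rewrite /lg; cmp_tac. Qed.

Lemma pow2_Nat n : Nat.pow 2 n = 2 ^ n.
Proof. by elim: n => //= n ->; rewrite expnS; lia. Qed.

Lemma lgE n : lg n = Nat.log2 n.
Proof.
case: n => // n; set m := n.+1.
have [lo hi] := Nat.log2_spec m (elimT ltP (ltn0Sn n)).
rewrite !pow2_Nat in lo hi; set l := Nat.log2 m in lo hi *.
have ln : l.+1 <= m.
  have : l < 2 ^ l by exact: ltn_expl.
  by lia.
rewrite /lg; set P := (fun i => _).
have PE i : P i = (l < i).
  rewrite /P; have [il|il] := ltnP l i.
    have : 2 ^ l.+1 <= 2 ^ i by rewrite leq_exp2l.
    have [h|h] := leqP (2 ^ i) m.+1; first by rewrite cpowE //; lia.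
    by rewrite cpow_cap // ltnSn.
  have : 2 ^ i <= 2 ^ l by rewrite leq_exp2l.
  by move=> h; rewrite cpowE //; lia.
have -> : find P (iota 0 m.+1) = l.+1; last by [].
have hP : has P (iota 0 m.+1).
  by apply/hasP; exists l.+1; [rewrite mem_iota; lia|rewrite PE].
have fs : find P (iota 0 m.+1) < m.+1 by move: hP; rewrite has_find size_iota.
have := nth_find 0 hP; rewrite nth_iota // add0n PE => h.
apply/eqP; rewrite eqn_leq h andbT leqNgt; apply/negP => h'.
by have := before_find 0 h'; rewrite nth_iota ?add0n ?PE ?ltnSn //; lia.
Qed.

Lemma cmp_read G (f : cX G -> nat) : cmp f -> cmp (fun x => tokn (read_in (cinp x) (f x))).
Proof.
move=> cf; apply: (@cmp_ext _ (fun x => if f x == 0 then 0 else tk (cinp x) (f x).-1)); last by cmp_tac.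
by move=> x _; rewrite /tk; case: (f x).
Qed.

Lemma cmp_move_in G (d : dir) (f : cX G -> nat) :
  cmp f -> cmp (fun x => move_in (size (cinp x)) d (f x)).
Proof. by move=> cf; case: d => /=; cmp_tac. Qed.

Lemma cmp_move_w G (d : dir) (f : cX G -> nat) : cmp f -> cmp (fun x => move_w d (f x)).
Proof. by move=> cf; case: d => /=; cmp_tac. Qed.

Ltac cmp_head ::=
  lazymatch goal with
  | |- @cmp ?G (fun x => lg (@?a x)) => refine (@cmp_lg G a _)
  | |- @cmp ?G (fun x => tokn (read_in _ (@?a x))) => refine (@cmp_read G a _)
  | |- @cmp ?G (fun x => move_in _ ?d (@?a x)) => refine (@cmp_move_in G d a _)
  | |- @cmp ?G (fun x => move_w ?d (@?a x)) => refine (@cmp_move_w G d a _)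
  end.

Section TransitionTable.
Variable M : TM.

Definition all_reads : seq (option tok) :=
  [:: None; Some T0; Some T1; Some TSep; Some TOpen; Some TClose; Some TNeg].

Definition trans : seq (st M * option tok * wal M * (st M * wal M * dir * dir * option tok)) :=
  flatten [seq flatten [seq flatten [seq [seq (q, a, g, tr) | tr <- delta M q a g]
    | g <- enum (wal M)] | a <- all_reads] | q <- enum (st M)].

Lemma transP q a g tr : List.In (q, a, g, tr) trans <-> List.In tr (delta M q a g).
Proof.
split=> [/In_flatten_map[q' _ /In_flatten_map[a' _ /In_flatten_map[g' _]]]|h].
  by move=> /List.in_map_iff[tr' [[<- <- <- <-]]].
apply/In_flatten_map; exists q; first by rewrite In_mem mem_enum.
apply/In_flatten_map; exists a; first by case: a {h} => [[]|] /=; tauto.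
apply/In_flatten_map; exists g; first by rewrite In_mem mem_enum.
by apply/List.in_map_iff; exists tr.
Qed.

(* The start state and the blank get rank 0, so that the initial configuration has code 0. *)
Definition rkq (q : st M) : nat := index q (q_start M :: enum (st M)).
Definition rkw (g : wal M) : nat := index g (wblank M :: enum (wal M)).

Lemma rkq_inj : injective rkq.
Proof.
move=> q q' h; rewrite -[q](nth_index (q_start M) (s := q_start M :: enum (st M))) ?inE ?mem_enum ?orbT //.
by rewrite -/(rkq q) h nth_index // inE mem_enum orbT.
Qed.

Lemma rkw_inj : injective rkw.
Proof.
move=> q q' h; rewrite -[q](nth_index (wblank M) (s := wblank M :: enum (wal M))) ?inE ?mem_enum ?orbT //.
by rewrite -/(rkw q) h nth_index // inE mem_enum orbT.
Qed.

Definition nQ := (size (enum (st M))).+1.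
Definition nG := (size (enum (wal M))).+1.

Lemma rkq_lt q : rkq q < nQ.
Proof. by rewrite /rkq -[nQ]/(size (q_start M :: enum (st M))) index_mem inE mem_enum orbT. Qed.

Lemma rkw_lt g : rkw g < nG.
Proof. by rewrite /rkw -[nG]/(size (wblank M :: enum (wal M))) index_mem inE mem_enum orbT. Qed.

Lemma cin_bound w c : reach M w c -> cin c <= (size w).+1.
Proof.
move=> /clos_rt_rtn1_iff; elim=> // d e [q [g [di [dw [o [_ ->]]]]]] _ /=.
by case: di => /=; lia.
Qed.

Lemma reach_step w c c' : reach M w c -> step M w c c' -> reach M w c'.
Proof. by move=> r s; apply: rt_trans r (rt_step _ _ _ _ s). Qed.
End TransitionTable.

Section TapeCode.
Variable g : nat.
Hypothesis g0 : 0 < g.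

Fixpoint tcode (s : nat) (d : nat -> nat) : nat :=
  if s is s'.+1 then d 0 + g * tcode s' (fun i => d i.+1) else 0.

Lemma tcode_eq s d d' : (forall i, i < s -> d i = d' i) -> tcode s d = tcode s d'.
Proof. by elim: s d d' => //= s IH d d' h; rewrite h // (IH _ (fun i => d' i.+1)) // => i hi; apply: h. Qed.

Lemma tcode_lt s d : (forall i, d i < g) -> tcode s d < g ^ s.
Proof.
elim: s d => //= s IH d h; rewrite expnS; have := IH (fun i => d i.+1) (fun i => h _); have := h 0; nia.
Qed.

Lemma tcode_digit s d p : (forall i, d i < g) -> p < s -> tcode s d %/ g ^ p %% g = d p.
Proof.
elim: s d p => //= s IH d [|p] h ps.
  by rewrite divn1 addnC mulnC modnMDl modn_small.
rewrite expnS divnMA [_ + g * _]addnC mulnC divnMDl // [d 0 %/ g]divn_small // addn0.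
exact: IH (fun i => h _) ps.
Qed.

(** Stated additively, in the form in which [step_code] tests a tape update on arbitrary numbers. *)
Lemma tcode_upd s d p v : p < s -> tcode s (upd d p v) + d p * g ^ p = tcode s d + v * g ^ p.
Proof.
elim: s d p => //= s IH d [|p] ps.
  by rewrite (@tcode_eq s _ (fun i => d i.+1)) /upd //= !muln1; lia.
have := IH (fun i => d i.+1) p ps.
rewrite (@tcode_eq s (fun i => upd d p.+1 v i.+1) (upd (fun i => d i.+1) p v)); last first.
  by move=> i _; rewrite /upd eqSS.
by move=> /(congr1 (muln g)); rewrite !mulnDr expnS {2}/upd /= ![_ * (g * _)]mulnCA; lia.
Qed.

Lemma tcode0 s : tcode s (fun=> 0) = 0.
Proof. by elim: s => //= s ->; rewrite muln0. Qed.
End TapeCode.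

Section NLHard.
Variables (M : TM) (c : nat).

Let g := nG M.
Let Q := nQ M.

Definition ncells (n : nat) : nat := c * lg n + c + 1.
(** A polynomial above the number of tape contents: [g <= 2 ^ g] turns [g ^ ncells n] into a power
    of two, and [2 ^ lg n <= n + 1] makes it polynomial. *)
Definition tape_cap (n : nat) : nat := (n + 1) ^ (g * c) * 2 ^ (g * c.+1).

Lemma tape_cap_le n : g ^ ncells n <= tape_cap n.
Proof.
have gl : g <= 2 ^ g by apply: ltnW; exact: ltn_expl.
apply: leq_trans (leq_expl _ gl) _; rewrite -expnM /ncells lgE /tape_cap.
have -> : g * (c * Nat.log2 n + c + 1) = Nat.log2 n * (g * c) + g * c.+1 by nia.
rewrite expnD leq_mul2r; apply/orP; right; rewrite expnM; apply: leq_expl.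
case: n => // n; have [h _] := Nat.log2_spec n.+1 (elimT ltP (ltn0Sn n)).
by rewrite pow2_Nat in h; lia.
Qed.

Definition tpow n p := cpow g p (tape_cap n).

Lemma tpowE n p : p <= ncells n -> tpow n p = g ^ p.
Proof.
move=> h; rewrite /tpow cpowE //; apply: leq_trans (tape_cap_le n).
by rewrite leq_pexp2l.
Qed.

Definition mkc n q h p tp := q + Q * (h + (n + 2) * (p + ncells n * tp)).
Definition dcq (x : nat) := x %% Q.
Definition dch n x := x %/ Q %% (n + 2).
Definition dcp n x := x %/ Q %/ (n + 2) %% ncells n.
Definition dct n x := x %/ Q %/ (n + 2) %/ ncells n.

Lemma mkcK n q h p tp : q < Q -> h < n + 2 -> p < ncells n ->
  let x := mkc n q h p tp in [/\ dcq x = q, dch n x = h, dcp n x = p & dct n x = tp].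
Proof.
move=> hq hh hp; rewrite /mkc /dcq /dch /dcp /dct.
have Q0 : 0 < Q by [].
have s0 : 0 < ncells n by lia.
have n0 : 0 < n + 2 by lia.
have e1 : (q + Q * (h + (n + 2) * (p + ncells n * tp))) %/ Q = h + (n + 2) * (p + ncells n * tp).
  by rewrite addnC mulnC divnMDl // divn_small ?addn0.
have e2 : (h + (n + 2) * (p + ncells n * tp)) %/ (n + 2) = p + ncells n * tp.
  by rewrite addnC mulnC divnMDl // divn_small ?addn0.
rewrite e1 e2; split.
- by rewrite addnC mulnC modnMDl modn_small.
- by rewrite addnC mulnC modnMDl modn_small.
- by rewrite addnC mulnC modnMDl modn_small.
- by rewrite addnC mulnC divnMDl // divn_small ?addn0.
Qed.

Lemma mkc_eta n y : y = mkc n (dcq y) (dch n y) (dcp n y) (dct n y).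
Proof.
rewrite /mkc /dcq /dch /dcp /dct.
rewrite [_ + ncells n * _]addnC [ncells n * _]mulnC -divn_eq.
rewrite [_ + (n + 2) * _]addnC [(n + 2) * _]mulnC -divn_eq.
by rewrite addnC mulnC -divn_eq.
Qed.

(** A transition is recognized on the numbers themselves, by reading one digit and testing one
    equation between tape codes, so that it can be expressed by a term. *)
Definition step_code (w : seq tok) (x y : nat) : bool :=
  let n := size w in
  has (fun tt => let: (q, a, s, (q', s', di, dw, _)) := tt in
    [&& dcq x == rkq q, tokn (read_in w (dch n x)) == tokn a,
        dct n x %/ tpow n (dcp n x) %% g == rkw s,
        dcq y == rkq q', dch n y == move_in n di (dch n x), dcp n y == move_w dw (dcp n x)
      & dct n y + rkw s * tpow n (dcp n x) == dct n x + rkw s' * tpow n (dcp n x)]) (trans M).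

Definition acc_code (x : nat) : bool :=
  has (fun q => dcq x == rkq q) [seq q <- enum (st M) | q_acc M q].

Definition ccode (n : nat) (d : cfg M) : nat :=
  mkc n (rkq (cq d)) (cin d) (cwp d) (tcode g (ncells n) (fun i => rkw (ctape d i))).

Definition ncodes n := Q * ((n + 2) * (ncells n * g ^ ncells n)).

Section Word.
Variable w : seq tok.
Let n := size w.
Hypothesis space : forall d, reach M w d -> cwp d < ncells n.

Lemma ccodeK d : reach M w d ->
  let x := ccode n d in
  [/\ dcq x = rkq (cq d), dch n x = cin d, dcp n x = cwp d &
      dct n x = tcode g (ncells n) (fun i => rkw (ctape d i))].
Proof.
move=> r; apply: mkcK; [exact: rkq_lt| |exact: space].
by have := cin_bound r; rewrite /n; lia.
Qed.

Lemma ccode_lt d : reach M w d -> ccode n d < ncodes n.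
Proof.
move=> r; rewrite /ccode /mkc /ncodes; have h1 := rkq_lt (cq d); have h2 := cin_bound r.
have h3 := space r; have h4 := @tcode_lt g (isT : 0 < g) (ncells n) (fun i => rkw (ctape d i)) (fun i => rkw_lt _).
move: h1 h2 h3 h4; rewrite -/Q -/n; set a := rkq _; set b := cin _; set e := cwp _; set t := tcode _ _ _.
set s := ncells n; set G := g ^ s => h1 h2 h3 h4.
have h5 : e + s * t < s * G by nia.
have h6 : b + (n + 2) * (e + s * t) < (n + 2) * (s * G) by nia.
by nia.
Qed.

Lemma step_code_complete d d' : reach M w d -> step M w d d' -> step_code w (ccode n d) (ccode n d').
Proof.
move=> r s; have r' := reach_step r s.
have [e1 e2 e3 e4] := ccodeK r; have [f1 f2 f3 f4] := ccodeK r'.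
move: s => [q' [g' [di [dw [o [tr dE]]]]]].
apply/has_In; exists (cq d, read_in w (cin d), ctape d (cwp d), (q', g', di, dw, o)); first exact/transP.
rewrite -/n e1 e2 e3 e4 f1 f2 f3 f4 tpowE; last by apply: ltnW; exact: space.
rewrite dE /= !eqxx tcode_digit ?eqxx //=; last exact: space; last by move=> i; exact: rkw_lt.
have <- := @tcode_upd g isT (ncells n) (fun i => rkw (ctape d i)) (cwp d) (rkw g') (space r).
by rewrite eqn_add2r; apply/eqP; apply: tcode_eq => i _; rewrite /upd; case: ifP.
Qed.

(** The components of [y] are determined by [d] and the transition, and they determine [y] by
    [mkc_eta]; so every number related to the code of a reachable configuration is again such a
    code. *)
Lemma step_code_sound d y : reach M w d -> step_code w (ccode n d) y ->
  exists2 d', step M w d d' & y = ccode n d'.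
Proof.
move=> r; have [e1 e2 e3 e4] := ccodeK r.
rewrite /step_code -/n => /has_In[[[[q a] s] [[[[q' s'] di] dw] o]] /transP tr].
rewrite e1 e2 e3 e4 tpowE; last by apply: ltnW; exact: space.
rewrite tcode_digit //; last exact: space; last by move=> i; exact: rkw_lt.
move=> /and5P[/eqP/rkq_inj qE /eqP/tokn_inj aE /eqP/rkw_inj sE /eqP yq].
move=> /and3P[/eqP yh /eqP yp /eqP yt].
pose d' := Cfg M q' (move_in n di (cin d)) (upd (ctape d) (cwp d) s') (move_w dw (cwp d))
             (cout d ++ (if o is Some t then [:: t] else [::])).
have sd : step M w d d' by exists q', s', di, dw, o; split=> //; rewrite qE aE sE.
exists d' => //; rewrite [y](mkc_eta n) yq yh yp /ccode /d' /=; congr mkc.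
have := @tcode_upd g isT (ncells n) (fun i => rkw (ctape d i)) (cwp d) (rkw s') (space r).
rewrite (@tcode_eq g _ (upd _ _ _) (fun i => rkw (upd (ctape d) (cwp d) s' i))); last first.
  by move=> i _; rewrite /upd; case: ifP.
by rewrite -yt sE; lia.
Qed.

Lemma acc_codeP d : reach M w d -> acc_code (ccode n d) = q_acc M (cq d).
Proof.
move=> r; have [e1 _ _ _] := ccodeK r; rewrite /acc_code e1; apply/hasP/idP.
  by move=> [q]; rewrite mem_filter => /andP[h _] /eqP/rkq_inj ->.
by move=> h; exists (cq d); [rewrite mem_filter h mem_enum|exact: eqxx].
Qed.
End Word.

(** Object [x.+1] is the configuration with code [x]; the initial one has code 0, hence the object
    [1]. Object [0] is a common target of all accepting configurations, because the query has to ask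
    for a fixed object. *)
Definition reach_facts (w : seq tok) : seq atom :=
  [:: (relI, [:: 1])] ++
  flatten [seq (if acc_code x then [:: (relE, [:: x.+1; 0])] else [::]) ++
     flatten [seq if step_code w x y then [:: (relE, [:: x.+1; y.+1])] else [::]
             | y <- iota 0 (ncodes (size w))]
  | x <- iota 0 (ncodes (size w))].

Lemma reach_factsP w a : List.In a (reach_facts w) <->
  [\/ a = (relI, [:: 1]),
      exists x, [/\ x < ncodes (size w), acc_code x & a = (relE, [:: x.+1; 0])] |
      exists x y, [/\ x < ncodes (size w), y < ncodes (size w), step_code w x y
                    & a = (relE, [:: x.+1; y.+1])]].
Proof.
rewrite /reach_facts In_cat In_seq1 In_flatten_map; split.
  case=> [->|[x /In_iota xn /In_cat[/In_if[h /In_seq1 ->]|]]]; first by constructor 1.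
    by constructor 2; exists x.
  by move=> /In_flatten_map[y /In_iota yn /In_if[h /In_seq1 ->]]; constructor 3; exists x, y.
case=> [->|[x [xn h ->]]|[x [y [xn yn h ->]]]]; first by left.
  by right; exists x; [exact/In_iota|apply/In_cat; left; apply/In_if; split=> //; left].
right; exists x; first exact/In_iota.
apply/In_cat; right; apply/In_flatten_map; exists y; first exact/In_iota.
by apply/In_if; split=> //; left.
Qed.

Lemma cmp_ncells G (f : cX G -> nat) : cmp f -> cmp (fun x => ncells (f x)).
Proof. by move=> cf; rewrite /ncells; cmp_tac. Qed.

Lemma cmp_tpow G (f h : cX G -> nat) : cmp f -> cmp h -> cmp (fun x => tpow (f x) (h x)).
Proof. by move=> cf ch; rewrite /tpow /tape_cap; cmp_tac. Qed.

Lemma cmp_ncodes G (f : cX G -> nat) : cmp f -> cmp (fun x => ncodes (f x)).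
Proof.
move=> cf; have cn := cmp_ncells cf; have ct := cmp_tpow cf cn.
(* The power [g ^ ncells] is polynomial only because [ncells] is logarithmic; the capped power has
   the same value and is representable. *)
apply: (@cmp_ext _ (fun x => Q * ((f x + 2) * (ncells (f x) * tpow (f x) (ncells (f x)))))).
  by move=> x _; rewrite tpowE.
by cmp_tac.
Qed.

Lemma cmp_step_code G (f h : cX G -> nat) : cmp f -> cmp h ->
  cmpb G (fun x => step_code (cinp x) (f x) (h x)).
Proof.
move=> cf ch; rewrite /step_code.
have cs : @cmp G (fun x => size (cinp x)) by exact: cmp_size.
have cn := cmp_ncells cs.
have cp : cmp (fun x => dcp (size (cinp x)) (f x)) by rewrite /dcp; cmp_tac.
have ct := cmp_tpow cs cp.
apply: cmp_has_const => -[[[q a] s] [[[[q' s'] di] dw] o]] _.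
by rewrite /dcq /dch /dct; rewrite /dcp in cp *; cmp_tac.
Qed.

Lemma fcmp_reach_facts : @fcmp ctx0 reach_facts.
Proof.
have cN : @cmp ctx0 (fun w => ncodes (size w)) by apply: cmp_ncodes; exact: cmp_size.
apply: fcmp_cat; first by apply: (fcmp_atom relI (fs := [:: fun=> 1])) => f [<-|//]; cmp_tac.
apply: (fcmp_for cN); apply: fcmp_cat.
  apply: fcmp_if; first by rewrite /acc_code /dcq; cmp_tac.
  by apply: (@fcmp_atom (ext _) relE [:: fun y => y.2.+1; fun=> 0]) => f [<-|[<-|//]]; cmp_tac.
apply: (@fcmp_for (ext _)); first by cmp_tac.
set G2 := ext _.
have c1 : @cmp G2 (fun y => y.1.2) by cmp_tac.
have c2 : @cmp G2 (fun y => y.2) by cmp_tac.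
apply: fcmp_if; first exact: cmp_step_code c1 c2.
by apply: (@fcmp_atom G2 relE [:: fun y => y.1.2.+1; fun y => y.2.+1]) => f [<-|[<-|//]]; cmp_tac.
Qed.
End NLHard.

Theorem reach_prog_NL_hard : NL_hard (query_lang reach_prog relN).
Proof.
move=> A [M [c dec]].
exists (fun w => enc_input (two_slices (reach_facts M c w)) [:: 0] 0).
have [T [k comp]] := fcmp_logspace 0 (fcmp_reach_facts M c).
exists T, k; split=> // w; have [AE sp] := dec w.
have space d : reach M w d -> cwp d < ncells c (size w).
  by move=> /sp; rewrite /log_bound /ncells lgE; lia.
have okF a : List.In a (reach_facts M c w) -> wf_atom a /\ edb reach_prog a.1.
  by move=> /reach_factsP[->|[x [_ _ ->]]|[x [y [_ _ _ ->]]]].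
have [[wfp _] _ _] := reach_prog_ok.
have dbok := db_two okF.
rewrite query_lang_enc (certain_der wfp dbok) (reach_prog_der _ _ okF) AE.
set Es := (fun u v => List.In (relE, [:: u; v]) (reach_facts M c w)).
have code0 : ccode c (size w) (init_cfg M) = 0.
  by rewrite /ccode /mkc /= /rkq /= eqxx /rkw (@tcode_eq _ _ _ (fun=> 0)) ?tcode0 ?muln0 //= => i _; rewrite eqxx.
split.
  move=> [d [r acc]].
  have path : clos_refl_trans nat Es 1 (ccode c (size w) d).+1.
    move: r => /clos_rt_rtn1_iff; elim=> [|e e' s re IH]; first by rewrite code0; exact: rt_refl.
    have {}re : reach M w e by apply/clos_rt_rtn1_iff.
    apply: rt_trans IH _; apply: rt_step; apply/reach_factsP; constructor 3.
    exists (ccode c (size w) e), (ccode c (size w) e'); split=> //.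
    - exact: ccode_lt.
    - by apply: ccode_lt => //; exact: reach_step s.
    - exact: step_code_complete.
  (* This edge also shows that [0] is an object of the database, which a valid instance requires. *)
  have last : Es (ccode c (size w) d).+1 0.
    apply/reach_factsP; constructor 2; exists (ccode c (size w) d); split=> //.
    - exact: ccode_lt.
    - by rewrite (acc_codeP space).
  split.
    split=> //.
    by rewrite /= andbT; apply: (objs_two last); rewrite !inE eqxx orbT.
  split=> //; exists 1; first by apply/reach_factsP; constructor 1.
  exact: rt_trans path (rt_step _ _ _ _ last).
move=> [_ [_ [y /reach_factsP yI /clos_rt_rtn1_iff path]]].
have yE : y = 1 by case: yI => [[->]|[x [_ _ []]]|[x [z [_ _ _ []]]]].
(* Invariant along paths: a vertex is the object of a reachable configuration, or it is [0] and some
   reachable configuration accepts. *)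
suff : forall u, clos_refl_trans_n1 nat Es y u ->
    (exists2 d, reach M w d & u = (ccode c (size w) d).+1) \/
    (u = 0 /\ exists d, reach M w d /\ q_acc M (cq d)).
  by move=> /(_ _ path)[[d _ //]|[]].
move=> u; elim=> [|v z vz _ IH].
  by left; exists (init_cfg M); [exact: rt_refl|rewrite code0 yE].
move: vz => /reach_factsP[//|[x [xn ax [vE zE]]]|[x [x' [xn xn' sx [vE zE]]]]].
  right; split=> //; case: IH => [[d r vE']|[v0]]; last by rewrite v0 in vE.
  exists d; split=> //; rewrite -(acc_codeP space r).
  by have -> : ccode c (size w) d = x by lia.
left; case: IH => [[d r vE']|[v0]]; last by rewrite v0 in vE.
have xE : x = ccode c (size w) d by lia.
rewrite xE in sx; have [d' s x'E] := step_code_sound space r sx.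
by exists d'; [exact: reach_step s|rewrite zE x'E].
Qed.

(** * PSPACE-hardness *)

Definition relG : relsym := (1, 1).
Definition relR : relsym := (3, 3).

(* Time is used as a counter: [relN] holds at [k] of the objects produced by
   exactly [k] rounds of binary inference steps, so the facts at [k] are the
   configuration of a machine after [k] steps: one object for the state and the
   head positions, and one for each cell with its content. *)
Definition stage_prog : program :=
  [:: Rule (relN, [:: 0]) [:: ([::], relI, [:: 0])];
      Rule (relN, [:: 2]) [:: ([:: OPrev], relN, [:: 0]); ([:: OPrev], relN, [:: 1]);
                              ([:: OPast], relR, [:: 0; 1; 2])];
      Rule (relG, [:: 0]) [:: ([:: OFut], relN, [:: 0])]].

Lemma stage_prog_ok : is_query stage_prog relG /\ monadic stage_prog.
Proof.
have wf : wf_program stage_prog.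
  move=> ru [<-|[<-|[<-|//]]]; split=> //; split.
  - by move=> l [<-|].
  - by move=> x; rewrite !inE => /eqP ->.
  - by move=> l [<-|[<-|[<-|]]].
  - by move=> x; rewrite !inE => /eqP ->.
  - by move=> l [<-|].
  - by move=> x; rewrite !inE => /eqP ->.
by split=> // ru [<-|[<-|[<-|]]].
Qed.

Section Stage.
Variable F : seq atom.
Hypothesis okF : forall a, List.In a F -> wf_atom a /\ edb stage_prog a.1.

Inductive stage : nat -> nat -> Prop :=
| stage0 x : List.In (relI, [:: x]) F -> stage 0 x
| stageS k x y z : stage k y -> stage k z -> List.In (relR, [:: y; z; x]) F -> stage k.+1 x.

Let D := two_slices F.

Lemma stage_objs k x : stage k x -> x \in objs D.
Proof.
by case=> [{}x|{}k {}x y z _ _] h; apply: (objs_two h); rewrite !inE eqxx ?orbT.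
Qed.

(** A model with no more facts than the stages provide bounds the certain facts from above. In the
    second rule both premises [relN] refer to the same time and therefore to the same stage. *)
Lemma stage_model : is_model stage_prog D (fun t a =>
  [\/ dfact D t a, exists k x, [/\ a = (relN, [:: x]), t = Z.of_nat k & stage k x] |
      exists k x, [/\ a = (relG, [:: x]), (t < Z.of_nat k)%Z & stage k x]]).
Proof.
have dbok := db_two okF.
split=> [t a [f|[k [x [-> _ s]]]|[k [x [-> _ s]]]]|].
- by have [w /andP[e _] o] := dfact_ok dbok f.
- by rewrite /= (stage_objs s).
- by rewrite /= (stage_objs s).
split=> [t a nidb|ru ri t nu nuo bd].
  split=> [[//|[k [x [aE _ _]]]|[k [x [aE _ _]]]]|]; try by rewrite aE in nidb.
  by constructor 1.
have notidb t' a : dfact D t' a -> a.1 = relN -> False.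
  by move=> f aE; have [_ e _] := dfact_ok dbok f; rewrite aE in e.
case: ri bd => [<-|[<-|[<-|//]]] bd /=.
- have := bd _ (or_introl erefl) => /= -[/dfact_two[tE h]|[k [x []]]|[k [x []]]] //.
  by constructor 2; exists 0, (nu 0); rewrite tE; split=> //; exact: stage0.
- have := bd _ (or_introl erefl) => /= -[/notidb/(_ erefl)//|[k [x [[xE] tk sx]]]|[k [x []]]] //.
  have := bd _ (or_intror (or_introl erefl)) => /= -[/notidb/(_ erefl)//|[k' [x' [[xE'] tk' sx']]]|[k' [x' []]]] //.
  have := bd _ (or_intror (or_intror (or_introl erefl))) => /= -[t' [_ [/dfact_two[_ h]|[? [? []]]|[? [? []]]]]] //.
  constructor 2; exists k.+1, (nu 2); split=> //; first lia.
  have kk' : k' = k by lia.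
  by apply: stageS sx _ _; [rewrite -kk'; exact: sx'|rewrite -xE -xE'].
- have := bd _ (or_introl erefl) => /= -[t' [lt [/notidb/(_ erefl)//|[k [x [[xE] tk sx]]]|[k [x []]]]]] //.
  by constructor 3; exists k, (nu 0); rewrite xE; split=> //; lia.
Qed.

Lemma stage_der k x : stage k x -> der stage_prog D (Z.of_nat k) [::] (relN, [:: x]).
Proof.
elim=> [{}x xI|{}k {}x y z _ IHy _ IHz h].
  apply: (der_rule (ru := Rule (relN, [:: 0]) [:: ([::], relI, [:: 0])]) (nu := fun=> x)).
  - by left.
  - by move=> u _; apply: (objs_two xI); exact: mem_head.
  - by move=> l [<-|//]; apply: der_fact; apply/dfact_two.
apply: (der_rule (ru := Rule (relN, [:: 2]) [:: ([:: OPrev], relN, [:: 0]); ([:: OPrev], relN, [:: 1]);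
                              ([:: OPast], relR, [:: 0; 1; 2])])
  (nu := fun u => if u == 0 then y else if u == 1 then z else x)).
- by right; left.
- by move=> u _; apply: (objs_two h); rewrite !inE; repeat case: ifP => _; rewrite ?eqxx ?orbT.
have tE : (Z.of_nat k.+1 - 1 = Z.of_nat k)%Z by lia.
move=> l [<-|[<-|[<-|//]]] /=.
- by apply: der_prev; rewrite tE.
- by apply: der_prev; rewrite tE.
(* The transitions are stored once, at time 0, and [OPast] makes them available at all later times;
   [k.+1] is positive. *)
apply: (holds_der (E := dfact D)); first by move=> *; apply: der_fact.
by exists 0%Z; split; [lia|exact/dfact_two].
Qed.

(** [OFut] is strict and thus excludes stage 0. This does no harm, as the object [0] asked for in
    the reduction appears at positive stages only. *)
Lemma stage_certain x :
  certain stage_prog D 0 (relG, [:: x]) <-> exists2 k, 0 < k & stage k x.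
Proof.
have [[wfp _] _] := stage_prog_ok; have dbok := db_two okF.
split=> [/(_ _ stage_model)[/dfact_two[_ /okF[]]//|[k [y []]]//|[k [y [[<-] lt s]]]]|[k k0 s]].
  by exists k => //; lia.
apply/(certain_der wfp dbok).
apply: (der_rule (ru := Rule (relG, [:: 0]) [:: ([:: OFut], relN, [:: 0])]) (nu := fun=> x)).
- by right; right; left.
- by move=> u _; exact: stage_objs s.
move=> l [<-|//]; apply: (holds_der (E := fun t a => der stage_prog D t [::] a)) => //.
by exists (Z.of_nat k); split; [lia|exact: stage_der].
Qed.
End Stage.

Section PSpaceHard.
Variables (M : TM) (c k : nat).
Hypothesis det : deterministic M.

Let g := nG M.
Let Q := nQ M.

Definition pcells (n : nat) : nat := c * n ^ k + c + 1.
Definition oH n (q j i : nat) : nat := (q + Q * (j + (n + 2) * i)).*2.+1.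
Definition oW (i s : nat) : nat := (s + g * i).*2.+2.

Lemma oH_inj n q j i q' j' i' : q < Q -> j < n + 2 -> q' < Q -> j' < n + 2 ->
  oH n q j i = oH n q' j' i' -> [/\ q = q', j = j' & i = i'].
Proof.
move=> hq hj hq' hj' [/double_inj e].
have eq : q = q'.
  have := congr1 (modn^~ Q) e; rewrite ![_ + Q * _]addnC ![Q * _]mulnC !modnMDl.
  by rewrite !modn_small.
have e2 : j + (n + 2) * i = j' + (n + 2) * i' by have : 0 < Q by []; nia.
have ej : j = j'.
  have := congr1 (modn^~ (n + 2)) e2; rewrite ![_ + (n + 2) * _]addnC ![(n + 2) * _]mulnC !modnMDl.
  by rewrite !modn_small.
by split=> //; nia.
Qed.

Lemma oW_inj i s i' s' : s < g -> s' < g -> oW i s = oW i' s' -> i = i' /\ s = s'.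
Proof.
move=> hs hs' [/double_inj e].
have es : s = s'.
  have := congr1 (modn^~ g) e; rewrite ![_ + g * _]addnC ![g * _]mulnC !modnMDl.
  by rewrite !modn_small.
by split=> //; have : 0 < g by []; nia.
Qed.

Lemma oH_oW n q j i i' s : oH n q j i <> oW i' s.
Proof. by rewrite /oH /oW; lia. Qed.

Definition trans_facts (w : seq tok) i j : seq atom :=
  flatten [seq (let: (q, a, s, (q', s', di, dw, _)) := tn in
    if tokn (read_in w j) == tokn a then
      [:: (relR, [:: oH (size w) (rkq q) j i; oW i (rkw s);
                     oH (size w) (rkq q') (move_in (size w) di j) (move_w dw i)])] ++
      [:: (relR, [:: oH (size w) (rkq q) j i; oW i (rkw s); oW i (rkw s')])]
    else [::]) | tn <- trans M].

(** Nothing persists from one time to the next by itself: every cell away from the head has to be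
    copied, and the object with the head position is the second premise that allows it. *)
Definition keep_facts (w : seq tok) i j : seq atom :=
  flatten [seq if i' != i then
      flatten [seq flatten [seq [:: (relR, [:: oH (size w) (rkq q) j i; oW i' (rkw s); oW i' (rkw s)])]
        | s <- enum (wal M)] | q <- enum (st M)]
    else [::] | i' <- iota 0 (pcells (size w))].

Definition accept_facts (w : seq tok) i j : seq atom :=
  flatten [seq flatten [seq [:: (relR, [:: oH (size w) (rkq q) j i; oW i (rkw s); 0])]
    | s <- enum (wal M)] | q <- enum (st M) & q_acc M q].

Definition stage_facts (w : seq tok) : seq atom :=
  [:: (relI, [:: oH (size w) 0 0 0])] ++
  flatten [seq [:: (relI, [:: oW i 0])] | i <- iota 0 (pcells (size w))] ++
  flatten [seq flatten [seq trans_facts w i j ++ (keep_facts w i j ++ accept_facts w i j)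
     | j <- iota 0 (size w + 2)] | i <- iota 0 (pcells (size w))].

Definition is_move (w : seq tok) (y z x : nat) : Prop :=
  exists i j, [/\ i < pcells (size w), j < size w + 2 &
  [\/ exists q s q' s' di dw o, [/\ List.In (q', s', di, dw, o) (delta M q (read_in w j) s),
        y = oH (size w) (rkq q) j i, z = oW i (rkw s) &
        x = oH (size w) (rkq q') (move_in (size w) di j) (move_w dw i) \/ x = oW i (rkw s')],
      exists (q : st M) (s : wal M) i', [/\ i' < pcells (size w), i' <> i, y = oH (size w) (rkq q) j i,
         z = oW i' (rkw s) & x = oW i' (rkw s)] |
      exists q (s : wal M), [/\ q_acc M q, y = oH (size w) (rkq q) j i, z = oW i (rkw s) & x = 0]]].

Lemma stage_facts_R w a : List.In a (stage_facts w) ->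
  (exists2 x, a = (relI, [:: x]) &
     x = oH (size w) 0 0 0 \/ exists2 i, i < pcells (size w) & x = oW i 0) \/
  (exists y z x, a = (relR, [:: y; z; x]) /\ is_move w y z x).
Proof.
rewrite /stage_facts !In_cat => -[/In_seq1 ->|[/In_flatten_map[i /In_iota hi /In_seq1 ->]|]].
- by left; exists (oH (size w) 0 0 0) => //; left.
- by left; exists (oW i 0) => //; right; exists i.
move=> /In_flatten_map[i /In_iota hi /In_flatten_map[j /In_iota hj]].
rewrite !In_cat => h; right; case: h => [|[|]].
- move=> /In_flatten_map[[[[q b] s] [[[[q' s'] di] dw] o]] /transP tr].
  move=> /In_if[/eqP/tokn_inj rd /In_cat[|] /In_seq1 ->].
    do 3!eexists; split=> //; exists i, j; split=> //; constructor 1.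
    exists q, s, q', s', di, dw, o; rewrite rd; split=> //; by left.
  do 3!eexists; split=> //; exists i, j; split=> //; constructor 1.
  exists q, s, q', s', di, dw, o; rewrite rd; split=> //; by right.
- move=> /In_flatten_map[i' /In_iota hi' /In_if[/eqP ne /In_flatten_map[q _ /In_flatten_map[s _ /In_seq1 ->]]]].
  do 3!eexists; split=> //; exists i, j; split=> //; constructor 2.
  by exists q, s, i'.
move=> /In_flatten_map[q /In_mem]; rewrite mem_filter => /andP[acc _] /In_flatten_map[s _ /In_seq1 ->].
do 3!eexists; split=> //; exists i, j; split=> //; constructor 3.
by exists q, s.
Qed.

Lemma is_move_fact w y z x : is_move w y z x -> List.In (relR, [:: y; z; x]) (stage_facts w).
Proof.
move=> [i [j [hi hj h]]]; rewrite /stage_facts !In_cat; right; right.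
apply/In_flatten_map; exists i; first exact/In_iota.
apply/In_flatten_map; exists j; first exact/In_iota.
rewrite !In_cat.
case: h => [[q [s [q' [s' [di [dw [o [tr -> -> xE]]]]]]]]|[q [s [i' [hi' ne -> -> ->]]]]|[q [s [acc -> -> ->]]]].
- left; apply/In_flatten_map; exists (q, read_in w j, s, (q', s', di, dw, o)); first exact/transP.
  by rewrite eqxx In_cat !In_seq1; case: xE => ->; [left|right].
- right; left; apply/In_flatten_map; exists i'; first exact/In_iota.
  apply/In_if; split; first exact/eqP.
  apply/In_flatten_map; exists q; first by rewrite In_mem mem_enum.
  by apply/In_flatten_map; exists s; [rewrite In_mem mem_enum|left].
- right; right; apply/In_flatten_map; exists q; first by rewrite In_mem mem_filter acc mem_enum.
  by apply/In_flatten_map; exists s; [rewrite In_mem mem_enum|left].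
Qed.

Lemma stage_facts_I w x : List.In (relI, [:: x]) (stage_facts w) <->
   x = oH (size w) 0 0 0 \/ exists2 i, i < pcells (size w) & x = oW i 0.
Proof.
split=> [/stage_facts_R[[y [->]]|[y [z [u []]]]] //|].
rewrite /stage_facts !In_cat => -[->|[i hi ->]]; first by left; left.
by right; left; apply/In_flatten_map; exists i; [exact/In_iota|left].
Qed.

Section Word.
Variable w : seq tok.
Let n := size w.
Hypothesis space : forall d, reach M w d -> cwp d < pcells n.

Notation stg := (stage (stage_facts w)).

Definition cH (d : cfg M) := oH n (rkq (cq d)) (cin d) (cwp d).

Lemma stage_complete d : reach M w d ->
  exists t, stg t (cH d) /\ forall i, i < pcells n -> stg t (oW i (rkw (ctape d i))).
Proof.
move=> /clos_rt_rtn1_iff; elim=> [|d1 d2 s r1 [t [sH sW]]].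
  exists 0; split.
    by apply: stage0; apply/stage_facts_I; left; rewrite /cH /= /rkq /= eqxx.
  move=> i hi; apply: stage0; apply/stage_facts_I; right; exists i => //.
  by rewrite /rkw /= eqxx.
have {}r1 : reach M w d1 by apply/clos_rt_rtn1_iff.
have hj : cin d1 < size w + 2 by have := cin_bound r1; lia.
have hi := space r1; have sT := sW _ hi.
move: s => [q' [s' [di [dw [o [tr ->]]]]]].
exists t.+1; split.
  apply: stageS sH sT _; apply: is_move_fact; exists (cwp d1), (cin d1); split=> //; constructor 1.
  by exists (cq d1), (ctape d1 (cwp d1)), q', s', di, dw, o; split=> //; left.
move=> i hi' /=; rewrite /upd; case: eqP => [->|ne].
  apply: stageS sH sT _; apply: is_move_fact; exists (cwp d1), (cin d1); split=> //; constructor 1.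
  by exists (cq d1), (ctape d1 (cwp d1)), q', s', di, dw, o; split=> //; right.
apply: stageS sH (sW _ hi') _; apply: is_move_fact; exists (cwp d1), (cin d1); split=> //; constructor 2.
by exists (cq d1), (ctape d1 i), i.
Qed.

(** Unless some reachable configuration accepts, each stage consists of parts of one reachable
    configuration. Determinism is what makes the head and the cells, inferred separately, belong to
    the same successor. *)
Lemma stage_sound t : (exists d, reach M w d /\ q_acc M (cq d)) \/
  exists2 d, reach M w d & forall x, stg t x ->
    x = cH d \/ exists i, x = oW i (rkw (ctape d i)).
Proof.
elim: t => [|t [IH|[d r IH]]]; [|by left|].
  right; exists (init_cfg M); first exact: rt_refl.
  move=> x s; inversion s as [x' h|]; subst; move: h => /stage_facts_I[->|[i _ ->]].
    by left; rewrite /cH /= /rkq /= eqxx.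
  by right; exists i; rewrite /rkw /= eqxx.
case acc: (q_acc M (cq d)); first by left; exists d.
right.
have hj : cin d < n + 2 by have := cin_bound r; rewrite /n; lia.
have inv x : stg t.+1 x -> (exists q' s' di dw o,
      List.In (q', s', di, dw, o) (delta M (cq d) (read_in w (cin d)) (ctape d (cwp d))) /\
      (x = oH n (rkq q') (move_in n di (cin d)) (move_w dw (cwp d)) \/ x = oW (cwp d) (rkw s'))) \/
    exists2 i, i <> cwp d & x = oW i (rkw (ctape d i)).
  move=> s; inversion s as [|t' x' y z sy sz h]; subst.
  move: h => /stage_facts_R[[? []]//|[y' [z' [x' [[<- <- <-] [i [j [hi hj' h]]]]]]]].
  have yE q : y = oH (size w) (rkq q) j i -> [/\ q = cq d, j = cin d & i = cwp d].
    move=> yE; have := IH _ sy; rewrite yE => -[|[i' /oH_oW//]].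
    by move=> /oH_inj[] //; try exact: rkq_lt; move=> /rkq_inj.
  have zE i' s0 : z = oW i' (rkw s0) -> s0 = ctape d i'.
    move=> zE; have := IH _ sz; rewrite zE => -[/esym/oH_oW//|[i0 /oW_inj[]]]; try exact: rkw_lt.
    by move=> -> /rkw_inj.
  case: h => [[q [s0 [q' [s' [di [dw [o [tr yE' zE' xE]]]]]]]]|[q [s0 [i' [_ ne yE' zE' xE]]]]|[q [s0 [aq yE' _ _]]]].
  - have [e1 e2 e3] := yE _ yE'; have e4 := zE _ _ zE'; subst q j i s0.
    by left; exists q', s', di, dw, o.
  - have [e1 e2 e3] := yE _ yE'; have e4 := zE _ _ zE'; subst q j i s0.
    by right; exists i'.
  - by have [e1 _ _] := yE _ yE'; rewrite -e1 aq in acc.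
have := det (cq d) (read_in w (cin d)) (ctape d (cwp d)).
case E: (delta M (cq d) (read_in w (cin d)) (ctape d (cwp d))) => [|[[[[q' s'] di] dw] o] [|//]] _.
  (* If the machine halts without accepting, only cells off the head are copied, and [d] itself
     still describes them. *)
  exists d => // x /inv; rewrite E => -[[? [? [? [? [? []]]]]]//|[i _ ->]].
  by right; exists i.
pose d' := Cfg M q' (move_in n di (cin d)) (upd (ctape d) (cwp d) s') (move_w dw (cwp d))
             (cout d ++ (if o is Some t then [:: t] else [::])).
exists d'; first by apply: (reach_step r); exists q', s', di, dw, o; rewrite E; split=> //; left.
move=> x /inv; rewrite E => -[[q2 [s2 [di2 [dw2 [o2 [h xE]]]]]]|[i ne ->]].
  by case: h xE => // -[<- <- <- <- _] [->|->]; [left|right; exists (cwp d); rewrite /= upd_eq].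
by right; exists i; rewrite /= /upd; case: eqP.
Qed.
End Word.

Lemma cmp_pcells G (f : cX G -> nat) : cmp f -> cmp (fun x => pcells (f x)).
Proof. by move=> cf; rewrite /pcells; cmp_tac. Qed.

Lemma cmp_oH G (n q j i : cX G -> nat) : cmp n -> cmp q -> cmp j -> cmp i ->
  cmp (fun x => oH (n x) (q x) (j x) (i x)).
Proof.
move=> cn cq cj ci; apply: (@cmp_ext _ (fun x => (2 * (q x + Q * (j x + (n x + 2) * i x))).+1)); last by cmp_tac.
by move=> x _; rewrite mul2n.
Qed.

Lemma cmp_oW G (i s : cX G -> nat) : cmp i -> cmp s -> cmp (fun x => oW (i x) (s x)).
Proof.
move=> ci cs; apply: (@cmp_ext _ (fun x => (2 * (s x + g * i x)).+2)); last by cmp_tac.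
by move=> x _; rewrite mul2n.
Qed.

Lemma fcmp3 (G : ctx) (R : relsym) (a b d : cX G -> nat) : cmp a -> cmp b -> cmp d ->
  fcmp (fun x => [:: (R, [:: a x; b x; d x])]).
Proof. by move=> ha hb hd; apply: (fcmp_atom R (fs := [:: a; b; d])) => f [<-|[<-|[<-|]]]. Qed.

Lemma fcmp1 (G : ctx) (R : relsym) (a : cX G -> nat) : cmp a -> fcmp (fun x => [:: (R, [:: a x])]).
Proof. by move=> ha; apply: (fcmp_atom R (fs := [:: a])) => f [<-|]. Qed.

Lemma fcmp_stage_facts : @fcmp ctx0 stage_facts.
Proof.
have cS G : @cmp G (fun x => size (cinp x)) by exact: cmp_size.
have cP G : @cmp G (fun x => pcells (size (cinp x))) by exact: cmp_pcells (cS G).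
apply: fcmp_cat.
  by apply: fcmp1; apply: cmp_oH; cmp_tac.
apply: fcmp_cat.
  apply: (fcmp_for (cP ctx0)).
  by apply: fcmp1; apply: cmp_oW; cmp_tac.
apply: (fcmp_for (cP ctx0)); apply: (@fcmp_for (ext _)); first by have := cS (@ext ctx0 (fun w => pcells (size w))) => ?; cmp_tac.
set G := ext _.
have ci : @cmp G (fun y => y.1.2) by cmp_tac.
have cj : @cmp G (fun y => y.2) by cmp_tac.
have cH (q : st M) : @cmp G (fun y => oH (size y.1.1) (rkq q) y.2 y.1.2).
  by apply: cmp_oH => //; cmp_tac.
apply: fcmp_cat; last apply: fcmp_cat.
- apply: fcmp_list => -[[[q a] s] [[[[q' s'] di] dw] o]] _.
  apply: fcmp_if; first by cmp_tac.
  have cW s0 : @cmp G (fun y => oW y.1.2 (rkw s0)) by apply: cmp_oW; cmp_tac.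
  apply: fcmp_cat; apply: fcmp3 => //.
  by apply: cmp_oH; cmp_tac.
- apply: (fcmp_for (cP G)); apply: fcmp_if; first by cmp_tac.
  apply: fcmp_list => q _; apply: fcmp_list => s _.
  by apply: fcmp3; [exact: (cmp_weak _ (cH q))|apply: cmp_oW; cmp_tac|apply: cmp_oW; cmp_tac].
- apply: fcmp_list => q _; apply: fcmp_list => s _.
  by apply: fcmp3 => //; [apply: cmp_oW; cmp_tac|cmp_tac].
Qed.
End PSpaceHard.

Theorem stage_prog_PSPACE_hard : PSPACE_hard (query_lang stage_prog relG).
Proof.
move=> A [M [c [k [det dec]]]].
exists (fun w => enc_input (two_slices (stage_facts M c k w)) [:: 0] 0).
have [T [m comp]] := fcmp_logspace 0 (fcmp_stage_facts M c k).
exists T, m; split=> // w; have [AE sp] := dec w.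
have space d : reach M w d -> cwp d < pcells c k (size w).
  by move=> /sp; rewrite /poly_bound /pcells; lia.
have okF a : List.In a (stage_facts M c k w) -> wf_atom a /\ edb stage_prog a.1.
  by move=> /stage_facts_R[[x -> _]|[x [y [z [-> _]]]]].
have dbok := db_two okF.
rewrite query_lang_enc (stage_certain okF) AE; split.
  move=> [d [r acc]]; have [t [sH sW]] := stage_complete space r.
  have s0 : stage (stage_facts M c k w) t.+1 0.
    apply: stageS sH (sW _ (space _ r)) _; apply: is_move_fact.
    exists (cwp d), (cin d); split; [exact: space|by have := cin_bound r; lia|constructor 3].
    by exists (cq d), (ctape d (cwp d)).
  split; last by exists t.+1.
  split=> //.
  by rewrite /= (stage_objs s0).
move=> [_ [t _ s]]; have [//|[d r inv]] := stage_sound c k det w t.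
by have := inv _ s; case=> [|[i]].
Qed.

(** * Extending closed assignments beyond a finite window *)

Section Extend.
Variables (S J : finType) (act : J -> {set S}).
Variables (rl : {set S} -> S -> Prop) (out inn : S -> S -> Prop) (sm : {set S} -> Prop).

Definition shifted (Z : {set S}) : {set S} := [set s' | `[< exists2 s, s \in Z & out s s' >]].
Definition closed_rl (Z : {set S}) : Prop := forall A s, rl A s -> A \subset Z -> s \in Z.

(* Premises [j : J] stand for the sets [act j] of facts imported from the left;
   [sm] singles out the premise sets that a single [j] can supply. *)
Hypothesis rl_sm : forall A s, rl A s -> sm A.
Hypothesis act_sm : forall j Z, act j \subset shifted Z ->
  exists A, [/\ sm A, A \subset Z & act j \subset shifted A].
Hypothesis sm_act : forall (U A : {set S}) (R : {set J * S}), sm A ->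
  (forall j j' s, act j \subset act j' -> (j, s) \in R -> (j', s) \in R) ->
  (forall y, y \in A -> exists2 j, act j \subset U & (j, y) \in R) ->
  exists2 j, act j \subset U & forall y, y \in A -> (j, y) \in R.
Hypothesis act1 : forall s, exists j, act j = [set s].

(** [Z] absorbs the excursions to the next level described by [R]: facts leave by [out], yield [s]
    there, and a consequence comes back by [inn]. *)
Definition bounce (R : {set J * S}) (Z : {set S}) : Prop :=
  forall j s z, act j \subset shifted Z -> (j, s) \in R -> inn s z -> z \in Z.

(* [(j, s)] is in the [h]-th iterate iff [act j] at level 0 yields [s] at level 0
   by derivations that stay within levels [0..h-1]. *)
Definition summary (R : {set J * S}) : {set J * S} :=
  [set js | `[< forall Z : {set S}, act js.1 \subset Z -> closed_rl Z -> bounce R Z -> js.2 \in Z >]].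

Lemma summaryP R j s : reflect
  (forall Z : {set S}, act j \subset Z -> closed_rl Z -> bounce R Z -> s \in Z) ((j, s) \in summary R).
Proof. by rewrite inE; exact: asboolP. Qed.

Lemma summary_mono : {homo summary : R R' / R \subset R'}.
Proof.
move=> R R' sub; apply/subsetP => -[j s] /summaryP h; apply/summaryP => Z jZ cZ bZ.
by apply: h => // j' s' z aj /(subsetP sub); exact: bZ.
Qed.

Lemma shiftedP (Z : {set S}) s' : reflect (exists2 s, s \in Z & out s s') (s' \in shifted Z).
Proof. by rewrite inE; exact: asboolP. Qed.

Lemma shiftedS (Z Z' : {set S}) : Z \subset Z' -> shifted Z \subset shifted Z'.
Proof.
by move=> /subsetP sub; apply/subsetP => s' /shiftedP[s /sub h o]; apply/shiftedP; exists s.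
Qed.

Let Rs := fixset summary.

Lemma RsE : summary Rs = Rs.
Proof. exact: fixsetK summary_mono. Qed.

Definition window_closed (H : nat) (sg : nat -> {set S}) : Prop :=
  [/\ forall k, k <= H -> closed_rl (sg k),
      forall k s s', k < H -> s \in sg k -> out s s' -> s' \in sg k.+1 &
      forall k s s', k < H -> s \in sg k.+1 -> inn s s' -> s' \in sg k].

(** By induction on the depth: what happens to the right of level 0 takes place in the window
    shifted by one, which is shorter by one. *)
Lemma window_summary h sg j s : window_closed h sg ->
  (j, s) \in iter h summary set0 -> act j \subset sg 0 -> s \in sg 0.
Proof.
elim: h sg j s => [|h IH] sg j s; first by rewrite inE.
move=> [c1 c2 c3] /summaryP hs js; apply: hs => //; first exact: c1.
move=> j' s' z aj jR is'; apply: (c3 0) is' => //.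
apply: (IH (fun k => sg k.+1) j') => //.
  by split=> [k kh|k t t' kh|k t t' kh]; [apply: c1|apply: c2|apply: c3].
apply: subset_trans aj _; apply/subsetP => t' /shiftedP[t t0 o].
exact: c2 t0 o.
Qed.

(** The summaries are stable after [#|{: J * S}|] rounds, and a window of that length starting at
    level 1 validates all of them; hence the strict inequality. Beyond level 0 the given sets are
    discarded: each further level consists of what the stable summaries yield from the facts handed
    over by the level before. *)
Theorem extend_right H sg : #|{: J * S}| < H -> window_closed H sg ->
  exists tau, [/\ tau 0 = sg 0, forall k, closed_rl (tau k),
     forall k s s', s \in tau k -> out s s' -> s' \in tau k.+1 &
     forall k s s', s \in tau k.+1 -> inn s s' -> s' \in tau k].
Proof.
move=> HJ [c1 c2 c3].
pose nxt (Z : {set S}) := [set s | `[< exists2 j, act j \subset shifted Z & (j, s) \in Rs >]].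
have nxtP (Z : {set S}) s : reflect (exists2 j, act j \subset shifted Z & (j, s) \in Rs) (s \in nxt Z).
  by rewrite inE; exact: asboolP.
have mono j j' s : act j \subset act j' -> (j, s) \in Rs -> (j', s) \in Rs.
  rewrite -RsE => jj' /summaryP h; apply/summaryP => Z jZ; apply: h.
  exact: subset_trans jj' jZ.
(* By [sm_act] one [j] supplies all premises of the rule; the fixed point equation then gives the
   conclusion from the same [j]. *)
have closedN Z : closed_rl (nxt Z).
  move=> A s rA AZ.
  have [j aj h] := sm_act (rl_sm rA) mono (fun y yA => elimT (nxtP Z y) (subsetP AZ y yA)).
  apply/nxtP; exists j => //; rewrite -RsE; apply/summaryP => Z' jZ' cZ' bZ'.
  apply: (cZ' _ _ rA); apply/subsetP => y /h; rewrite -RsE => /summaryP; exact.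
have bounceN Z : bounce Rs (nxt Z).
  move=> j s z aj jR isz; have [A [sA AN jA]] := act_sm aj.
  have [j' aj' h] := sm_act sA mono (fun y yA => elimT (nxtP Z y) (subsetP AN y yA)).
  apply/nxtP; exists j' => //; rewrite -RsE; apply/summaryP => Z' jZ' cZ' bZ'.
  apply: (bZ' j s z _ jR isz); apply: subset_trans jA (shiftedS _).
  by apply/subsetP => y /h; rewrite -RsE => /summaryP; exact.
have bounce0 : bounce Rs (sg 0).
  move=> j s z aj jR isz; apply: (c3 0 s); [by lia| |by []].
  apply: (@window_summary #|{: J * S}| (fun k => sg k.+1) j) => //.
    split=> [k kh|k t t' kh|k t t' kh]; [apply: c1|apply: c2|apply: c3]; lia.
  apply: subset_trans aj _; apply/subsetP => t' /shiftedP[t t0 o].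
  by apply: (c2 0 t); [lia|by []|by []].
pose tau k := iter k nxt (sg 0).
have bounceT k : bounce Rs (tau k) by case: k => [|k]; [exact: bounce0|exact: bounceN].
exists tau; split=> //.
- by case=> [|k]; [exact: c1|exact: closedN].
- move=> k s s' sk o; rewrite /tau iterS; apply/nxtP; have [j jE] := act1 s'.
  exists j; first by rewrite jE sub1set; apply/shiftedP; exists s.
  by rewrite -RsE; apply/summaryP => Z; rewrite jE sub1set.
- move=> k s s'; rewrite {1}/tau iterS => /nxtP[j aj jR] isz.
  exact: bounceT aj jR isz.
Qed.
End Extend.

Section TwoSided.
Variables (S J : finType) (act : J -> {set S}).
Variables (rl : Z -> {set S} -> S -> Prop) (up dn : S -> S -> Prop) (sm : {set S} -> Prop).

Hypothesis rl_sm : forall t A s, rl t A s -> sm A.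
Hypothesis act_up : forall j Z, act j \subset shifted up Z ->
  exists A, [/\ sm A, A \subset Z & act j \subset shifted up A].
Hypothesis act_dn : forall j Z, act j \subset shifted dn Z ->
  exists A, [/\ sm A, A \subset Z & act j \subset shifted dn A].
Hypothesis sm_act : forall (U A : {set S}) (R : {set J * S}), sm A ->
  (forall j j' s, act j \subset act j' -> (j, s) \in R -> (j', s) \in R) ->
  (forall y, y \in A -> exists2 j, act j \subset U & (j, y) \in R) ->
  exists2 j, act j \subset U & forall y, y \in A -> (j, y) \in R.
Hypothesis act1 : forall s, exists j, act j = [set s].

Definition closed_on (P : Z -> Prop) (sg : Z -> {set S}) : Prop :=
  [/\ forall t, P t -> closed_rl (rl t) (sg t),
      forall t s s', P t -> P (t + 1)%Z -> s \in sg t -> up s s' -> s' \in sg (t + 1)%Z &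
      forall t s s', P t -> P (t - 1)%Z -> s \in sg t -> dn s s' -> s' \in sg (t - 1)%Z].

(** Below [a] and above [b] the rules do not depend on time, so each side is an instance of the
    one-sided theorem, on the left with [up] and [dn] exchanged. The two extensions are glued to the
    unchanged middle. *)
Theorem extend_both (lo a b hi : Z) (H : nat) sg :
  #|{: J * S}| < H -> (lo + Z.of_nat H <= a)%Z -> (a <= b)%Z -> (b + Z.of_nat H <= hi)%Z ->
  (forall t A s, (t <= a)%Z -> rl t A s <-> rl a A s) ->
  (forall t A s, (b <= t)%Z -> rl t A s <-> rl b A s) ->
  closed_on (fun t => (lo <= t <= hi)%Z) sg ->
  exists2 sg', (forall t, (a <= t <= b)%Z -> sg' t = sg t) & closed_on (fun=> True) sg'.
Proof.
move=> HJ la ab bh rla rlb [c1 c2 c3].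
have [|tr [r0 r1 r2 r3]] := @extend_right S J act (rl b) up dn sm (@rl_sm b) act_up sm_act act1
    H (fun k => sg (b + Z.of_nat k)%Z) HJ.
  split=> [k kH A s h AS|k s s' kH sk u|k s s' kH sk u].
  - have [|_ h'] := rlb (b + Z.of_nat k)%Z A s; first lia.
    by apply: (c1 (b + Z.of_nat k)%Z _ A s (h' h) AS); lia.
  - have -> : (b + Z.of_nat k.+1 = b + Z.of_nat k + 1)%Z by lia.
    by apply: c2 sk u; lia.
  - have -> : (b + Z.of_nat k = b + Z.of_nat k.+1 - 1)%Z by lia.
    by apply: c3 sk u; lia.
have [|tl [l0 l1 l2 l3]] := @extend_right S J act (rl a) dn up sm (@rl_sm a) act_dn sm_act act1
    H (fun k => sg (a - Z.of_nat k)%Z) HJ.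
  split=> [k kH A s h AS|k s s' kH sk u|k s s' kH sk u].
  - have [|_ h'] := rla (a - Z.of_nat k)%Z A s; first lia.
    by apply: (c1 (a - Z.of_nat k)%Z _ A s (h' h) AS); lia.
  - have -> : (a - Z.of_nat k.+1 = a - Z.of_nat k - 1)%Z by lia.
    by apply: c3 sk u; lia.
  - have -> : (a - Z.of_nat k = a - Z.of_nat k.+1 + 1)%Z by lia.
    by apply: c2 sk u; lia.
have e0 : (b + Z.of_nat 0 = b)%Z by lia.
have e0' : (a - Z.of_nat 0 = a)%Z by lia.
rewrite e0 in r0; rewrite e0' in l0.
pose sg' t := if (t <? a)%Z then tl (Z.to_nat (a - t)) else if (b <? t)%Z then tr (Z.to_nat (t - b)) else sg t.
have mid t : (a <= t <= b)%Z -> sg' t = sg t.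
  by move=> h; rewrite /sg'; case: Z.ltb_spec => ?; first lia; case: Z.ltb_spec => ? //; lia.
have lft t : (t <= a)%Z -> sg' t = tl (Z.to_nat (a - t)).
  rewrite /sg'; case: Z.ltb_spec => // h1 h2; have -> : t = a by lia.
  by case: Z.ltb_spec => ?; [lia|rewrite Z.sub_diag -l0].
have rgt t : (b <= t)%Z -> sg' t = tr (Z.to_nat (t - b)).
  rewrite /sg'; case: Z.ltb_spec => [h1 h2|h1]; first by lia.
  case: Z.ltb_spec => // h2 h3; have -> : t = b by lia.
  by rewrite Z.sub_diag -r0.
exists sg' => //; split=> [t _ A s h AZ|t s s' _ _ st u|t s s' _ _ st u].
- have [ta|at_] := Z.le_gt_cases t a.
    move: AZ; rewrite lft // => AZ; by have [h' _] := rla t A s ta; apply: l1 (h' h) AZ.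
  have [bt|tb] := Z.le_gt_cases b t.
    move: AZ; rewrite rgt // => AZ; by have [h' _] := rlb t A s bt; apply: r1 (h' h) AZ.
  by move: AZ; rewrite mid; [move=> AZ; apply: (c1 t) h AZ; lia|lia].
- have [ta|at_] := Z.lt_ge_cases t a.
    move: st; rewrite !lft; [|lia|lia].
    have -> : Z.to_nat (a - t) = (Z.to_nat (a - (t + 1))).+1 by lia.
    by move=> st; exact: l3 st u.
  have [bt|tb] := Z.le_gt_cases b t.
    move: st; rewrite !rgt; [|lia|lia].
    have -> : Z.to_nat (t + 1 - b) = (Z.to_nat (t - b)).+1 by lia.
    by move=> st; exact: r2 st u.
  move: st; rewrite !mid; [|lia|lia] => st.
  by apply: c2 st u; lia.
- have [ta|at_] := Z.le_gt_cases t a.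
    move: st; rewrite !lft; [|lia|lia].
    have -> : Z.to_nat (a - (t - 1)) = (Z.to_nat (a - t)).+1 by lia.
    by move=> st; exact: l2 st u.
  have [bt|tb] := Z.lt_ge_cases b t.
    move: st; rewrite !rgt; [|lia|lia].
    have -> : Z.to_nat (t - b) = (Z.to_nat (t - 1 - b)).+1 by lia.
    by move=> st; exact: r3 st u.
  move: st; rewrite !mid; [|lia|lia] => st.
  by apply: c3 st u; lia.
Qed.
End TwoSided.

(** * Parsing the input *)

Lemma tk_drop w i : tk w i = tokn (ohead (drop i w)).
Proof.
rewrite /tk /read_in /=; case: ltnP => h; last by rewrite drop_oversize.
by rewrite (drop_nth T0 h).
Qed.

Fixpoint lit (w : seq tok) (i : nat) (s : seq tok) : bool :=
  if s is t :: s' then (tk w i == tokn (Some t)) && lit w i.+1 s' else true.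

Lemma litP w i s : reflect (exists r, drop i w = s ++ r) (lit w i s).
Proof.
elim: s i => [|t s IH] i /=; first by constructor; exists (drop i w).
apply: (iffP andP) => [[/eqP h /IH[r hr]]|[r hr]].
  exists r; move: h; rewrite tk_drop; case E: (drop i w) => [|u v] h.
    by have := @tokn_inj None (Some t) h.
  have [->] := @tokn_inj (Some u) (Some t) h.
  by congr cons; rewrite /= -hr -add1n -drop_drop E drop1.
rewrite tk_drop hr eqxx; split=> //; apply/IH; exists r.
by rewrite -add1n -drop_drop hr drop1.
Qed.

Lemma drop_cat_size (w : seq tok) i s r : drop i w = s ++ r -> r = drop (i + size s) w.
Proof. by move=> h; rewrite addnC -drop_drop h drop_size_cat. Qed.

Lemma cmp_lit G (f : cX G -> nat) s : cmp f -> cmpb G (fun x => lit (cinp x) (f x) s).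
Proof.
elim: s f => [|t s IH] f cf /=; first exact: cmp_const.
by apply: cmp_and; [cmp_tac|apply: IH; cmp_tac].
Qed.

Section Pspec.
Variables (T : Type) (enc : T -> seq tok) (ok : T -> Prop).

(* A parser returns the position after the parsed block, or 0 on failure. *)
Record pspec (P : seq tok -> nat -> nat) : Prop := Pspec {
  ps_sound : forall w i, P w i != 0 ->
    exists x, [/\ ok x, drop i w = enc x ++ drop (P w i) w & P w i = i + size (enc x)];
  ps_complete : forall w i x r, ok x -> drop i w = enc x ++ r -> P w i = i + size (enc x);
  ps_pos : forall x, 0 < size (enc x);
  ps_le : forall w i, P w i <= size w;
  ps_cmp : forall G (f : cX G -> nat), cmp f -> cmp (fun x => P (cinp x) (f x))
}.

(** Failure keeps the position, so iterating more often than there are blocks is harmless; blocks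
    being nonempty, [size w] rounds are always enough. *)
Definition pnext (P : seq tok -> nat -> nat) w c := if P w c == 0 then c else P w c.
Definition pos P w i k := iter k (pnext P w) i.
Definition pstar P w i := pos P w i (size w).

Variable P : seq tok -> nat -> nat.
Hypothesis sP : pspec P.

Lemma ps_fail (w : seq tok) i r : drop i w = r -> (forall x s, ok x -> r <> enc x ++ s) -> P w i = 0.
Proof.
move=> e h; apply/eqP; apply: contraT => /(ps_sound sP)[x [okx ex _]].
by case: (h x (drop (P w i) w) okx); rewrite -e.
Qed.

Lemma cmp_pos G (f k : cX G -> nat) : cmp f -> cmp k -> cmp (fun x => pos P (cinp x) (f x) (k x)).
Proof.
move=> cf ck; apply: (@cmp_iter G k (fun x => f x + size (cinp x)) f) => //; first by cmp_tac.
  rewrite /pnext; set G' := ext _.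
  have c1 : @cmp G' (fun y => y.2) by cmp_tac.
  by have c2 := ps_cmp sP c1; cmp_tac.
move=> x j _ _; elim: j => [|j IH] /=; first by lia.
by rewrite {1}/pnext; case: ifP => // _; have := ps_le sP (cinp x) (iter j (pnext P (cinp x)) (f x)); lia.
Qed.

Lemma cmp_pstar G (f : cX G -> nat) : cmp f -> cmp (fun x => pstar P (cinp x) (f x)).
Proof. by move=> cf; apply: cmp_pos => //; exact: cmp_size. Qed.

Lemma posE w i xs r k : (forall x, List.In x xs -> ok x) -> drop i w = flatten (map enc xs) ++ r ->
  k <= size xs -> pos P w i k = i + size (flatten (map enc (take k xs))).
Proof.
elim: k xs i => [|k IH] [|x xs] i okx e // kx; rewrite ?addn0 // /pos iterSr.
have -> : pnext P w i = i + size (enc x).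
  rewrite /pnext (ps_complete sP (okx x (or_introl erefl)) (r := flatten (map enc xs) ++ r)); last by rewrite catA.
  by have := ps_pos sP x; case: ifP => //; lia.
rewrite -/(pos P w _ k) (IH xs) /= ?size_cat; first by lia.
- by move=> y yx; apply: okx; right.
- by rewrite -(drop_cat_size (s := enc x) (r := flatten (map enc xs) ++ r)) // e /= catA.
- by [].
Qed.

Lemma pos_stop w i k : P w i = 0 -> pos P w i k = i.
Proof. by move=> h; elim: k => //= k ->; rewrite /pnext h. Qed.

Lemma pos_add w i a b : pos P w i (a + b) = pos P w (pos P w i a) b.
Proof. by rewrite /pos addnC iterD. Qed.

Lemma size_flatten_ge xs : size xs <= size (flatten (map enc xs)).
Proof. by elim: xs => //= x xs IH; rewrite size_cat; have := ps_pos sP x; lia. Qed.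

Lemma pstar_complete w i xs r : (forall x, List.In x xs -> ok x) ->
  drop i w = flatten (map enc xs) ++ r -> (forall x s, ok x -> r <> enc x ++ s) ->
  pstar P w i = i + size (flatten (map enc xs)).
Proof.
move=> okx e nor; have le : size xs <= size w.
  apply: leq_trans (size_flatten_ge xs) _; have := congr1 size e.
  by rewrite size_drop size_cat; lia.
rewrite /pstar -(subnKC le) pos_add (posE okx e (leqnn _)) take_size pos_stop //.
by apply: ps_fail nor; rewrite -(drop_cat_size e).
Qed.

Lemma pos_sound w i k : exists xs, [/\ forall x, List.In x xs -> ok x,
  drop i w = flatten (map enc xs) ++ drop (pos P w i k) w & pos P w i k = i + size (flatten (map enc xs))].
Proof.
elim: k i => [|k IH] i; first by exists [::]; rewrite addn0.
rewrite /pos iterSr -/(pos P w _ k) /pnext; case: ifP => [/eqP h|/negbT h].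
  have [xs [h1 h2 h3]] := IH i; exists xs.
  by move: h2 h3; rewrite pos_stop.
have [x [okx ex px]] := ps_sound sP h; have [xs [h1 h2 h3]] := IH (P w i).
exists (x :: xs); split=> /=; first by move=> y [<-|/h1].
  by rewrite ex h2 catA.
by rewrite h3 px size_cat addnA.
Qed.

Lemma posn_sound w i k : (forall k', k' < k -> P w (pos P w i k') != 0) ->
  exists xs, [/\ size xs = k, forall x, List.In x xs -> ok x,
    drop i w = flatten (map enc xs) ++ drop (pos P w i k) w &
    pos P w i k = i + size (flatten (map enc xs))].
Proof.
elim: k i => [|k IH] i h; first by exists [::]; rewrite addn0.
have h0 : P w i != 0 by exact: (h 0).
have E k' : pos P w i k'.+1 = pos P w (P w i) k' by rewrite /pos iterSr /pnext (negPf h0).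
have [x [okx ex px]] := ps_sound sP h0.
have [|xs [h1 h2 h3 h4]] := IH (P w i); first by move=> k' kk'; rewrite -E; apply: h.
exists (x :: xs); rewrite E; split=> /=; first by rewrite h1.
- by move=> y [<-|/h2].
- by rewrite ex h3 catA.
- by rewrite h4 px size_cat addnA.
Qed.

Section Blocks.
Variables (x0 : T) (w : seq tok) (i : nat) (xs : seq T) (r : seq tok).
Hypothesis okx : forall x, List.In x xs -> ok x.
Hypothesis e : drop i w = flatten (map enc xs) ++ r.
Hypothesis nor : forall x s, ok x -> r <> enc x ++ s.

Lemma pos_drop k : k <= size xs ->
  drop (pos P w i k) w = flatten (map enc (drop k xs)) ++ r.
Proof.
move=> kx; rewrite (posE okx e kx); set p := flatten _.
have e' : drop i w = p ++ (flatten (map enc (drop k xs)) ++ r).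
  by rewrite e /p catA -flatten_cat -map_cat cat_take_drop.
by rewrite -(drop_cat_size e').
Qed.

Lemma pos_nth k : k < size xs ->
  drop (pos P w i k) w = enc (nth x0 xs k) ++ (flatten (map enc (drop k.+1 xs)) ++ r).
Proof. by move=> kx; rewrite pos_drop ?(ltnW kx) // (drop_nth x0 kx) /= catA. Qed.

Lemma In_nth k : k < size xs -> List.In (nth x0 xs k) xs.
Proof. by elim: xs k => // y ys IH [|k] //=; [left|right; apply: IH]. Qed.

Lemma pos_block k : (P w (pos P w i k) != 0) = (k < size xs).
Proof.
have [kx|kx] := ltnP k (size xs).
  rewrite (ps_complete sP (okx (In_nth kx)) (pos_nth kx)).
  by have := ps_pos sP (nth x0 xs k); lia.
have P0 : P w (pos P w i (size xs)) = 0.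
  by apply: ps_fail nor; rewrite pos_drop // drop_size.
by rewrite -(subnKC kx) pos_add pos_stop // P0.
Qed.

End Blocks.

End Pspec.
Arguments pos : simpl never.

Lemma pspec_iff (T : Type) (enc : T -> seq tok) (ok ok' : T -> Prop) P :
  (forall x, ok x <-> ok' x) -> pspec enc ok P -> pspec enc ok' P.
Proof.
move=> h [h1 h2 h3 h4 h5]; split=> //.
  by move=> w i /h1[x [/h ? ? ?]]; exists x.
by move=> w i x r /h; exact: h2.
Qed.

Definition pbracket (P : seq tok -> nat -> nat) w i : nat :=
  let j := pstar P w i.+1 in if (tk w i == 4) && (tk w j == 5) then j.+1 else 0.

Lemma tk_lt w i : tk w i != 0 -> i < size w.
Proof. by rewrite /tk /read_in /=; case: ltnP. Qed.

Lemma tkP w i t : (tk w i == tokn (Some t)) <-> exists r, drop i w = t :: r.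
Proof.
rewrite tk_drop; split=> [/eqP|[r ->]]; last exact/eqP.
case: (drop i w) => [|u r] h; first by have := @tokn_inj None (Some t) h.
by have [->] := @tokn_inj (Some u) (Some t) h; exists r.
Qed.

Lemma pbracket_spec (T : Type) (enc : T -> seq tok) ok P : pspec enc ok P ->
  (forall x s r, TClose :: r <> enc x ++ s) ->
  pspec (fun xs => TOpen :: flatten (map enc xs) ++ [:: TClose])
        (fun xs => forall x, List.In x xs -> ok x) (pbracket P).
Proof.
move=> sP nc; split.
- move=> w i; rewrite /pbracket; case: ifP => // /andP[/(tkP _ _ TOpen)[r e4] /(tkP _ _ TClose)[r' e5]] _.
  have [xs [h1 h2 h3]] := pos_sound sP w i.+1 (size w); rewrite -/(pstar P w i.+1) in h2 h3.
  have er : drop i.+1 w = r by rewrite -add1n -drop_drop e4 drop1.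
  have er' : drop (pstar P w i.+1).+1 w = r' by rewrite -add1n -drop_drop e5 drop1.
  exists xs; split=> //.
    by rewrite e4 -er h2 e5 er' /= -catA.
  by rewrite h3 /= size_cat /=; lia.
- move=> w i xs r okx e.
  have e' : drop i.+1 w = flatten (map enc xs) ++ TClose :: r.
    by rewrite -add1n -drop_drop e /= drop0 -catA.
  rewrite /pbracket (pstar_complete sP okx e'); last by move=> x s _; exact: nc.
  have -> : tk w i == 4 by apply/(tkP w i TOpen); rewrite e; eexists.
  have -> : tk w (i.+1 + size (flatten (map enc xs))) == 5.
    by apply/(tkP _ _ TClose); exists r; rewrite -(drop_cat_size e').
  by rewrite /= size_cat /=; lia.
- by move=> xs /=.
- move=> w i; rewrite /pbracket; case: ifP => // /andP[_ h].
  by apply: tk_lt; rewrite (eqP h).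
- move=> G f cf; rewrite /pbracket.
  by have cs := cmp_pstar sP (cmp_succ cf); cmp_tac.
Qed.

Definition isbit w i := (tk w i == 1) || (tk w i == 2).
Definition nend w i := i + find (fun k => ~~ isbit w (i + k)) (iota 0 (size w).+1).
(* [pnat] accepts the maximal run of bits if it is a numeral without superfluous
   leading zeros, i.e. it ends in [T1] or is a single bit. *)
Definition pnat w i := let j := nend w i in
  if (i < j) && ((tk w j.-1 == 2) || (j == i.+1)) then j else 0.

Lemma isbitP w i : isbit w i <-> exists t r, drop i w = t :: r /\ is_bit t.
Proof.
split=> [/orP[/(tkP _ _ T0)[r e]|/(tkP _ _ T1)[r e]]|[[] [r [e]]]//= _].
- by exists T0, r.
- by exists T1, r.
- by apply/orP; left; apply/(tkP _ _ T0); exists r.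
- by apply/orP; right; apply/(tkP _ _ T1); exists r.
Qed.

Lemma nend_spec w i : exists s, [/\ all is_bit s, nobit (drop (nend w i) w),
  drop i w = s ++ drop (nend w i) w & nend w i = i + size s].
Proof.
have key k : all (fun k => isbit w (i + k)) (iota 0 k) ->
    exists s, [/\ all is_bit s, drop i w = s ++ drop (i + k) w & size s = k].
  elim: k => [|k IH] h; first by exists [::]; rewrite addn0.
  move: h; rewrite -addn1 iotaD all_cat /= andbT add0n => /andP[/IH[s [b e sz]] /isbitP[t [r [er bt]]]].
  exists (rcons s t); rewrite all_rcons b bt size_rcons sz addn1; split=> //.
  by rewrite e cat_rcons er addnS -[(i + k).+1]add1n -drop_drop er drop1.
set N := (size w).+1; set Pb := fun k => ~~ isbit w (i + k).
have hN : has Pb (iota 0 N).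
  apply/hasP; exists (size w); first by rewrite mem_iota /N; lia.
  apply/negP => /isbitP[t [r [e _]]]; have := congr1 size e; rewrite size_drop /=; lia.
have fN : find Pb (iota 0 N) < N by move: hN; rewrite has_find size_iota.
have [|s [b e sz]] := key (find Pb (iota 0 N)).
  apply/allP => k; rewrite mem_iota add0n => /andP[_ kf]; have := before_find 0 kf.
  by rewrite nth_iota ?add0n /Pb => [/negbFE//|]; lia.
exists s; split=> //; last by rewrite /nend sz.
have := nth_find 0 hN; rewrite nth_iota // add0n /Pb /nobit -/(nend w i) => /negP h.
rewrite /nend -/N -/Pb; case E: (drop _ w) => [|t r] //; apply/negP => bt; apply: h.
by apply/isbitP; exists t, r.
Qed.

Lemma enc_nat_bits_ok d : all is_bit (enc_nat d) /\ (last T0 (enc_nat d) = T1 \/ size (enc_nat d) = 1).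
Proof.
rewrite /enc_nat; case: (N.of_nat d) => [|q]; first by split=> //; right.
have h : all is_bit (enc_pos q) /\ forall t, last t (enc_pos q) = T1.
  by elim: q => //= q [-> h].
by case: h => [-> h]; split=> //; left.
Qed.

Lemma bits_enc_pos s : all is_bit s -> last T0 s = T1 -> exists q, s = enc_pos q.
Proof.
elim: s => // t [|u s] IH /=; first by move=> _ ->; exists xH.
move=> /and3P[bt bu bs] l; have [|//|q ->] := IH; first by rewrite /= bu.
by case: t bt => // _; [exists (xO q)|exists (xI q)].
Qed.

Lemma bits_enc_nat s : all is_bit s -> last T0 s = T1 \/ size s = 1 -> exists d, s = enc_nat d.
Proof.
have pos_nat q : exists d, enc_pos q = enc_nat d.
  by exists (Pos.to_nat q); rewrite /enc_nat positive_nat_N.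
move=> b [l|]; first by have [q ->] := bits_enc_pos b l.
case: s b => [|t [|u s]] //= /andP[bt _] _; case: t bt => // _; first by exists 0.
exact: (pos_nat xH).
Qed.

Lemma pnat_sound w i : pnat w i != 0 ->
  exists d, [/\ drop i w = enc_nat d ++ drop (pnat w i) w, pnat w i = i + size (enc_nat d)
   & nobit (drop (pnat w i) w)].
Proof.
rewrite /pnat; have [s [bs nb e E]] := nend_spec w i.
case: ifP => // /andP[lt h] _; have [|d sE] := bits_enc_nat bs.
  case/orP: h => [/(tkP _ _ T1)[r er]|/eqP h]; last by right; lia.
  left; case/lastP: s bs e E => [|s t] bs e E; first by rewrite /= in E; lia.
  rewrite size_rcons in E; rewrite last_rcons; move: er; rewrite E addnS /= => er.
  have := drop_cat_size (s := s) (r := t :: drop (nend w i) w) (w := w) (i := i).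
  by rewrite -cat_rcons => /(_ e); rewrite er => -[].
by exists d; rewrite -sE.
Qed.

Lemma bits_nobit_inj s s' r r' : all is_bit s -> all is_bit s' -> nobit r -> nobit r' ->
  s ++ r = s' ++ r' -> s = s'.
Proof.
elim: s s' => [|t s IH] [|t' s'] //=.
- by move=> _ /andP[bt _] + _ E; rewrite E /= bt.
- by move=> /andP[bt _] _ _ + E; rewrite -E /= bt.
by move=> /andP[_ b] /andP[_ b'] n n' [-> /(IH _ b b' n n') ->].
Qed.

Lemma pnat_complete w i d r : drop i w = enc_nat d ++ r -> nobit r -> pnat w i = i + size (enc_nat d).
Proof.
move=> e nr; have [s [bs nb e' E]] := nend_spec w i; have [bd ld] := enc_nat_bits_ok d.
have sE : s = enc_nat d by apply: bits_nobit_inj bs bd nb nr _; rewrite -e -e'.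
rewrite /pnat; have [t [u [eN bt]]] := enc_nat_head d.
have s0 : 0 < size s by rewrite sE eN.
rewrite ifT ?E -?sE //; apply/andP; split; first by lia.
rewrite -sE in ld; case: ld => [l|->]; last by rewrite addn1 eqxx orbT.
apply/orP; left; apply/(tkP _ _ T1).
case/lastP: s s0 {bs e' E sE nb} (sE) l => [|s t'] // _ sE; rewrite last_rcons => tE.
exists r; rewrite size_rcons addnS /= -(drop_cat_size (s := s) (r := T1 :: r)) //.
by rewrite e -sE tE cat_rcons.
Qed.

Lemma cmp_pnat G (f : cX G -> nat) : cmp f -> cmp (fun x => pnat (cinp x) (f x)).
Proof.
move=> cf; rewrite /pnat /nend /isbit.
have c1 : cmp (fun x => f x + find (fun k => ~~ ((tk (cinp x) (f x + k) == 1) || (tk (cinp x) (f x + k) == 2)))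
      (iota 0 (size (cinp x)).+1)) by cmp_tac.
by cmp_tac.
Qed.

Definition parg w i := let j := pnat w i in if (j != 0) && (tk w j == 3) then j.+1 else 0.

Lemma parg_spec : pspec enc_arg (fun=> True) parg.
Proof.
split.
- move=> w i; rewrite /parg; case: ifP => // /andP[/pnat_sound[d [e E _]] /(tkP _ _ TSep)[r er]] _.
  exists d; rewrite /enc_arg size_cat addn1 addnS -E -catA; split=> //.
  by rewrite e er -add1n -drop_drop er drop1.
- move=> w i d r _; rewrite /enc_arg -catA => e; rewrite /parg (pnat_complete e) //.
  have -> : tk w (i + size (enc_nat d)) == 3.
    by apply/(tkP _ _ TSep); exists r; rewrite -(drop_cat_size e).
  have [t [u [-> _]]] := enc_nat_head d.
  by rewrite andbT ifT ?size_cat /=; lia.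
- by move=> d; rewrite /enc_arg size_cat addn1.
- by move=> w i; rewrite /parg; case: ifP => // /andP[_ h]; apply: tk_lt; rewrite (eqP h).
- by move=> G f cf; have c1 := cmp_pnat cf; rewrite /parg; cmp_tac.
Qed.

(** The rejected case is a minus sign before the numeral of 0, which is the code of no integer. *)
Definition pZ w i :=
  if tk w i == 6 then
    if (tk w i.+1 == 1) && (pnat w i.+1 == i.+2) then 0 else pnat w i.+1
  else pnat w i.

Lemma enc_Z_cases z : (0 <= z)%Z /\ enc_Z z = enc_nat (Z.to_nat z) \/
  (z < 0)%Z /\ enc_Z z = TNeg :: enc_nat (Z.to_nat (- z)).
Proof.
case: z => [|q|q]; [by left|left|right]; split=> //; rewrite /enc_nat /=.
  by rewrite positive_nat_N.
by rewrite positive_nat_N.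
Qed.

Lemma pZ_sound w i : pZ w i != 0 ->
  exists z, [/\ drop i w = enc_Z z ++ drop (pZ w i) w, pZ w i = i + size (enc_Z z)
   & nobit (drop (pZ w i) w)].
Proof.
rewrite /pZ; case: ifP => [/(tkP _ _ TNeg)[r er]|_]; last first.
  move=> /pnat_sound[d [e E nb]]; exists (Z.of_nat d).
  have [[_ ->]|[]] := enc_Z_cases (Z.of_nat d); last by lia.
  by rewrite Nat2Z.id.
case: ifP => // nz /pnat_sound[d [e E nb]]; exists (- Z.of_nat d)%Z.
have d0 : 0 < d.
  case: d e E {nb} => // e E; move: nz; rewrite E addn1 eqxx andbT.
  by have -> : tk w i.+1 == 1 by apply/(tkP _ _ T0); rewrite e; eexists.
have [[]|[_ ->]] := enc_Z_cases (- Z.of_nat d)%Z; first by lia.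
have -> : Z.to_nat (- - Z.of_nat d) = d by lia.
split=> //=; last by rewrite E; lia.
by rewrite -e er -add1n -drop_drop er drop1.
Qed.

Lemma pZ_complete w i z r : drop i w = enc_Z z ++ r -> nobit r -> pZ w i = i + size (enc_Z z).
Proof.
have [[z0 ->]|[z0 ->]] := enc_Z_cases z => e nr; rewrite /pZ.
  rewrite ifF; first exact: pnat_complete nr.
  apply/negP => /(tkP _ _ TNeg)[r' e']; have [t [u [eN bt]]] := enc_nat_head (Z.to_nat z).
  by move: e'; rewrite e eN /= => -[tE _]; rewrite tE in bt.
have -> : tk w i == 6 by apply/(tkP _ _ TNeg); rewrite e; eexists.
have e' : drop i.+1 w = enc_nat (Z.to_nat (- z)) ++ r by rewrite -add1n -drop_drop e /= drop0.
rewrite (pnat_complete e') // ifF; first by rewrite /=; lia.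
apply/negP => /andP[/(tkP _ _ T0)[r' er'] /eqP sz].
have := @enc_nat_half (Z.to_nat (- z)); rewrite ?/is_true; case: ltnP => // h; last by lia.
move=> /(_ erefl) eN; move: sz er'; rewrite e' eN /=.
case: ifP => [/eqP h2 _|h2].
  by have -> : Z.to_nat (- z) = 1 by lia.
have [t [u [-> _]]] := enc_nat_head (Z.to_nat (- z) %/ 2); rewrite /=; lia.
Qed.

Lemma cmp_pZ G (f : cX G -> nat) : cmp f -> cmp (fun x => pZ (cinp x) (f x)).
Proof.
move=> cf; have c1 := cmp_pnat cf; have c2 := cmp_pnat (cmp_succ cf).
by rewrite /pZ; cmp_tac.
Qed.

Definition apre (R : relsym) : seq tok :=
  TOpen :: enc_nat R.1 ++ TSep :: enc_nat R.2 ++ [:: TSep; TOpen].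

Lemma enc_atomE a : enc_atom a = apre a.1 ++ flatten (map enc_arg a.2) ++ [:: TClose; TClose].
Proof. by rewrite /enc_atom /apre /enc_tuple /= -?catA /= -?catA /= -?catA. Qed.

(** Name and arity are matched as one fixed word. The program has finitely many EDB relations, so
    the parsers for all of them can be combined by [pspec_or]. *)
Definition patomR (R : relsym) w i :=
  let a := i + size (apre R) in let j := pos parg w a R.2 in
  if [&& lit w i (apre R), all (fun k => parg w (pos parg w a k) != 0) (iota 0 R.2)
       & lit w j [:: TClose; TClose]] then j + 2 else 0.

Lemma patomR_spec R : pspec enc_atom (fun a => a.1 = R /\ size a.2 = R.2) (patomR R).
Proof.
split.
- move=> w i; rewrite /patomR; case: ifP => // /and3P[/litP[r e] /allP h /litP[r' e']] _.
  have [|ds [h1 _ h3 h4]] := @posn_sound _ _ _ _ parg_spec w (i + size (apre R)) R.2.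
    by move=> k kR; apply: h; rewrite mem_iota.
  exists (R, ds); rewrite enc_atomE; split=> //.
    rewrite e (drop_cat_size e) h3 e' -!catA; do 3!congr (_ ++ _).
    exact: (drop_cat_size e').
  by rewrite h4 !size_cat /=; lia.
- move=> w i a r [RE sz]; rewrite enc_atomE -!catA RE => e.
  have e1 := esym (drop_cat_size e).
  have nc x s : True -> [:: TClose; TClose] ++ r <> enc_arg x ++ s by move=> _; exact: enc_arg_noclose.
  have pE := posE parg_spec (fun _ _ => I) e1 (leqnn _); rewrite take_size sz in pE.
  rewrite /patomR pE.
  have -> : lit w i (apre R) by apply/litP; eexists; exact: e.
  have -> : lit w (i + size (apre R) + size (flatten (map enc_arg a.2))) [:: TClose; TClose].
    by apply/litP; exists r; rewrite -(drop_cat_size e1).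
  rewrite ifT; first by rewrite !size_cat /=; lia.
  rewrite /= andbT; apply/allP => k; rewrite mem_iota /= => kR.
  by rewrite (pos_block parg_spec 0 (fun _ _ => I) e1 nc) sz.
- by move=> a; rewrite enc_atomE.
- move=> w i; rewrite /patomR; case: ifP => // /and3P[_ _]; set j := pos _ _ _ _.
  by rewrite /= => /and3P[_ /eqP h _]; have := @tk_lt w j.+1; rewrite h; lia.
- move=> G f cf; rewrite /patomR.
  have c0 : cmp (fun x => f x + size (apre R)) by cmp_tac.
  have c1 k : cmp (fun x => pos parg (cinp x) (f x + size (apre R)) k).
    exact: (cmp_pos parg_spec c0 (cmp_const _ k)).
  have c2 k := ps_cmp parg_spec (c1 k).
  have c3 := cmp_lit (apre R) cf; have c4 := cmp_lit [:: TClose; TClose] (c1 R.2).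
  by apply: cmp_if; [apply: cmp_and => //; apply: cmp_and => //; apply: cmp_all_const => k _; have := c2 k => ?|..]; cmp_tac.
Qed.

Section Or.
Variables (T : Type) (enc : T -> seq tok).
Hypothesis encI : forall x x' r r', enc x ++ r = enc x' ++ r' -> x = x' /\ r = r'.

Lemma pspec_none : (forall x, 0 < size (enc x)) -> pspec enc (fun=> False) (fun _ _ => 0).
Proof. by move=> h; split=> // G f _; exact: cmp_const. Qed.

(** If the first parser succeeds on a block meant for the second one, unique decoding makes both
    find the same block. *)
Lemma pspec_or ok1 ok2 P1 P2 : pspec enc ok1 P1 -> pspec enc ok2 P2 ->
  pspec enc (fun x => ok1 x \/ ok2 x) (fun w i => if P1 w i != 0 then P1 w i else P2 w i).
Proof.
move=> s1 s2; split.
- move=> w i; case: ifP => [/(ps_sound s1)[x [o e E]] _|_ /(ps_sound s2)[x [o e E]]].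
    by exists x; split=> //; left.
  by exists x; split=> //; right.
- move=> w i x r [o|o] e.
    by rewrite (ps_complete s1 o e); have := ps_pos s1 x; case: ifP => //; lia.
  case: ifP => [/(ps_sound s1)[x' [o' e' E]]|_]; last exact: (ps_complete s2 o e).
  by have [|<- _] := @encI x' x (drop (P1 w i) w) r; rewrite -?e' -?e.
- exact: (ps_pos s1).
- by move=> w i; case: ifP => _; [exact: (ps_le s1)|exact: (ps_le s2)].
- by move=> G f cf; have c1 := ps_cmp s1 cf; have c2 := ps_cmp s2 cf; cmp_tac.
Qed.
End Or.

Section Prog.
Variable p : program.

Definition edbs : seq relsym := [seq R <- rels p | ~~ idb p R].

Lemma edbsP R : (R \in edbs) = edb p R.
Proof. by rewrite mem_filter andbC. Qed.

Definition patom : seq tok -> nat -> nat :=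
  foldr (fun R P w i => if patomR R w i != 0 then patomR R w i else P w i) (fun _ _ => 0) edbs.

Definition okatom (a : atom) : Prop := wf_atom a /\ edb p a.1.

Lemma patom_spec : pspec enc_atom okatom patom.
Proof.
suff h : pspec enc_atom (fun a => wf_atom a /\ a.1 \in edbs) patom.
  by apply: pspec_iff h => a; rewrite edbsP.
rewrite /patom; elim: edbs => [|R s IH] /=.
  apply: (@pspec_iff _ _ (fun=> False)); first by move=> a; rewrite in_nil; split=> // -[].
  by apply: pspec_none => a.
have := pspec_or enc_atom_inj (patomR_spec R) IH; apply: pspec_iff => a; rewrite inE /wf_atom /arity.
split=> [[[<- ->]|[-> ->]]|[h /orP[/eqP e|->]]]; rewrite ?eqxx ?orbT //.
  by left; rewrite -e.
by right.
Qed.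

Definition pset := pbracket patom.
Definition ptuple := pbracket parg.

Lemma pset_spec : pspec enc_set (fun s => forall a, List.In a s -> okatom a) pset.
Proof. by apply: (pbracket_spec patom_spec) => a s r; exact: enc_atom_noclose. Qed.

Lemma ptuple_spec : pspec enc_tuple (fun=> True) ptuple.
Proof.
have := pbracket_spec parg_spec (fun x s r => @enc_arg_noclose x s r).
by apply: pspec_iff => ds; split.
Qed.

Definition pS0 w := (pZ w 0).+1.
Definition pU0 w := (pstar pset w (pS0 w)).+1.
Definition pU1 w := ptuple w (pU0 w).

(** Since 0 means failure, reaching the end of the word counts as success of the last parser only if
    the word is not empty. *)
Definition wellformed w := [&& pZ w 0 != 0, tk w (pZ w 0) == 3,
  tk w (pstar pset w (pS0 w)) == 3, pU1 w != 0 & (pZ w (pU1 w) == size w) && (size w != 0)].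

Lemma wellformed_sound w : wellformed w ->
  exists D ds t, w = enc_input D ds t /\ forall a, a \in flatten (tsets D) -> okatom a.
Proof.
move=> /and5P[/pZ_sound[l [e1 E1 _]] /(tkP _ _ TSep)[r1 er1] /(tkP _ _ TSep)[r2 er2]].
move=> /(ps_sound ptuple_spec)[ds [_ e3 E3]] /andP[/eqP e4 w0].
have [|t [e5 E5 _]] := @pZ_sound w (pU1 w); first by rewrite e4.
have [ss [h1 e2 E2]] := pos_sound pset_spec w (pS0 w) (size w); rewrite -/(pstar _ _ _) in e2.
have er1' : r1 = drop (pS0 w) w by rewrite /pS0 -add1n -drop_drop er1 drop1.
have er2' : r2 = drop (pU0 w) w by rewrite /pU0 -add1n -drop_drop er2 drop1.
exists (TDB l ss), ds, t; split.
  rewrite /enc_input /enc_db /= -!catA -{1}[w]drop0 e1 er1 er1' e2 er2 er2' e3 -/(pU1 w) e5 e4.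
  by rewrite drop_size cats0 /= -!catA.
by move=> a /flattenP[s /In_mem sS /In_mem aS]; exact: h1 sS _ aS.
Qed.

Section Layout.
Variables (D : tdb) (ds : seq nat) (t : Z) (w : seq tok).
Hypothesis wE : w = enc_input D ds t.
Hypothesis okD : forall a, a \in flatten (tsets D) -> okatom a.

Lemma okset s : List.In s (tsets D) -> forall a, List.In a s -> okatom a.
Proof. by move=> /In_mem h a /In_mem ha; apply: okD; apply/flattenP; exists s. Qed.

Let rest := TSep :: enc_tuple ds ++ enc_Z t.

Lemma lay_Z : pZ w 0 = size (enc_Z (tl D)) /\
  drop (pS0 w) w = flatten (map enc_set (tsets D)) ++ rest.
Proof.
have e : drop 0 w = enc_Z (tl D) ++ TSep :: flatten (map enc_set (tsets D)) ++ rest.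
  by rewrite drop0 wE /enc_input /enc_db /rest -!catA /= -!catA.
have pE : pZ w 0 = size (enc_Z (tl D)) by rewrite (pZ_complete e).
split=> //; have := drop_cat_size e; rewrite add0n -pE => e'.
by rewrite /pS0 -add1n -drop_drop -e' drop1.
Qed.

Lemma rest_noset s r : (forall a, List.In a s -> okatom a) -> rest <> enc_set s ++ r.
Proof. by []. Qed.

Lemma lay_U0 : drop (pU0 w) w = enc_tuple ds ++ enc_Z t.
Proof.
have [_ e] := lay_Z.
rewrite /pU0 (pstar_complete pset_spec okset e); last by move=> s r; exact: rest_noset.
by rewrite -add1n -drop_drop -(drop_cat_size e) drop1.
Qed.

Lemma lay_U1 : pU1 w = pU0 w + size (enc_tuple ds) /\ drop (pU1 w) w = enc_Z t.
Proof.
have e := lay_U0; have pE := ps_complete ptuple_spec I e; split=> //.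
by rewrite /pU1 pE -(drop_cat_size e).
Qed.

Lemma lay_end : pZ w (pU1 w) = size w.
Proof.
have [_ e] := lay_U1; rewrite (@pZ_complete w (pU1 w) t [::]) ?cats0 //.
have := congr1 size e; rewrite size_drop; have : 0 < size (enc_Z t).
  by case: (t) => [|q|q] //; case: q.
lia.
Qed.

Lemma layout_wellformed : wellformed w.
Proof.
have [pE e] := lay_Z; have [U1E eU] := lay_U1.
have zs z : 0 < size (enc_Z z) by case: z => [|q|q] //; case: q.
apply/and5P; split.
- by rewrite pE -lt0n zs.
- apply/(tkP _ _ TSep); eexists; rewrite pE -[size _]add0n.
  by symmetry; apply: drop_cat_size; rewrite drop0 wE /enc_input /enc_db -!catA /=.
- rewrite (pstar_complete pset_spec okset e); last by move=> s r; exact: rest_noset.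
  by apply/(tkP _ _ TSep); eexists; rewrite -(drop_cat_size e).
- by rewrite U1E /enc_tuple /=; lia.
- rewrite lay_end eqxx; have := congr1 size eU; rewrite size_drop; have := zs t; lia.
Qed.
End Layout.
End Prog.

(** * Objects and facts as positions of the input *)

Definition acode (N : nat) (xs : seq nat) : nat := tcode N (size xs) (nth 0 xs).

Lemma acode_digit N xs i : 0 < N -> all (fun x => x < N) xs -> i < size xs ->
  acode N xs %/ N ^ i %% N = nth 0 xs i.
Proof.
move=> N0 h; apply: tcode_digit => // k; have [ks|ks] := ltnP k (size xs).
  exact: (all_nthP 0 h).
by rewrite nth_default.
Qed.

Lemma acode_lt N xs : 0 < N -> all (fun x => x < N) xs -> acode N xs < N ^ size xs.
Proof.
move=> N0 h; apply: tcode_lt => // k; have [ks|ks] := ltnP k (size xs).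
  exact: (all_nthP 0 h).
by rewrite nth_default.
Qed.

Lemma acode_inj N xs ys : 0 < N -> all (fun x => x < N) xs -> all (fun x => x < N) ys ->
  size xs = size ys -> acode N xs = acode N ys -> xs = ys.
Proof.
move=> N0 hx hy sz e; apply: (@eq_from_nth _ 0) => // i ix.
by rewrite -(acode_digit N0 hx ix) e acode_digit // -sz.
Qed.

Lemma acode_digits N xs a : 0 < N -> a < N ^ size xs ->
  (forall i, i < size xs -> a %/ N ^ i %% N = nth 0 xs i) -> a = acode N xs.
Proof.
move=> N0; elim: xs a => [|x xs IH] a /=; first by rewrite expn0 ltnS leqn0 => /eqP.
rewrite expnSr => aN h; rewrite {1}(divn_eq a N) addnC; have := h 0 isT; rewrite divn1 => /= ->.
rewrite mulnC [in LHS](IH (a %/ N)) //; first by rewrite ltn_divLR.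
by move=> i ix; rewrite -divnMA -expnS; exact: (h i.+1).
Qed.

Section Positions.
Variable p : program.

Definition sl w j := pos (pset p) w (pS0 w) j.
Definition atp w j l := pos (patom p) w (sl w j).+1 l.
Definition arp w q R i := pos parg w (q + size (apre R)) i.
Definition hasatom w j l R :=
  [&& pset p w (sl w j) != 0, patom p w (atp w j l) != 0 & lit w (atp w j l) (apre R)].
Definition isarg w (x : nat) :=
  has (fun j => has (fun l => has (fun R => hasatom w j l R &&
      has (fun i => x == arp w (atp w j l) R i) (iota 0 R.2)) (edbs p))
    (iota 0 (size w).+1)) (iota 0 (size w).+1).
Definition same w x y := (parg w x - x == parg w y - y) &&
  all (fun k => tk w (x + k) == tk w (y + k)) (iota 0 (parg w x - x)).
(** Object names may be exponentially large numbers, so an object is represented by the position of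
    its first occurrence as an argument of a fact. The value is [size w] if there is none, as for an
    entry of the query tuple that is foreign to the database. *)
Definition cpos w y := find (fun x => isarg w x && same w x y) (iota 0 (size w)).
Definition canon w (x : nat) := isarg w x && (cpos w x == x).
Definition factb w j R a :=
  has (fun l => hasatom w j l R && all (fun i =>
    cpos w (arp w (atp w j l) R i) == a %/ (size w).+1 ^ i %% (size w).+1) (iota 0 R.2))
  (iota 0 (size w).+1).
Definition nsl w := find (fun j => pset p w (sl w j) == 0) (iota 0 (size w).+1).
Definition qp w i := pos parg w (pU0 p w).+1 i.

Definition dflt_atom : atom := ((0, 0), [::]).

Section Layout.
Variables (D : tdb) (ds : seq nat) (t : Z) (w : seq tok).
Hypothesis wE : w = enc_input D ds t.
Hypothesis okD : forall a, a \in flatten (tsets D) -> okatom p a.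

Let S j := nth [::] (tsets D) j.
Let n := size w.

Lemma slice_ok j : (pset p w (sl w j) != 0) = (j < size (tsets D)).
Proof.
have [_ e] := lay_Z wE; apply: (pos_block (pset_spec p) [::] (okset okD) e).
by move=> s r; exact: rest_noset.
Qed.

Lemma slice_drop j : j < size (tsets D) ->
  exists r, drop (sl w j).+1 w = flatten (map enc_atom (S j)) ++ TClose :: r.
Proof.
move=> js; have [_ e] := lay_Z wE.
have := pos_nth (pset_spec p) [::] (okset okD) e js; rewrite -/(sl w j) => e'.
by rewrite -add1n -drop_drop e' /enc_set /= drop0 -catA; eexists.
Qed.

Lemma slice_okatom j : j < size (tsets D) -> forall a, List.In a (S j) -> okatom p a.
Proof. by move=> js; apply: (okset okD); exact: In_nth. Qed.

Lemma atom_ok j l : j < size (tsets D) -> (patom p w (atp w j l) != 0) = (l < size (S j)).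
Proof.
move=> js; have [r e] := slice_drop js.
apply: (pos_block (patom_spec p) dflt_atom (slice_okatom js) e).
by move=> a s _; exact: enc_atom_noclose.
Qed.

Lemma atom_drop j l : j < size (tsets D) -> l < size (S j) ->
  exists r, drop (atp w j l) w = enc_atom (nth dflt_atom (S j) l) ++ r.
Proof.
move=> js ls; have [r e] := slice_drop js; eexists.
exact: (pos_nth (patom_spec p) dflt_atom (slice_okatom js) e ls).
Qed.

Lemma apre_inj R R' r r' : apre R ++ r = apre R' ++ r' -> R = R'.
Proof.
case: R R' => [a b] [a' b']; rewrite /apre /= => -[]; rewrite -!catA /= -!catA.
by move=> /enc_nat_inj[] // -> [] /enc_nat_inj[] // ->.
Qed.

Lemma hasatomP j l R : hasatom w j l R <->
  [/\ j < size (tsets D), l < size (S j) & (nth dflt_atom (S j) l).1 = R].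
Proof.
rewrite /hasatom slice_ok; split=> [/and3P[js]|[js ls <-]].
  rewrite atom_ok // => ls /litP[r e]; split=> //.
  have [r' e'] := atom_drop js ls; move: e'; rewrite e enc_atomE -!catA.
  by move=> /apre_inj ->.
apply/and3P; split=> //; first by rewrite atom_ok.
by apply/litP; have [r ->] := atom_drop js ls; rewrite enc_atomE -!catA; eexists.
Qed.

Lemma arg_drop j l i : let a := nth dflt_atom (S j) l in
  j < size (tsets D) -> l < size (S j) -> i < size a.2 ->
  exists r, drop (arp w (atp w j l) a.1 i) w = enc_arg (nth 0 a.2 i) ++ r.
Proof.
move=> a js ls ia; have [r] := atom_drop js ls; rewrite -/a enc_atomE -!catA => e.
have e1 := esym (drop_cat_size e); eexists.
exact: (pos_nth parg_spec 0 (fun _ _ => I) e1 ia).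
Qed.

Lemma arg_size (a : atom) j l : j < size (tsets D) -> l < size (S j) ->
  a = nth dflt_atom (S j) l -> size a.2 = a.1.2.
Proof. by move=> js ls ->; have [-> _] := slice_okatom js (In_nth dflt_atom ls). Qed.

Lemma slices_le : size (tsets D) <= n /\ forall j, j < size (tsets D) -> size (S j) <= n.
Proof.
have [_ e] := lay_Z wE; split.
  apply: leq_trans (size_flatten_ge (pset_spec p) _) _; have := congr1 size e.
  by rewrite size_drop size_cat /n; lia.
move=> j js; have [r e'] := slice_drop js.
apply: leq_trans (size_flatten_ge (patom_spec p) _) _; have := congr1 size e'.
by rewrite size_drop size_cat /n; lia.
Qed.

Lemma isargP x : isarg w x <-> exists j l i,
  let a := nth dflt_atom (S j) l in
  [/\ j < size (tsets D), l < size (S j), i < size a.2 & x = arp w (atp w j l) a.1 i].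
Proof.
have [sl1 sl2] := slices_le; split.
  move=> /hasP[j _ /hasP[l _ /hasP[R _ /andP[/hasatomP[js ls <-] /hasP[i]]]]].
  rewrite mem_iota add0n /= => ir /eqP ->; exists j, l, i; split=> //.
  by rewrite (arg_size js ls erefl).
move=> [j [l [i [js ls ia ->]]]]; have ls' := sl2 _ js.
apply/hasP; exists j; first by rewrite mem_iota; move: sl1; rewrite /n; lia.
apply/hasP; exists l; first by rewrite mem_iota; move: ls'; rewrite /n; lia.
apply/hasP; exists (nth dflt_atom (S j) l).1.
  by rewrite edbsP; have [_ ->] := slice_okatom js (In_nth dflt_atom ls).
apply/andP; split; first exact/hasatomP.
by apply/hasP; exists i; rewrite ?eqxx // mem_iota -(arg_size js ls erefl).
Qed.

Lemma isarg_obj x : isarg w x -> exists2 d, d \in objs D & lit w x (enc_arg d).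
Proof.
move=> /isargP[j [l [i [js ls ia ->]]]]; set a := nth _ _ _ in ia *.
exists (nth 0 a.2 i); last by apply/litP; exact: arg_drop.
apply/flattenP; exists a.2; last exact: mem_nth.
apply/mapP; exists a => //; apply/flattenP; exists (S j); first exact: mem_nth.
exact: mem_nth.
Qed.

Lemma obj_isarg d : d \in objs D -> exists2 x, isarg w x & lit w x (enc_arg d).
Proof.
move=> /flattenP[da /mapP[a /flattenP[s ss sa] ->] dd].
have js : index s (tsets D) < size (tsets D) by rewrite index_mem.
have sE : S (index s (tsets D)) = s by rewrite /S nth_index.
have ls : index a (S (index s (tsets D))) < size (S (index s (tsets D))) by rewrite sE index_mem.
have aE : nth dflt_atom (S (index s (tsets D))) (index a (S (index s (tsets D)))) = a.
  by rewrite nth_index // sE.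
have ii : index d a.2 < size a.2 by rewrite index_mem.
exists (arp w (atp w (index s (tsets D)) (index a (S (index s (tsets D))))) a.1 (index d a.2)).
  by apply/isargP; exists (index s (tsets D)), (index a (S (index s (tsets D)))), (index d a.2); rewrite aE.
apply/litP; have := @arg_drop _ _ (index d a.2) js ls; rewrite aE => /(_ ii).
by rewrite nth_index.
Qed.

Lemma lit_lt x d : lit w x (enc_arg d) -> x < n.
Proof.
move=> /litP[r e]; have := congr1 size e; rewrite size_drop size_cat.
by have := ps_pos parg_spec d; rewrite /n; lia.
Qed.

Lemma lit_uniq x d d' : lit w x (enc_arg d) -> lit w x (enc_arg d') -> d = d'.
Proof. by move=> /litP[r e] /litP[r']; rewrite e => /enc_arg_inj[]. Qed.

Lemma sameE x y d d' : lit w x (enc_arg d) -> lit w y (enc_arg d') -> same w x y = (d == d').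
Proof.
move=> /litP[r e] /litP[r' e']; rewrite /same.
rewrite (ps_complete parg_spec I e) (ps_complete parg_spec I e') !addKn.
have tkE z s u k : drop z w = s ++ u -> k < size s -> tk w (z + k) = tokn (Some (nth T0 s k)).
  move=> ez ks; rewrite tk_drop addnC -drop_drop ez; congr tokn.
  by rewrite drop_cat ks; case E: (drop k s) (drop_nth T0 ks) => [|c v] -> //=.
apply/andP/eqP => [[/eqP sz /allP h]|dd]; last subst d'.
  suff : enc_arg d = enc_arg d' by move=> e1; have [] := @enc_arg_inj d d' [::] [::]; rewrite ?e1.
  apply: (@eq_from_nth _ T0) => // k ks; have := h k; rewrite mem_iota add0n ks => /(_ isT) /eqP.
  by rewrite (tkE _ _ _ _ e ks) (tkE _ _ _ _ e') -?sz // => /tokn_inj[].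
split=> //; apply/allP => k; rewrite mem_iota add0n => /andP[_ k1].
by rewrite (tkE _ _ _ _ e k1) (tkE _ _ _ _ e' k1).
Qed.

Definition cp o := find (fun x => isarg w x && lit w x (enc_arg o)) (iota 0 n).

Lemma cposE y o : lit w y (enc_arg o) -> cpos w y = cp o.
Proof.
move=> yo; apply: eq_find => x; case ax: (isarg w x) => //=.
have [d _ xd] := isarg_obj ax; rewrite (sameE xd yo); apply/eqP/idP => [<- //|xo].
exact: lit_uniq xd xo.
Qed.

Lemma cp_obj o : o \in objs D -> [/\ cp o < n, isarg w (cp o) & lit w (cp o) (enc_arg o)].
Proof.
move=> /obj_isarg[x ax xo].
have h : has (fun x => isarg w x && lit w x (enc_arg o)) (iota 0 n).
  by apply/hasP; exists x; rewrite ?ax // mem_iota; exact: lit_lt xo.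
have lt : cp o < n by move: h; rewrite has_find size_iota.
by have /andP[] := nth_find 0 h; rewrite -/(cp o) nth_iota.
Qed.

Lemma cp_inj o o' : o \in objs D -> o' \in objs D -> cp o = cp o' -> o = o'.
Proof.
move=> /cp_obj[_ _ h] /cp_obj[_ _ h'] e; rewrite e in h; exact: lit_uniq h h'.
Qed.

Lemma canonP x : canon w x <-> exists2 o, o \in objs D & x = cp o.
Proof.
split=> [/andP[/isarg_obj[d dD xd] /eqP <-]|[o oD ->]].
  by exists d => //; rewrite (cposE xd).
by have [_ h1 h2] := cp_obj oD; rewrite /canon h1 (cposE h2) eqxx.
Qed.

Lemma cp_all os : all (fun d => d \in objs D) os -> all (fun x => x < n.+1) (map cp os).
Proof.
move=> /allP h; apply/allP => x /mapP[o /h /cp_obj[lt _ _] ->]; lia.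
Qed.

Lemma map_cp_inj os os' : all (fun d => d \in objs D) os -> all (fun d => d \in objs D) os' ->
  map cp os = map cp os' -> os = os'.
Proof.
elim: os os' => [|o os IH] [|o' os'] //= /andP[h1 h2] /andP[h3 h4] [/cp_inj -> // /IH ->] //.
Qed.

Lemma cpos_arp j l i : let a := nth dflt_atom (S j) l in j < size (tsets D) -> l < size (S j) ->
  i < size a.2 -> cpos w (arp w (atp w j l) a.1 i) = cp (nth 0 a.2 i).
Proof. by move=> a js ls ia; apply: cposE; apply/litP; exact: arg_drop. Qed.

(** [factb] inspects only the lowest [R.2] digits; the bound on [a] excludes further ones, so that
    [a] is determined by the fact. *)
Lemma factb_decode j R a : factb w j R a -> a < n.+1 ^ R.2 -> exists os,
  [/\ j < size (tsets D), List.In (R, os) (S j) & a = acode n.+1 (map cp os)].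
Proof.
move=> /hasP[l _ /andP[/hasatomP[js ls RE] /allP h]] an; exists (nth dflt_atom (S j) l).2.
have szl := arg_size js ls erefl.
split=> //; first by rewrite -RE -surjective_pairing; exact: In_nth.
apply: acode_digits => //; rewrite size_map szl RE // => i iR.
have := h i; rewrite mem_iota add0n iR => /(_ isT)/eqP <-.
by rewrite -{1}RE cpos_arp ?szl ?RE // (nth_map 0) ?szl ?RE.
Qed.

Lemma factbP j R os : size os = R.2 -> all (fun d => d \in objs D) os ->
  factb w j R (acode n.+1 (map cp os)) <-> j < size (tsets D) /\ List.In (R, os) (S j).
Proof.
move=> sz oD; have [sl1 sl2] := slices_le.
split.
  move=> /hasP[l _ /andP[/hasatomP[js ls RE] /allP h]]; split=> //.
  have szl := arg_size js ls erefl.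
  suff -> : (R, os) = nth dflt_atom (S j) l by exact: In_nth.
  rewrite [RHS]surjective_pairing RE; congr pair.
  apply: (@eq_from_nth _ 0) => [|i io]; first by rewrite sz -RE szl.
  have iR : i < R.2 by rewrite -sz.
  have := h i; rewrite mem_iota add0n iR => /(_ isT); rewrite -/n acode_digit ?size_map //; last exact: cp_all.
  rewrite (nth_map 0) // -RE cpos_arp ?szl ?RE // => /eqP/cp_inj -> //.
    apply/flattenP; exists (nth dflt_atom (S j) l).2.
      apply/mapP; exists (nth dflt_atom (S j) l) => //; apply/flattenP; exists (S j); exact: mem_nth.
    by apply: mem_nth; rewrite szl RE.
  exact: (all_nthP 0 oD).
move=> [js /In_mem aS]; have ls : index (R, os) (S j) < size (S j) by rewrite index_mem.
have aE : nth dflt_atom (S j) (index (R, os) (S j)) = (R, os) by rewrite nth_index.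
apply/hasP; exists (index (R, os) (S j)); first by rewrite mem_iota; have := sl2 _ js; rewrite /n; lia.
apply/andP; split; first by apply/hasatomP; rewrite aE.
apply/allP => i; rewrite mem_iota add0n => /andP[_ iR].
rewrite -/n acode_digit ?size_map ?sz //; last exact: cp_all.
by have := @cpos_arp _ _ i js ls; rewrite aE /= sz (nth_map 0) ?sz // => ->.
Qed.

Lemma nslE : nsl w = size (tsets D).
Proof.
have [h _] := slices_le; rewrite /nsl.
set P := (fun j => _); have PE j : P j = (size (tsets D) <= j).
  by rewrite /P -[_ == 0]negbK slice_ok -leqNgt.
have hP : has P (iota 0 n.+1) by apply/hasP; exists (size (tsets D)); rewrite ?PE // mem_iota; lia.
have fs : find P (iota 0 n.+1) < n.+1 by move: hP; rewrite has_find size_iota.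
have := nth_find 0 hP; rewrite nth_iota // add0n PE => h1.
apply/eqP; rewrite eqn_leq h1 andbT leqNgt; apply/negP => h2.
by have := before_find 0 h2; rewrite nth_iota ?add0n ?PE ?leqnn //; lia.
Qed.

Lemma query_drop : exists r, drop (pU0 p w).+1 w = flatten (map enc_arg ds) ++ TClose :: r.
Proof.
by rewrite -add1n -drop_drop (lay_U0 wE okD) /enc_tuple /= drop0 -catA; eexists.
Qed.

Lemma qp_ok i : (parg w (qp w i) != 0) = (i < size ds).
Proof.
have [r e] := query_drop; apply: (pos_block parg_spec 0 (fun _ _ => I) e).
by move=> d s _; exact: enc_arg_noclose.
Qed.

Lemma qp_lit i : i < size ds -> lit w (qp w i) (enc_arg (nth 0 ds i)).
Proof.
move=> ids; have [r e] := query_drop; apply/litP; eexists.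
exact: (pos_nth parg_spec 0 (fun _ _ => I) e ids).
Qed.

Lemma cpos_lt y o : lit w y (enc_arg o) -> (cpos w y < n) = (o \in objs D).
Proof.
move=> yo; rewrite (cposE yo); apply/idP/idP => [lt|/cp_obj[]//].
have h : has (fun x => isarg w x && lit w x (enc_arg o)) (iota 0 n) by rewrite has_find size_iota.
have /andP[] := nth_find 0 h; rewrite -/(cp o) nth_iota // add0n => /isarg_obj[d dD h1] h2.
by rewrite (lit_uniq h2 h1).
Qed.
End Layout.

Lemma cmp_sl G (f : cX G -> nat) : cmp f -> cmp (fun x => sl (cinp x) (f x)).
Proof.
move=> cf; apply: (cmp_pos (pset_spec p)) => //; rewrite /pS0; apply: cmp_succ.
exact: (cmp_pZ (cmp_const _ 0)).
Qed.

Lemma cmp_atp G (f h : cX G -> nat) : cmp f -> cmp h -> cmp (fun x => atp (cinp x) (f x) (h x)).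
Proof. by move=> cf ch; apply: (cmp_pos (patom_spec p)) => //; apply: cmp_succ; exact: cmp_sl. Qed.

Lemma cmp_arp G (f : cX G -> nat) R i : cmp f -> cmp (fun x => arp (cinp x) (f x) R i).
Proof. by move=> cf; apply: (cmp_pos parg_spec); cmp_tac. Qed.

Lemma cmp_hasatom G (f h : cX G -> nat) R : cmp f -> cmp h ->
  cmpb G (fun x => hasatom (cinp x) (f x) (h x) R).
Proof.
move=> cf ch; have c1 := cmp_sl cf; have c2 := cmp_atp cf ch.
have c3 := ps_cmp (pset_spec p) c1; have c4 := ps_cmp (patom_spec p) c2; have c5 := cmp_lit (apre R) c2.
by rewrite /hasatom; cmp_tac.
Qed.

Lemma cmp_isarg G (f : cX G -> nat) : cmp f -> cmpb G (fun x => isarg (cinp x) (f x)).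
Proof.
move=> cf; rewrite /isarg; cmp_step; first by cmp_tac.
cmp_step; first by cmp_tac.
apply: cmp_has_const => R _; set G' := ext _.
have cj : @cmp G' (fun y => y.1.2) by cmp_tac.
have cl : @cmp G' (fun y => y.2) by cmp_tac.
have ch := cmp_hasatom R cj cl; have ca := cmp_atp cj cl.
apply: cmp_and => //; apply: cmp_has_const => i _.
by have c := cmp_arp R i ca; cmp_tac.
Qed.

Lemma cmp_same G (f h : cX G -> nat) : cmp f -> cmp h ->
  cmpb G (fun x => same (cinp x) (f x) (h x)).
Proof.
by move=> cf ch; have c1 := ps_cmp parg_spec cf; have c2 := ps_cmp parg_spec ch; rewrite /same; cmp_tac.
Qed.

Lemma cmp_cpos G (f : cX G -> nat) : cmp f -> cmp (fun x => cpos (cinp x) (f x)).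
Proof.
move=> cf; rewrite /cpos; cmp_step; first by cmp_tac.
set G' := ext _.
have cx : @cmp G' (fun y => y.2) by cmp_tac.
have cf' : @cmp G' (fun y => f y.1) by cmp_tac.
have c1 := cmp_isarg cx; have c2 := cmp_same cx cf'.
exact: cmp_and c1 c2.
Qed.

Lemma cmp_canon G (f : cX G -> nat) : cmp f -> cmpb G (fun x => canon (cinp x) (f x)).
Proof. by move=> cf; have c1 := cmp_isarg cf; have c2 := cmp_cpos cf; rewrite /canon; cmp_tac. Qed.

Lemma cmp_factb G (f h : cX G -> nat) R : cmp f -> cmp h ->
  cmpb G (fun x => factb (cinp x) (f x) R (h x)).
Proof.
move=> cf ch; rewrite /factb; cmp_step; first by cmp_tac.
set G' := ext _.
have cl : @cmp G' (fun y => y.2) by cmp_tac.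
have cf' : @cmp G' (fun y => f y.1) by cmp_tac.
have c1 := cmp_hasatom R cf' cl; have c2 := cmp_atp cf' cl.
apply: cmp_and => //; apply: cmp_all_const => i _.
by have c3 := cmp_cpos (cmp_arp R i c2); cmp_tac.
Qed.

Lemma cmp_nsl G : @cmp G (fun x => nsl (cinp x)).
Proof.
rewrite /nsl; cmp_step; first by cmp_tac.
set G' := ext _; have cl : @cmp G' (fun y => y.2) by cmp_tac.
by have c := ps_cmp (pset_spec p) (cmp_sl cl); cmp_tac.
Qed.

Lemma cmp_pU0 G : @cmp G (fun x => pU0 p (cinp x)).
Proof.
apply: cmp_succ; apply: (cmp_pstar (pset_spec p)); apply: cmp_succ; exact: (cmp_pZ (cmp_const _ 0)).
Qed.

Lemma cmp_qp G i : @cmp G (fun x => qp (cinp x) i).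
Proof. by have c := cmp_pU0 G; apply: (cmp_pos parg_spec); cmp_tac. Qed.
End Positions.

(** * Comparing timestamps in binary *)

Lemma enc_nat_nth m k : (tokn (Some (nth T0 (enc_nat m) k)) == 2) = odd (m %/ 2 ^ k).
Proof.
elim: k m => [|k IH] m; have [->|m0] := posnP m; rewrite ?div0n //.
- by rewrite enc_nat_half //= expn0 divn1; case: odd.
- by rewrite nth_default.
rewrite expnS divnMA -IH enc_nat_half //; congr (tokn (Some _) == 2) => /=.
by case: ifP => [/eqP ->|//]; rewrite nth_nil; case: k {IH} => // k; rewrite nth_default.
Qed.

Definition numbit w i e k := (k < e - i) && (tk w (i + k) == 2).

Lemma numbitE w i m r k : drop i w = enc_nat m ++ r ->
  numbit w i (i + size (enc_nat m)) k = odd (m %/ 2 ^ k).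
Proof.
move=> e; rewrite /numbit addKn -enc_nat_nth; case: ltnP => h.
  rewrite tk_drop addnC -drop_drop e drop_cat h.
  by case E: (drop k _) (drop_nth T0 h) => [|c v] -> /=.
by rewrite nth_default.
Qed.

(* Checks [A + C = E] bit by bit, from the least significant one; the running
   value is the carry, or 2 after a mismatch. *)
Definition addck (L : nat) (a c e : nat -> bool) : bool :=
  iteri L (fun i r => if 1 < r then 2 else
     if odd (a i + c i + r) == e i then (a i + c i + r)./2 else 2) 0 == 0.

Lemma modn_bit A i : A %% 2 ^ i.+1 = A %% 2 ^ i + odd (A %/ 2 ^ i) * 2 ^ i.
Proof.
have p0 : 0 < 2 ^ i by rewrite expn_gt0.
rewrite {1}(divn_eq A (2 ^ i)) {1}(divn_eq (A %/ 2 ^ i) 2) modn2 mulnDl -mulnA -expnS -addnA modnMDl.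
rewrite modn_small; first by rewrite addnC.
by have := ltn_pmod A p0; rewrite expnS; case: odd; lia.
Qed.

(** One column of the addition. A mismatch is final because the lower parts then disagree for either
    carry, which no higher digit can repair. *)
Lemma add_bit (X a c e r : nat) (ba bc be : bool) : a < X -> c < X -> e < X ->
  let r' := if 1 < r then 2 else if odd (ba + bc + r) == be then (ba + bc + r)./2 else 2 in
  [/\ r <= 2, r <= 1 -> a + c = e + r * X & r = 2 -> a + c <> e /\ a + c <> e + X] ->
  [/\ r' <= 2, r' <= 1 -> (a + ba * X) + (c + bc * X) = (e + be * X) + r' * (2 * X)
    & r' = 2 -> (a + ba * X) + (c + bc * X) <> e + be * X /\
                (a + ba * X) + (c + bc * X) <> e + be * X + 2 * X].
Proof.
move=> la lc le r' [h0 h1 h2]; rewrite {}/r'; case: r h0 h1 h2 => [|[|[|//]]] _.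
- by move=> /(_ isT) h1 _; case: ba; case: bc; case: be => /=; split; lia.
- by move=> /(_ isT) h1 _; case: ba; case: bc; case: be => /=; split; lia.
- by move=> _ /(_ erefl) h2; case: ba; case: bc; case: be => /=; split; lia.
Qed.

Lemma addckE L (A C E : nat) : A < 2 ^ L -> C < 2 ^ L -> E < 2 ^ L ->
  addck L (fun i => odd (A %/ 2 ^ i)) (fun i => odd (C %/ 2 ^ i)) (fun i => odd (E %/ 2 ^ i)) = (A + C == E).
Proof.
move=> hA hC hE; rewrite /addck; set F := (fun i r => _).
have inv i : [/\ iteri i F 0 <= 2,
    iteri i F 0 <= 1 -> A %% 2 ^ i + C %% 2 ^ i = E %% 2 ^ i + iteri i F 0 * 2 ^ i &
    iteri i F 0 = 2 -> A %% 2 ^ i + C %% 2 ^ i <> E %% 2 ^ i /\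
      A %% 2 ^ i + C %% 2 ^ i <> E %% 2 ^ i + 2 ^ i].
  elim: i => [|i IH]; first by rewrite !expn0 !modn1.
  have p0 : 0 < 2 ^ i by rewrite expn_gt0.
  rewrite !modn_bit expnS.
  exact: (add_bit _ _ _ (ltn_pmod A p0) (ltn_pmod C p0) (ltn_pmod E p0) IH).
have p0 : 0 < 2 ^ L by rewrite expn_gt0.
have [] := inv L; rewrite !modn_small // {inv}.
move: (iteri L F 0) (2 ^ L) p0 => r X p0 h0 h1 h2; case: r h0 h1 h2 => [|[|[|//]]] _.
- by move=> /(_ isT) h _; rewrite h mul0n addn0 !eqxx.
- by move=> /(_ isT) h _; rewrite h mul1n; apply/esym/negbTE; lia.
- by move=> _ /(_ erefl)[h _]; apply/esym/negbTE/eqP.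
Qed.

Lemma cmp_addck G (L : cX G -> nat) (a c e : cX G -> nat -> bool) : cmp L ->
  cmpb (ext L) (fun y => a y.1 y.2) -> cmpb (ext L) (fun y => c y.1 y.2) ->
  cmpb (ext L) (fun y => e y.1 y.2) -> cmpb G (fun x => addck (L x) (a x) (c x) (e x)).
Proof.
move=> cL ca cc ce; rewrite /addck.
apply: cmp_eq; last exact: cmp_const.
apply: (@cmp_iteri G L (fun=> 2) (fun=> 0) (fun x i r => if 1 < r then 2 else
     if odd (a x i + c x i + r) == e x i then (a x i + c x i + r)./2 else 2)).
- exact: cL.
- exact: cmp_const.
- exact: cmp_const.
- set G' := ext _.
  have ca' : cmpb G' (fun y => a y.1.1 y.1.2) := cmp_weak _ ca.
  have cc' : cmpb G' (fun y => c y.1.1 y.1.2) := cmp_weak _ cc.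
  have ce' : cmpb G' (fun y => e y.1.1 y.1.2) := cmp_weak _ ce.
  have co : cmpb G' (fun y => odd (a y.1.1 y.1.2 + c y.1.1 y.1.2 + y.2)) by cmp_tac.
  have ch : @cmp G' (fun y => (a y.1.1 y.1.2 + c y.1.1 y.1.2 + y.2)./2).
    apply: (@cmp_ext G' (fun y => (a y.1.1 y.1.2 + c y.1.1 y.1.2 + y.2) %/ 2)); last by cmp_tac.
    by move=> y _; rewrite divn2.
  have cE : cmpb G' (fun y => odd (a y.1.1 y.1.2 + c y.1.1 y.1.2 + y.2) == e y.1.1 y.1.2).
    apply: cmp_ext (cmp_eq co ce') => y _; by case: (odd _); case: (e _ _).
  by cmp_tac.
- move=> x k _ _; elim: k => //= k IH; case: ltnP => // h; case: ifP => // _.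
  by case: (a x k); case: (c x k); move: h IH; set r := iteri _ _ _; lia.
Qed.

Lemma odd_half_iter k i : odd (iter i (fun a => a %/ 2) k) = odd (k %/ 2 ^ i).
Proof.
have -> // : iter i (fun a => a %/ 2) k = k %/ 2 ^ i.
by elim: i => [|i IH]; rewrite ?divn1 // iterS IH expnSr divnMA.
Qed.

Section Offset.
Variable p : program.

Definition lneg w := tk w 0 == 6.
Definition tneg w := tk w (pU1 p w) == 6.
Definition lbit w := numbit w (nat_of_bool (lneg w)) (pZ w 0).
Definition tbit w := numbit w (pU1 p w + tneg w) (size w).
Definition kbit k i := odd (iter i (fun a => a %/ 2) k).

(* [tl D + k = t], by cases on the signs of [tl D] and [t] *)
Definition offb w k : bool :=
  let L := (size w).+1 in
  if lneg w then
    if tneg w then addck L (tbit w) (kbit k) (lbit w) else addck L (lbit w) (tbit w) (kbit k)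
  else ~~ tneg w && addck L (lbit w) (kbit k) (tbit w).

(** The timestamps themselves may be exponentially large, but for a valid instance their difference
    is below the number of slices and is found by trying all candidates. *)
Definition toff w := find (offb w) (iota 0 (nsl p w)).

Lemma enc_nat_lt m : m < 2 ^ size (enc_nat m).
Proof.
have [k] := ubnP m; elim: k m => // k IH m mk.
have [->//|m0] := posnP m; rewrite enc_nat_half //=.
case: eqP => h; rewrite ?expnS /=; first by rewrite expn0; lia.
have := IH (m %/ 2); lia.
Qed.

Lemma addck_ext L a a' c c' e e' : a =1 a' -> c =1 c' -> e =1 e' -> addck L a c e = addck L a' c' e'.
Proof.
move=> ha hc he; rewrite /addck; congr (_ == _); elim: L => //= L ->.
by rewrite ha hc he.
Qed.

Section Layout.
Variables (D : tdb) (ds : seq nat) (t : Z) (w : seq tok).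
Hypothesis wE : w = enc_input D ds t.
Hypothesis okD : forall a, a \in flatten (tsets D) -> okatom p a.

Lemma offbP k : k <= size w -> offb w k = (tl D + Z.of_nat k =? t)%Z.
Proof.
move=> kw; have [pE _] := lay_Z wE; have [_ eU] := lay_U1 wE okD.
set rest := TSep :: flatten [seq enc_set s | s <- tsets D] ++ TSep :: enc_tuple ds ++ enc_Z t.
have e0 : drop 0 w = enc_Z (tl D) ++ rest.
  by rewrite drop0 wE /enc_input /enc_db /rest -!catA /= -!catA.
have signP i z r : drop i w = enc_Z z ++ r ->
    [/\ (tk w i == 6) = (z <? 0)%Z,
        forall e, e = i + size (enc_Z z) ->
          numbit w (i + (z <? 0)%Z) e =1 (fun k => odd (Z.abs_nat z %/ 2 ^ k)) &
        Z.abs_nat z < 2 ^ size (enc_Z z)].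
  have [[z0 ->]|[z0 ->]] := enc_Z_cases z => e.
    have -> : (z <? 0)%Z = false by lia.
    have -> : Z.abs_nat z = Z.to_nat z by lia.
    rewrite addn0; split.
    - apply/negP => /(tkP _ _ TNeg)[r' e']; have [u [v [eN bt]]] := enc_nat_head (Z.to_nat z).
      by move: e'; rewrite e eN /= => -[uE _]; rewrite uE in bt.
    - by move=> e1 -> k'; rewrite (numbitE _ e).
    - exact: enc_nat_lt.
  have -> : (z <? 0)%Z = true by lia.
  have -> : Z.abs_nat z = Z.to_nat (- z) by lia.
  have e' : drop i.+1 w = enc_nat (Z.to_nat (- z)) ++ r by rewrite -add1n -drop_drop e /= drop0.
  split.
  - by apply/(tkP _ _ TNeg); rewrite e; eexists.
  - by move=> e1 -> k'; rewrite addn1 /= addnS -addSn (numbitE _ e').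
  - by rewrite /= expnS; have := enc_nat_lt (Z.to_nat (- z)); lia.
have [s1 b1 l1] := signP _ _ _ e0; have [|s2 b2 l2] := signP (pU1 p w) t [::]; first by rewrite cats0.
have zw1 : size (enc_Z (tl D)) <= size w by have := congr1 size e0; rewrite drop0 size_cat; lia.
have ze : pU1 p w + size (enc_Z t) = size w.
  have := congr1 size eU; rewrite size_drop; have : 0 < size (enc_Z t) by case: (t) => [|q|q] //; case: q.
  lia.
have zw2 : size (enc_Z t) <= size w by lia.
have pw a : a <= size w -> 2 ^ a <= 2 ^ (size w).+1 by move=> h; rewrite leq_exp2l //; lia.
have h1 : Z.abs_nat (tl D) < 2 ^ (size w).+1 by apply: leq_trans l1 (pw _ zw1).
have h2 : Z.abs_nat t < 2 ^ (size w).+1 by apply: leq_trans l2 (pw _ zw2).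
have h3 : k < 2 ^ (size w).+1.
  by apply: leq_ltn_trans kw _; apply: leq_trans (ltn_expl _ (ltnSn 1)) (pw _ _).
have lb : lbit w =1 (fun k => odd (Z.abs_nat (tl D) %/ 2 ^ k)).
  by rewrite /lbit /lneg s1 -[nat_of_bool _]add0n; apply: b1.
have tb : tbit w =1 (fun k => odd (Z.abs_nat t %/ 2 ^ k)).
  by rewrite /tbit /tneg s2; apply: b2; rewrite ze.
have kb : kbit k =1 (fun i => odd (k %/ 2 ^ i)) by move=> i; exact: odd_half_iter.
rewrite /offb /lneg /tneg s1 s2.
case: Z.ltb_spec => z1; case: Z.ltb_spec => z2 //=.
- by rewrite (addck_ext _ tb kb lb) addckE //; lia.
- by rewrite (addck_ext _ lb tb kb) addckE //; lia.
- lia.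
- by rewrite (addck_ext _ lb kb tb) addckE //; lia.
Qed.

Lemma toffP : (toff w < nsl p w) <-> in_tem D t.
Proof.
have nE := nslE wE okD; have [h _] := slices_le wE okD.
have -> : (toff w < nsl p w) = has (offb w) (iota 0 (nsl p w)) by rewrite has_find size_iota.
rewrite nE /in_tem /tr; split=> [/hasP[k]|ht].
  by rewrite mem_iota add0n /= => kn; rewrite offbP; [|lia]; move=> /Z.eqb_eq; lia.
apply/hasP; exists (Z.to_nat (t - tl D)); first by rewrite mem_iota; lia.
by rewrite offbP; [apply/Z.eqb_eq|]; lia.
Qed.

Lemma toffE : in_tem D t -> t = (tl D + Z.of_nat (toff w))%Z.
Proof.
move=> /toffP lt; have nE := nslE wE okD; have [h _] := slices_le wE okD.
have hs : has (offb w) (iota 0 (nsl p w)) by rewrite has_find size_iota.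
have := nth_find 0 hs; rewrite -/(toff w) nth_iota // add0n offbP; last by lia.
by move=> /Z.eqb_eq.
Qed.
End Layout.

Lemma cmp_numbit G (i e k : cX G -> nat) : cmp i -> cmp e -> cmp k ->
  cmpb G (fun x => numbit (cinp x) (i x) (e x) (k x)).
Proof. by move=> ci ce ck; rewrite /numbit; cmp_tac. Qed.

Lemma cmp_pU1 G : @cmp G (fun x => pU1 p (cinp x)).
Proof. exact: (ps_cmp ptuple_spec (cmp_pU0 p G)). Qed.

Lemma cmp_offb G (k : cX G -> nat) : cmp k -> cmpb G (fun x => offb (cinp x) (k x)).
Proof.
move=> ck.
have cln G' : cmpb G' (fun x => lneg (cinp x)) by rewrite /lneg; cmp_tac.
have ctn G' : cmpb G' (fun x => tneg (cinp x)) by have c := cmp_pU1 G'; rewrite /tneg; cmp_tac.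
have cL : @cmp G (fun x => (size (cinp x)).+1) by cmp_tac.
set G' := ext (fun x : cX G => (size (cinp x)).+1).
have ci : @cmp G' (fun y => y.2) by cmp_tac.
have cl : cmpb G' (fun y => lbit (cinp y.1) y.2).
  by apply: (@cmp_numbit G' (fun y => lneg (cinp y.1)) (fun y => pZ (cinp y.1) 0) (fun y => y.2) (cln G')) => //; exact: (@cmp_pZ G' _ (cmp_const _ 0)).
have ct : cmpb G' (fun y => tbit (cinp y.1) y.2).
  apply: (@cmp_numbit G' (fun y => pU1 p (cinp y.1) + tneg (cinp y.1)) (fun y => size (cinp y.1)) (fun y => y.2)) => //.
    by apply: cmp_add; [exact: (cmp_pU1 G')|exact: (ctn G')].
  exact: (cmp_size G').
have ckb : cmpb G' (fun y => kbit (k y.1) y.2).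
  apply: cmp_odd; apply: (@cmp_iter G' _ (fun y => k y.1)); try by cmp_tac.
  by move=> y i _ _; elim: i => //= i IH; apply: leq_trans (leq_div _ _) IH.
have a1 := @cmp_addck G _ (fun x => tbit (cinp x)) (fun x => kbit (k x)) (fun x => lbit (cinp x)) cL ct ckb cl.
have a2 := @cmp_addck G _ (fun x => lbit (cinp x)) (fun x => tbit (cinp x)) (fun x => kbit (k x)) cL cl ct ckb.
have a3 := @cmp_addck G _ (fun x => lbit (cinp x)) (fun x => kbit (k x)) (fun x => tbit (cinp x)) cL cl ckb ct.
have cl0 := cln G; have ct0 := ctn G.
rewrite /offb; apply: (@cmp_ext _ (fun x => if lneg (cinp x) then
    if tneg (cinp x) then nat_of_bool (addck (size (cinp x)).+1 (tbit (cinp x)) (kbit (k x)) (lbit (cinp x)))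
    else nat_of_bool (addck (size (cinp x)).+1 (lbit (cinp x)) (tbit (cinp x)) (kbit (k x)))
  else nat_of_bool (~~ tneg (cinp x) && addck (size (cinp x)).+1 (lbit (cinp x)) (kbit (k x)) (tbit (cinp x))))).
  by move=> x _; case: (lneg _) => //; case: (tneg _).
apply: cmp_if => //; first by apply: cmp_if.
by apply: cmp_and => //; apply: cmp_neg.
Qed.

Lemma cmp_toff G : @cmp G (fun x => toff (cinp x)).
Proof.
rewrite /toff; apply: (@cmp_find G (fun x => offb (cinp x))); first exact: cmp_nsl.
by apply: (@cmp_offb (ext _)); cmp_tac.
Qed.

Variable Gr : relsym.

Definition valid w :=
  [&& wellformed p w, 1 < nsl p w, all (fun i => parg w (qp p w i) != 0) (iota 0 Gr.2),
      parg w (qp p w Gr.2) == 0, all (fun i => cpos p w (qp p w i) < size w) (iota 0 Gr.2)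
    & toff w < nsl p w].

Definition qcode w := acode (size w).+1 [seq cpos p w (qp p w i) | i <- iota 0 Gr.2].

Lemma validP w : valid w <-> exists D ds t,
  [/\ db_over_edb p D, size ds = arity Gr, all (fun d => d \in objs D) ds, in_tem D t
    & w = enc_input D ds t].
Proof.
split=> [/and5P[/wellformed_sound[D [ds [t [wE okD]]]] ns /allP a1 a2 /andP[/allP a3 tf]]|].
  exists D, ds, t; rewrite (nslE wE okD) in ns.
  have sz : size ds = arity Gr.
    apply/eqP; rewrite eqn_leq; apply/andP; split.
      by rewrite leqNgt -(qp_ok wE okD) (eqP a2).
    rewrite leqNgt; apply/negP => h.
    by have := a1 (size ds); rewrite mem_iota (qp_ok wE okD) ltnn => /(_ h).
  split=> //.
  - apply/(all_nthP 0) => i ids.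
    by rewrite -(cpos_lt wE okD (qp_lit wE okD ids)) a3 // mem_iota add0n -/(arity Gr) -sz.
  - by apply/(toffP wE okD).
move=> [D [ds [t [[s2 okD] sz oD ht wE]]]].
apply/and5P; split.
- exact: layout_wellformed wE okD.
- by rewrite (nslE wE okD).
- by apply/allP => i; rewrite mem_iota (qp_ok wE okD) sz.
- by rewrite -[_ == 0]negbK (qp_ok wE okD) sz ltnn.
- apply/andP; split; last by apply/(toffP wE okD).
  apply/allP => i; rewrite mem_iota add0n -/(arity Gr) -sz => ids.
  rewrite (cpos_lt wE okD (qp_lit wE okD ids)); exact: (all_nthP 0 oD).
Qed.

Lemma qcodeE w D ds t : w = enc_input D ds t -> (forall a, a \in flatten (tsets D) -> okatom p a) ->
  size ds = arity Gr -> qcode w = acode (size w).+1 (map (cp p w) ds).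
Proof.
move=> wE okD sz; rewrite /qcode; congr acode; apply: (@eq_from_nth _ 0).
  by rewrite !size_map size_iota.
move=> i; rewrite size_map size_iota => iG; rewrite (nth_map 0) ?size_iota // nth_iota // add0n.
have ids : i < size ds by rewrite sz.
by rewrite (nth_map 0) // (cposE wE okD (qp_lit wE okD ids)).
Qed.

Lemma cmp_acode G (N : cX G -> nat) (fs : seq (cX G -> nat)) : cmp N ->
  (forall f, List.In f fs -> cmp f) -> cmp (fun x => acode (N x) [seq f x | f <- fs]).
Proof.
move=> cN; elim: fs => [|f fs IH] h; first exact: cmp_const.
have c1 := IH (fun f' ff => h f' (or_intror ff)); have c2 := h f (or_introl erefl).
by apply: (@cmp_ext _ (fun x => f x + N x * acode (N x) [seq f x | f <- fs])); [by []|cmp_tac].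
Qed.

Lemma cmp_qcode G : @cmp G (fun x => qcode (cinp x)).
Proof.
have cN : @cmp G (fun x => (size (cinp x)).+1) by cmp_tac.
apply: (cmp_ext _ (cmp_acode (fs := [seq (fun x : cX G => cpos p (cinp x) (qp p (cinp x) i)) | i <- iota 0 Gr.2]) cN _)).
  by move=> x _; rewrite /qcode -map_comp.
move=> f /List.in_map_iff[i [<- _]]; apply: cmp_cpos; exact: cmp_qp.
Qed.

Lemma cmp_valid G : cmpb G (fun x => valid (cinp x)).
Proof.
have c0 : @cmp G (fun x => pZ (cinp x) 0) := cmp_pZ (cmp_const _ 0).
have cS : @cmp G (fun x => pstar (pset p) (cinp x) (pS0 (cinp x))).
  by apply: (cmp_pstar (pset_spec p)); rewrite /pS0; cmp_tac.
have c1 := cmp_pU1 G; have c2 := cmp_pZ c1; have cn := cmp_nsl p G; have ct := cmp_toff G.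
have cq i := cmp_qp p G i; have ca i := ps_cmp parg_spec (cq i); have cc i := cmp_cpos p (cq i).
have cw : cmpb G (fun x => wellformed p (cinp x)) by rewrite /wellformed; cmp_tac.
rewrite /valid; apply: cmp_and => //; apply: cmp_and; first by cmp_tac.
apply: cmp_and; first by apply: cmp_all_const => i _; have := ca i => ?; cmp_tac.
apply: cmp_and; first by have := ca Gr.2 => ?; cmp_tac.
apply: cmp_and; first by apply: cmp_all_const => i _; have := cc i => ?; cmp_tac.
by cmp_tac.
Qed.
End Offset.

(** * Codes of facts with pending operators *)

Definition opn (o : top) : nat := match o with ONext => 0 | OPrev => 1 | OFut => 2 | OPast => 3 end.

Lemma opn_inj : injective opn.
Proof. by case; case. Qed.

Lemma leq_sumn_map (T : Type) (f : T -> nat) s x : List.In x s -> f x <= sumn (map f s).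
Proof. by elim: s => //= y s IH [->|/IH]; lia. Qed.

Definition dop (d : bool) : top := if d then OPrev else ONext.
Definition fop (d : bool) : top := if d then OPast else OFut.

Lemma opn_dop d : opn (dop d) = d. Proof. by case: d. Qed.
Lemma opn_fop d : opn (fop d) = d + 2. Proof. by case: d. Qed.

Definition mv (d : bool) (o o' : seq top) : Prop :=
  [\/ o' = dop d :: o, o' = fop d :: o | o' = o /\ exists o1, o = fop d :: o1].

Section Codes.
Variable p : program.

Definition plits : seq literal := flatten [seq rbody ru | ru <- p].

Fixpoint tails (T : Type) (s : seq T) : seq (seq T) := s :: (if s is _ :: s' then tails s' else [::]).

(** A kind is a relation together with pending operators. Only suffixes of the operator lists in the
    program arise, so there are finitely many kinds and, the program being fixed, polynomially many
    facts. *)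
Definition kinds : seq (seq nat * relsym) :=
  [seq ([::], (rhead ru).1) | ru <- p] ++
  flatten [seq [seq (o, lit_rel l) | o <- tails (map opn (lit_ops l))] | l <- plits].

Definition nk := size kinds.
Definition kidx (o : seq top) (R : relsym) : nat := index (map opn o, R) kinds.
Definition has_kind (o : seq top) (R : relsym) : bool := (map opn o, R) \in kinds.

Lemma tails_self (T : Type) (s : seq T) : List.In s (tails s).
Proof. by case: s => [|x s]; left. Qed.

Lemma tails_cons (T : Type) (s : seq T) x o : List.In (x :: o) (tails s) -> List.In o (tails s).
Proof.
elim: s => [|y s IH] /=; first by case.
by case=> [[_ ->]|/IH]; right; first exact: tails_self.
Qed.

Lemma In_plits ru l : List.In ru p -> List.In l (rbody ru) -> List.In l plits.
Proof. by move=> h1 h2; apply/In_flatten_map; exists ru. Qed.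

Lemma has_kind_lit ru l : List.In ru p -> List.In l (rbody ru) -> has_kind (lit_ops l) (lit_rel l).
Proof.
move=> h1 h2; apply/In_mem/In_cat; right; apply/In_flatten_map; exists l; first exact: In_plits h1 h2.
apply/List.in_map_iff; exists (map opn (lit_ops l)); split=> //; exact: tails_self.
Qed.

Lemma has_kind_head ru : List.In ru p -> has_kind [::] (rhead ru).1.
Proof. by move=> h; apply/In_mem/In_cat; left; apply/List.in_map_iff; exists ru. Qed.

Lemma has_kind_idb R : idb p R -> has_kind [::] R.
Proof. by rewrite /idb => /In_mem/List.in_map_iff[ru [<- h]]; exact: has_kind_head. Qed.

Lemma has_kind_cons o os R : has_kind (o :: os) R -> has_kind os R.
Proof.
move=> /In_mem/In_cat[/List.in_map_iff[ru []]//|/In_flatten_map[l lp /List.in_map_iff[o' [[oE <-] h]]]].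
apply/In_mem/In_cat; right; apply/In_flatten_map; exists l => //.
by apply/List.in_map_iff; exists (map opn os); split=> //; apply: (tails_cons (x := opn o)); rewrite -[_ :: _]oE.
Qed.

Lemma kidx_lt o R : has_kind o R -> kidx o R < nk.
Proof. by rewrite /kidx /nk index_mem. Qed.

Lemma kidx_inj o R o' R' : has_kind o R -> has_kind o' R' -> kidx o R = kidx o' R' -> o = o' /\ R = R'.
Proof.
move=> h h' e; have := nth_index ([::], R) h; rewrite -/(kidx o R) e nth_index // => -[].
by move=> /(inj_map opn_inj) -> ->.
Qed.

Definition marity : nat := sumn [seq R.2 | R : relsym <- rels p].

Lemma marity_ge R : R \in rels p -> R.2 <= marity.
Proof. by move=> h; apply: leq_sumn_map; apply/In_mem. Qed.

Lemma has_kind_rels o R : has_kind o R -> R \in rels p.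
Proof.
rewrite /rels => /In_mem/In_cat[/List.in_map_iff[ru [[_ <-] h]]|].
  by apply/In_mem/In_flatten_map; exists ru => //; left.
move=> /In_flatten_map[l /In_flatten_map[ru h1 h2] /List.in_map_iff[o' [[_ <-] _]]].
by apply/In_mem/In_flatten_map; exists ru => //; right; apply/List.in_map_iff; exists l.
Qed.

Definition nvar : nat := (sumn [seq sumn (rvars ru) | ru <- p]).+1.

Lemma nvar_gt ru x : List.In ru p -> x \in rvars ru -> x < nvar.
Proof.
move=> h1 h2; have := leq_sumn_map (fun ru => sumn (rvars ru)) h1.
by have := leq_sumn_map id (s := rvars ru) (x := x) (proj2 (In_mem _ _) h2); rewrite map_id /nvar; lia.
Qed.

Definition base (w : seq tok) : nat := (size w).+1.
Definition nfacts (w : seq tok) : nat := nk * base w ^ marity.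
(** A number [m] codes an assignment: its digit [x] in base [base w] is the position that represents
    the value of variable [x]. Rules are instantiated by running through such numbers. *)
Definition dig w m x : nat := m %/ base w ^ x %% base w.
Definition okasg w ru m : bool := all (fun x => canon p w (dig w m x)) (rvars ru).
Definition acode_at w m (xs : seq nat) : nat := acode (base w) [seq dig w m x | x <- xs].
Definition lcode w m (l : literal) : nat :=
  kidx (lit_ops l) (lit_rel l) + nk * acode_at w m (lit_args l).
Definition hcode w m ru : nat := kidx [::] (rhead ru).1 + nk * acode_at w m (rhead ru).2.

(* A fact of kind [k] at [t] yields one of kind [k'] at [t - 1] if [d = 0]
   (operators [ONext] and [OFut]), and at [t + 1] if [d = 1]. *)
Definition mvk (d : nat) (k k' : seq nat * relsym) : bool :=
  (k.2 == k'.2) && [|| k'.1 == d :: k.1, k'.1 == (d + 2) :: k.1 | (k' == k) && (head 0 k.1 == d + 2)].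
Definition mvb (d s s' : nat) : bool :=
  (s %/ nk == s' %/ nk) && has (fun k => has (fun k' =>
    [&& mvk d k k', s %% nk == index k kinds & s' %% nk == index k' kinds]) kinds) kinds.

Section Layout.
Variables (D : tdb) (ds : seq nat) (t0 : Z) (w : seq tok).
Hypothesis wE : w = enc_input D ds t0.
Hypothesis okD : forall a, a \in flatten (tsets D) -> okatom p a.
Hypothesis wfp : wf_program p.

Definition okf (a : atom) : Prop := size a.2 = a.1.2 /\ all (fun d => d \in objs D) a.2.
Definition fc (o : seq top) (a : atom) : nat := kidx o a.1 + nk * acode (base w) (map (cp p w) a.2).

Lemma fc_mod o a : has_kind o a.1 -> fc o a %% nk = kidx o a.1.
Proof. by move=> /kidx_lt h; rewrite /fc addnC mulnC modnMDl modn_small. Qed.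

Lemma fc_div o a : has_kind o a.1 -> fc o a %/ nk = acode (base w) (map (cp p w) a.2).
Proof.
move=> /kidx_lt h; rewrite /fc addnC mulnC divnMDl; last by lia.
by rewrite (divn_small h) addn0.
Qed.

Lemma acode_cp_lt os : all (fun d => d \in objs D) os ->
  acode (base w) (map (cp p w) os) < base w ^ size os.
Proof. by move=> h; rewrite -(size_map (cp p w)); apply: acode_lt => //; exact: cp_all wE okD _ h. Qed.

Lemma fc_lt o a : has_kind o a.1 -> okf a -> fc o a < nfacts w.
Proof.
move=> h [sz oa]; rewrite /fc /nfacts; have h1 := kidx_lt h.
have h2 : acode (base w) (map (cp p w) a.2) < base w ^ marity.
  apply: leq_trans (acode_cp_lt oa) _; rewrite leq_exp2l; last first.
    rewrite /base wE /enc_input /enc_db !size_cat /=; lia.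
  by rewrite sz; apply: marity_ge; exact: has_kind_rels h.
by move: h1 h2; set P := _ ^ _; set q := acode _ _; nia.
Qed.

Lemma fc_inj o a o' a' : has_kind o a.1 -> has_kind o' a'.1 -> okf a -> okf a' ->
  fc o a = fc o' a' -> o = o' /\ a = a'.
Proof.
move=> h h' [sz oa] [sz' oa'] e; have := fc_mod h; have := fc_div h; rewrite e fc_div // fc_mod //.
move=> ea /(kidx_inj h' h)[oE RE]; split=> //; case: a a' RE ea {h h' e} sz sz' oa oa' => [R os] [R' os'] /= ->.
move=> /acode_inj e sz sz' oa oa'; congr pair; apply: (map_cp_inj wE okD oa oa'); apply/esym/e => //.
- exact: cp_all wE okD _ oa'.
- exact: cp_all wE okD _ oa.
- by rewrite !size_map sz sz'.
Qed.

Lemma asg_decode ru m : okasg w ru m ->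
  exists nu, forall x, x \in rvars ru -> nu x \in objs D /\ cp p w (nu x) = dig w m x.
Proof.
move=> /allP h.
have : forall x, exists y, x \in rvars ru -> y \in objs D /\ cp p w y = dig w m x.
  move=> x; case xr: (x \in rvars ru); last by exists 0.
  by have /(canonP wE okD)[o oD e] := h x xr; exists o.
(* The boolean form lets [ex_minn] select a value for each variable. *)
move=> ex; have {}ex x : exists y, (x \in rvars ru) ==> ((y \in objs D) && (cp p w y == dig w m x)).
  have [y hy] := ex x; exists y; apply/implyP => /hy[-> ->]; exact: eqxx.
by exists (fun x => ex_minn (ex x)) => x xr; case: ex_minnP => y /implyP/(_ xr)/andP[? /eqP ?].
Qed.

Lemma asg_encode ru nu : List.In ru p -> (forall x, x \in rvars ru -> nu x \in objs D) ->
  exists m, [/\ m < base w ^ nvar, okasg w ru m & forall x, x \in rvars ru -> cp p w (nu x) = dig w m x].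
Proof.
move=> ri h; pose f x := if x \in rvars ru then cp p w (nu x) else 0.
have fb : all (fun x => x < base w) (map f (iota 0 nvar)).
  apply/allP => y /mapP[x _ ->]; rewrite /f; case: ifP => // /h/(cp_obj wE okD)[lt _ _].
  by rewrite /base; lia.
have dE x : x \in rvars ru -> cp p w (nu x) = dig w (acode (base w) (map f (iota 0 nvar))) x.
  move=> xr; have xn := nvar_gt ri xr; rewrite /dig acode_digit //; last by rewrite size_map size_iota.
  by rewrite (nth_map 0) ?size_iota // nth_iota // add0n /f xr.
exists (acode (base w) (map f (iota 0 nvar))); split=> //.
  by have := acode_lt (isT : 0 < base w) fb; rewrite size_map size_iota.
by apply/allP => x xr; rewrite -dE //; apply/(canonP wE okD); exists (nu x) => //; exact: h.
Qed.

Lemma acode_at_asg ru m nu xs : (forall x, x \in rvars ru -> cp p w (nu x) = dig w m x) ->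
  {subset xs <= rvars ru} -> acode_at w m xs = acode (base w) (map (cp p w) (map nu xs)).
Proof. by move=> h sub; rewrite /acode_at -map_comp; congr acode; apply/eq_in_map => x /sub/h /= ->. Qed.

Lemma lit_rvars ru l : List.In l (rbody ru) -> {subset lit_args l <= rvars ru}.
Proof.
move=> h x xl; rewrite /rvars mem_cat; apply/orP; right; apply/In_mem/In_flatten_map.
by exists l => //; apply/In_mem.
Qed.

Lemma lcodeE ru m nu l : (forall x, x \in rvars ru -> cp p w (nu x) = dig w m x) ->
  List.In l (rbody ru) -> lcode w m l = fc (lit_ops l) (lit_rel l, map nu (lit_args l)).
Proof. by move=> h lb; rewrite /lcode (acode_at_asg h (lit_rvars lb)). Qed.

Lemma hcodeE ru m nu : (forall x, x \in rvars ru -> cp p w (nu x) = dig w m x) ->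
  hcode w m ru = fc [::] ((rhead ru).1, map nu (rhead ru).2).
Proof.
move=> h; rewrite /hcode (acode_at_asg h) //.
by move=> x xl; rewrite /rvars mem_cat xl.
Qed.

Lemma okf_lit ru nu l : List.In ru p -> (forall x, x \in rvars ru -> nu x \in objs D) ->
  List.In l (rbody ru) -> okf (lit_rel l, map nu (lit_args l)).
Proof.
move=> ri h lb; have [_ [sz _]] := wfp ri; split; first by rewrite size_map; exact: sz lb.
by apply/allP => y /mapP[x xl ->]; apply: h; exact: lit_rvars lb _ xl.
Qed.

Lemma okf_head ru nu : List.In ru p -> (forall x, x \in rvars ru -> nu x \in objs D) ->
  okf ((rhead ru).1, map nu (rhead ru).2).
Proof.
move=> ri h; have [sz _] := wfp ri; split; first by rewrite size_map.
by apply/allP => y /mapP[x xl ->]; apply: h; rewrite /rvars mem_cat xl.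
Qed.

Lemma mvbP (d : bool) o a s' : has_kind o a.1 ->
  mvb d (fc o a) s' <-> exists o', [/\ mv d o o', has_kind o' a.1 & s' = fc o' a].
Proof.
move=> ho; rewrite /mvb fc_div // fc_mod //; split.
  move=> /andP[/eqP eq1 /hasP[k kk /hasP[k' kk' /and3P[m /eqP i1 /eqP i2]]]].
  have kE : k = (map opn o, a.1).
    by have := nth_index ([::], a.1) kk; rewrite -i1 nth_index.
  have sE : s' = index k' kinds + nk * acode (base w) (map (cp p w) a.2).
    by rewrite [s'](divn_eq _ nk) -i2 -eq1 addnC mulnC.
  have [o' mo k'E] : exists2 o', mv d o o' & k' = (map opn o', a.1).
    move: m; rewrite kE /mvk /=; case: k' {i2 sE kk'} => [q R] /= /andP[/eqP <-] /or3P[/eqP ->|/eqP ->|].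
    - by exists (dop d :: o); [constructor 1|rewrite /= opn_dop].
    - by exists (fop d :: o); [constructor 2|rewrite /= opn_fop].
    - move=> /andP[/eqP[->] h]; exists o => //; constructor 3; split=> //.
      case: (o) h => [|c o1] /=; first by rewrite addn2.
      by rewrite -opn_fop => /eqP/opn_inj ->; exists o1.
  by exists o'; split=> //; [rewrite /has_kind -k'E|rewrite sE k'E].
move=> [o' [m ho' ->]]; rewrite fc_div // fc_mod // eqxx /=.
apply/hasP; exists (map opn o, a.1) => //; apply/hasP; exists (map opn o', a.1) => //.
rewrite !eqxx !andbT /mvk /= eqxx /=.
case: m => [->|->|[-> [o1 ->]]] /=; rewrite ?opn_dop ?opn_fop ?eqxx ?orbT //.
Qed.

Lemma der_mv (d : bool) t o o' a :
  der p D (if d then t - 1 else t + 1)%Z o a -> mv d o o' -> der p D t o' a.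
Proof.
case: d => h [->|->|[-> [o1 oE]]].
- exact: der_prev.
- exact: der_past1.
- by move: h; rewrite oE; exact: der_pastS.
- exact: der_next.
- exact: der_fut1.
- by move: h; rewrite oE; exact: der_futS.
Qed.
End Layout.

Lemma cmp_base G : @cmp G (fun x => base (cinp x)).
Proof. by rewrite /base; cmp_tac. Qed.

Lemma cmp_nfacts G : @cmp G (fun x => nfacts (cinp x)).
Proof. by have c := cmp_base G; rewrite /nfacts; cmp_tac. Qed.

Lemma cmp_dig G (m : cX G -> nat) x : cmp m -> cmp (fun y => dig (cinp y) (m y) x).
Proof. by move=> cm; have c := cmp_base G; rewrite /dig; cmp_tac. Qed.

Lemma cmp_okasg G (m : cX G -> nat) ru : cmp m -> cmpb G (fun y => okasg (cinp y) ru (m y)).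
Proof.
move=> cm; rewrite /okasg; apply: cmp_all_const => x _.
exact: cmp_canon (cmp_dig x cm).
Qed.

Lemma cmp_acode_at G (m : cX G -> nat) xs : cmp m -> cmp (fun y => acode_at (cinp y) (m y) xs).
Proof.
move=> cm; apply: (cmp_ext _ (cmp_acode (fs := [seq (fun y : cX G => dig (cinp y) (m y) x) | x <- xs]) (cmp_base G) _)).
  by move=> y _; rewrite /acode_at -map_comp.
by move=> f /List.in_map_iff[x [<- _]]; exact: cmp_dig.
Qed.

Lemma cmp_lcode G (m : cX G -> nat) l : cmp m -> cmp (fun y => lcode (cinp y) (m y) l).
Proof. by move=> cm; have c := cmp_acode_at (lit_args l) cm; rewrite /lcode; cmp_tac. Qed.

Lemma cmp_hcode G (m : cX G -> nat) ru : cmp m -> cmp (fun y => hcode (cinp y) (m y) ru).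
Proof. by move=> cm; have c := cmp_acode_at (rhead ru).2 cm; rewrite /hcode; cmp_tac. Qed.

Lemma cmp_mvb G d (f g : cX G -> nat) : cmp f -> cmp g -> cmpb G (fun y => mvb d (f y) (g y)).
Proof. by move=> cf cg; rewrite /mvb; cmp_tac. Qed.
End Codes.

(** * Linear queries *)

Lemma holds_impl (E E' : Z -> atom -> Prop) t o a : (forall t, E t a -> E' t a) -> holds E t o a -> holds E' t o a.
Proof.
move=> EE; elim: o t => [|[] o IH] t /=; [exact: EE|exact: IH|exact: IH| |].
- by move=> [t' [h /IH]]; exists t'.
- by move=> [t' [h /IH]]; exists t'.
Qed.

Section Support.
Variables (E : Z -> atom -> Prop) (a : atom) (l r : Z).
Hypothesis supp : forall t, E t a -> (l <= t <= r)%Z.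

(** So far to the left, the single steps of the operators cannot reach the support, and all of it
    lies in the future of every time met; hence the exact time does not matter. *)
Lemma holds_left o t t' : (t + Z.of_nat (size o) < l)%Z -> (t' + Z.of_nat (size o) < l)%Z ->
  holds E t o a -> holds E t' o a.
Proof.
elim: o t t' => [|[] o IH] t t' /= h h'.
- by move=> /supp; lia.
- by apply: IH; lia.
- by apply: IH; lia.
- move=> [t1 [lt h1]]; have [le|gt] := Z.le_gt_cases t1 t'; last by exists t1; split=> //; lia.
  by exists (t' + 1)%Z; split; [lia|apply: IH h1; lia].
- by move=> [t1 [lt h1]]; exists (t' - 1)%Z; split; [lia|apply: IH h1; lia].
Qed.

Lemma holds_right o t t' : (r < t - Z.of_nat (size o))%Z -> (r < t' - Z.of_nat (size o))%Z ->
  holds E t o a -> holds E t' o a.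
Proof.
elim: o t t' => [|[] o IH] t t' /= h h'.
- by move=> /supp; lia.
- by apply: IH; lia.
- by apply: IH; lia.
- by move=> [t1 [lt h1]]; exists (t' + 1)%Z; split; [lia|apply: IH h1; lia].
- move=> [t1 [lt h1]]; have [le|gt] := Z.le_gt_cases t' t1; last by exists t1; split=> //; lia.
  by exists (t' - 1)%Z; split; [lia|apply: IH h1; lia].
Qed.
End Support.

Section Linear.
Variable p : program.

Definition kmax : nat := sumn [seq size (lit_ops l) | l <- plits p].

Lemma kmax_ge ru l : List.In ru p -> List.In l (rbody ru) -> size (lit_ops l) <= kmax.
Proof. by move=> h1 h2; apply: (leq_sumn_map (fun l => size (lit_ops l))); exact: In_plits h1 h2. Qed.

(* Time is counted from [bo] steps before the first slice, and quantification
   is restricted to the indices below [W]. *)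
Fixpoint ehold (w : seq tok) (bo W : nat) (o : seq top) (R : relsym) (v a : nat) : bool :=
  match o with
  | [::] => (bo <= v) && factb p w (v - bo) R a
  | ONext :: o => ehold w bo W o R v.+1 a
  | OPrev :: o => ehold w bo W o R v.-1 a
  | OFut :: o => has (fun v' : nat => (v < v') && (v' + size o < W) && ehold w bo W o R v' a) (iota 0 W)
  | OPast :: o => has (fun v' : nat => (v' < v) && (size o <= v') && ehold w bo W o R v' a) (iota 0 W)
  end.

Lemma cmp_ehold o R G (bo W v a : cX G -> nat) : cmp bo -> cmp W -> cmp v -> cmp a ->
  cmpb G (fun x => ehold (cinp x) (bo x) (W x) o R (v x) (a x)).
Proof.
elim: o G bo W v a => [|[] o IH] G bo W v a cb cW cv ca /=.
- have c : @cmp G (fun x => v x - bo x) by cmp_tac.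
  by have c' := cmp_factb p R c ca; cmp_tac.
- by apply: IH => //; cmp_tac.
- by apply: IH => //; cmp_tac.
- apply: cmp_has => //; apply: cmp_and; first by cmp_tac.
  by apply: (IH (ext W) (fun y => bo y.1) (fun y => W y.1) (fun y => y.2) (fun y => a y.1)); cmp_tac.
- apply: cmp_has => //; apply: cmp_and; first by cmp_tac.
  by apply: (IH (ext W) (fun y => bo y.1) (fun y => W y.1) (fun y => y.2) (fun y => a y.1)); cmp_tac.
Qed.

Definition nst (w : seq tok) : nat := (nfacts p w).+1.
(** The extension argument asks for more than [nst w * nst w] steps on each side of the region where
    rules depend on time, and EDB literals may extend this region by [kmax] steps beyond the
    database. *)
Definition off (w : seq tok) : nat := nst w * nst w + 2 * kmax + 2.
Definition wid (w : seq tok) : nat := off w + off w + (size w).+1.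

(** Shifting the index by [kmax] and enlarging the range accordingly ensures that up to [kmax]
    nested operators do not lead out of it. *)
Definition edbtrue w u m (l : literal) : bool :=
  ehold w (off w + kmax) (wid w + 2 * kmax + 1) (lit_ops l) (lit_rel l) (u + kmax)
    (acode_at w m (lit_args l)).

(* State [0] stands for the empty set of premises, [s.+1] for the fact coded [s]. *)
Definition premise (ru : rule) (f : literal -> nat) : nat :=
  if [seq l <- rbody ru | idb p (lit_rel l)] is l :: _ then (f l).+1 else 0.

Definition ruleb w u s s' : bool :=
  has (fun ru => has (fun m : nat =>
    [&& okasg p w ru m, s' == (hcode p w m ru).+1, s == premise ru (lcode p w m) &
        all (fun l => idb p (lit_rel l) || edbtrue w u m l) (rbody ru)])
    (iota 0 (base w ^ nvar p))) p.

(** The empty premise set is available at every time: letting state [0] move along the time axis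
    makes it reachable everywhere from a single start node. *)
Definition mvs (d : bool) (s s' : nat) : bool :=
  (s == 0) && (s' == 0) || [&& 0 < s, 0 < s' & mvb p d s.-1 s'.-1].

Definition sedge w (u s u' s' : nat) : bool :=
  [|| (u' == u.+1) && mvs true s s', (u == u'.+1) && mvs false s s' | (u == u') && ruleb w u s s'].
Definition edge w (x y : nat) : bool :=
  sedge w (x %/ nst w) (x %% nst w) (y %/ nst w) (y %% nst w).

Lemma cmp_nst G : @cmp G (fun x => nst (cinp x)).
Proof. by have c := cmp_nfacts p G; rewrite /nst; cmp_tac. Qed.

Lemma cmp_off G : @cmp G (fun x => off (cinp x)).
Proof. by have c := cmp_nst G; rewrite /off; cmp_tac. Qed.

Lemma cmp_wid G : @cmp G (fun x => wid (cinp x)).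
Proof. by have c := cmp_off G; rewrite /wid; cmp_tac. Qed.

Lemma cmp_premise G (f : cX G -> literal -> nat) ru : (forall l, cmp (fun x => f x l)) ->
  cmp (fun x => premise ru (f x)).
Proof.
by move=> cf; rewrite /premise; case: [seq _ <- _ | _] => [|l r]; [exact: cmp_const|exact: cmp_succ].
Qed.

Lemma cmp_ruleb G (u s s' : cX G -> nat) : cmp u -> cmp s -> cmp s' ->
  cmpb G (fun x => ruleb (cinp x) (u x) (s x) (s' x)).
Proof.
move=> cu cs cs'; rewrite /ruleb; apply: cmp_has_const => ru _.
have cb : @cmp G (fun x => base (cinp x) ^ nvar p) by apply: cmp_expn_const; exact: cmp_base.
apply: cmp_has => //; set G' := ext _.
have cm : @cmp G' (fun y => y.2) by cmp_tac.
have c1 := cmp_okasg p ru cm; have c2 := cmp_hcode p ru cm.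
have c3 := cmp_premise ru (fun l => cmp_lcode p l cm).
have cu' : @cmp G' (fun y => u y.1) by cmp_tac.
have c4 l : cmpb G' (fun y => idb p (lit_rel l) || edbtrue (cinp y.1) (u y.1) y.2 l).
  apply: cmp_or; first exact: cmp_const.
  have o' := cmp_off G'; have w' := cmp_wid G'; have a' := cmp_acode_at (lit_args l) cm.
  apply: (@cmp_ehold _ _ G' (fun y => off (cinp y.1) + kmax) (fun y => wid (cinp y.1) + 2 * kmax + 1)
            (fun y => u y.1 + kmax)); by cmp_tac.
apply: cmp_and; first exact: c1.
apply: cmp_and; first by apply: cmp_eq; [cmp_tac|apply: cmp_succ; exact: c2].
apply: cmp_and; first by apply: cmp_eq; [cmp_tac|exact: c3].
by apply: cmp_all_const => l _; exact: c4.
Qed.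

Lemma cmp_mvs G d (f g : cX G -> nat) : cmp f -> cmp g -> cmpb G (fun x => mvs d (f x) (g x)).
Proof.
move=> cf cg; have c1 : cmp (fun x => (f x).-1) by cmp_tac.
have c2 : cmp (fun x => (g x).-1) by cmp_tac.
by have c3 := cmp_mvb p d c1 c2; rewrite /mvs; cmp_tac.
Qed.

Lemma cmp_edge G (f g : cX G -> nat) : cmp f -> cmp g -> cmpb G (fun x => edge (cinp x) (f x) (g x)).
Proof.
move=> cf cg; have cn := cmp_nst G; rewrite /edge /sedge.
have c1 := cmp_div cf cn; have c2 := cmp_mod cf cn; have c3 := cmp_div cg cn; have c4 := cmp_mod cg cn.
by have c5 := cmp_mvs true c2 c4; have c6 := cmp_mvs false c2 c4; have c7 := cmp_ruleb c1 c2 c4; cmp_tac.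
Qed.

Section Layout.
Variables (D : tdb) (ds : seq nat) (t0 : Z) (w : seq tok).
Hypothesis wE : w = enc_input D ds t0.
Hypothesis Dp : db_over_edb p D.
Hypothesis wfp : wf_program p.
Hypothesis lin : linear p.

Let okD := Dp.2.
Let M := nst w.
Let time (u : nat) : Z := (tl D + Z.of_nat u - Z.of_nat (off w))%Z.

Lemma dfact_supp t a : dfact D t a -> (tl D <= t <= tr D)%Z.
Proof. by case. Qed.

Lemma eholdP bo W o R os v : 2 * size o < bo -> bo + size (tsets D) + 2 * size o < W ->
  size os = R.2 -> all (fun d => d \in objs D) os -> size o <= v -> v + size o < W ->
  ehold w bo W o R v (acode (base w) (map (cp p w) os)) <->
  holds (dfact D) (tl D + Z.of_nat v - Z.of_nat bo) o (R, os).
Proof.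
move=> + + sz oD; set tm := (fun v : nat => (tl D + Z.of_nat v - Z.of_nat bo)%Z); rewrite -/(tm v).
have supp t : dfact D t (R, os) -> (tl D <= t <= tl D + Z.of_nat (size (tsets D)) - 1)%Z by exact: dfact_supp.
elim: o v => [|[] o IH] v /= b1 b2 v1 v2.
- split=> [/andP[bv /(factbP wE okD _ sz oD)[h1 h2]]|[h1 h2]].
    split; first by rewrite /in_tem /tr /tm; lia.
    by have -> : Z.to_nat (tm v - tl D) = v - bo by rewrite /tm; lia.
  rewrite /in_tem /tr /tm in h1; have bv : bo <= v by lia.
  rewrite bv; apply/(factbP wE okD _ sz oD); split; first by lia.
  by have <- : Z.to_nat (tm v - tl D) = v - bo by rewrite /tm; lia.
- have -> : (tm v + 1 = tm v.+1)%Z by rewrite /tm; lia.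
  by apply: IH; lia.
- have -> : (tm v - 1 = tm v.-1)%Z by rewrite /tm; lia.
  by apply: IH; lia.
- split=> [/hasP[v' _ /andP[/andP[lt v'W] h]]|[t' [lt h]]].
    by exists (tm v'); split; [rewrite /tm; lia|apply/IH => //; lia].
  (* A witness far beyond the database may lie outside the range; there the literal has the same
     truth value as at the last admissible index. *)
  have [v' [vv' v'W h']] : exists v', [/\ v < v', v' + size o < W & holds (dfact D) (tm v') o (R, os)].
    have [le|gt] := Z.le_gt_cases (tm (W - size o)) t'.
      exists (W - size o).-1; split; [lia|lia|].
      by apply: (holds_right supp _ _ h); rewrite /tm in le *; lia.
    exists (Z.to_nat (t' - tl D + Z.of_nat bo)); rewrite /tm in lt gt *.
    split; [lia|lia|]; by have <- : (t' = tl D + Z.of_nat (Z.to_nat (t' - tl D + Z.of_nat bo)) - Z.of_nat bo)%Z by lia.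
  apply/hasP; exists v'; first by rewrite mem_iota; lia.
  by rewrite vv' v'W; apply/IH => //; lia.
- split=> [/hasP[v' _ /andP[/andP[lt v'W] h]]|[t' [lt h]]].
    by exists (tm v'); split; [rewrite /tm; lia|apply/IH => //; lia].
  have [v' [vv' v'W h']] : exists v', [/\ v' < v, size o <= v' & holds (dfact D) (tm v') o (R, os)].
    have [le|gt] := Z.le_gt_cases (tm (size o)) t'; last first.
      exists (size o); split; [lia|lia|].
      by apply: (holds_left supp _ _ h); rewrite /tm in gt *; lia.
    exists (Z.to_nat (t' - tl D + Z.of_nat bo)); rewrite /tm in lt le *.
    split; [lia|lia|]; by have <- : (t' = tl D + Z.of_nat (Z.to_nat (t' - tl D + Z.of_nat bo)) - Z.of_nat bo)%Z by lia.
  apply/hasP; exists v'; first by rewrite mem_iota; lia.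
  by rewrite vv' v'W; apply/IH => //; lia.
Qed.

Definition latom (nu : nat -> nat) (l : literal) : atom := (lit_rel l, map nu (lit_args l)).

Definition srule (t : Z) (s s' : nat) : Prop := exists ru nu,
  [/\ List.In ru p, forall x, x \in rvars ru -> nu x \in objs D,
      forall l, List.In l (rbody ru) -> ~~ idb p (lit_rel l) -> holds (dfact D) t (lit_ops l) (latom nu l),
      s' = (fc p w [::] ((rhead ru).1, map nu (rhead ru).2)).+1 &
      s = premise ru (fun l => fc p w (lit_ops l) (latom nu l))].

Lemma In_filter (T : Type) (P : pred T) s x : List.In x (filter P s) <-> P x /\ List.In x s.
Proof.
elim: s => [|y s IH] /=; first by split=> // -[].
by case: ifP => h /=; rewrite IH; intuition; subst; congruence.
Qed.

Lemma premise_eq ru f g : (forall l, List.In l (rbody ru) -> f l = g l) -> premise ru f = premise ru g.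
Proof.
move=> h; rewrite /premise; case E: [seq _ <- _ | _] => [|l r] //; rewrite h //.
by have /(proj1 (In_filter _ _ _))[] : List.In l [seq l <- rbody ru | idb p (lit_rel l)] by rewrite E; left.
Qed.

Lemma all_In (T : Type) (P : pred T) s : all P s <-> forall x, List.In x s -> P x.
Proof.
elim: s => //= y s IH; split=> [/andP[h1 /IH h2] x [<-|/h2]|h] //.
by rewrite h /=; [apply/IH => x xs; apply: h; right|left].
Qed.

Lemma slices_bound : size (tsets D) <= size w.
Proof. by have [] := slices_le wE okD. Qed.

Lemma edbtrueP u m ru nu l : u < wid w -> List.In ru p -> List.In l (rbody ru) ->
  (forall x, x \in rvars ru -> nu x \in objs D) ->
  (forall x, x \in rvars ru -> cp p w (nu x) = dig w m x) ->
  edbtrue w u m l <-> holds (dfact D) (time u) (lit_ops l) (latom nu l).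
Proof.
move=> uw ri lb nuo nud; have [sz oa] := okf_lit wfp ri nuo lb; have ks := kmax_ge ri lb.
have sb := slices_bound.
rewrite /edbtrue (acode_at_asg nud (lit_rvars lb)) eholdP //; try (rewrite /wid /off; lia); last lia.
have -> : (tl D + Z.of_nat (u + kmax) - Z.of_nat (off w + kmax) = time u)%Z by rewrite /time; lia.
by [].
Qed.

Lemma rulebP u s s' : u < wid w -> ruleb w u s s' <-> srule (time u) s s'.
Proof.
move=> uw; rewrite /ruleb has_In; split=> [[ru ri /hasP[m _ /and4P[okm /eqP e1 /eqP e2 /all_In al]]]|].
  have [nu h] := asg_decode wE okD okm.
  have h1 x (xr : x \in rvars ru) := proj1 (h x xr); have h2 x (xr : x \in rvars ru) := proj2 (h x xr).
  exists ru, nu; split=> //.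
  - move=> l lb nid; apply/(edbtrueP uw ri lb h1 h2).
    by have := al l lb; rewrite (negbTE nid).
  - by rewrite e1 (hcodeE h2).
  - by rewrite e2; apply: premise_eq => l lb; rewrite (lcodeE h2).
move=> [ru [nu [ri nuo h1 h2 h3]]]; exists ru => //.
have [m [mb okm nud]] := asg_encode wE okD ri nuo.
apply/hasP; exists m; first by rewrite mem_iota.
apply/and4P; split=> //.
- by rewrite h2 (hcodeE nud).
- by rewrite h3; apply/eqP; apply: premise_eq => l lb; rewrite (lcodeE nud).
- apply/all_In => l lb; case nid: (idb p (lit_rel l)) => //=.
  by apply/(edbtrueP uw ri lb nuo nud); apply: h1; rewrite ?nid.
Qed.

Definition sound_state (t : Z) (s : nat) : Prop := s = 0 \/ exists o a,
  [/\ has_kind p o a.1, okf D a, s = (fc p w o a).+1 & der p D t o a].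

Lemma sedge_sound u s u' s' : u < wid w -> sound_state (time u) s -> sedge w u s u' s' ->
  sound_state (time u') s'.
Proof.
move=> uw ss.
have mvS (d : bool) : (if d then time u' - 1 else time u' + 1)%Z = time u -> mvs d s s' ->
    sound_state (time u') s'.
  move=> tE /orP[/andP[_ /eqP ->]|/and3P[s0 s0' m]]; first by left.
  case: ss => [s00|[o [a [ho oa sE da]]]]; first by rewrite s00 in s0.
  move: m; rewrite sE /= => /(mvbP w d _ ho)[o' [mo ho' e]].
  right; exists o', a; split=> //; first by lia.
  by apply: der_mv mo; rewrite tE.
case/or3P=> /andP[/eqP e h].
- by apply: (mvS true) h; rewrite /time e; lia.
- by apply: (mvS false) h; rewrite /time e; lia.
move: h; rewrite (rulebP s s' uw) => -[ru [nu [ri nuo h1 h2 h3]]]; right.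
exists [::], ((rhead ru).1, map nu (rhead ru).2); split=> //.
- exact: has_kind_head.
- exact: (okf_head wfp).
rewrite -e; apply: der_rule => // l lb; case nid: (idb p (lit_rel l)); last first.
  apply: (holds_der (E := dfact D)); first by move=> t a; exact: der_fact.
  by apply: h1; rewrite ?nid.
move: h3; rewrite /premise; case E: [seq _ <- _ | _] => [|l' r].
  have : List.In l [seq l <- rbody ru | idb p (lit_rel l)] by apply/In_filter.
  by rewrite E.
have ll' : l = l'.
  have : List.In l [seq l <- rbody ru | idb p (lit_rel l)] by apply/In_filter.
  by have := lin ri; rewrite -size_filter E; case: (r) => [_ [//|//]|].
rewrite -ll' => sE; case: ss => [s0|[o [a [ho oa sE' da]]]]; first by rewrite s0 in sE.
have [||oE aE] := fc_inj (a' := latom nu l) wE okD ho (has_kind_lit ri lb) oa.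
- exact: (okf_lit wfp ri nuo lb).
- by move: sE; rewrite sE' => -[].
by rewrite -oE -[(_, _)]aE.
Qed.

Let act (s : 'I_M) : {set 'I_M} := [set s].
Let sm (A : {set 'I_M}) : Prop := exists s, A = [set s].
Let rl t (A : {set 'I_M}) (s : 'I_M) : Prop := exists2 s0 : 'I_M, A = [set s0] & srule t s0 s.
Let up (s s' : 'I_M) : Prop := mvs true s s'.
Let dn (s s' : 'I_M) : Prop := mvs false s s'.

Lemma srule_ext t t' s s' :
  (forall ru l nu, List.In ru p -> List.In l (rbody ru) ->
     holds (dfact D) t (lit_ops l) (latom nu l) -> holds (dfact D) t' (lit_ops l) (latom nu l)) ->
  srule t s s' -> srule t' s s'.
Proof.
move=> h [ru [nu [ri nuo h1 h2 h3]]]; exists ru, nu; split=> // l lb nid.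
exact: (h ru l nu ri lb (h1 l lb nid)).
Qed.

(* Single premises suffice, so the window need only exceed the number of pairs of states. *)
Lemma linear_extend sg : closed_on rl up dn (fun t => (time 0 <= t <= time (wid w).-1)%Z) sg ->
  exists2 sg', (forall t, (tl D <= t <= tr D)%Z -> sg' t = sg t) & closed_on rl up dn (fun=> True) sg'.
Proof.
move=> cl.
pose a := (tl D - Z.of_nat kmax - 1)%Z; pose b := (tr D + Z.of_nat kmax + 1)%Z.
have sb := slices_bound; have s2 := Dp.1.
have [||||||||||||sg' h1 h2] := @extend_both _ _ act rl up dn sm _ _ _ _ _ (time 0) a b (time (wid w).-1) (M * M).+1 sg.
- by move=> t A s [s0 -> _]; exists s0.
- move=> j Z; rewrite sub1set => /shiftedP[s sZ us]; exists [set s]; split; [by exists s|by rewrite sub1set|].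
  by rewrite sub1set; apply/shiftedP; exists s => //; rewrite inE.
- move=> j Z; rewrite sub1set => /shiftedP[s sZ us]; exists [set s]; split; [by exists s|by rewrite sub1set|].
  by rewrite sub1set; apply/shiftedP; exists s => //; rewrite inE.
- move=> U A R [s ->] _ /(_ s); rewrite inE eqxx => /(_ isT)[j jU jR]; exists j => // y.
  by rewrite inE => /eqP ->.
- by move=> s; exists s.
- by rewrite card_prod !card_ord.
- by rewrite /time /a /off -/M; lia.
- by rewrite /a /b /tr; lia.
- by rewrite /time /b /tr /wid /off -/M; lia.
- move=> t A s ta; rewrite /a in ta.
  have inv t1 t2 : (t1 <= a)%Z -> (t2 <= a)%Z -> rl t1 A s -> rl t2 A s.
    rewrite /a => l1 l2 [s0 -> h]; exists s0 => //; apply: srule_ext h => ru l nu ri lb.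
    have ks := kmax_ge ri lb.
    by apply: (holds_left (l := tl D) (r := tr D)) => [t' /dfact_supp //| |]; lia.
  by split; apply: inv; rewrite /a; lia.
- move=> t A s ta; rewrite /b in ta.
  have inv t1 t2 : (b <= t1)%Z -> (b <= t2)%Z -> rl t1 A s -> rl t2 A s.
    rewrite /b => l1 l2 [s0 -> h]; exists s0 => //; apply: srule_ext h => ru l nu ri lb.
    have ks := kmax_ge ri lb.
    by apply: (holds_right (l := tl D) (r := tr D)) => [t' /dfact_supp //| |]; lia.
  by split; apply: inv; rewrite /b; lia.
- exact: cl.
by exists sg' => // t ht; apply: h1; rewrite /a /b; lia.
Qed.

(** Induction over derivations. Only IDB facts are followed, since [srule] tests EDB premises
    against the database; rules without IDB premise start from state 0. *)
Lemma linear_closed_der sg : closed_on rl up dn (fun=> True) sg ->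
  (forall t, exists2 s : 'I_M, s \in sg t & s = 0 :> nat) ->
  forall t o a, der p D t o a -> idb p a.1 -> has_kind p o a.1 -> okf D a ->
  exists2 s : 'I_M, s \in sg t & s = (fc p w o a).+1 :> nat.
Proof.
move=> [c1 c2 c3] z0 t o a.
have mvC (d : bool) t1 o1 o2 a1 : has_kind p o1 a1.1 -> has_kind p o2 a1.1 -> okf D a1 -> mv d o1 o2 ->
    (exists2 s : 'I_M, s \in sg (if d then t1 - 1 else t1 + 1)%Z & s = (fc p w o1 a1).+1 :> nat) ->
    exists2 s : 'I_M, s \in sg t1 & s = (fc p w o2 a1).+1 :> nat.
  move=> k1 k2 ok1 m [s sg1 sE].
  have lt : (fc p w o2 a1).+1 < M by rewrite ltnS; exact: (fc_lt wE okD).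
  exists (Ordinal lt) => //.
  have mb : mvs d s (Ordinal lt) by rewrite /mvs sE /=; apply/(mvbP w d _ k1); exists o2.
  case: d m sg1 mb => m sg1 mb.
    by have := c2 _ _ _ I I sg1 mb; rewrite Z.sub_add.
  by have := c3 _ _ _ I I sg1 mb; rewrite Z.add_simpl_r.
elim=> {t o a}.
- by move=> t a /(dfact_ok Dp)[_ /andP[_ /negbTE ->]].
- move=> ru t nu ri nuo dl IH id hk oh.
  have lt : (fc p w [::] ((rhead ru).1, map nu (rhead ru).2)).+1 < M by rewrite ltnS; exact: (fc_lt wE okD).
  exists (Ordinal lt) => //.
  have [s sgs sE] : exists2 s : 'I_M, s \in sg t &
      s = premise ru (fun l => fc p w (lit_ops l) (latom nu l)) :> nat.
    rewrite /premise; case E: [seq _ <- _ | _] => [|l r]; first exact: z0.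
    have /(proj1 (In_filter _ _ _))[li lb] : List.In l [seq l <- rbody ru | idb p (lit_rel l)] by rewrite E; left.
    by apply: IH => //; [exact: has_kind_lit ri lb|exact: (okf_lit wfp ri nuo lb)].
  apply: (c1 t I [set s]); last by rewrite sub1set.
  exists s => //; exists ru, nu; split=> // l lb nid.
  apply: (@holds_impl (fun t a => der p D t [::] a)); first by move=> t' h; exact: der_edb h nid.
  by apply: (der_holds Dp (der_model wfp Dp)); exact: dl.
- move=> t o a _ IH id hk oa; have hk' := has_kind_cons hk.
  by apply: (mvC false _ o _ a hk' hk oa _ (IH id hk' oa)); constructor 1.
- move=> t o a _ IH id hk oa; have hk' := has_kind_cons hk.
  by apply: (mvC true _ o _ a hk' hk oa _ (IH id hk' oa)); constructor 1.
- move=> t o a _ IH id hk oa; have hk' := has_kind_cons hk.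
  by apply: (mvC false _ o _ a hk' hk oa _ (IH id hk' oa)); constructor 2.
- move=> t o a _ IH id hk oa.
  by apply: (mvC false _ _ _ a hk hk oa _ (IH id hk oa)); constructor 3; split=> //; exists o.
- move=> t o a _ IH id hk oa; have hk' := has_kind_cons hk.
  by apply: (mvC true _ o _ a hk' hk oa _ (IH id hk' oa)); constructor 2.
- move=> t o a _ IH id hk oa.
  by apply: (mvC true _ _ _ a hk hk oa _ (IH id hk oa)); constructor 3; split=> //; exists o.
Qed.

Let node (u s : nat) : nat := s + M * u.

Lemma node_div u (s : 'I_M) : node u s %/ M = u.
Proof. by rewrite /node addnC mulnC divnMDl // divn_small ?addn0. Qed.

Lemma node_mod u (s : 'I_M) : node u s %% M = s.
Proof. by rewrite /node addnC mulnC modnMDl modn_small. Qed.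

Definition step_in (x y : nat) : Prop := [/\ x < M * wid w, y < M * wid w & edge w x y].

Lemma linear_reach t a : in_tem D t -> idb p a.1 -> okf D a ->
  certain p D t a <->
  clos_refl_trans nat step_in 0 (node (off w + Z.to_nat (t - tl D)) (fc p w [::] a).+1).
Proof.
move=> tt id oa; rewrite (certain_der wfp Dp); set u0 := _ + _; have sb := slices_bound.
have u0W : u0 < wid w by rewrite /in_tem /tr in tt; rewrite /u0 /wid; lia.
have u0E : time u0 = t by rewrite /in_tem in tt; rewrite /time /u0; lia.
have hk := has_kind_idb id.
have ltq : (fc p w [::] a).+1 < M by rewrite ltnS; exact: (fc_lt wE okD).
have W0 : 0 < wid w by rewrite /wid addnS.
have nlt u (s : 'I_M) : u < wid w -> node u s < M * wid w.
  by move=> h; have := ltn_ord s; rewrite /node; nia.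
split=> [da|/clos_rt_rtn1_iff r]; last first.
  have gen x : clos_refl_trans_n1 nat step_in 0 x -> sound_state (time (x %/ M)) (x %% M).
    elim=> [|y z [yb zb e] _ IH]; first by left; rewrite mod0n.
    by apply: sedge_sound IH e; rewrite ltn_divLR // mulnC.
  have := gen _ r; rewrite (node_div u0 (Ordinal ltq)) (node_mod u0 (Ordinal ltq)) /=.
  case=> // -[o [a' [ho oa' [e] d]]]; have [oE aE] := fc_inj wE okD hk ho oa oa' e.
  by rewrite -u0E oE aE.
(* The states reachable in the graph are closed under inference on the window, hence extend to a
   closed assignment on all of [Z]. It contains everything derivable, and at the queried time it
   agrees with reachability. *)
pose sg t := [set s : 'I_M | `[< clos_refl_trans nat step_in 0 (node (Z.to_nat (t - time 0)) s) >]].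
have sgP t1 (s : 'I_M) : reflect (clos_refl_trans nat step_in 0 (node (Z.to_nat (t1 - time 0)) s)) (s \in sg t1).
  by rewrite inE; exact: asboolP.
have stp u u' (s s' : 'I_M) : u < wid w -> u' < wid w -> sedge w u s u' s' ->
    clos_refl_trans nat step_in 0 (node u s) -> clos_refl_trans nat step_in 0 (node u' s').
  move=> uw uw' e r; apply: rt_trans r _; apply: rt_step; split; [exact: nlt|exact: nlt|].
  by rewrite /edge -/M !node_div !node_mod.
have bnd t1 : (time 0 <= t1 <= time (wid w).-1)%Z -> Z.to_nat (t1 - time 0) < wid w by rewrite /time; lia.
have cl : closed_on rl up dn (fun t => (time 0 <= t <= time (wid w).-1)%Z) sg.
  split.
  - move=> t1 h1 A s [s0 -> h]; rewrite sub1set => /sgP r; apply/sgP; apply: stp r; try exact: bnd.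
    rewrite /sedge eqxx /=; apply/orP; right; apply/orP; right; rewrite rulebP; last exact: bnd.
    by have -> : time (Z.to_nat (t1 - time 0)) = t1 by rewrite /time in h1 *; lia.
  - move=> t1 s s' h1 h2 /sgP r us; apply/sgP; apply: stp r; try exact: bnd.
    by rewrite /sedge us andbT; apply/orP; left; lia.
  - move=> t1 s s' h1 h2 /sgP r us; apply/sgP; apply: stp r; try exact: bnd.
    by rewrite /sedge us andbT; apply/orP; right; apply/orP; left; lia.
have z0 : 0 < M by [].
have sg0 t1 : (time 0 <= t1 <= time (wid w).-1)%Z -> Ordinal z0 \in sg t1.
  move=> h1; have -> : t1 = (time 0 + Z.of_nat (Z.to_nat (t1 - time 0)))%Z by lia.
  have := bnd _ h1; elim: (Z.to_nat _) => [|n IH] nW.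
    by apply/sgP; rewrite Z.add_0_r Z.sub_diag /node muln0; exact: rt_refl.
  have -> : (time 0 + Z.of_nat n.+1 = time 0 + Z.of_nat n + 1)%Z by lia.
  have [_ c2 _] := cl; apply: c2 (IH (ltnW nW)) _ => //; rewrite /time in nW *; lia.
have [sg' agr cl'] := linear_extend cl; have [_ c2 c3] := cl'.
(* Outside the database the extension is only known to be closed, so state 0 is carried there from
   [t], in both directions, by its moves to itself. *)
have z' t1 : exists2 s : 'I_M, s \in sg' t1 & s = 0 :> nat.
  exists (Ordinal z0) => //.
  have base0 : Ordinal z0 \in sg' t by rewrite agr //; apply: sg0; move: u0W; rewrite -u0E /time; lia.
  have upn n : Ordinal z0 \in sg' (t + Z.of_nat n)%Z.
    elim: n => [|n IH]; first by rewrite Z.add_0_r.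
    by have := c2 _ _ (Ordinal z0) I I IH isT; rewrite Nat2Z.inj_succ -Z.add_1_r Z.add_assoc.
  have dnn n : Ordinal z0 \in sg' (t - Z.of_nat n)%Z.
    elim: n => [|n IH]; first by rewrite Z.sub_0_r.
    by have := c3 _ _ (Ordinal z0) I I IH isT; have -> : (t - Z.of_nat n - 1 = t - Z.of_nat n.+1)%Z by lia.
  have [le|gt] := Z.le_gt_cases t t1.
    by have -> : t1 = (t + Z.of_nat (Z.to_nat (t1 - t)))%Z by lia.
  by have -> : t1 = (t - Z.of_nat (Z.to_nat (t - t1)))%Z by lia.
have [s + sE] := linear_closed_der cl' z' da id hk oa.
rewrite agr // => /sgP; rewrite sE.
by have -> : Z.to_nat (t - time 0) = u0 by rewrite -u0E /time; lia.
Qed.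
End Layout.

Variable Gr : relsym.

Definition nl_acc (w : seq tok) (x : nat) : bool :=
  valid p Gr w && (x == (kidx p [::] Gr + nk p * qcode p Gr w).+1 + nst w * (off w + toff p w)).

Theorem linear_NL : is_query p Gr -> linear p -> in_NL (query_lang p Gr).
Proof.
move=> [wfp id] lin.
apply: (@NL_of_graph _ (fun w => nst w * wid w) edge nl_acc).
- by move=> G; have c1 := cmp_nst G; have c2 := cmp_wid G; cmp_tac.
- exact: cmp_edge.
- move=> G f cf; have c1 := cmp_nst G; have c2 := cmp_off G; have c3 := cmp_toff p G.
  by have c4 := cmp_qcode p Gr G; have c5 := cmp_valid p Gr G; rewrite /nl_acc; cmp_tac.
- by move=> w; rewrite /wid addnS mulnS.
have key w D ds t : db_over_edb p D -> size ds = arity Gr -> all (fun d => d \in objs D) ds ->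
    in_tem D t -> w = enc_input D ds t -> certain p D t (Gr, ds) <->
    clos_refl_trans nat (step_in w) 0 ((kidx p [::] Gr + nk p * qcode p Gr w).+1 + nst w * (off w + toff p w)).
  move=> h1 h2 h3 h4 wE; have := @linear_reach D ds t w wE h1 wfp lin t (Gr, ds) h4 id (conj h2 h3).
  have -> : Z.to_nat (t - tl D) = toff p w by have := toffE wE h1.2 h4; lia.
  by rewrite (qcodeE wE h1.2 h2) => ->.
move=> w; split=> [[D [ds [t [[h1 h2 h3 h4 wE] c]]]]|[x [r /andP[/validP[D [ds [t [h1 h2 h3 h4 wE]]]] /eqP xE]]]].
  exists ((kidx p [::] Gr + nk p * qcode p Gr w).+1 + nst w * (off w + toff p w)); split.
    exact/(key w D ds t h1 h2 h3 h4 wE).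
  by apply/andP; split=> //; apply/validP; exists D, ds, t.
exists D, ds, t; split=> //; apply/(key w D ds t h1 h2 h3 h4 wE).
by rewrite -xE.
Qed.
End Linear.

(** * Saturating an exponentially long window in polynomial space *)

Definition bsum (f : nat -> bool) (a b : nat) : nat := \sum_(a <= i < b) f i * 2 ^ i.

Lemma bsum_lt f k : bsum f 0 k < 2 ^ k.
Proof.
elim: k => [|k IH]; first by rewrite /bsum big_geq.
by rewrite /bsum big_nat_recr //= -/(bsum f 0 k) expnS; case: (f k); lia.
Qed.

Lemma bsum_dvd f a b : 2 ^ a %| bsum f a b.
Proof.
rewrite /bsum big_seq_cond; apply: dvdn_sum => i.
by rewrite andbT mem_index_iota => /andP[h _]; apply: dvdn_mull; exact: dvdn_exp2l.
Qed.

Lemma bsum_split f k b : k < b -> bsum f 0 b = bsum f 0 k + f k * 2 ^ k + bsum f k.+1 b.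
Proof.
move=> h; rewrite /bsum (big_cat_nat (leq0n k) (ltnW h)) /= -addnA; congr (_ + _).
by rewrite big_ltn.
Qed.

Lemma eq_bsum f g a b : (forall i, a <= i < b -> f i = g i) -> bsum f a b = bsum g a b.
Proof. by move=> h; apply: eq_big_nat => i /h ->. Qed.

Section Sweep.
Variables (S : finType) (D K : nat) (gl gr : nat -> {set S} -> {set S} -> {set S}).
Hypothesis gl_sub : forall v (A B : {set S}), A \subset gl v A B.
Hypothesis gr_sub : forall v (A B : {set S}), B \subset gr v A B.
Hypothesis SK : #|S| < K.

Let Q := 2 * K.
Let Q0 : 0 < Q. Proof. by rewrite /Q; lia. Qed.

(** As [Q] is even, the parity of the quotient is that of the [i]-th digit of [n]. *)
Definition dg (n i : nat) : bool := odd (n %/ Q ^ i).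
Definition cur (n : nat) : nat := bsum (dg n) 0 D.
(** A subwindow of length [2 ^ i.+1] starts at a multiple of its length, so its midpoint has 2-adic
    valuation [i]; the right end [2 ^ D] of the window gets slot [D]. The left end 0 has no
    valuation and gets a slot of its own. *)
Definition slot (v : nat) : nat := if v == 0 then D.+1 else logn 2 v.

Definition infer (n : nat) (m : nat -> {set S}) (k : nat) : {set S} :=
  let v := cur n in
  if k == slot v then gl v (m (slot v)) (m (slot v.+1))
  else if k == slot v.+1 then gr v (m (slot v)) (m (slot v.+1)) else m k.

(* The window is bisected recursively: slot [k] holds the set of the midpoint of
   the current subwindow of length [2 ^ k.+1], the two last slots those of the
   end points of the window. Both halves of a subwindow are processed [K] times;
   the parity of the [k]-th digit of [n] in base [2 * K] tells which one is current. *)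
Fixpoint store (n : nat) : nat -> {set S} :=
  if n is n'.+1 then
    fun k => if (k < D) && (Q ^ k.+1 %| n) then set0 else infer n' (store n') k
  else fun=> set0.

Definition pre (n : nat) : nat -> {set S} := infer n.-1 (store n.-1).

Lemma store_pre n k : 0 < n -> ~~ ((k < D) && (Q ^ k.+1 %| n)) -> store n k = pre n k.
Proof. by case: n => // n _ /= /negbTE ->. Qed.

Lemma infer_sub n (m : nat -> {set S}) k : m k \subset infer n m k.
Proof. by rewrite /infer; case: eqP => [->|_]; [exact: gl_sub|case: eqP => [->|_]; [exact: gr_sub|]]. Qed.

Lemma store_mono k n n' : n <= n' ->
  (forall j, n < j <= n' -> ~~ ((k < D) && (Q ^ k.+1 %| j))) -> store n k \subset store n' k.
Proof.
move=> /subnK <-; elim: (n' - n) => [|d IH] h //; rewrite addSn.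
apply: subset_trans (IH _) _; first by move=> j hj; apply: h; lia.
rewrite (@store_pre (d + n).+1) //; last by apply: h; lia.
exact: infer_sub.
Qed.

Lemma cur_lt n : cur n < 2 ^ D.
Proof. exact: bsum_lt. Qed.

Lemma dg_dvd n i k : Q ^ i %| n -> k < i -> dg n k = false.
Proof.
move=> /dvdnP[c ->] ki; rewrite /dg -(subnK ki) addnS expnS expnD mulnA.
by rewrite mulnA mulnK ?expn_gt0 ?Q0 // mulnCA oddM /Q oddM.
Qed.

Lemma dg_add n i r k : Q ^ i.+1 %| n -> r < Q -> dg (n + r * Q ^ i) k =
  if k == i then odd r else dg n k.
Proof.
move=> dn rQ; have pk j : 0 < Q ^ j by rewrite expn_gt0 Q0.
case: (ltngtP k i) => [ki|ik|->].
- rewrite (dg_dvd dn) ?(ltnW ki) //; last by lia.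
  apply: (dg_dvd (i := i)) ki; apply: dvdn_add; last exact: dvdn_mull.
  exact: dvdn_trans (dvdn_exp2l _ (leqnSn i)) dn.
- rewrite /dg -(subnKC ik) expnD !divnMA; congr (odd (_ %/ _)).
  move: dn => /dvdnP[c ->]; rewrite divnMDl ?pk // mulnK ?pk //.
  by rewrite divn_small ?addn0 // expnS ltn_mul2r pk.
- rewrite /dg; move: dn => /dvdnP[c ->].
  by rewrite expnS mulnA -mulnDl mulnK ?pk // oddD oddM /Q oddM andbF.
Qed.

Lemma cur_add n i r : Q ^ i.+1 %| n -> r < Q -> i < D -> cur (n + r * Q ^ i) = cur n + odd r * 2 ^ i.
Proof.
move=> dn rQ iD; rewrite /cur !(bsum_split _ iD).
rewrite (@eq_bsum _ (dg n) 0); last by move=> k ki; rewrite dg_add //; case: eqP => //; lia.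
rewrite (@eq_bsum _ (dg n) i.+1); last by move=> k ki; rewrite dg_add //; case: eqP => //; lia.
rewrite dg_add // eqxx (dg_dvd dn) // mul0n addn0; lia.
Qed.

Lemma cur_dvd n i : Q ^ i %| n -> i <= D -> 2 ^ i %| cur n.
Proof.
move=> dn iD; rewrite /cur /bsum (big_cat_nat (leq0n i) iD) /= -!/(bsum _ _ _).
apply: dvdn_add (bsum_dvd _ _ _); rewrite /bsum big_nat big1 ?dvdn0 // => k /andP[_ ki].
by rewrite (dg_dvd dn).
Qed.

Lemma slot_mid x i : 2 ^ i.+1 %| x -> slot (x + 2 ^ i) = i.
Proof.
move=> /dvdnP[c ->]; have -> : c * 2 ^ i.+1 + 2 ^ i = (c * 2).+1 * 2 ^ i by rewrite expnS mulnA mulSn addnC.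
have p0 : 0 < 2 ^ i by rewrite expn_gt0.
rewrite /slot ifN ?muln_eq0 ?negb_or -?lt0n //.
by rewrite lognM // pfactorK // lognE /= dvdn2 /= oddM andbF.
Qed.

Lemma slot_ge v i : 2 ^ i %| v -> i <= D -> i <= slot v.
Proof.
rewrite /slot; case: eqP => [_ _|/eqP v0]; first by lia.
by rewrite pfactor_dvdn // lt0n.
Qed.

(** The last clause ties [sg v] to a set that is in the store while the sweep visits [v]; a machine
    that cannot tell when saturation is reached can still meet it there. *)
Definition saturated (sg : nat -> {set S}) (v : nat) : Prop :=
  [/\ gl v (sg v) (sg v.+1) = sg v, gr v (sg v) (sg v.+1) = sg v.+1 &
      exists n, cur n = v /\ sg v = store n (slot v)].

(* If the end points do not change, neither does the midpoint in one of the [K] rounds,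
   since it can grow at most [#|S|] times. *)
Lemma sweep i n0 : i <= D -> Q ^ i %| n0 -> let x := cur n0 in
  pre (n0 + Q ^ i) (slot x) = store n0 (slot x) ->
  pre (n0 + Q ^ i) (slot (x + 2 ^ i)) = store n0 (slot (x + 2 ^ i)) ->
  exists sg, [/\ sg x = store n0 (slot x), sg (x + 2 ^ i) = store n0 (slot (x + 2 ^ i)) &
    forall v, x <= v < x + 2 ^ i -> saturated sg v].
Proof.
elim: i n0 => [|i IH] n0 iD dn x hl hr.
  (* Neighbouring points differ in parity, so they never share a slot. *)
  have sne : (slot x.+1 == slot x) = false.
    rewrite /slot; case: x {hl hr} (cur_lt n0 : x < 2 ^ D) => [|x] xD; first by rewrite logn1.
    apply/negbTE/eqP => e.
    have h : 2 %| x.+1 = (2 %| x.+2).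
      by rewrite -(expn1 2) !pfactor_dvdn // -e.
    by move: h; rewrite !dvdn2 /=; case: odd.
  exists (fun v => if v == x then store n0 (slot x) else store n0 (slot x.+1)).
  rewrite expn0 !addn1 eqxx; have nx : (x.+1 == x) = false by lia.
  rewrite nx; split=> // v vx; have -> : v = x by lia.
  rewrite /saturated eqxx nx.
  move: hl hr; rewrite expn0 !addn1 /pre /= /infer -/x eqxx sne eqxx => hl hr.
  by split=> //; exists n0.
have p0 j : 0 < Q ^ j by rewrite expn_gt0 Q0.
have dx : 2 ^ i.+1 %| x by exact: cur_dvd.
pose y := x + 2 ^ i; pose z := x + 2 ^ i.+1.
have sy : slot y = i by exact: slot_mid.
have yz : y + 2 ^ i = z by rewrite /y /z expnS; lia.
pose n r := n0 + r * Q ^ i.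
have nQ : n Q = n0 + Q ^ i.+1 by rewrite /n expnS.
have cn r : r < Q -> cur (n r) = if odd r then y else x.
  by move=> rQ; rewrite /n cur_add // -/x /y; case: odd; rewrite ?mul1n ?mul0n ?addn0.
have dnr r : Q ^ i %| n r.
  by apply: dvdn_add; [exact: dvdn_trans (dvdn_exp2l _ (leqnSn i)) dn|exact: dvdn_mull].
have nS r : n r.+1 = n r + Q ^ i by rewrite /n mulSn; lia.
(* While the subwindow is processed, the slots of its midpoint and end points are not cleared. *)
have keep k j : i <= k -> n0 < j < n0 + Q ^ i.+1 -> ~~ ((k < D) && (Q ^ k.+1 %| j)).
  move=> ik hj; rewrite negb_and; apply/orP; right; apply/negP => h.
  have : Q ^ i.+1 %| j - n0 by rewrite dvdn_subr ?(dvdn_trans (dvdn_exp2l Q _) h) ?(ltnW (proj1 (andP hj))).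
  by move=> /dvdn_leq; lia.
have nlt r r' : r < r' -> n r < n r' by move=> h; rewrite /n ltn_add2l ltn_mul2r p0.
(* The contents at the start of half-round [r]; for [r = Q] the value before the clearing that
   closes the subwindow. *)
pose at_ r k := if r == Q then pre (n Q) k else store (n r) k.
have atE r k : i <= k -> 0 < r <= Q -> at_ r k = pre (n r) k.
  move=> ik hr'; rewrite /at_; case: eqP => [->//|/eqP rQ].
  have b1 : n 0 < n r by apply: nlt; lia.
  have b2 : n r < n Q by apply: nlt; lia.
  rewrite nQ in b2; rewrite {1}/n mul0n addn0 in b1.
  by apply: store_pre; [lia|apply: keep => //; rewrite b1 b2].
have atS r k : i <= k -> r < Q -> at_ r k \subset at_ r.+1 k.
  move=> ik rQ; rewrite (@atE r.+1) //.
  rewrite /at_ ifN; last by lia.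
  rewrite /pre; apply: subset_trans (infer_sub _ _ _); apply: store_mono.
    by have := nlt r r.+1; lia.
  move=> j hj; apply: keep => //; have := nlt r r.+1; have : n0 <= n r by rewrite /n leq_addr.
  have : n r.+1 <= n Q by rewrite /n leq_add2l leq_mul2r rQ orbT.
  by rewrite nQ; lia.
have atM r r' k : i <= k -> r <= r' -> r' <= Q -> at_ r k \subset at_ r' k.
  move=> ik /subnK <-; elim: (r' - r) => [|d IHd] h //; rewrite addSn.
  by apply: subset_trans (IHd _) (atS _ _ ik _); lia.
have Q1 : Q > 0 := Q0.
have at0 k : at_ 0 k = store n0 k by rewrite /at_ /n mul0n addn0 ifN //; lia.
have const k : i <= k -> at_ Q k = at_ 0 k -> forall r, r <= Q -> at_ r k = store n0 k.
  move=> ik e r rQ; rewrite -at0; apply/eqP; rewrite eqEsubset; apply/andP.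
  by split; [rewrite -e; exact: atM|exact: atM].
have ex : i <= slot x by apply: slot_ge; [exact: dvdn_trans (dvdn_exp2l _ (leqnSn i)) dx|exact: ltnW].
have ez : i <= slot z.
  apply: slot_ge; last exact: ltnW.
  by rewrite /z; apply: dvdn_add; [exact: dvdn_trans (dvdn_exp2l _ (leqnSn i)) dx|exact: dvdn_exp2l].
have cx : forall r, r <= Q -> at_ r (slot x) = store n0 (slot x).
  by apply: const => //; rewrite at0 -hl /at_ eqxx nQ.
have cz : forall r, r <= Q -> at_ r (slot z) = store n0 (slot z).
  by apply: const => //; rewrite at0 -hr /at_ eqxx nQ.
have mat r k : r < Q -> store (n r) k = at_ r k by move=> rQ; rewrite /at_ ifN //; lia.
have [r rK /eqP cy] : exists2 r, r < K & at_ (2 * r) i == at_ (2 * r).+2 i.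
  have [/hasP[r]|/hasPn no] := boolP (has (fun r => at_ (2 * r) i == at_ (2 * r).+2 i) (iota 0 K)).
    by rewrite mem_iota => h1 h2; exists r.
  have big r : r <= K -> r <= #|at_ (2 * r) i|.
    elim: r => // r IHr rK; apply: leq_ltn_trans (IHr (ltnW rK)) _; apply: proper_card.
    rewrite properEneq mulnS add2n no ?mem_iota //=; apply: atM; rewrite ?leqnn //; rewrite /Q; lia.
  have h1 : #|at_ (2 * K) i| <= #|S| := max_card _.
  by have := big K (leqnn _); lia.
have rQ : (2 * r).+1 < Q by rewrite /Q; lia.
have cy1 : at_ (2 * r).+1 i = at_ (2 * r) i.
  by apply/eqP; rewrite eqEsubset {1}cy !atM //; lia.
have or : odd (2 * r) = false by rewrite oddM.
(* In the stationary round, half-round [2 * r] treats the left half and [(2 * r).+1] the right half;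
   the two results agree at the midpoint [y]. *)
have [||||s1 [s1x s1y h1]] := IH (n (2 * r)); rewrite ?cn ?or ?(ltnW rQ) //=.
- exact: ltnW.
- by rewrite -nS -atE ?mat ?cx //; lia.
- by rewrite -nS -/y sy -atE ?mat //; lia.
rewrite cn ?or ?(ltnW rQ) // -/y sy in s1x s1y h1.
have [||||s2 [s2y s2z h2]] := IH (n (2 * r).+1); rewrite ?cn //= ?or //=.
- exact: ltnW.
- by rewrite -nS sy -atE ?mat -?cy ?cy1 //; lia.
- by rewrite -nS yz -atE ?mat ?cz //; lia.
rewrite cn //= or /= sy yz in s2y s2z h2.
have xy : x < y by rewrite /y -{1}[x]addn0 ltn_add2l expn_gt0.
have yz' : y < z by rewrite -yz -{1}[y]addn0 ltn_add2l expn_gt0.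
exists (fun v => if v < y then s1 v else s2 v); rewrite -/z; split.
- by rewrite xy s1x mat ?cx //; lia.
- by rewrite ltnNge (ltnW yz') /= s2z mat ?cz //; lia.
move=> v hv; have [vy|yv] := ltnP v y.
  have [|e1 e2 e3] := h1 v; first by lia.
  rewrite /saturated vy; case: (ltnP v.+1 y) => [//|yv].
  have -> : v.+1 = y by lia.
  have -> : s2 y = s1 y by rewrite s1y s2y !mat ?cy1 //; lia.
  by have <- : v.+1 = y by lia.
have [|e1 e2 e3] := h2 v; first by lia.
by rewrite /saturated ltnNge yv /= ltnNge (leqW yv).
Qed.

Theorem sweep_saturates : exists sg, forall v, v < 2 ^ D -> saturated sg v.
Proof.
have p0 j : 0 < Q ^ j by rewrite expn_gt0 Q0.
have c0 c : cur (c * Q ^ D) = 0.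
  have := cur_dvd (n := c * Q ^ D) (i := D) (dvdn_mull _ (dvdnn _)) (leqnn _).
  by move=> /dvdnP[e h]; have := cur_lt (c * Q ^ D); rewrite h; case: e {h} => //= e; rewrite mulSn; lia.
have sD : slot (2 ^ D) = D by rewrite -[2 ^ D]add0n slot_mid.
have s0 : slot 0 = D.+1 by [].
pose f c := #|store (c * Q ^ D) D.+1| + #|store (c * Q ^ D) D|.
have keep k j : D <= k -> ~~ ((k < D) && (Q ^ k.+1 %| j)) by move=> h; rewrite ltnNge h.
have sub c k : D <= k -> store (c * Q ^ D) k \subset store (c.+1 * Q ^ D) k.
  by move=> h; apply: store_mono => [|j _]; [rewrite leq_mul2r leqnSn orbT|exact: keep].
(* The end points of the whole window are never cleared. Together they can grow at most [2 * #|S|]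
   times, so one of [2 * K] sweeps leaves both unchanged. *)
have [c e1 e2] : exists2 c, store (c * Q ^ D) D.+1 = store (c.+1 * Q ^ D) D.+1
     & store (c * Q ^ D) D = store (c.+1 * Q ^ D) D.
  have [/hasP[c _ /andP[/eqP h1 /eqP h2]]|/hasPn no] := boolP (has (fun c =>
      (store (c * Q ^ D) D.+1 == store (c.+1 * Q ^ D) D.+1) && (store (c * Q ^ D) D == store (c.+1 * Q ^ D) D))
      (iota 0 (2 * K))); first by exists c.
  have big c : c <= 2 * K -> c <= f c.
    elim: c => // c IHc cK; apply: leq_ltn_trans (IHc (ltnW cK)) _.
    have := no c; rewrite mem_iota /= add0n => /(_ cK).
    have h1 := sub c _ (leqnSn D); have h2 := sub c _ (leqnn D).
    have l1 := subset_leq_card h1; have l2 := subset_leq_card h2.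
    rewrite negb_and => /orP[ne|ne].
      have : store (c * Q ^ D) D.+1 \proper store (c.+1 * Q ^ D) D.+1 by rewrite properEneq ne.
      by move/proper_card; rewrite /f; lia.
    have : store (c * Q ^ D) D \proper store (c.+1 * Q ^ D) D by rewrite properEneq ne.
    by move/proper_card; rewrite /f; lia.
  have h1 k : #|store (2 * K * Q ^ D) k| <= #|S| := max_card _.
  by have := big (2 * K) (leqnn _); have := h1 D; have := h1 D.+1; rewrite /f; lia.
have dc : Q ^ D %| c * Q ^ D by exact: dvdn_mull.
have := @sweep D (c * Q ^ D) (leqnn _) dc; rewrite /= c0 add0n sD s0 addnC -mulSn => sw.
have pE k : D <= k -> pre (c.+1 * Q ^ D) k = store (c.+1 * Q ^ D) k.
  by move=> h; rewrite store_pre ?keep // muln_gt0 p0.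
have [||sg [_ _ h]] := sw; first by rewrite pE // -e1.
  by rewrite pE // -e2.
by exists sg => v vD; apply: h.
Qed.

(** The time point whose facts slot [k] holds at step [n]: the midpoint of the current subwindow of
    length [2 ^ k.+1], or an end point of the window. *)
Definition pt (n k : nat) : nat := if D < k then 0 else bsum (dg n) k.+1 D + 2 ^ k.

Lemma odd_part v : 0 < v -> exists q, v = (q * 2).+1 * 2 ^ logn 2 v.
Proof.
move=> v0; have [m c e] := pfactor_coprime (isT : prime 2) v0; exists m./2.
rewrite {1}e; congr (_ * _); rewrite muln2 -[in LHS](odd_double_half m).
by move: c; rewrite coprime2n => ->.
Qed.

Lemma cur_split n k : k < D -> exists2 q, bsum (dg n) k.+1 D = q * 2 ^ k.+1 &
  cur n = bsum (dg n) 0 k + dg n k * 2 ^ k + q * 2 ^ k.+1.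
Proof.
by move=> kD; have /dvdnP[q e] := bsum_dvd (dg n) k.+1 D; exists q => //; rewrite -e -bsum_split.
Qed.

Lemma small_mult l X a b : l < X -> l + a * X = b * X -> l = 0 /\ a = b.
Proof.
move=> lX e; have l0 : l = 0.
  by have := congr1 (modn^~ X) e; rewrite /= addnC modnMDl modnMl modn_small.
split=> //; move: e; rewrite l0 add0n => /eqP; rewrite eqn_pmul2r; [move/eqP|]; lia.
Qed.

Lemma logn_lt v : 0 < v <= 2 ^ D -> logn 2 v <= D.
Proof.
move=> /andP[v0 vD]; have := pfactor_dvdnn 2 v => /(dvdn_leq v0) h.
by rewrite -(@leq_exp2l 2) //; exact: leq_trans h vD.
Qed.

Lemma pt_cur n : pt n (slot (cur n)) = cur n.
Proof.
rewrite /pt /slot; have lt := cur_lt n; case: eqP => [->|/eqP]; first by rewrite ltnSn.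
rewrite -lt0n => v0; have [q e] := odd_part v0; set k := logn 2 _ in e *.
have kD : k < D.
  rewrite -(@ltn_exp2l 2) //; apply: leq_ltn_trans lt; rewrite e mulSn; lia.
rewrite ifN; last by rewrite -leqNgt ltnW.
have [q' -> e'] := cur_split n kD; have lo := bsum_lt (dg n) k; move: e; rewrite {1 2}e' expnS.
set X := 2 ^ k in lo *; set l := bsum _ _ _ in lo *.
have X0 : 0 < X by rewrite /X expn_gt0.
move=> e; have [] := @small_mult l X (dg n k + q' * 2) (q * 2).+1 lo.
  by rewrite -e mulnDl -mulnA -addnA.
by case: (dg n k) => l0 /=; lia.
Qed.

Lemma pt_curS n : pt n (slot (cur n).+1) = (cur n).+1.
Proof.
rewrite /pt /slot /=; have lt := cur_lt n.
have [q e] := odd_part (isT : 0 < (cur n).+1); set k := logn 2 _ in e *.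
have kD : k <= D by apply: logn_lt; rewrite /= lt.
rewrite ifN; last by rewrite -leqNgt.
move: kD; rewrite leq_eqVlt => /orP[/eqP kE|kD].
  rewrite kE /bsum big_geq // add0n; move: e; rewrite kE.
  by move: lt; set X := 2 ^ D; case: q => [|q]; rewrite ?mul1n // mulSn => h1 h2; nia.
have [q' -> e'] := cur_split n kD; have lo := bsum_lt (dg n) k; move: e; rewrite {1 2}e' expnS.
set X := 2 ^ k in lo *; set l := bsum _ _ _ in lo *.
have X0 : 0 < X by rewrite /X expn_gt0.
move=> e; have e2 : l.+1 + (dg n k + q' * 2) * X = (q * 2).+1 * X by rewrite -e mulnDl -mulnA; lia.
have [lt'|le] := ltnP l.+1 X; first by have [] := small_mult lt' e2.
have lX : l.+1 = X by lia.
have [] := @small_mult 0 X (dg n k + q' * 2).+1 (q * 2).+1 X0.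
  by rewrite add0n -e2 mulSn lX.
by case: (dg n k) => _ /=; lia.
Qed.

Theorem sweep_sound (P : nat -> S -> Prop) :
  (forall v (A B : {set S}), v < 2 ^ D -> (forall s, s \in A -> P v s) -> (forall s, s \in B -> P v.+1 s) ->
     (forall s, s \in gl v A B -> P v s) /\ (forall s, s \in gr v A B -> P v.+1 s)) ->
  forall n s, s \in store n (slot (cur n)) -> P (cur n) s.
Proof.
move=> h; suff inv n k s : s \in store n k -> P (pt n k) s by move=> n s /inv; rewrite pt_cur.
elim: n k s => [|n IH] k s /=; first by rewrite inE.
case: ifP => [_|c]; first by rewrite inE.
(* The point of slot [k] depends only on the digits above [k], and these change only when the slot
   is cleared. *)
have -> : pt n.+1 k = pt n k.
  rewrite /pt; case: ltnP => // kD; congr (_ + _); apply: eq_bsum => i ki; rewrite /dg.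
  have kD' : k < D by lia.
  have {}c : ~~ (Q ^ k.+1 %| n.+1) by move: c; rewrite kD' /= => ->.
  have p0 j : 0 < Q ^ j by rewrite expn_gt0 Q0.
  have -> : i = k.+1 + (i - k.+1) by lia.
  by rewrite expnD !divnMA; congr (odd (_ %/ _)); rewrite divnS // (negbTE c).
have [hA hB] := h (cur n) (store n (slot (cur n))) (store n (slot (cur n).+1)) (cur_lt n)
  (fun s hs => eq_ind _ (fun v => P v s) (IH _ _ hs) _ (pt_cur n))
  (fun s hs => eq_ind _ (fun v => P v s) (IH _ _ hs) _ (pt_curS n)).
rewrite /infer; case: eqP => [->|_]; first by rewrite pt_cur; exact: hA.
by case: eqP => [->|_]; [rewrite pt_curS; exact: hB|exact: IH].
Qed.
End Sweep.

(** * Arbitrary queries *)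

Lemma bsum_bit f L i : i < L -> odd (bsum f 0 L %/ 2 ^ i) = f i.
Proof.
move=> iL; rewrite (bsum_split _ iL); have /dvdnP[q ->] := bsum_dvd f i.+1 L.
have p0 : 0 < 2 ^ i by rewrite expn_gt0.
have -> : bsum f 0 i + f i * 2 ^ i + q * 2 ^ i.+1 = (f i + q * 2) * 2 ^ i + bsum f 0 i.
  by rewrite mulnDl -mulnA -expnS; lia.
by rewrite divnMDl // divn_small ?bsum_lt // addn0 oddD oddM andbF addbF; case: (f i).
Qed.

Section General.
Variable p : program.

Let N := nfacts p.
Let K (w : seq tok) := (N w).+1.
Definition qbase (w : seq tok) := 2 * (nfacts p w).+1.
Let Q := qbase.
(** The window has [2 ^ depth w] unit steps, half of them before the first slice. The exponent makes
    this half exceed the number of pairs of a set of facts and a fact plus the length of the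
    database; see [window_margin]. *)
Definition depth (w : seq tok) : nat := 2 * nfacts p w + size w + 3.
Let D := depth.
Definition nbits (w : seq tok) : nat := (depth w + 2) * nfacts p w.
Definition bitbound (w : seq tok) : nat := qbase w * depth w + nbits w + depth w + 1.

Definition inset n (A : {set 'I_n}) (s : nat) : bool := [exists x : 'I_n, (x \in A) && (x == s :> nat)].

Lemma insetP n (A : {set 'I_n}) (s : 'I_n) : inset A s = (s \in A).
Proof.
apply/existsP/idP => [[x /andP[xA /eqP e]]|h]; last by exists s; rewrite h eqxx.
by have <- : x = s by apply: val_inj.
Qed.

Lemma inset_lt n (A : {set 'I_n}) s : inset A s -> s < n.
Proof. by move=> /existsP[x /andP[_ /eqP <-]]. Qed.

Definition localb w o v (A : nat -> bool) (s : nat) : bool :=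
  has (fun R => [&& has_kind p [::] R, s %% nk p == kidx p [::] R, s %/ nk p < base w ^ R.2, o <= v &
       factb p w (v - o) R (s %/ nk p)])
    (edbs p) ||
  has (fun ru => has (fun m : nat => [&& okasg p w ru m, s == hcode p w m ru &
    all (fun l => A (lcode p w m l)) (rbody ru)]) (iota 0 (base w ^ nvar p))) p.

Definition infL w o v (A B : nat -> bool) (s : nat) : bool :=
  [|| A s, localb w o v A s | has (fun s' : nat => B s' && mvb p false s' s) (iota 0 (nfacts p w))].
Definition infR w o v (A B : nat -> bool) (s : nat) : bool :=
  [|| B s, localb w o v.+1 B s | has (fun s' : nat => A s' && mvb p true s' s) (iota 0 (nfacts p w))].

Definition gL w o v (A B : {set 'I_(N w)}) := [set s : 'I_(N w) | infL w o v (inset A) (inset B) s].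
Definition gR w o v (A B : {set 'I_(N w)}) := [set s : 'I_(N w) | infR w o v (inset A) (inset B) s].

Definition woff (w : seq tok) : nat := 2 ^ (depth w).-1.

Let sto w := store (D w) (K w) (@gL w (woff w)) (@gR w (woff w)).
Let cr w := cur (D w) (K w).
Let slt w := slot (D w).

(** The exponent is capped so that the power is bounded for all arguments, as representability
    requires; for existing slots the cap is not reached. *)
Definition rdb w (M k s : nat) : bool :=
  (s < nfacts p w) && odd (M %/ 2 ^ (minn (nbits w) (k * nfacts p w + s))).

Definition newbit w (j M i : nat) : bool :=
  let v := cr w j in let k := i %/ nfacts p w in let s := i %% nfacts p w in
  if (k < depth w) && (qbase w ^ minn (depth w) k.+1 %| j.+1) then false
  else if k == slt w v then infL w (woff w) v (rdb w M (slt w v)) (rdb w M (slt w v.+1)) s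
  else if k == slt w v.+1 then infR w (woff w) v (rdb w M (slt w v)) (rdb w M (slt w v.+1)) s
  else rdb w M k s.

(** The state packs the step counter [z %% P] and the store [z %/ P]. The counter may be kept modulo
    [P], because the current point and the clearing of slots depend only on its lowest [depth w]
    digits. *)
Definition wstep w (z : nat) : nat :=
  let P := qbase w ^ depth w in
  (z %% P).+1 %% P + P * bsum (newbit w (z %% P) (z %/ P)) 0 (nbits w).

Definition enc_store w n : nat :=
  bsum (fun i => inset (sto w n (i %/ nfacts p w)) (i %% nfacts p w)) 0 (nbits w).

Lemma nfacts_gt0 w : 0 < nk p -> 0 < nfacts p w.
Proof. by move=> nk0; rewrite /nfacts muln_gt0 nk0 expn_gt0. Qed.

Lemma rdb_store w n k s : 0 < nk p -> k < D w + 2 -> rdb w (enc_store w n) k s = inset (sto w n k) s.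
Proof.
move=> nk0 kD; rewrite /rdb; have [sN|sN] := ltnP s (nfacts p w); last first.
  by apply/esym/negbTE/negP => /inset_lt; rewrite /N; lia.
have lt : k * nfacts p w + s < nbits w.
  by rewrite /nbits; apply: (@leq_trans (k.+1 * nfacts p w)); [rewrite mulSn; lia|rewrite leq_mul2r; apply/orP; right].
rewrite (minn_idPr (ltnW lt)) /= bsum_bit // divnMDl ?nfacts_gt0 // divn_small // addn0.
by rewrite modnMDl modn_small.
Qed.

Lemma localb_ext w o v A A' s : A =1 A' -> localb w o v A s = localb w o v A' s.
Proof.
move=> AA; rewrite /localb; congr (_ || _); apply: eq_has => ru; apply: eq_has => m.
by congr [&& _, _ & _]; apply: eq_all => l.
Qed.

Lemma infL_ext w o v A A' B B' s : A =1 A' -> B =1 B' -> infL w o v A B s = infL w o v A' B' s.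
Proof.
move=> AA BB; rewrite /infL AA (localb_ext _ _ _ _ AA); congr [|| _, _ | _].
by apply: eq_has => s'; rewrite BB.
Qed.

Lemma infR_ext w o v A A' B B' s : A =1 A' -> B =1 B' -> infR w o v A B s = infR w o v A' B' s.
Proof.
move=> AA BB; rewrite /infR BB (localb_ext _ _ _ _ BB); congr [|| _, _ | _].
by apply: eq_has => s'; rewrite AA.
Qed.

Lemma slt_le w v : v <= 2 ^ D w -> slt w v < D w + 2.
Proof.
rewrite /slt /slot; case: eqP => [|/eqP v0 h]; first by lia.
by have := @logn_lt (D w) v; rewrite lt0n v0 h => /(_ isT); lia.
Qed.

Lemma dg_mod w n i : i < D w -> dg (K w) (n %% Q w ^ D w) i = dg (K w) n i.
Proof.
move=> iD; rewrite /dg -!/(qbase w) -/Q; have p0 j : 0 < Q w ^ j by rewrite expn_gt0 /Q /qbase mul2n.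
have E : Q w ^ D w = Q w * Q w ^ (D w - i.+1) * Q w ^ i by rewrite -expnS -expnD; congr (_ ^ _); lia.
have := divn_eq n (Q w ^ D w); move: (n %/ _) (n %% _) => c r nE.
have oQ : odd (Q w) = false by rewrite /Q /qbase mul2n odd_double.
by rewrite nE E mulnA divnMDl // oddD mulnCA [odd (Q w * _)]oddM oQ.
Qed.

Lemma cr_mod w n : cr w (n %% Q w ^ D w) = cr w n.
Proof. by apply: eq_bsum => i h; apply: dg_mod; lia. Qed.

Lemma wstep_iter w n : 0 < nk p -> iter n (wstep w) 0 = n %% Q w ^ D w + Q w ^ D w * enc_store w n.
Proof.
move=> nk0; have p0 j : 0 < Q w ^ j by rewrite expn_gt0 /Q /qbase mul2n.
elim: n => [|n IH].
  rewrite mod0n /enc_store /= /bsum big1 ?muln0 // => i _.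
  by rewrite (_ : inset _ _ = false) //; apply/negbTE/existsPn => x; rewrite inE.
rewrite iterS IH /wstep -/Q -/D; set P := Q w ^ D w; set M := enc_store w n.
have -> : (n %% P + P * M) %% P = n %% P by rewrite addnC mulnC modnMDl modn_mod.
have -> : (n %% P + P * M) %/ P = M by rewrite addnC mulnC divnMDl ?p0 // divn_small ?addn0 // ltn_pmod // p0.
congr (_ + _ * _); first by rewrite -addn1 modnDml addn1.
apply: eq_bsum => i /andP[_ iL]; rewrite /newbit cr_mod.
have iN : i %% nfacts p w < nfacts p w by rewrite ltn_pmod // nfacts_gt0.
have kD : i %/ nfacts p w < D w + 2 by rewrite ltn_divLR ?nfacts_gt0.
set k := i %/ _ in kD *; set s := i %% _ in iN *.
have cl : (k < depth w) && (qbase w ^ minn (depth w) k.+1 %| (n %% P).+1) =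
          (k < D w) && ((2 * K w) ^ k.+1 %| n.+1).
  rewrite -/D; case: ltnP => //= kD'; rewrite (minn_idPr kD') -/Q.
  have dP : Q w ^ k.+1 %| P by exact: dvdn_exp2l.
  have -> : 2 * K w = Q w by [].
  by rewrite [in RHS](divn_eq n P) -addnS dvdn_addr // dvdn_mull.
rewrite cl /sto /=; case: ifP => _.
  by apply/esym/negbTE/existsPn => x; rewrite inE.
rewrite /infer -/(cr w n) -/(slt w _) -/(slt w _) -/(sto w n).
have v1 := slt_le (ltnW (cur_lt (D w) (K w) n)); have v2 := slt_le (cur_lt (D w) (K w) n).
rewrite -/(cr w n) in v1 v2.
case: eqP => _.
  rewrite (insetP _ (Ordinal iN)) inE /=; apply: infL_ext => x; exact: rdb_store.
case: eqP => _.
  rewrite (insetP _ (Ordinal iN)) inE /=; apply: infR_ext => x; exact: rdb_store.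
exact: rdb_store.
Qed.

(** Exponentials are representable only under a representable bound. These contexts provide the one
    power of two that dominates all exponentials occurring in a step. *)
Definition bctx (G : ctx) : Prop :=
  exists2 b : cX G -> nat, cmp b & forall x, cok x -> b x = 2 ^ bitbound (cinp x).

Lemma bctx_ext G b : bctx G -> bctx (@ext G b).
Proof. by move=> [f cf h]; exists (fun y => f y.1); [exact: cmp_weak|move=> y [h' _]; exact: h]. Qed.

Lemma cmp_pow2 G f : bctx G -> cmp f -> (forall x, cok x -> f x <= bitbound (cinp x)) ->
  @cmp G (fun x => 2 ^ f x).
Proof.
move=> [b cb hb] cf h; apply: (cmp_expn (cmp_const _ 2) cf cb) => x ox.
by rewrite hb // leq_exp2l // h.
Qed.

Lemma cmp_qbase G : @cmp G (fun x => qbase (cinp x)).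
Proof. by have c := cmp_nfacts p G; rewrite /qbase; cmp_tac. Qed.

Lemma cmp_depth G : @cmp G (fun x => depth (cinp x)).
Proof. by have c := cmp_nfacts p G; rewrite /depth; cmp_tac. Qed.

Lemma cmp_nbits G : @cmp G (fun x => nbits (cinp x)).
Proof. by have c := cmp_nfacts p G; have d := cmp_depth G; rewrite /nbits; cmp_tac. Qed.

Lemma cmp_bitbound G : @cmp G (fun x => bitbound (cinp x)).
Proof.
by have c := cmp_qbase G; have d := cmp_depth G; have e := cmp_nbits G; rewrite /bitbound; cmp_tac.
Qed.

Lemma powQ_le w k : k <= depth w -> qbase w ^ k <= 2 ^ bitbound w.
Proof.
move=> h; apply: (@leq_trans (qbase w ^ depth w)); first by rewrite leq_pexp2l // /qbase mul2n.
apply: (@leq_trans (2 ^ (qbase w * depth w))); last by rewrite leq_exp2l // /bitbound; lia.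
by rewrite expnM leq_expl // ltnW // ltn_expl.
Qed.

Lemma cmp_powQ G f : bctx G -> cmp f -> (forall x, cok x -> f x <= depth (cinp x)) ->
  @cmp G (fun x => qbase (cinp x) ^ f x).
Proof.
move=> [b cb hb] cf h; apply: (cmp_expn (cmp_qbase G) cf cb) => x ox; split; first by rewrite /qbase mul2n.
by rewrite hb // powQ_le // h.
Qed.

Lemma cmp_bsum G (n : cX G -> nat) (F : cX G -> nat -> bool) : bctx G -> cmp n ->
  (forall x, cok x -> n x <= bitbound (cinp x)) -> cmpb (ext n) (fun y => F y.1 y.2) ->
  cmp (fun x => bsum (F x) 0 (n x)).
Proof.
move=> bG cn nT cF; have [b cb hb] := bG.
have itE x k : iteri k (fun i r => r + F x i * 2 ^ i) 0 = bsum (F x) 0 k.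
  elim: k => [|k IH]; first by rewrite /bsum big_geq.
  by rewrite /bsum big_nat_recr //= -/(bsum _ _ _) -IH.
apply: (@cmp_ext _ (fun x => iteri (n x) (fun i r => r + F x i * 2 ^ i) 0)); first by move=> x _; rewrite itE.
apply: (@cmp_iteri G n b (fun=> 0) (fun x i r => r + F x i * 2 ^ i)) => //; first exact: cmp_const.
  set G' := ext _.
  have c1 : cmpb G' (fun y => F y.1.1 y.1.2) := cmp_weak _ cF.
  have c2 : @cmp G' (fun y => 2 ^ y.1.2).
    apply: cmp_pow2; [by do 2!apply: bctx_ext|by cmp_tac|].
    by move=> [[x k] r] [[ox kn] _]; apply: leq_trans (ltnW kn) (nT _ ox).
  by cmp_tac.
move=> x k ox kn; rewrite itE hb //; apply: leq_trans (ltnW (bsum_lt _ _)) _.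
by rewrite leq_exp2l //; apply: leq_trans kn (nT _ ox).
Qed.

Lemma cmp_cr G (j : cX G -> nat) : bctx G -> cmp j -> cmp (fun x => cr (cinp x) (j x)).
Proof.
move=> bG cj; apply: (@cmp_bsum G _ (fun x => dg (K (cinp x)) (j x))) => //; first exact: cmp_depth.
  by move=> x _; rewrite /bitbound /D; lia.
have c : @cmp (ext (fun x : cX G => D (cinp x))) (fun y => qbase (cinp y.1) ^ y.2).
  by apply: cmp_powQ; [exact: bctx_ext|cmp_tac|move=> [x k] [_ /= /ltnW]].
apply: cmp_odd; apply: cmp_div; [exact: cmp_weak|exact: c].
Qed.

Lemma cmp_slt G (v : cX G -> nat) : bctx G -> cmp v -> (forall x, cok x -> v x <= 2 ^ depth (cinp x)) ->
  cmp (fun x => slt (cinp x) (v x)).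
Proof.
move=> bG cv h; have cd := cmp_depth G.
apply: (@cmp_ext _ (fun x => if v x == 0 then (depth (cinp x)).+1 else
    find (fun i : nat => ~~ (2 ^ i.+1 %| v x)) (iota 0 (depth (cinp x)).+1))).
  move=> x ox; rewrite /slt /slot; case: eqP => // /eqP v0; rewrite -lt0n in v0.
  set l := logn 2 (v x); have lD : l <= D (cinp x) by apply: logn_lt; rewrite v0 h.
  set P := (fun i => _); have PE i : P i = (l <= i) by rewrite /P pfactor_dvdn // -ltnNge.
  have hP : has P (iota 0 (depth (cinp x)).+1) by apply/hasP; exists l; [rewrite mem_iota|rewrite PE].
  have fs : find P (iota 0 (depth (cinp x)).+1) < (depth (cinp x)).+1 by move: hP; rewrite has_find size_iota.
  have := nth_find 0 hP; rewrite nth_iota // add0n PE => h1.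
  apply/eqP; rewrite eqn_leq h1 andbT leqNgt; apply/negP => h2.
  by have := before_find 0 h2; rewrite nth_iota ?add0n ?PE ?leqnn //; lia.
have c : @cmp (ext (fun x : cX G => (depth (cinp x)).+1)) (fun y => 2 ^ y.2.+1).
  apply: cmp_pow2; [exact: bctx_ext|cmp_tac|move=> [x k] [_ /= kD]].
  by rewrite /bitbound; lia.
by cmp_tac.
Qed.

Lemma cmp_rdb G (M k s : cX G -> nat) : bctx G -> cmp M -> cmp k -> cmp s ->
  cmpb G (fun x => rdb (cinp x) (M x) (k x) (s x)).
Proof.
move=> bG cM ck cs; have cn := cmp_nfacts p G; have cb := cmp_nbits G.
have c : @cmp G (fun x => 2 ^ minn (nbits (cinp x)) (k x * nfacts p (cinp x) + s x)).
  by apply: cmp_pow2 => //; [cmp_tac|move=> x _; rewrite /bitbound; lia].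
by rewrite /rdb; cmp_tac.
Qed.

Lemma cmp_localb G (o v M k s : cX G -> nat) : bctx G -> cmp o -> cmp v -> cmp M -> cmp k -> cmp s ->
  cmpb G (fun x => localb (cinp x) (o x) (v x) (rdb (cinp x) (M x) (k x)) (s x)).
Proof.
move=> bG co cv cM ck cs; rewrite /localb; apply: cmp_or.
  apply: cmp_has_const => R _.
  have c1 : cmp (fun x => v x - o x) by cmp_tac.
  have c2 : cmp (fun x => s x %/ nk p) by cmp_tac.
  by have c3 := cmp_factb p R c1 c2; have c4 := cmp_base G; cmp_tac.
apply: cmp_has_const => ru _.
have cb : @cmp G (fun x => base (cinp x) ^ nvar p) by apply: cmp_expn_const; exact: cmp_base.
apply: cmp_has => //; set G' := ext _.
have cm : @cmp G' (fun y => y.2) by cmp_tac.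
have c1 := cmp_okasg p ru cm; have c2 := cmp_hcode p ru cm.
apply: cmp_and; first exact: c1.
apply: cmp_and; first by apply: cmp_eq; [cmp_tac|exact: c2].
apply: cmp_all_const => l _.
have cM' : @cmp G' (fun y => M y.1) by cmp_tac.
have ck' : @cmp G' (fun y => k y.1) by cmp_tac.
have bG' : bctx G' by exact: bctx_ext.
exact: (cmp_rdb bG' cM' ck' (cmp_lcode p l cm)).
Qed.

Lemma cmp_inf G (o v M k k' s : cX G -> nat) : bctx G -> cmp o -> cmp v -> cmp M -> cmp k -> cmp k' -> cmp s ->
  cmpb G (fun x => infL (cinp x) (o x) (v x) (rdb (cinp x) (M x) (k x)) (rdb (cinp x) (M x) (k' x)) (s x)) /\
  cmpb G (fun x => infR (cinp x) (o x) (v x) (rdb (cinp x) (M x) (k x)) (rdb (cinp x) (M x) (k' x)) (s x)).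
Proof.
move=> bG co cv cM ck ck' cs; have cn := cmp_nfacts p G.
have cv' : cmp (fun x => (v x).+1) by cmp_tac.
have l1 := cmp_localb bG co cv cM ck cs; have l2 := cmp_localb bG co cv' cM ck' cs.
have r1 := cmp_rdb bG cM ck cs; have r2 := cmp_rdb bG cM ck' cs.
have shift d (h : cX G -> nat) : cmp h -> cmpb G (fun x =>
    has (fun s' : nat => rdb (cinp x) (M x) (h x) s' && mvb p d s' (s x)) (iota 0 (nfacts p (cinp x)))).
  move=> ch; apply: (@cmp_has G (fun x s' => rdb (cinp x) (M x) (h x) s' && mvb p d s' (s x))) => //.
  set G' := ext _.
  have cm : @cmp G' (fun y => y.2) by cmp_tac.
  have cM' : @cmp G' (fun y => M y.1) by cmp_tac.
  have ch' : @cmp G' (fun y => h y.1) by cmp_tac.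
  have cs' : @cmp G' (fun y => s y.1) by cmp_tac.
  have bG' : bctx G' by exact: bctx_ext.
  exact: (cmp_and (cmp_rdb bG' cM' ch' cm) (cmp_mvb p d cm cs')).
have s1 := shift false k' ck'; have s2 := shift true k ck.
by split; rewrite /infL /infR; apply: cmp_or => //; apply: cmp_or.
Qed.

Lemma cmp_woff G : bctx G -> @cmp G (fun x => woff (cinp x)).
Proof.
move=> bG; have c := cmp_depth G; apply: cmp_pow2 => //; first by cmp_tac.
by move=> x _; rewrite /bitbound; lia.
Qed.

Lemma cmp_newbit G (j M i : cX G -> nat) : bctx G -> cmp j -> cmp M -> cmp i ->
  cmpb G (fun x => newbit (cinp x) (j x) (M x) (i x)).
Proof.
move=> bG cj cM ci; have cn := cmp_nfacts p G; have cd := cmp_depth G.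
have cv := cmp_cr bG cj; have cv' := cmp_succ cv.
have lt x : cr (cinp x) (j x) < 2 ^ depth (cinp x) by exact: cur_lt.
have s1 := cmp_slt bG cv (fun x _ => ltnW (lt x)); have s2 := cmp_slt bG cv' (fun x _ => lt x).
have ck : cmp (fun x => i x %/ nfacts p (cinp x)) by cmp_tac.
have cs : cmp (fun x => i x %% nfacts p (cinp x)) by cmp_tac.
have cq : cmp (fun x => qbase (cinp x) ^ minn (depth (cinp x)) (i x %/ nfacts p (cinp x)).+1).
  by apply: cmp_powQ => //; [cmp_tac|move=> x _; exact: geq_minl].
have [i1 i2] := cmp_inf bG (cmp_woff bG) cv cM s1 s2 cs.
have r := cmp_rdb bG cM ck cs.
rewrite /newbit; apply: (@cmp_ext _ (fun x =>
  if (i x %/ nfacts p (cinp x) < depth (cinp x)) &&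
     (qbase (cinp x) ^ minn (depth (cinp x)) (i x %/ nfacts p (cinp x)).+1 %| (j x).+1) then 0
  else if i x %/ nfacts p (cinp x) == slt (cinp x) (cr (cinp x) (j x)) then
    nat_of_bool (infL (cinp x) (woff (cinp x)) (cr (cinp x) (j x)) (rdb (cinp x) (M x) (slt (cinp x) (cr (cinp x) (j x))))
      (rdb (cinp x) (M x) (slt (cinp x) (cr (cinp x) (j x)).+1)) (i x %% nfacts p (cinp x)))
  else if i x %/ nfacts p (cinp x) == slt (cinp x) (cr (cinp x) (j x)).+1 then
    nat_of_bool (infR (cinp x) (woff (cinp x)) (cr (cinp x) (j x)) (rdb (cinp x) (M x) (slt (cinp x) (cr (cinp x) (j x))))
      (rdb (cinp x) (M x) (slt (cinp x) (cr (cinp x) (j x)).+1)) (i x %% nfacts p (cinp x)))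
  else nat_of_bool (rdb (cinp x) (M x) (i x %/ nfacts p (cinp x)) (i x %% nfacts p (cinp x))))).
  by move=> x _ /=; do 3!case: ifP => //.
apply: cmp_if; [by cmp_tac|exact: cmp_const|].
apply: cmp_if; [by cmp_tac|exact: i1|].
by apply: cmp_if; [by cmp_tac|exact: i2|exact: r].
Qed.

Lemma cmp_wstep G (z : cX G -> nat) : bctx G -> cmp z -> cmp (fun x => wstep (cinp x) (z x)).
Proof.
move=> bG cz; have cP : @cmp G (fun x => qbase (cinp x) ^ depth (cinp x)).
  by apply: cmp_powQ => //; exact: cmp_depth.
have c1 : cmp (fun x => z x %% qbase (cinp x) ^ depth (cinp x)) by exact: cmp_mod.
have c2 : cmp (fun x => z x %/ qbase (cinp x) ^ depth (cinp x)) by exact: cmp_div.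
have cb : cmp (fun x => bsum (newbit (cinp x) (z x %% qbase (cinp x) ^ depth (cinp x))
    (z x %/ qbase (cinp x) ^ depth (cinp x))) 0 (nbits (cinp x))).
  apply: (@cmp_bsum G (fun x => nbits (cinp x)) (fun x => newbit (cinp x) (z x %% qbase (cinp x) ^ depth (cinp x))
    (z x %/ qbase (cinp x) ^ depth (cinp x)))) => //; first exact: cmp_nbits.
    by move=> x _; rewrite /bitbound; lia.
  apply: (@cmp_newbit (ext _) (fun y => z y.1 %% _) (fun y => z y.1 %/ _) (fun y => y.2)).
  - exact: bctx_ext.
  - exact: (cmp_weak _ c1).
  - exact: (cmp_weak _ c2).
  - exact: cmp_v0.
rewrite /wstep; apply: cmp_add; last exact: cmp_mul.
by apply: cmp_mod => //; exact: cmp_succ.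
Qed.
End General.

(** * Correctness of the saturation *)

Section PSPACE.
Variable p : program.

Section Layout.
Variables (D : tdb) (ds : seq nat) (t0 : Z) (w : seq tok).
Hypothesis wE : w = enc_input D ds t0.
Hypothesis Dp : db_over_edb p D.
Hypothesis wfp : wf_program p.

Let okD := Dp.2.
Let N := nfacts p w.
Let o := woff p w.
Let W := 2 ^ depth p w.
Let time (v : nat) : Z := (tl D + Z.of_nat v - Z.of_nat o)%Z.
Let gl := @gL p w o.
Let gr := @gR p w o.
Let crn := cur (depth p w) N.+1.
Let sl0 := slot (depth p w).
Let sto := store (depth p w) N.+1 gl gr.

(** Database facts are conclusions here, and literals refer to the current set of facts by their
    pending operators; hence the rules depend on time only inside the database. *)
Definition srl (t : Z) (A : nat -> bool) (s : nat) : Prop :=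
  (exists a, [/\ dfact D t a, has_kind p [::] a.1 & s = fc p w [::] a]) \/
  exists ru nu, [/\ List.In ru p, forall x, x \in rvars ru -> nu x \in objs D,
    forall l, List.In l (rbody ru) -> A (fc p w (lit_ops l) (latom nu l)) &
    s = fc p w [::] ((rhead ru).1, map nu (rhead ru).2)].

Lemma dfact_okf t a : dfact D t a -> okf D a.
Proof. by move=> /(dfact_ok Dp)[]. Qed.

Definition true_at (v : nat) (s : nat) : Prop := exists ops a,
  [/\ has_kind p ops a.1, okf D a, s = fc p w ops a & der p D (time v) ops a].

Lemma localb_true v (A : nat -> bool) s : (forall s, A s -> true_at v s) -> localb p w o v A s -> true_at v s.
Proof.
move=> hA /orP[/has_In[R Re /and5P[hk /eqP km an ov fb]]|/has_In[ru ri /hasP[m _ /and3P[okm /eqP -> /all_In al]]]].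
  have [os [js inS aE]] := factb_decode wE okD fb an.
  have df : dfact D (time v) (R, os).
    split; first by rewrite /in_tem /tr /time; lia.
    by have -> : Z.to_nat (time v - tl D) = v - o by rewrite /time; lia.
  exists [::], (R, os); split=> //; [exact: dfact_okf df| |exact: der_fact].
  by rewrite [LHS](divn_eq s (nk p)) km aE addnC mulnC.
have [nu h] := asg_decode wE okD okm.
have h1 x (xr : x \in rvars ru) := proj1 (h x xr); have h2 x (xr : x \in rvars ru) := proj2 (h x xr).
exists [::], ((rhead ru).1, map nu (rhead ru).2); split.
- exact: has_kind_head.
- exact: (okf_head wfp).
- exact: hcodeE.
apply: der_rule => // l lb; have := hA _ (al l lb); rewrite (lcodeE h2 lb) => -[o' [a [hk ok e d]]].
have [oE aE] := fc_inj (a := latom nu l) wE okD (has_kind_lit ri lb) hk (okf_lit wfp ri h1 lb) ok e.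
by rewrite oE -/(latom nu l) aE.
Qed.

Lemma localb_complete v (A : nat -> bool) s : srl (time v) A s -> localb p w o v A s.
Proof.
case=> [[[R os] [df hk ->]]|[ru [nu [ri nuo h ->]]]]; apply/orP.
  left; apply/has_In; have [_ ed oo] := dfact_ok Dp df; have [sz _] := dfact_okf df.
  exists R; first by apply/In_mem; rewrite edbsP.
  have lt := acode_cp_lt wE okD oo; rewrite /= sz in lt.
  rewrite hk fc_mod // fc_div // eqxx lt /=; have [[h1 h2] inS] := df; rewrite /tr /time in h1 h2 inS.
  have ov : o <= v by lia.
  rewrite ov; apply/(factbP wE okD _ sz oo); split; first by lia.
  by have <- : Z.to_nat (tl D + Z.of_nat v - Z.of_nat o - tl D) = v - o by lia.
right; apply/has_In; exists ru => //; have [m [mb okm nud]] := asg_encode wE okD ri nuo.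
apply/hasP; exists m; first by rewrite mem_iota.
apply/and3P; split=> //; first by rewrite (hcodeE nud).
by apply/all_In => l lb; rewrite (lcodeE nud lb); exact: h.
Qed.

Lemma inset_ind (P : nat -> Prop) (A : {set 'I_N}) s : (forall x : 'I_N, x \in A -> P x) -> inset A s -> P s.
Proof. by move=> h /existsP[x /andP[/h + /eqP <-]]. Qed.

Lemma timeS v : time v.+1 = (time v + 1)%Z.
Proof. by rewrite /time; lia. Qed.

Lemma true_mv (d : bool) v v' s s' : (if d then time v' - 1 else time v' + 1)%Z = time v ->
  true_at v s -> mvb p d s s' -> true_at v' s'.
Proof.
move=> e [ops [a [hk ok -> da]]] /(mvbP w d _ hk)[ops' [m hk' ->]].
by exists ops', a; split=> //; apply: der_mv m; rewrite e.
Qed.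

Lemma store_true n (s : 'I_N) : s \in sto n (sl0 (crn n)) -> true_at (crn n) s.
Proof.
have SK : #|'I_N| < N.+1 by rewrite card_ord.
apply: (sweep_sound SK (P := fun v (s : 'I_N) => true_at v s)) => v A B _ hA hB.
have iA x : inset A x -> true_at v x by apply: inset_ind.
have iB x : inset B x -> true_at v.+1 x by apply: inset_ind.
split=> x; rewrite inE => /or3P[|/localb_true|/hasP[s' _ /andP[h m]]].
- exact: iA.
- by apply.
- by apply: true_mv (iB _ h) m; rewrite timeS.
- exact: iB.
- by apply.
- by apply: true_mv (iA _ h) m; rewrite timeS Z.add_simpl_r.
Qed.

Let rl t (A : {set 'I_N}) (s : 'I_N) : Prop := srl t (inset A) s.
Let up (s s' : 'I_N) : Prop := mvb p true s s'.
Let dn (s s' : 'I_N) : Prop := mvb p false s s'.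

Lemma window_margin : 2 ^ N * N + size w + 4 <= o.
Proof.
rewrite /o /woff /depth -/N; have -> : (2 * N + size w + 3).-1 = N + N + size w + 2 by lia.
rewrite !expnD; have h1 : N < 2 ^ N by exact: ltn_expl.
have h2 : size w < 2 ^ size w by exact: ltn_expl.
have h3 : 4 <= size w.
  rewrite wE /enc_input /enc_db !size_cat /= !size_cat /=; lia.
move: h1 h2 h3; set X := 2 ^ N; set Y := 2 ^ size w; set n := size w => h1 h2 h3.
have h4 : X * N + X <= X * X by rewrite addnC -mulnS leq_mul2l h1 orbT.
have h5 : X * X <= X * X * Y by rewrite leq_pmulr //; lia.
have h6 : Y <= X * X * Y by rewrite leq_pmull // muln_gt0; lia.
by rewrite (_ : 2 ^ 2 = 4) //; move: h4 h5 h6; set a := X * X * Y; lia.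
Qed.

Lemma window_half : W = o + o.
Proof. by rewrite /W /o /woff /depth addnS /= expnS mul2n addnn. Qed.

Lemma srl_mono t (A A' : nat -> bool) s : (forall x, A x -> A' x) -> srl t A s -> srl t A' s.
Proof.
move=> h [l|[ru [nu [ri nuo h1 h2]]]]; [by left|right; exists ru, nu; split=> // l lb].
by apply: h; exact: h1.
Qed.

(** A rule may use any set of premises, so [J] consists of all sets of facts, which makes
    [2 ^ N * N] pairs. The rules are constant from one step outside the database on. *)
Lemma general_extend sg : closed_on rl up dn (fun t => (time 0 <= t <= time W.-1)%Z) sg ->
  exists2 sg', (forall t, (tl D <= t <= tr D)%Z -> sg' t = sg t) & closed_on rl up dn (fun=> True) sg'.
Proof.
move=> cl; have [sb _] := slices_le wE okD; have mg := window_margin; have s2 := Dp.1.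
have WE := window_half.
pose a := (tl D - 1)%Z; pose b := (tr D + 1)%Z.
have out t t' A s : ~ in_tem D t -> rl t A s -> rl t' A s.
  by move=> nt [[a' [[/nt]]]|h] //; right.
have [||||||||||||sg' h1 h2] := @extend_both _ {set 'I_N} id rl up dn (fun=> True) _ _ _ _ _ (time 0) a b
    (time W.-1) (2 ^ N * N).+1 sg.
- by [].
- by move=> j Z h; exists Z.
- by move=> j Z h; exists Z.
- move=> U A R _ mono h; exists U => // y /h[j jU jR]; exact: mono jU jR.
- by move=> s; exists [set s].
- by rewrite card_prod card_ord -cardsT -powersetT card_powerset cardsT card_ord.
- by rewrite /time /a; lia.
- by rewrite /a /b /tr; lia.
- by rewrite /time /b /tr; lia.
- by move=> t A s ta; split; apply: out; rewrite /in_tem /a in ta *; lia.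
- by move=> t A s ta; split; apply: out; rewrite /in_tem /b in ta *; lia.
- exact: cl.
by exists sg' => // t ht; apply: h1; rewrite /a /b; lia.
Qed.

Lemma general_closed_der sg : closed_on rl up dn (fun=> True) sg ->
  forall t ops a, der p D t ops a -> has_kind p ops a.1 -> okf D a -> inset (sg t) (fc p w ops a).
Proof.
move=> [c1 c2 c3] t ops a.
have inI t1 o1 a1 (lt : fc p w o1 a1 < N) : inset (sg t1) (fc p w o1 a1) = (Ordinal lt \in sg t1).
  by rewrite -insetP.
have mvC (d : bool) t1 o1 o2 a1 : has_kind p o1 a1.1 -> has_kind p o2 a1.1 -> okf D a1 -> mv d o1 o2 ->
    inset (sg (if d then t1 - 1 else t1 + 1)%Z) (fc p w o1 a1) -> inset (sg t1) (fc p w o2 a1).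
  move=> k1 k2 ok1 m; have lt1 := fc_lt wE okD k1 ok1; have lt2 := fc_lt wE okD k2 ok1.
  rewrite (inI _ _ _ lt1) (inI _ _ _ lt2) => h.
  have mb : mvb p d (Ordinal lt1) (Ordinal lt2) by apply/(mvbP w d _ k1); exists o2.
  case: d m h mb => m h mb.
    by have := c2 _ _ _ I I h mb; rewrite Z.sub_add.
  by have := c3 _ _ _ I I h mb; rewrite Z.add_simpl_r.
elim=> {t ops a}.
- move=> t a df hk ok; have lt := fc_lt wE okD hk ok; rewrite (inI _ _ _ lt).
  by apply: (c1 t I (sg t)) => //; left; exists a.
- move=> ru t nu ri nuo dl IH hk ok; have lt := fc_lt wE okD hk ok; rewrite (inI _ _ _ lt).
  apply: (c1 t I (sg t)) => //; right; exists ru, nu; split=> // l lb.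
  by apply: IH => //; [exact: has_kind_lit ri lb|exact: (okf_lit wfp ri nuo lb)].
- move=> t ops a _ IH hk oa; have hk' := has_kind_cons hk.
  by apply: (mvC false _ ops _ a hk' hk oa _ (IH hk' oa)); constructor 1.
- move=> t ops a _ IH hk oa; have hk' := has_kind_cons hk.
  by apply: (mvC true _ ops _ a hk' hk oa _ (IH hk' oa)); constructor 1.
- move=> t ops a _ IH hk oa; have hk' := has_kind_cons hk.
  by apply: (mvC false _ ops _ a hk' hk oa _ (IH hk' oa)); constructor 2.
- move=> t ops a _ IH hk oa.
  by apply: (mvC false _ _ _ a hk hk oa _ (IH hk oa)); constructor 3; split=> //; exists ops.
- move=> t ops a _ IH hk oa; have hk' := has_kind_cons hk.
  by apply: (mvC true _ ops _ a hk' hk oa _ (IH hk' oa)); constructor 2.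
- move=> t ops a _ IH hk oa.
  by apply: (mvC true _ _ _ a hk hk oa _ (IH hk oa)); constructor 3; split=> //; exists ops.
Qed.

(** Soundness holds for every stored set at any step. For completeness, the saturated sets are
    extended to all times and contain every derivable fact, and each of them is stored at some
    step. *)
Lemma general_window t a : in_tem D t -> has_kind p [::] a.1 -> okf D a ->
  certain p D t a <->
  exists n, crn n = o + Z.to_nat (t - tl D) /\ inset (sto n (sl0 (crn n))) (fc p w [::] a).
Proof.
move=> tt hk ok; rewrite (certain_der wfp Dp); set v0 := _ + _.
have [sb _] := slices_le wE okD; have mg := window_margin.
have WE := window_half.
have v0W : v0 < W by rewrite /in_tem /tr in tt; rewrite /v0; lia.
have v0E : time v0 = t by rewrite /in_tem in tt; rewrite /time /v0; lia.
have lt := fc_lt wE okD hk ok.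
split=> [da|[n [cn]]]; last first.
  rewrite (insetP _ (Ordinal lt)) => /store_true; rewrite cn => -[ops [a' [hk' ok' e d]]].
  by have [oE aE] := fc_inj wE okD hk hk' ok ok' e; rewrite oE aE -v0E.
have glS v (A B : {set 'I_N}) : A \subset gl v A B by apply/subsetP => s h; rewrite inE /infL insetP h.
have grS v (A B : {set 'I_N}) : B \subset gr v A B by apply/subsetP => s h; rewrite inE /infR insetP h.
have SK : #|'I_N| < N.+1 by rewrite card_ord.
have [sg sat] := sweep_saturates (depth p w) glS grS SK.
pose sgt t := sg (Z.to_nat (t - time 0)).
have bnd t1 : (time 0 <= t1 <= time W.-1)%Z -> Z.to_nat (t1 - time 0) < W by rewrite /time; lia.
have cl : closed_on rl up dn (fun t => (time 0 <= t <= time W.-1)%Z) sgt.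
  split.
  - move=> t1 h1 A s h AS; rewrite /sgt; have [<- _ _] := sat _ (bnd _ h1).
    rewrite inE /infL; apply/or3P; constructor 2; apply: localb_complete.
    have -> : time (Z.to_nat (t1 - time 0)) = t1 by rewrite /time in h1 *; lia.
    apply: srl_mono h => x /existsP[y /andP[yA /eqP <-]].
    by rewrite insetP; exact: (subsetP AS).
  - move=> t1 s s' h1 h2 h us; have [_ + _] := sat _ (bnd _ h1).
    have -> : (Z.to_nat (t1 - time 0)).+1 = Z.to_nat (t1 + 1 - time 0) by lia.
    rewrite /sgt => <-; rewrite inE /infR; apply/or3P; constructor 3; apply/hasP; exists (s : nat).
      by rewrite mem_iota /=.
    by rewrite insetP; apply/andP; split.
  - move=> t1 s s' h1 h2 h us; have [+ _ _] := sat _ (bnd _ h2).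
    have -> : (Z.to_nat (t1 - 1 - time 0)).+1 = Z.to_nat (t1 - time 0) by lia.
    rewrite /sgt => <-; rewrite inE /infL; apply/or3P; constructor 3; apply/hasP; exists (s : nat).
      by rewrite mem_iota /=.
    by rewrite insetP; apply/andP; split.
have [sg' agr cl'] := general_extend cl.
have := general_closed_der cl' da hk ok; rewrite agr //.
have -> : sgt t = sg v0 by rewrite /sgt -v0E; congr sg; rewrite /time; lia.
have [_ _ [n [cn ->]]] := sat v0 v0W => h; exists n; split=> //.
by rewrite -[crn n]/(cur _ _ n) cn.
Qed.
End Layout.

Variable Gr : relsym.

Definition pspace_acc (w : seq tok) (z : nat) : bool :=
  let P := qbase p w ^ depth p w in
  let q := woff p w + toff p w in
  [&& valid p Gr w, cur (depth p w) (nfacts p w).+1 (z %% P) == q &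
      rdb p w (z %/ P) (slot (depth p w) (cur (depth p w) (nfacts p w).+1 (z %% P)))
        (kidx p [::] Gr + nk p * qcode p Gr w)].

Theorem query_PSPACE : is_query p Gr -> in_PSPACE (query_lang p Gr).
Proof.
move=> [wfp id]; have hk := has_kind_idb id.
have nk0 : 0 < nk p by apply: leq_ltn_trans (leq0n _) (kidx_lt hk).
have Q0 w j : 0 < qbase p w ^ j by rewrite expn_gt0 /qbase mul2n.
have bP : bctx p (ctxP (bitbound p)) by exists snd => //; exists (Var 0) => -[w B] e _.
apply: (@PSPACE_of_iter _ (bitbound p)
   (fun x => qbase p x.1 ^ depth p x.1 * 2 ^ nbits p x.1) (fun w _ => wstep p w) (fun w _ => pspace_acc w)).
- exact: (cmp_bitbound p ctx0).
- apply: cmp_mul.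
    by apply: (@cmp_powQ p (ctxP (bitbound p)) (fun x => depth p x.1)) => //; exact: (cmp_depth p (ctxP (bitbound p))).
  apply: (@cmp_pow2 p (ctxP (bitbound p)) (fun x => nbits p x.1)) => //; first exact: (cmp_nbits p (ctxP (bitbound p))).
  by move=> [w B] _ /=; rewrite /bitbound; lia.
- set G := ext _; have bG : bctx p G by exact: bctx_ext.
  have cz : @cmp G (fun y => y.2) by exact: cmp_v0.
  exact: (cmp_wstep bG cz).
- set G := ext _; have bG : bctx p G by exact: bctx_ext.
  have cz : @cmp G (fun y => y.2) by exact: cmp_v0.
  have cP : @cmp G (fun y => qbase p (cinp y) ^ depth p (cinp y)) by apply: cmp_powQ => //; exact: cmp_depth.
  have c1 := cmp_mod cz cP; have c2 := cmp_div cz cP; have c3 := cmp_cr bG c1.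
  have c4 := cmp_slt bG c3 (fun x _ => ltnW (cur_lt _ _ _)).
  have c5 := cmp_qcode p Gr G.
  have c6 : @cmp G (fun y => kidx p [::] Gr + nk p * qcode p Gr (cinp y)) by cmp_tac.
  have c7 := cmp_rdb bG c2 c4 c6; have c8 := cmp_valid p Gr G; have c9 := cmp_woff bG; have c10 := cmp_toff p G.
  apply: (cmp_and c8); apply: cmp_and c7; apply: cmp_eq c3 _; exact: cmp_add.
- move=> w B; split; first by rewrite muln_gt0 Q0 expn_gt0.
  move=> z _; rewrite /wstep /=; have := bsum_lt (newbit p w (z %% qbase p w ^ depth p w) (z %/ qbase p w ^ depth p w)) (nbits p w).
  have := ltn_pmod (z %% qbase p w ^ depth p w).+1 (Q0 w (depth p w)).
  by move: (Q0 w (depth p w)); set P := _ ^ depth _ _; set R := 2 ^ _; set a := _ %% P; set b := bsum _ _ _; nia.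
have key w D ds t : db_over_edb p D -> size ds = arity Gr -> all (fun d => d \in objs D) ds ->
    in_tem D t -> w = enc_input D ds t -> certain p D t (Gr, ds) <-> exists n, pspace_acc w (iter n (wstep p w) 0).
  move=> h1 h2 h3 h4 wE.
  rewrite (@general_window D ds t w wE h1 wfp t (Gr, ds) h4 hk (conj h2 h3)).
  have -> : Z.to_nat (t - tl D) = toff p w by have := toffE wE h1.2 h4; lia.
  have va : valid p Gr w by apply/validP; exists D, ds, t.
  have accE n : pspace_acc w (iter n (wstep p w) 0) =
      (cur (depth p w) (nfacts p w).+1 n == woff p w + toff p w) &&
      inset (store (depth p w) (nfacts p w).+1 (@gL p w (woff p w)) (@gR p w (woff p w)) n
               (slot (depth p w) (cur (depth p w) (nfacts p w).+1 n))) (fc p w [::] (Gr, ds)).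
    rewrite /pspace_acc va wstep_iter //=; set P := qbase p w ^ depth p w.
    have -> : (n %% P + P * enc_store p w n) %% P = n %% P by rewrite addnC mulnC modnMDl modn_mod.
    have -> : (n %% P + P * enc_store p w n) %/ P = enc_store p w n.
      by rewrite addnC mulnC divnMDl ?Q0 // divn_small ?addn0 // ltn_pmod ?Q0.
    have -> := @cr_mod p w n; congr (_ && _); rewrite rdb_store //; last exact: slt_le (ltnW (cur_lt _ _ _)).
    by rewrite (qcodeE wE h1.2 h2).
  by split=> -[n h]; exists n; move: h; rewrite accE; [move=> [-> ->]; rewrite eqxx|move=> /andP[/eqP -> ->]].
move=> w B; split=> [[D [ds [t [[h1 h2 h3 h4 wE] c]]]]|[n h]].
  exact/(key w D ds t h1 h2 h3 h4 wE).
have /and3P[/validP[D [ds [t [h1 h2 h3 h4 wE]]]] _ _] := h.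
by exists D, ds, t; split=> //; apply/(key w D ds t h1 h2 h3 h4 wE); exists n.
Qed.
End PSPACE.

Theorem theorem4 :
  ((forall (p : program) (G : relsym), is_query p G -> in_PSPACE (query_lang p G)) /\
   (exists (p : program) (G : relsym), is_query p G /\ monadic p /\ PSPACE_hard (query_lang p G))) /\
  ((forall (p : program) (G : relsym), is_query p G -> linear p -> in_NL (query_lang p G)) /\
   (exists (p : program) (G : relsym),
      is_query p G /\ linear p /\ monadic p /\ NL_hard (query_lang p G))).
Proof.
split; split.
- exact: query_PSPACE.
- have [h1 h2] := stage_prog_ok; exists stage_prog, relG; do 2!split=> //; exact: stage_prog_PSPACE_hard.
- exact: linear_NL.
- have [h1 h2 h3] := reach_prog_ok; exists reach_prog, relN; do 3!split=> //; exact: reach_prog_NL_hard.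
Qed.
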